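(* Let $S \subseteq K^n$ be definable in $(K, \bm k)$ and let $\overline{S}$ be its closure in $K^n$. Then $\dim_2 (\overline{S}\setminus S) < \dim_2 S$.
   Context: Let $(K,\dot{\mathcal O})$ be a pre-$H$-field that is differential-henselian and Liouville closed (real closed, closed under integration and exponential integration) with $\dot{\mathcal O}\neq K$, and let $\bm k\subseteq\dot{\mathcal O}$ be a lift of its differential residue field $\operatorname{res}(K,\dot{\mathcal O})$, i.e. a differential subfield of $\dot{\mathcal O}$ mapped isomorphically onto $\operatorname{res}(K,\dot{\mathcal O})$ by the residue map. The pair $(K,\bm k)$ is viewed as a structure in the language of ordered differential rings with a relation for the dominance relation of $\dot{\mathcal O}$, expanded by a unary predicate for $\bm k$; ''definable'' means definable with parameters in this structure. $K$ carries the order topology and $K^n$ the product topology. For nonempty $S\subseteq K^n$, $\dim_2 S=\max\{\operatorname{dtrdeg}(K\bm k^*\langle s\rangle\mid K\bm k^* ): s\in S^*\}$, where $(K^*,\bm k^*,S^* )$ is an $|K|^+$-saturated elementary extension of $(K,\bm k,S)$ and $\operatorname{dtrdeg}$ is differential transcendence degree; $\dim_2\emptyset=-\infty$.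
   Formalization: S is assumed nonempty: for S empty, the closure minus S is also empty and the claim would read −∞ < −∞, which is false. *)

(* Defs.v *)
From HB Require Import structures.
From mathcomp Require Import all_boot all_order all_algebra finmap.
(* monalg must be imported before mathcomp-analysis: in the other order the
   levels of their notations clash. *)
From mathcomp.multinomials Require Import monalg.
From mathcomp Require Import all_classical all_reals topology.

Set Implicit Arguments.
Unset Strict Implicit.
Unset Printing Implicit Defensive.

Import Order.TTheory GRing.Theory Num.Theory.

Local Open Scope classical_set_scope.
Local Open Scope ring_scope.

(** * First-order logic *)

Record signature := Signature {
  fsym : Type; farity : fsym -> nat;
  rsym : Type; rarity : rsym -> nat }.

Record structure (L : signature) := Structure {
  domain :> Type;
  finterp : forall f : fsym L, ('I_(farity f) -> domain) -> domain;
  rinterp : forall r : rsym L, set ('I_(rarity r) -> domain) }.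

Inductive term (L : signature) : Type :=
| Var of nat
| App (f : fsym L) of ('I_(farity f) -> term L).

Inductive formula (L : signature) : Type :=
| FFalse
| FEq of term L & term L
| FRel (r : rsym L) of ('I_(rarity r) -> term L)
| FImp of formula L & formula L
| FAll of nat & formula L.

Section Semantics.
Variables (L : signature) (M : structure L).

Fixpoint eval_term (v : nat -> M) (t : term L) : M :=
  match t with
  | Var i => v i
  | App f ts => finterp (fun j => eval_term v (ts j))
  end.

Definition update (v : nat -> M) (i : nat) (a : M) : nat -> M :=
  fun j => if j == i then a else v j.

Fixpoint sat (v : nat -> M) (phi : formula L) : Prop :=
  match phi with
  | FFalse => False
  | FEq t u => eval_term v t = eval_term v u
  | FRel r ts => rinterp (fun j => eval_term v (ts j))
  | FImp phi psi => sat v phi -> sat v psi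
  | FAll i phi => forall a, sat (update v i a) phi
  end.

(* Variables 0, ..., n-1 receive the point x; all others are parameters. *)
Definition assign n (x : 'I_n -> M) (v : nat -> M) : nat -> M :=
  fun j => if insub j is Some i then x i else v j.

Definition definable n (S : set ('I_n -> M)) : Prop :=
  exists (phi : formula L) (v : nat -> M),
    forall x, S x <-> sat (assign x v) phi.

(* |X|^+-saturation, for an infinite type X: every 1-type over a parameter set
   A of cardinality at most |X| is realized. The variable of the type is 0; a
   pair (phi, v) in p is the formula phi with parameters v 1, v 2, ... in A. *)
Definition succ_card_saturated (X : Type) : Prop :=
  forall (A : set M) (p : set (formula L * (nat -> M))),
    (A #<= [set: X])%card ->
    (forall q, p q -> forall j, A (q.2 j)) ->
    (forall D, finite_set D -> D `<=` p ->
       exists a, forall q, D q -> sat (update q.2 0 a) q.1) ->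
    exists a, forall q, p q -> sat (update q.2 0 a) q.1.

End Semantics.

Definition elementary_embedding (L : signature) (M N : structure L)
    (i : M -> N) : Prop :=
  forall (phi : formula L) (v : nat -> M), sat v phi <-> sat (i \o v) phi.

(* Expansion by one n-ary relation symbol. *)
Definition expand_signature (L : signature) (n : nat) : signature :=
  @Signature (fsym L) (@farity L) (option (rsym L))
    (fun r => if r is Some r' then rarity r' else n).

Definition expand (L : signature) (M : structure L) n (S : set ('I_n -> M)) :
    structure (expand_signature L n) :=
  @Structure (expand_signature L n) M (@finterp L M)
    (fun r => match r return
       set ('I_(@rarity (expand_signature L n) r) -> M) with
     | Some r' => @rinterp L M r'
     | None => S
     end).

(** * Differential fields *)

Section DifferentialFields.
Variables (K : fieldType) (der : K -> K).

Definition derivation : Prop :=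
  (forall a b, der (a + b) = der a + der b) /\
  (forall a b, der (a * b) = der a * b + a * der b).

Definition subfield (A : set K) : Prop :=
  [/\ A 1, forall a b, A a -> A b -> A (a - b)
    & forall a b, A a -> A b -> A (a / b)].

Definition diff_subfield (A : set K) : Prop :=
  subfield A /\ forall a, A a -> A (der a).

Definition field_gen (A : set K) : set K := smallest subfield A.
Definition diff_field_gen (A : set K) : set K := smallest diff_subfield A.

(* K{Y_0, ..., Y_(d-1)}: polynomials in the indeterminates Y_i^(j), the latter
   being indexed by the pair (i, j). *)
Definition dpoly (d : nat) := {malg K[{cmonom ('I_d * nat)%type}]}.

Definition dpoly_over d (A : set K) (P : dpoly d) : Prop :=
  forall m, A P@_m.

Definition dpoly_eval d (P : dpoly d) (y : 'I_d -> K) : K :=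
  \sum_(m <- msupp P)
    P@_m * \prod_(u <- finsupp (cmonom_val m)) iter u.2 der (y u.1) ^+ m u.

Definition d_algebraic (F : set K) (a : K) : Prop :=
  exists P : dpoly 1, [/\ dpoly_over F P, P != 0 & dpoly_eval P (fun=> a) = 0].

Definition d_alg_independent (F : set K) d (b : 'I_d -> K) : Prop :=
  forall P : dpoly d, dpoly_over F P -> dpoly_eval P b = 0 -> P = 0.

Definition d_trans_basis (F E : set K) d (b : 'I_d -> K) : Prop :=
  [/\ forall j, E (b j), d_alg_independent F b
    & forall a, E a -> d_algebraic (diff_field_gen (F `|` range b)) a].

(* dtrdeg (E | F) = d *)
Definition is_dtrdeg (F E : set K) (d : nat) : Prop :=
  exists b : 'I_d -> K, d_trans_basis F E b.

End DifferentialFields.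

(** * Ordered valued differential fields *)

Section ValuedFields.
Variables (K : realFieldType) (der : K -> K) (O : set K).

Definition valuation_ring : Prop :=
  [/\ O 1, forall a b, O a -> O b -> O (a - b),
      forall a b, O a -> O b -> O (a * b)
    & forall a, O a \/ O a^-1].

(* f ≼ g, f ≺ g and f ≍ g *)
Definition dominated (f g : K) : Prop := exists2 a, O a & f = a * g.
Definition sdominated (f g : K) : Prop := dominated f g /\ ~ dominated g f.
Definition asymp (f g : K) : Prop := dominated f g /\ dominated g f.

Definition pre_d_valued : Prop :=
  forall f g, dominated f 1 -> g != 0 -> sdominated g 1 ->
    sdominated (der f) (der g / g).

Definition convex_ring : Prop :=
  forall a b c, O a -> O c -> a <= b <= c -> O b.

Definition pre_H_field : Prop :=
  [/\ derivation der, valuation_ring, pre_d_valued, convex_ring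
    & forall f, (forall a, O a -> a < f) -> 0 < der f].

Definition small_derivation : Prop :=
  forall f, sdominated f 1 -> sdominated (der f) 1.

(* Linear surjectivity of the differential residue field, on representatives:
   a residue class vanishes iff its representatives are ≺ 1. *)
Definition residue_lin_surjective : Prop :=
  forall r (a : 'I_r.+1 -> K) (b : K),
    (forall j, O (a j)) -> (exists j, ~ sdominated (a j) 1) -> O b ->
    exists2 y, O y & sdominated (\sum_j a j * iter j der y - b) 1.

(* P ∈ O{Y}, P_0 ≺ 1 and P_1 ≍ 1, where P_i is the homogeneous part of degree
   i of P and K{Y} carries the gaussian extension of the valuation. *)
Definition d_henselian : Prop :=
  [/\ small_derivation, residue_lin_surjective
    & forall P : dpoly K 1,
        dpoly_over O P ->
        sdominated P@_(onecm ('I_1 * nat)%type) 1 ->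
        (exists2 m, mdeg m = 1%N & asymp P@_m 1) ->
        exists2 y, sdominated y 1 & dpoly_eval der P (fun=> y) = 0].

Definition liouville_closed : Prop :=
  [/\ Num.real_closed_axiom K,
      forall a, exists y, der y = a
    & forall a, exists2 z, z != 0 & der z / z = a].

Definition residue_class (a : K) : set K :=
  [set b | sdominated (b - a) 1].

Definition residue_lift (k : set K) : Prop :=
  [/\ diff_subfield der k, k `<=` O
    & set_bij k (residue_class @` O) residue_class].

End ValuedFields.

(** * The structure (K, k) *)

Inductive pair_fsym := F_zero | F_one | F_opp | F_add | F_mul | F_der.
Inductive pair_rsym := R_le | R_dom | R_lift.

Definition pair_signature : signature :=
  @Signature
    pair_fsym (fun f => match f with
      | F_zero | F_one => 0 | F_opp | F_der => 1 | F_add | F_mul => 2 end)%N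
    pair_rsym (fun r => match r with R_le | R_dom => 2 | R_lift => 1 end)%N.

Definition pair_structure (K : realFieldType) (der : K -> K) (O k : set K) :
    structure pair_signature :=
  @Structure pair_signature K
    (fun f => match f return ('I_(@farity pair_signature f) -> K) -> K with
     | F_zero => fun _ => 0
     | F_one => fun _ => 1
     | F_opp => fun x => - x ord0
     | F_add => fun x => x ord0 + x ord_max
     | F_mul => fun x => x ord0 * x ord_max
     | F_der => fun x => der (x ord0)
     end)
    (fun r => match r return set ('I_(@rarity pair_signature r) -> K) with
     | R_le => [set x | x ord0 <= x ord_max]
     | R_dom => [set x | dominated O (x ord0) (x ord_max)]
     | R_lift => [set x | k (x ord0)]
     end).

(** * The dimension dim_2 *)

Section Dim2.
Variables (K : realFieldType) (der : K -> K) (O k : set K) (n : nat).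

Definition elementary_saturated_extension (S : set ('I_n -> K))
    (K' : realFieldType) (der' : K' -> K') (O' k' : set K')
    (S' : set ('I_n -> K')) (i : K -> K') : Prop :=
  let M := @expand _ (pair_structure der O k) n S in
  let M' := @expand _ (pair_structure der' O' k') n S' in
  @elementary_embedding _ M M' i /\ @succ_card_saturated _ M' K.

(* d is the maximum of dtrdeg (K k'<s> | K k') for s in S'. *)
Definition is_dim2 (S : set ('I_n -> K)) (d : nat) : Prop :=
  exists (K' : realFieldType) (der' : K' -> K') (O' k' : set K')
    (S' : set ('I_n -> K')) (i : K -> K'),
    let F := field_gen (range i `|` k') in
    let E s := diff_field_gen der' (F `|` range s) in
    [/\ elementary_saturated_extension S der' O' k' S' i,
        exists2 s, S' s & is_dtrdeg der' F (E s) d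
      & forall s e, S' s -> is_dtrdeg der' F (E s) e -> (e <= d)%N].

Definition dim2 (S : set ('I_n -> K)) : \bar int :=
  if `[< S = set0 >] then -oo%E else (Posz (xget 0%N (is_dim2 S)))%:E.

End Dim2.

(* K^n with the product of the order topologies. *)
Definition closure_ord (K : realFieldType) n (S : set ('I_n -> K)) :
    set ('I_n -> K) :=
  @closure {ptws 'I_n -> order_topology K} S.

(* Main.v *)
(* If the frontier of S had dimension >= d = dim_2 S, an elementary extension L
   would contain b in the frontier with d coordinates x0 differentially
   independent over K k*. Choose over L a generic infinitesimal box (center y1,
   radius w) around the other coordinates y0 of b, and over that (x, y) in S*
   infinitesimally close to b. By independence, differential polynomials over
   K k* take asymptotically equivalent values at (x, y1, w) and (x0, y1, w), so
   quantifier elimination relative to k gives y* in the box with (x0, y* ) in S*.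
   As b is not in S*, some coordinate of y* - y0 is a nonzero infinitesimal over
   L; its iterated logarithmic derivatives have independent sizes, so it is
   differentially transcendental over L k*, and dim_2 S > d. *)
From HB Require Import structures.
From mathcomp Require Import all_boot all_order all_algebra finmap.
From mathcomp.multinomials Require Import mpoly.
From mathcomp Require Import all_classical all_reals topology.
From mathcomp Require Import ring lra.
Require Import Defs.

Set Implicit Arguments.
Unset Strict Implicit.
Unset Printing Implicit Defensive.

Import Order.TTheory GRing.Theory Num.Theory.

Local Open Scope classical_set_scope.
Local Open Scope ring_scope.

(** Most of the work is the relative quantifier elimination, an embedding theorem: an isomorphism
    between ordered valued differential subfields, elementary on the residue part, extends to the
    whole field when the target is saturated. Residue extensions need only saturation. An immediate
    extension may require a zero, at the limit of a pseudo-Cauchy family, of a minimal differential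
    polynomial [P] whose values do not settle. At the scale of the cut the linear part of [P]
    dominates, so d-henselianity gives zeros arbitrarily near the limit; if none reached it, the
    linear part would be an operator with more kernel elements of distinct values than its order
    allows. A new value [z] brings in the value of its logarithmic derivative, corrected by the
    subfield, and so on, so countably many values are adjoined at once. The box has an independent
    center and radius because [y0] may be differentially algebraic over [x0]: an isomorphism sending
    [x] to [x0] and fixing [y0] may then not exist, whereas one fixing [y1] and [w] does. *)

Local Notation RF := realFieldType.
Local Notation PS := pair_signature.

Reserved Notation "x <=: y" (at level 70).
Reserved Notation "x <: y" (at level 70).
Reserved Notation "x =: y" (at level 70).
Reserved Notation "x ~: y" (at level 70).
Reserved Notation "x <=:' y" (at level 70).
Reserved Notation "x <:' y" (at level 70).
Reserved Notation "x ~:' y" (at level 70).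

(** * Calculus of dominance, strict dominance and asymptotic equivalence *)

Section ValuationRing.
Variables (K : RF) (O : set K).
Hypothesis hO : valuation_ring O.
Notation "x <=: y" := (dominated O x y).
Notation "x <: y" := (~ dominated O y x).
Notation "x =: y" := (asymp O x y).
Notation "x ~: y" := (~ dominated O y (x - y)).
Lemma O1 : O 1. by case: hO. Qed.
Lemma OB a b : O a -> O b -> O (a - b). by case: hO=> _ h _ _;exact: h. Qed.
Lemma OM a b : O a -> O b -> O (a * b). by case: hO=> _ _ h _;exact: h. Qed.
Lemma OV a : O a \/ O a^-1. by case: hO=> _ _ _;exact. Qed.
Lemma O0 : O 0. by rewrite -(subrr 1);apply: OB O1 O1. Qed.
Lemma ON a : O a -> O (- a). by rewrite -sub0r;apply: OB O0. Qed.
Lemma OD a b : O a -> O b -> O (a + b).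
move=> ha hb;rewrite -(opprK b);apply: OB=> //;exact: ON. Qed.
Lemma OX a n : O a -> O (a ^+ n).
by move=> ha;elim: n=> [|n IH];rewrite ?expr0 ?exprS;[exact: O1|exact: OM]. Qed.
Lemma On n : O n%:R.
by elim: n=> [|n IH];rewrite ?mulr0n ?mulrS;[exact: O0|apply: OD=> //;exact: O1]. Qed.
Lemma dle1 x : x <=: 1 <-> O x.
by split=> [[a ha ->]|hx];[rewrite mulr1|exists x;rewrite ?mulr1]. Qed.
Lemma dleP x y : y != 0 -> x <=: y <-> O (x / y).
move=> y0;split=> [[a ha ->]|h];first by rewrite mulfK.
by exists (x / y)=> //;rewrite divfK.
Qed.
Lemma dle_refl x : x <=: x. by exists 1;[exact: O1|rewrite mul1r]. Qed.
Hint Resolve dle_refl : core.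
Lemma dle_trans y x z : x <=: y -> y <=: z -> x <=: z.
by move=> [a ha ->] [b hb ->];exists (a * b);[exact: OM|rewrite mulrA]. Qed.
Lemma dle0x x : 0 <=: x. by exists 0;[exact: O0|rewrite mul0r]. Qed.
Hint Resolve dle0x : core.
Lemma dlex0 x : x <=: 0 -> x = 0. by case=> a _ ->;rewrite mulr0. Qed.
Lemma dle_total x y : x <=: y \/ y <=: x.
have [->|y0] := eqVneq y 0;first by right.
have [->|x0] := eqVneq x 0;first by left.
by case: (OV (x / y))=> h;[left|right];apply/dleP=> //;rewrite -[y / x]invf_div.
Qed.
(** Strict dominance is encoded as failure of the converse dominance, so totality is what turns it
    into dominance. The encoding forces the larger side to be nonzero, and hence both sides of an
    equivalence [x ~: y]. *)
Lemma dltW x y : x <: y -> x <=: y.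
by move=> h;case: (dle_total x y)=> // /h. Qed.
Lemma dlt_neq0 x y : x <: y -> y != 0.
by move=> h;apply/eqP=> y0;apply: h;rewrite y0. Qed.
Lemma dlt_irr x : ~ (x <: x). by apply. Qed.
Lemma dle_lt_trans y x z : x <=: y -> y <: z -> x <: z.
by move=> xy yz zx;apply: yz;apply: dle_trans xy. Qed.
Lemma dlt_le_trans y x z : x <: y -> y <=: z -> x <: z.
by move=> xy yz zx;apply: xy;apply: dle_trans zx. Qed.
Lemma dlt_trans y x z : x <: y -> y <: z -> x <: z.
move=> xy /dltW;exact: dlt_le_trans. Qed.
Lemma dlt0x x : x != 0 -> 0 <: x.
by move=> x0 /dlex0 e;rewrite e eqxx in x0. Qed.
Lemma dleM x y x' y' : x <=: y -> x' <=: y' -> x * x' <=: y * y'.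
by move=> [a ha ->] [b hb ->];exists (a * b);[exact: OM|rewrite mulrACA]. Qed.
Lemma dleMr z x y : x <=: y -> x * z <=: y * z. by move/dleM;apply. Qed.
Lemma dleMl z x y : x <=: y -> z * x <=: z * y. exact: dleM. Qed.
Lemma dle_M2r z x y : z != 0 -> x * z <=: y * z -> x <=: y.
by move=> z0 /(dleMr z^-1);rewrite !mulfK. Qed.
Lemma dle_M2l z x y : z != 0 -> z * x <=: z * y -> x <=: y.
rewrite ![z * _]mulrC;exact: dle_M2r. Qed.
Lemma dltMr z x y : z != 0 -> x <: y -> x * z <: y * z.
by move=> z0 h /(dle_M2r z0). Qed.
Lemma dltMl z x y : z != 0 -> x <: y -> z * x <: z * y.
by move=> z0 h /(dle_M2l z0). Qed.
Lemma dltM x y x' y' : y' != 0 -> x <: y -> x' <=: y' -> x * x' <: y * y'.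
by move=> y0 xy xy';apply: (@dle_lt_trans (x * y'));[exact: dleMl|exact: dltMr]. Qed.
Lemma dltM' x y x' y' : x <: y -> x' <: y' -> x * x' <: y * y'.
by move=> xy xy';apply: dltM=> //;[exact: dlt_neq0 xy'|exact: dltW]. Qed.
Lemma dleX n x y : x <=: y -> x ^+ n <=: y ^+ n.
by move=> [a ha ->];exists (a ^+ n);[exact: OX|rewrite exprMn]. Qed.
Lemma dltX n x y : x <: y -> x ^+ n.+1 <: y ^+ n.+1.
by move=> h;elim: n=> [|n IH];rewrite ?expr1 // (exprS x) (exprS y);apply: dltM'.
Qed.
Lemma dleX_inv n x y : x ^+ n.+1 <=: y ^+ n.+1 -> x <=: y.
by move=> h;apply: contrapT=> /(@dltX n);apply. Qed.
Lemma dleV x y : x != 0 -> x <=: y -> y^-1 <=: x^-1.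
move=> x0 xy;have y0 : y != 0 by apply/eqP=> e;move: xy x0;rewrite e=> /dlex0 ->;rewrite eqxx.
by have := dleMr (x^-1 * y^-1) xy;rewrite mulrA mulfV // mul1r mulrCA mulfV // mulr1.
Qed.
Lemma dltV x y : x != 0 -> x <: y -> y^-1 <: x^-1.
move=> x0 xy h;apply: xy.
by move/(dleV (invr_neq0 x0)): h;rewrite !invrK.
Qed.
Lemma dleN x y : x <=: y -> - x <=: y.
by move=> [a ha ->];exists (- a);[exact: ON|rewrite mulNr]. Qed.
Lemma dleNE x y : (- x <=: y) <-> x <=: y.
by split=> /dleN;rewrite ?opprK. Qed.
Lemma dleNr x y : (x <=: - y) <-> x <=: y.
split=> -[a ha ->];exists (- a);rewrite ?mulrNN ?mulNr ?mulrN //;exact: ON.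
Qed.
Lemma dleD z x y : x <=: z -> y <=: z -> x + y <=: z.
by move=> [a ha ->] [b hb ->];exists (a + b);[exact: OD|rewrite mulrDl]. Qed.
Lemma dleB z x y : x <=: z -> y <=: z -> x - y <=: z.
move=> hx hy;apply: dleD=> //;exact: dleN. Qed.
Lemma dltD z x y : x <: z -> y <: z -> x + y <: z.
move=> hx hy;case: (dle_total x y)=> h.
 by apply: (dle_lt_trans _ hy);apply: dleD.
by apply: (dle_lt_trans _ hx);apply: dleD.
Qed.
Lemma dltN x y : x <: y -> - x <: y.
by move=> h /dleNr. Qed.
Lemma dltB z x y : x <: z -> y <: z -> x - y <: z.
move=> hx hy;apply: dltD=> //;exact: dltN. Qed.
Lemma dle_sum (I : Type) (r : seq I) (P : pred I) (F : I -> K) z :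
 (forall i, P i -> F i <=: z) -> \sum_(i <- r | P i) F i <=: z.
move=> h;elim/big_ind: _=> // x y;exact: dleD. Qed.
Lemma dlt_sum (I : Type) (r : seq I) (P : pred I) (F : I -> K) z :
 z != 0 -> (forall i, P i -> F i <: z) -> \sum_(i <- r | P i) F i <: z.
by move=> z0 h;elim/big_ind: _=> // [|x y];[exact: dlt0x|exact: dltD]. Qed.
Lemma dlt_sum_seq (I : eqType) (r : seq I) (F : I -> K) z :
 z != 0 -> (forall i, i \in r -> F i <: z) -> \sum_(i <- r) F i <: z.
by move=> z0 h;rewrite big_seq;apply: dlt_sum. Qed.
Lemma dle_addr x y : y <: x -> x <=: x + y.
move=> yx;apply: contrapT=> h.
apply: (@dlt_irr x);rewrite -[X in X <: _](addrK y x);exact: dltB h yx.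
Qed.
Lemma asymp_refl x : x =: x. by []. Qed.
Lemma asymp_sym x y : x =: y -> y =: x. by case. Qed.
Lemma asymp_trans y x z : x =: y -> y =: z -> x =: z.
by move=> [a b] [c d];split;[apply: dle_trans c|apply: dle_trans b]. Qed.
Lemma asympM x y x' y' : x =: y -> x' =: y' -> x * x' =: y * y'.
move=> [a b] [c d];split;exact: dleM. Qed.
Lemma asympX n x y : x =: y -> x ^+ n =: y ^+ n.
move=> [a b];split;exact: dleX. Qed.
Lemma asymp_neq0 x y : x =: y -> y != 0 -> x != 0.
by move=> [_ h] y0;apply/eqP=> e;move: h y0;rewrite e=> /dlex0 ->;rewrite eqxx. Qed.
Lemma asympV x y : y != 0 -> x =: y -> x^-1 =: y^-1.
move=> y0 h;have x0 := asymp_neq0 h y0;case: h=> a b;split;exact: dleV. Qed.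
Lemma asymp_max (I : eqType) (r : seq I) (F : I -> K) i0 : i0 \in r ->
 exists2 i, i \in r & forall j, j \in r -> F j <=: F i.
elim: r i0=> // a r IH i0 _;case: r IH=> [_|b r IH].
 by exists a;rewrite ?mem_head // => j;rewrite inE=> /eqP ->.
have [i ir hi] := IH b (mem_head _ _);case: (dle_total (F a) (F i))=> h.
 by exists i;[rewrite inE ir orbT|move=> j;rewrite inE=> /orP[/eqP ->|/hi]].
exists a;first exact: mem_head.
move=> j;rewrite inE=> /orP[/eqP ->//|/hi hj];exact: dle_trans h.
Qed.
Lemma sim_neq0 x y : x ~: y -> y != 0. exact: dlt_neq0. Qed.
Lemma sim_asymp x y : x ~: y -> x =: y.
move=> h;split;last by rewrite -[X in _ <=: X](subrK y x) addrC;exact: dle_addr.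
rewrite -(subrK y x);apply: dleD=> //;exact: dltW.
Qed.
Lemma sim_neq0l x y : x ~: y -> x != 0.
move=> h;exact: asymp_neq0 (sim_asymp h) (sim_neq0 h). Qed.
Lemma sim_refl x : x != 0 -> x ~: x. by move=> x0;rewrite subrr;exact: dlt0x. Qed.
Lemma sim_sym x y : x ~: y -> y ~: x.
move=> h;apply: (dlt_le_trans _ (sim_asymp h).2);rewrite -opprB;exact: dltN.
Qed.
Lemma simM x y x' y' : x ~: y -> x' ~: y' -> x * x' ~: y * y'.
move=> h h';have -> : x * x' - y * y' = (x - y) * x' + y * (x' - y') by ring.
apply: dltD;last by apply: dltMl=> //;exact: sim_neq0 h.
by apply: dltM=> //;[exact: sim_neq0 h'|exact: (sim_asymp h').1].
Qed.
Lemma simV x y : x ~: y -> x^-1 ~: y^-1.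
move=> h;have x0 := sim_neq0l h;have y0 := sim_neq0 h.
have -> : x^-1 - y^-1 = (y - x) * (x^-1 * y^-1) by field;apply/andP;split.
rewrite -{1}[y^-1]mul1r -[X in X * _](mulfV x0) -mulrA;apply: dltMr (sim_sym h).
by rewrite mulf_neq0 ?invr_neq0.
Qed.
Lemma simDr x y : y <: x -> x + y ~: x.
by rewrite addrAC subrr add0r. Qed.

Section Convex.
Hypothesis hconv : convex_ring O.
Lemma dle_abs x y : `|x| <= `|y| -> x <=: y.
have [->|y0] := eqVneq y 0;first by rewrite normr0 normr_le0=> /eqP ->.
move=> h;apply/dleP=> //;apply: (hconv (a := -1) (c := 1));[exact: ON O1|exact: O1|].
by rewrite -ler_norml normrM normfV ler_pdivrMr ?normr_gt0 ?mul1r.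
Qed.
Lemma dle_pos x y : 0 <= x -> x <= y -> x <=: y.
by move=> x0 xy;apply: dle_abs;rewrite !ger0_norm ?(le_trans x0). Qed.
Lemma dlt_abs x y : x <: y -> `|x| < `|y|.
by move=> h;rewrite ltNge;apply/negP=> /dle_abs. Qed.
Lemma sim_gt0 x y : x ~: y -> (0 < x) = (0 < y).
move=> h;have := dlt_abs h;have := sim_neq0 h;have := sim_neq0l h.
by case: (ltgtP 0 x)=> // x0;case: (ltgtP 0 y)=> // y0 _ _;
 rewrite real_lter_distl ?num_real // ?(gtr0_norm y0) ?(ltr0_norm y0)=> /andP[];lra.
Qed.
Lemma natS_asymp n : n.+1%:R =: 1.
split;first by apply/dle1;exact: On.
by apply: dle_abs;rewrite normr1 normr_nat ler1n.
Qed.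
Lemma dle_nat n x y : x *+ n.+1 <=: y -> x <=: y.
move=> h;apply: dle_trans h;rewrite -mulr_natr -{1}[x]mulr1;apply: dleMl.
exact: (natS_asymp n).2.
Qed.
Lemma dlt_nat n x y : x *+ n.+1 <: y -> x <: y.
move=> h /= yx;apply: h;apply: dle_trans yx _;rewrite -mulr_natr -{1}[x]mulr1;apply: dleMl;exact: (natS_asymp n).2. Qed.
Lemma dleMn n x y : x <=: y -> x *+ n <=: y.
move=> [a ha ->];exists (a *+ n);rewrite ?mulrnAl // -mulr_natr;apply: OM=> //;exact: On. Qed.
End Convex.
End ValuationRing.

(** * Derivations and logarithmic derivatives *)

Section Derivation.
Variables (K : RF) (der : K -> K).
Hypothesis hd : derivation der.
Definition logder x := der x / x.
Notation logd := logder.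
Lemma derD a b : der (a + b) = der a + der b. exact: hd.1. Qed.
Lemma derM a b : der (a * b) = der a * b + a * der b. exact: hd.2. Qed.
Lemma der0 : der 0 = 0.
by apply: (addrI (der 0));rewrite -derD !addr0. Qed.
Lemma derN a : der (- a) = - der a.
by apply: (addrI (der a));rewrite -derD !subrr der0. Qed.
Lemma derB a b : der (a - b) = der a - der b. by rewrite derD derN. Qed.
Lemma der1 : der 1 = 0.
by apply: (addrI (der 1));rewrite addr0 -{3}(mulr1 1) derM mulr1 mul1r. Qed.
Lemma derMn a n : der (a *+ n) = der a *+ n.
by elim: n=> [|n IH];rewrite ?mulr0n ?der0 // !mulrS derD IH. Qed.
Lemma der_nat n : der n%:R = 0. by rewrite derMn der1 mul0rn. Qed.
Lemma der_sum (I : Type) (r : seq I) (P : pred I) (F : I -> K) :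
 der (\sum_(i <- r | P i) F i) = \sum_(i <- r | P i) der (F i).
by elim/big_rec2: _=> [|i y x _ <-];rewrite ?der0 ?derD. Qed.
Lemma derX a n : der (a ^+ n) = (a ^+ n.-1 * der a) *+ n.
elim: n=> [|n IH];first by rewrite expr0 der1.
rewrite exprS derM IH /=;case: n IH=> [|n] _;first by rewrite !expr0 mulr0n mulr0 addr0 mulr1 mul1r.
by rewrite /= mulrnAr mulrA -exprS [RHS]mulrS mulrC.
Qed.
Lemma derV a : a != 0 -> der a^-1 = - der a / a ^+ 2.
move=> a0;have : der (a * a^-1) = 0 by rewrite mulfV ?der1.
rewrite derM=> /eqP;rewrite addr_eq0=> /eqP h.
by apply: (mulfI a0);rewrite -[LHS]opprK -h;field.
Qed.
Lemma der_div a b : b != 0 -> der (a / b) = (der a * b - a * der b) / b ^+ 2.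
by move=> b0;rewrite derM derV //;field. Qed.
Lemma iter_der0 n : iter n der 0 = 0. by elim: n=> //= n ->;exact: der0. Qed.
Lemma iter_derD n a b : iter n der (a + b) = iter n der a + iter n der b.
elim: n=> //= n ->;exact: derD. Qed.
Lemma iter_derN n a : iter n der (- a) = - iter n der a.
elim: n=> //= n ->;exact: derN. Qed.
Lemma iter_derB n a b : iter n der (a - b) = iter n der a - iter n der b.
by rewrite iter_derD iter_derN. Qed.
Lemma iter_derM n a b : iter n der (a * b) =
 \sum_(i < n.+1) (iter (n - i) der a * iter i der b) *+ 'C(n, i).
elim: n=> [|n IH];first by rewrite big_ord1 bin0.
rewrite /= IH der_sum (eq_bigr (fun i : 'I_n.+1 =>
 (iter (n.+1 - i) der a * iter i der b) *+ 'C(n, i) +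
 (iter (n - i) der a * iter i.+1 der b) *+ 'C(n, i)));last first.
 by move=> i _;rewrite derMn derM -mulrnDl /= subSn ?leq_ord.
rewrite big_split /= [RHS]big_ord_recl /= bin0.
rewrite (big_ord_recl n) /= bin0 -!addrA;congr (_ + _).
rewrite [in LHS](big_ord_recr n) /= [in RHS]big_ord_recr /= addrA;congr (_ + _);last first.
 by rewrite /bump /= add1n add0n !binn !subnn.
rewrite -big_split /=;apply: eq_bigr=> i _.
by rewrite /bump /= add1n add0n binS mulrnDr subSS.
Qed.
Lemma logdM a b : a != 0 -> b != 0 -> logd (a * b) = logd a + logd b.
by move=> a0 b0;rewrite /logder derM;field;rewrite a0 b0. Qed.
Lemma logdV a : a != 0 -> logd a^-1 = - logd a.
by move=> a0;rewrite /logder derV //;field. Qed.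
Lemma logd_div a b : a != 0 -> b != 0 -> logd (a / b) = logd a - logd b.
by move=> a0 b0;rewrite logdM ?invr_eq0 // logdV. Qed.
Lemma logdX a n : a != 0 -> logd (a ^+ n) = logd a *+ n.
move=> a0;elim: n=> [|n IH];first by rewrite expr0 /logd der1 mul0r.
by rewrite exprS logdM ?expf_neq0 // IH mulrS.
Qed.
Lemma logdN a : logd (- a) = logd a.
by rewrite /logder derN invrN mulrNN. Qed.
Lemma der_logd a : a != 0 -> der a = a * logd a.
by move=> a0;rewrite /logder mulrC divfK. Qed.
End Derivation.

(** The consequences of the hypotheses that the proof works with, all first-order or schemes of
    first-order statements, so that elementary extensions inherit them. [t_psi] is the pre-d-valued
    axiom applied to an element of [k] of derivative 1. [t_DH1] and [t_DH2] are d-henselianity for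
    polynomials that are linear modulo infinitesimals; the second allows a constant term that is not
    small, since linear surjectivity of the residue field is built in. *)
Record tame (K : RF) (der : K -> K) (O k : set K) : Prop := Tame {
 t_der : derivation der;
 t_val : valuation_ring O;
 t_conv : convex_ring O;
 t_H : forall f, (forall a, O a -> a < f) -> 0 < der f;
 t_small : forall f, ~ dominated O 1 f -> ~ dominated O 1 (der f);
 t_k1 : k 1;
 t_kB : forall a b, k a -> k b -> k (a - b);
 t_kM : forall a b, k a -> k b -> k (a * b);
 t_kV : forall a, k a -> k a^-1;
 t_kder : forall a, k a -> k (der a);
 t_kO : forall a, k a -> O a;
 t_lift : forall x, O x -> exists2 c, k c & ~ dominated O 1 (x - c);
 t_k0 : forall c, k c -> ~ dominated O 1 c -> c = 0;
 t_x : exists2 x, k x & der x = 1;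
 t_ne : exists2 e : K, e != 0 & ~ dominated O 1 e;
 t_root : forall (e : K) n, 0 < e -> exists2 x : K, 0 < x & x ^+ n.+1 = e;
 t_exp : forall a, exists2 z : K, z != 0 & der z = a * z;
 t_psi : forall g : K, g != 0 -> ~ dominated O 1 g -> ~ dominated O (logder der g) 1;
 t_DH1 : forall n (R : {mpoly K[n]}), (forall m, O R@_m) ->
 (forall m, (1 < mdeg m)%N -> ~ dominated O 1 R@_m) ->
 (exists i, dominated O 1 R@_U_(i)) -> ~ dominated O 1 R@_0 ->
 exists2 y, ~ dominated O 1 y & R.@[fun i=> iter i der y] = 0;
 t_DH2 : forall n (R : {mpoly K[n]}), (forall m, O R@_m) ->
 (forall m, (1 < mdeg m)%N -> ~ dominated O 1 R@_m) ->
 (exists i, dominated O 1 R@_U_(i)) ->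
 exists2 y, O y & R.@[fun i=> iter i der y] = 0
}.

(** * Asymptotics of derivatives and logarithmic derivatives *)

Section Tame.
Variables (K : RF) (der : K -> K) (O k : set K).
Hypothesis T : tame der O k.
Notation "x <=: y" := (dominated O x y).
Notation "x <: y" := (~ dominated O y x).
Notation "x =: y" := (asymp O x y).
Notation logd := (logder der).
Let hO := t_val T.
Let hd := t_der T.
Let hc := t_conv T.
Local Hint Resolve hO hd hc : core.
Local Hint Resolve dle_refl dle0x : core.
Lemma k0 : k 0. by rewrite -(subrr 1);apply: (t_kB T);exact: (t_k1 T). Qed.
Lemma k_asymp1 c : k c -> c != 0 -> c =: 1.
move=> kc c0;split;first by apply/dle1=> //;exact: (t_kO T).
by apply: contrapT=> h;move: c0;rewrite (t_k0 T kc h) eqxx.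
Qed.
(** A bounded element is an element of [k], which is closed under the derivation, plus an
    infinitesimal, whose derivative is infinitesimal. *)
Lemma Oder x : O x -> O (der x).
move=> /(t_lift T)[c kc h];rewrite -(subrK c x) derD //;apply: OD=> //.
 apply/dle1=> //;apply: dltW=> //;exact: (t_small T).
apply: (t_kO T);exact: (t_kder T).
Qed.
Lemma Oiter n x : O x -> O (iter n der x).
move=> h;elim: n=> //= n;exact: Oder. Qed.
Lemma logd_unit x : x =: 1 -> logd x <=: 1.
move=> h;have x0 := asymp_neq0 h (oner_neq0 _);apply/dle1=> //.
by apply: OM=> //;[apply: Oder;apply/dle1=> //;exact: h.1|apply/dle1=> //;rewrite -invr1;apply: dleV=> //;[exact: oner_neq0|exact: h.2]].
Qed.
(** Below 1 this is [t_psi]; above 1 pass to the inverse, which only changes the sign of the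
    logarithmic derivative. *)
Lemma logd_big (x : K) : x != 0 -> ~ (x =: 1) -> 1 <: logd x.
move=> x0 nx;case: (pselect (1 <=: x))=> h1;last exact: (t_psi T).
have h2 : x^-1 <: 1.
 rewrite -invr1;apply: dltV=> //;first exact: oner_neq0.
 by move=> h;apply: nx.
have := t_psi T (invr_neq0 x0) h2;rewrite logdV // => h h';apply: h;exact: dleN.
Qed.
Lemma logd_leq1 x : x != 0 -> logd x <=: 1 -> x =: 1.
by move=> x0 h;apply: contrapT=> /(logd_big x0);apply. Qed.
Lemma logd_gt0 x : 1 <: x -> 0 < x -> 0 < logd x.
move=> h x0;rewrite divr_gt0 //;apply: (t_H T)=> a ha;rewrite ltNge;apply/negP=> xa.
by apply: h;apply: (@dle_trans _ _ hO a);[apply: dle_pos=> //;exact: ltW|apply/dle1].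
Qed.
Lemma logd_lt0 x : x <: 1 -> 0 < x -> logd x < 0.
move=> h x0;rewrite -oppr_gt0 -logdV ?gt_eqF //;apply: logd_gt0;rewrite ?invr_gt0 //.
by rewrite -invr1;apply: dltV=> //;rewrite gt_eqF.
Qed.
Lemma logd_abs x : logd `|x| = logd x.
by case: (lerP 0 x)=> h;rewrite ?(ger0_norm h) ?(ltr0_norm h) ?logdN. Qed.
Lemma dle_norm x y : (`|x| <=: y) <-> (x <=: y).
case: (lerP 0 x)=> h;rewrite ?(ger0_norm h) ?(ltr0_norm h) //;exact: dleNE. Qed.
Lemma dle_normr x y : (x <=: `|y|) <-> (x <=: y).
case: (lerP 0 y)=> h;rewrite ?(ger0_norm h) ?(ltr0_norm h) //;exact: dleNr. Qed.
(** For positive [u] and [w]: if [w / u] is infinite, its logarithmic derivative is positive, so the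
    two are ordered as real elements; if it is a unit, they differ by a bounded amount, negligible
    against the infinite [logd w]. *)
Lemma logd_mono u w : 1 <: u -> u <=: w -> logd u <=: logd w.
wlog u0 : u w / 0 < u.
 move=> H hu;have u0 := dlt_neq0 hO hu;rewrite -(logd_abs u) -(dle_norm u).
 by apply: H;rewrite ?normr_gt0 // => /dle_norm.
wlog w0 : w / 0 < w.
 move=> H hu huw;have w0 : w != 0.
 by apply/eqP=> e;rewrite e in huw;move/(dlex0): huw=> h;rewrite h ltxx in u0.
 by rewrite -(logd_abs w);apply: H=> //;rewrite ?normr_gt0 //;apply/dle_normr.
move=> hu huw;have hw : 1 <: w by exact: dlt_le_trans huw.
have u1 : u != 0 by rewrite gt_eqF. have w1 : w != 0 by rewrite gt_eqF.
case: (pselect (w <=: u))=> hwu;last first.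
 have h : 1 <: w / u by move=> /(dleMr hO u);rewrite divfK // mul1r.
 have := logd_gt0 h;rewrite divr_gt0 // => /(_ isT);rewrite logd_div // subr_gt0=> /ltW.
 by apply: dle_pos=> //;apply/ltW/logd_gt0.
have h : w / u =: 1.
 split;first by apply/dle1=> //;apply/dleP.
 by rewrite -invf_div -{1}invr1;apply: dleV=> //;[rewrite mulf_neq0 ?invr_neq0|apply/dle1=> //;apply/dleP].
have := logd_unit h;rewrite logd_div // => h1.
have lw : 1 <: logd w by apply: logd_big=> // -[] /hw.
rewrite -[logd u](subKr (logd w));apply: dleB=> //;first exact: dle_refl.
apply: (dle_trans hO h1);exact: dltW.
Qed.
(** With [s = logd u], the inequality [u <=: s ^+ N] would give [s <=: logd s] by monotonicity. Then
    the derivative of the infinitesimal [s^-1], which is [- logd s / s], would not be small. *)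
Lemma logdX_small u N : 1 <: u -> logd u ^+ N <: u.
move=> hu;have u0 := dlt_neq0 hO hu;set s := logd u.
have hs : 1 <: s by apply: logd_big=> // -[] /hu.
have s0 := dlt_neq0 hO hs.
move=> hN;have := logd_mono hu hN;rewrite logdX // -/s=> h.
have {}h : s <=: logd s by apply: (dle_trans hO h);apply: dleMn=> //;exact: dle_refl.
have : der s^-1 <: 1.
 apply: (t_small T);rewrite -[X in ~ dominated _ X _]invr1;apply: dltV=> //;exact: oner_neq0.
apply;rewrite derV // mulNr;apply/dleNr=> //.
have -> : der s / s ^+ 2 = logd s / s by rewrite /logder;field.
rewrite -(mulfV s0);exact: dleMr.
Qed.
(** Write [x = (x / y) * y]. In the product rule both terms are strictly below [y * logd y], because
    [logd y] is infinite while [x / y] and its derivative are infinitesimal. *)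
Lemma der_dlt (x y : K) : y != 0 -> ~ (y =: 1) -> x <: y -> der x <: der y.
move=> y0 ny xy;have ly := logd_big y0 ny.
have ex : x / y <: 1 by move=> /(dleMr hO y);rewrite divfK // mul1r.
rewrite -{1}(divfK y0 x) derM // (der_logd der y0).
have l0 := dlt_neq0 hO ly.
apply: dltD=> //.
 rewrite [y * _]mulrC;apply: dltMr=> //;apply: (dlt_trans hO _ ly);exact: (t_small T).
by rewrite -[X in ~ dominated _ X _]mul1r;apply: dltMr=> //;rewrite mulf_neq0.
Qed.

(* v(z^(m)) >= v z + m v(z†) *)
Lemma iter_der_le (z : K) m : z != 0 -> ~ (z =: 1) -> iter m der z <=: z * logd z ^+ m.
move=> z0 nz;have lz := logd_big z0 nz;set nu := logd z in lz *.
have n0 := dlt_neq0 hO lz.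
have dnu : der nu <=: nu ^+ 2.
 rewrite der_logd // -/nu expr2;apply: dleMl=> //.
 by have := dltW hO (logdX_small (N := 1) lz);rewrite expr1.
have step y j : y <=: nu ^+ j -> der y <=: nu ^+ j.+1.
 move=> [a ha ->];rewrite derM //;apply: dleD=> //.
 rewrite exprS;apply: dleM=> //;last exact: dle_refl.
 by apply: (dle_trans hO (y := 1));[apply/dle1=> //;exact: Oder|exact: dltW].
 rewrite derX // -[X in _ <=: X]mul1r;apply: dleM=> //;first exact/dle1.
 case: j=> [|j];first by rewrite mulr0n;exact: dle0x.
 apply: dleMn=> //.
 apply: (dle_trans hO (dleMl hO _ dnu));rewrite -exprD addn2;exact: dle_refl.
have aux j : iter j der z / z <=: nu ^+ j.
 elim: j=> [|j IH];first by rewrite expr0 mulfV //;exact: dle_refl.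
 have -> : iter j.+1 der z / z = der (iter j der z / z) + iter j der z / z * nu.
 by rewrite /= [in X in _ + X]/nu /logder der_div //;field.
 apply: dleD=> //;first exact: step.
 rewrite exprSr;exact: dleMr.
rewrite -(divfK z0 (iter m der z)) mulrC;apply: dleMl=> //;exact: aux.
Qed.
End Tame.
Lemma mnm1_eq n (i j : 'I_n) : (U_(i)%MM == U_(j)%MM) = (i == j).
by apply/eqP/eqP=> [/mnmP/(_ j)|->//];rewrite !mnm1E eqxx;case: eqP.
Qed.

(** * Substitutions in multivariate polynomials *)

Section MpolyGeneric.
Variable R : comNzRingType.
Definition linsub n (A : 'M[R]_n) : n.-tuple {mpoly R[n]} :=
 [tuple \sum_j A i j *: 'X_j | i < n].
Lemma comp_mpolyA n m l (P : {mpoly R[n]}) (p : n.-tuple {mpoly R[m]})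
 (q : m.-tuple {mpoly R[l]}) :
 (P \mPo p) \mPo q = P \mPo [tuple tnth p i \mPo q | i < n].
rewrite (comp_mpolyEX P p) (comp_mpolyEX P) raddf_sum /=.
apply: eq_bigr=> m0 _;rewrite comp_mpolyZ;congr (_ *: _).
rewrite !comp_mpolyX rmorph_prod /=;apply: eq_bigr=> i _.
by rewrite rmorphXn /= tnth_mktuple.
Qed.
Lemma linsub_comp n (A B : 'M[R]_n) (P : {mpoly R[n]}) :
 (P \mPo linsub A) \mPo linsub B = P \mPo linsub (A *m B).
rewrite comp_mpolyA;congr (P \mPo _);apply: eq_from_tnth=> i.
rewrite !tnth_mktuple raddf_sum /=.
under eq_bigr=> j _ do rewrite comp_mpolyZ comp_mpolyXU -tnth_nth tnth_mktuple scaler_sumr.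
rewrite exchange_big /=;apply: eq_bigr=> l _;rewrite mxE scaler_suml.
by apply: eq_bigr=> j _;rewrite scalerA.
Qed.
Lemma linsub1 n (P : {mpoly R[n]}) : P \mPo linsub 1%:M = P.
rewrite -[RHS]comp_mpoly_id;congr (P \mPo _);apply: eq_from_tnth=> i.
rewrite !tnth_mktuple (bigD1 i) //= mxE eqxx scale1r big1 ?addr0 // => j ji.
by rewrite mxE eq_sym (negPf ji) scale0r.
Qed.
(** The chain rule; on monomials it follows from the product rule by splitting off one variable [i0]
    that occurs. *)
Lemma mderiv_comp n m (P : {mpoly R[n]}) (q : n.-tuple {mpoly R[m]}) (j : 'I_m) :
 (P \mPo q)^`M(j) = \sum_i (P^`M(i) \mPo q) * (tnth q i)^`M(j).
have mono d (mm : 'X_{1..n}) : mdeg mm = d ->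
 ('X_[mm] \mPo q)^`M(j) = \sum_i ('X_[mm]^`M(i) \mPo q) * (tnth q i)^`M(j).
 elim: d mm=> [|d IH] mm hm.
 have -> : mm = 0%MM by apply/eqP;rewrite -mdeg_eq0 hm.
 rewrite mpolyX0 comp_mpoly1 -mpolyC1 mderivC big1 // => i _.
 by rewrite mderivC comp_mpoly0 mul0r.
 have [i0 hi0] : exists i, mm i != 0%N.
 apply/existsP;rewrite -negb_forall;apply/negP=> /forallP h.
 by move: hm;rewrite mdegE big1 // => i _;apply/eqP.
 have e : mm = (U_(i0) + (mm - U_(i0)))%MM.
 apply/mnmP=> i;rewrite mnmDE mnmBE mnm1E;case: eqP=> [<-|_];last by rewrite add0n subn0.
 by rewrite add1n subn1 prednK // lt0n.
 have hd : mdeg (mm - U_(i0)) = d.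
 by apply: succn_inj;rewrite -hm [in RHS]e mdegD mdeg1.
 rewrite e mpolyXD rmorphM /= mderivM (IH _ hd).
 under [RHS]eq_bigr=> i _ do rewrite mderivM rmorphD /= !rmorphM /= mulrDl.
 rewrite big_split /=;congr (_ + _);last first.
 by rewrite mulr_sumr;apply: eq_bigr=> i _;rewrite mulrA.
 rewrite (bigD1 i0) //= [X in _ + X]big1 ?addr0=> [|i ii];last first.
 by rewrite mderivX mnm1E eq_sym (negPf ii) scale0r comp_mpoly0 !mul0r.
 rewrite comp_mpolyXU -tnth_nth mderivX mnm1E eqxx scale1r.
 have -> : (U_(i0) - U_(i0) = 0 :> 'X_{1..n})%MM by apply/mnmP=> l;rewrite mnmBE subnn mnm0E.
 by rewrite mpolyX0 comp_mpoly1 mul1r mulrC.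
rewrite {1}comp_mpolyEX raddf_sum /=.
under eq_bigr=> mm _ do rewrite mderivZ (mono _ _ erefl) scaler_sumr.
rewrite exchange_big /=;apply: eq_bigr=> i _.
rewrite [in RHS](mpolyE P) (raddf_sum (mderiv i)) (raddf_sum (comp_mpoly q)) mulr_suml /=.
by apply: eq_bigr=> mm _;rewrite mderivZ comp_mpolyZ scalerAl.
Qed.
Lemma mcoeff0_comp n m (P : {mpoly R[n]}) (q : n.-tuple {mpoly R[m]}) :
 (P \mPo q)@_0 = P.@[fun i=> (tnth q i)@_0].
have h (p : {mpoly R[m]}) : p@_0 = p.@[fun=> 0].
 rewrite mevalE [in LHS](mpolyE p) raddf_sum /=;apply: eq_bigr=> mm _.
 rewrite mcoeffZ mcoeffX;congr (_ * _);case: eqVneq=> [->|ne].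
 by rewrite big1 // => i _;rewrite mnm0E expr0.
 have [i0 hi0] : exists i, mm i != 0%N.
 apply/existsP;rewrite -negb_forall;apply: contraNN ne=> /forallP hh.
 by apply/eqP/mnmP=> i;rewrite mnm0E;apply/eqP.
 by rewrite (bigD1 i0) //= expr0n (negPf hi0) mul0r.
by rewrite h comp_mpoly_meval;apply: meval_eq=> i;rewrite h.
Qed.
(** The exponent vector [m] completed by [e] for one more, last variable. It is the dictionary for
    [muni], which reads a polynomial as univariate in the last variable. *)
Definition mext n (m : 'X_{1..n}) (e : nat) : 'X_{1..n.+1} :=
 [multinom (if insub (val i) is Some j then m j else e) | i < n.+1].
Lemma muni_coef n (p : {mpoly R[n.+1]}) e m : (muni p)`_e@_m = p@_(mext m e).
rewrite muniE coef_sum raddf_sum /= [in RHS](mpolyE p) raddf_sum /=.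
apply: eq_bigr=> m' _.
rewrite coefZ coefXn mcoeffZ mcoeffX.
have -> : (m' == mext m e) = ([multinom m' (widen_ord (leqnSn n) i) | i < n] == m)%MM && (e == m' ord_max).
 apply/eqP/andP=> [->|[/eqP h1 /eqP h2]].
 split;last by rewrite mnmE insubF //= ltnn.
 apply/eqP/mnmP=> i;rewrite !mnmE /= insubT // => h;congr (m _);exact: val_inj.
 apply/mnmP=> i;rewrite mnmE;case: insubP=> [u ui vi|].
 by rewrite -h1 mnmE;congr (m' _);apply: val_inj.
 rewrite -leqNgt h2=> ni;congr (m' _);apply: val_inj=> /=;apply/eqP.
 by rewrite eqn_leq ni -ltnS ltn_ord.
rewrite andbC;case: eqP=> _ /=;last by rewrite !mulr0 mcoeff0.
by rewrite mulr1 mcoeffZ mcoeffX.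
Qed.
Lemma muni_eval n (p : {mpoly R[n.+1]}) v :
 p.@[v] = (map_poly (meval (fun i=> v (widen_ord (leqnSn n) i))) (muni p)).[v ord_max].
rewrite muniE mevalE raddf_sum /= horner_sum;apply: eq_bigr=> m _.
rewrite -!mul_polyC !rmorphM /= !map_polyC /= map_polyXn !hornerE.
rewrite mevalZ mevalX -mulrA big_ord_recr /=;congr (_ * (_ * _)).
by apply: eq_bigr=> i _;rewrite mnmE.
Qed.

Section Jet.
Variable der : R -> R.
Definition jet n y : 'I_n -> R := fun i=> iter i der y.
(** The Leibniz rule as a matrix: row i expands the i-th derivative of [g * y] in the jet of [y].
    The truncated subtraction for j > i is harmless because the binomial vanishes there. *)
Definition Lmx n g : 'M[R]_n := \matrix_(i, j) (iter (i - j) der g *+ 'C(i, j)).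
(** Composition with this tuple is the additive and multiplicative conjugate of a differential
    polynomial, which evaluates at [y] to the value of the original at [a + g * y]. *)
Definition asub n a g : n.-tuple {mpoly R[n]} :=
 [tuple (iter i der a)%:MP + \sum_j Lmx n g i j *: 'X_j | i < n].
Lemma asub_coef0 n (P : {mpoly R[n]}) a g : (P \mPo asub n a g)@_0 = P.@[jet a].
rewrite mcoeff0_comp;apply: meval_eq=> i;rewrite tnth_mktuple mcoeffD mcoeffC eqxx mulr1.
rewrite raddf_sum big1 ?addr0 // => j _ /=;rewrite mcoeffZ mcoeffX mnm1_eq0 mulr0.
by [].
Qed.
Lemma mderiv_asub n (P : {mpoly R[n]}) a g j :
 (P \mPo asub n a g)^`M(j) = \sum_i Lmx n g i j *: (P^`M(i) \mPo asub n a g).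
rewrite mderiv_comp;apply: eq_bigr=> i _;rewrite -mul_mpolyC mulrC;congr (_ * _).
rewrite tnth_mktuple mderivD mderivC add0r raddf_sum /= (bigD1 j) //=.
rewrite [X in _ + X]big1 ?addr0=> [|l lj];rewrite mderivZ mderivX mnm1E.
 rewrite eqxx scale1r (_ : (U_(j) - U_(j))%MM = 0%MM) ?mpolyX0 ?alg_mpolyC //.
 by apply/mnmP=> l;rewrite mnmBE subnn mnm0E.
by rewrite (negPf lj) scale0r scaler0.
Qed.

End Jet.
End MpolyGeneric.

(** * Gaussian valuation and detection of small coefficients by values *)

Section Gauss.
Variables (K : RF) (O : set K).
Hypothesis hO : valuation_ring O.
Hypothesis hc : convex_ring O.
Notation "x <=: y" := (dominated O x y).
Notation "x <: y" := (~ dominated O y x).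
Lemma mcoeffM_le n (P Q : {mpoly K[n]}) a b :
 (forall m, P@_m <=: a) -> (forall m, Q@_m <=: b) -> forall m, (P * Q)@_m <=: a * b.
move=> hP hQ m;rewrite mcoeffM;apply: dle_sum=> // i _;exact: dleM. Qed.
Lemma mcoeff_prod_O (I : Type) (r : seq I) n (F : I -> {mpoly K[n]}) :
 (forall i m, O (F i)@_m) -> forall m, O (\prod_(i <- r) F i)@_m.
move=> h;elim: r=> [|i r IH] m;first by rewrite big_nil mcoeff1;exact: On.
rewrite big_cons;apply/dle1;rewrite -[X in dominated _ _ X]mulr1;apply: mcoeffM_le=> m';exact/dle1.
Qed.
Lemma mcoeffX_O n (F : {mpoly K[n]}) e :
 (forall m, O F@_m) -> forall m, O (F ^+ e)@_m.
move=> h m;have -> : F ^+ e = \prod_(i <- nseq e tt) F.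
 by rewrite big_nseq;elim: e=> //= e <-;rewrite exprS.
exact: mcoeff_prod_O.
Qed.
Lemma mcoeff_comp n m (P : {mpoly K[n]}) (q : n.-tuple {mpoly K[m]}) mm :
 (P \mPo q)@_mm = \sum_(m' <- msupp P) P@_m' * ('X_[m'] \mPo q)@_mm.
by rewrite (comp_mpolyEX P) raddf_sum /=;apply: eq_bigr=> m' _;rewrite mcoeffZ. Qed.
Lemma mcoeff_compX_O n m (q : n.-tuple {mpoly K[m]}) m' mm :
 (forall i m1, O (tnth q i)@_m1) -> O ('X_[m'] \mPo q)@_mm.
by move=> h;rewrite comp_mpolyX;apply: mcoeff_prod_O=> i;apply: mcoeffX_O. Qed.
Lemma mcoeff_comp_le n m (P : {mpoly K[n]}) (q : n.-tuple {mpoly K[m]}) z :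
 (forall i m1, O (tnth q i)@_m1) -> (forall m1, P@_m1 <=: z) ->
 forall mm, (P \mPo q)@_mm <=: z.
move=> hq hP mm;rewrite mcoeff_comp;apply: dle_sum=> // m' _.
rewrite -[z]mulr1;apply: dleM=> //;apply/dle1;exact: mcoeff_compX_O.
Qed.
Lemma mcoeff_comp_lt n m (P : {mpoly K[n]}) (q : n.-tuple {mpoly K[m]}) z :
 z != 0 -> (forall i m1, O (tnth q i)@_m1) -> (forall m1, P@_m1 <: z) ->
 forall mm, (P \mPo q)@_mm <: z.
move=> z0 hq hP mm;rewrite mcoeff_comp;apply: dlt_sum=> // m' _.
rewrite -[z]mulr1;apply: dltM=> //;first exact: oner_neq0.
apply/dle1;exact: mcoeff_compX_O.
Qed.
Lemma O_det n (A : 'M[K]_n) : (forall i j, O (A i j)) -> O (\det A).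
move=> h;apply/dle1;apply: dle_sum=> // s _;rewrite -[X in dominated _ _ X]mulr1;apply: dleM=> //.
 apply/dle1;case: (perm.odd_perm _);rewrite ?expr1 ?expr0;[apply: ON=> //|];exact: O1.
elim/big_ind: _=> [|x y hx hy|i _];first exact: dle_refl.
 rewrite -[X in dominated _ _ X]mulr1;exact: dleM.
exact/dle1.
Qed.
Lemma O_adj n (A : 'M[K]_n) : (forall i j, O (A i j)) -> forall i j, O (\adj A i j).
move=> h i j;rewrite mxE /cofactor;apply: OM=> //.
 by elim: (_ + _)%N=> [|e IH];rewrite ?expr0 ?exprS;[exact: O1|apply: OM=> //;apply: ON=> //;exact: O1].
by apply: O_det=> i' j';rewrite !mxE.
Qed.
(** The Vandermonde determinant of 0, ..., n-1 is a product of positive integers, hence asymptotic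
    to 1. The coefficients are thus combinations over [O] of the values, by Cramer's rule. *)
Lemma poly_nat_small (p : {poly K}) :
 (forall c : nat, p.[c%:R] <: 1) -> forall i, p`_i <: 1.
move=> h i;have n10 := oner_neq0 K.
have [ip|ip] := ltnP i (size p);last by rewrite nth_default //;exact: dlt0x.
set n := size p in ip;pose a : 'rV[K]_n := \row_j (val j)%:R.
pose V := Vandermonde n a;pose c : 'rV[K]_n := \row_j p`_j.
have hV i' j' : O (V i' j') by rewrite !mxE;apply: OX=> //;exact: On.
have e : c *m V = \row_j p.[(val j)%:R].
 apply/rowP=> j;rewrite !mxE horner_coef;apply: eq_bigr=> l _;by rewrite !mxE.
have e2 : \det V *: c = (\row_j p.[(val j)%:R]) *m \adj V.
 by rewrite -e -mulmxA mul_mx_adj mul_mx_scalar.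
have dV : asymp O (\det V) 1.
 rewrite det_Vandermonde;elim/big_ind: _=> [|x y hx hy|i' _];first exact: asymp_refl.
 rewrite -[1]mulr1;exact: asympM.
 elim/big_ind: _=> [|x y hx hy|j' ij];first exact: asymp_refl.
 rewrite -[1]mulr1;exact: asympM.
 rewrite !mxE -natrB 1?ltnW //;move: ij;rewrite -subn_gt0;case: (_ - _)%N=> // d _.
 exact: natS_asymp.
have : \det V * p`_i <: 1.
 have := congr1 (fun M : 'rV_n=> M 0 (Ordinal ip)) e2;rewrite !mxE /= => ->.
 apply: dlt_sum=> // j _;rewrite -[X in ~ dominated _ X _]mulr1;apply: dltM=> //;first by rewrite mxE;exact: h.
 apply/dle1;exact: O_adj.
move=> h1 h2;apply: h1;apply: (dle_trans hO h2);rewrite -{1}[p`_i]mul1r;apply: dleMr=> //.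
exact: dV.2.
Qed.
(** Induction on the number of variables: with the first variables specialized to naturals, the
    one-variable case bounds the coefficients of the powers of the last one. *)
Lemma mpoly_nat_small n (P : {mpoly K[n]}) :
 (forall c : 'I_n -> nat, P.@[fun i=> (c i)%:R] <: 1) -> forall m, P@_m <: 1.
elim: n P=> [|n IH] P h m.
 have := h (fun=> 0%N);rewrite mevalE=> h1.
 have -> : m = 0%MM by apply/mnmP=> -[].
 have -> : P@_0 = \sum_(m1 <- msupp P) P@_m1 * \prod_(i < 0) 0%:R ^+ m1 i;last exact: h1.
 rewrite [in LHS](mpolyE P) raddf_sum /=;apply: eq_bigr=> m1 _.
 by rewrite mcoeffZ mcoeffX big_ord0 (_ : m1 = 0%MM) ?eqxx //;apply/mnmP=> -[].
have -> : m = mext [multinom m (widen_ord (leqnSn n) i) | i < n] (m ord_max).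
 apply/mnmP=> i;rewrite mnmE;case: insubP=> [u ui vi|];first by rewrite mnmE;congr (m _);apply: val_inj.
 rewrite -leqNgt=> ni;congr (m _);apply: val_inj=> /=;apply/eqP.
 by rewrite eqn_leq ni -ltnS ltn_ord.
rewrite -muni_coef;apply: IH=> c.
rewrite -[X in ~ dominated _ _ X](coef_map (meval _)) /=;apply: poly_nat_small=> c0.
have := h (fun i=> if insub (val i) is Some j then c j else c0).
rewrite muni_eval /= insubF ?ltnn // => hh;rewrite (eq_map_poly (g := meval (fun i : 'I_n=> (if insub (val (widen_ord (leqnSn n) i)) is Some j then c j else c0)%:R))) //.
move=> q /=;apply: meval_eq=> i /=;rewrite insubT // => hi.
by congr (c _)%:R;apply: val_inj.
Qed.
End Gauss.

(** * Conjugation of differential polynomials and its effect on coefficients *)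

Section Jets.
Variables (K : RF) (der : K -> K) (O k : set K).
Hypothesis T : tame der O k.
Notation "x <=: y" := (dominated O x y).
Notation "x <: y" := (~ dominated O y x).
Let hO := t_val T.
Let hd := t_der T.
Let hc := t_conv T.
Local Hint Resolve hO hd hc : core.

Notation jet := (jet der).
Notation asub := (asub der).
Notation Lmx := (Lmx der).
Lemma asub0 n g : asub n 0 g = linsub (Lmx n g).
by apply: eq_from_tnth=> i;rewrite !tnth_mktuple iter_der0 // mpolyC0 add0r. Qed.
Lemma asub_eval n (P : {mpoly K[n]}) a g y :
 (P \mPo asub n a g).@[jet y] = P.@[jet (a + g * y)].
rewrite comp_mpoly_meval;apply: meval_eq=> i;rewrite tnth_mktuple mevalD mevalC.
rewrite /jet iter_derD // iter_derM //;congr (_ + _);rewrite raddf_sum /=.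
rewrite (big_ord_widen _ (fun j=> (iter (i - j) der g * iter j der y) *+ 'C(i, j)) (ltn_ord i)).
rewrite [RHS]big_mkcond /=;apply: eq_bigr=> j _;rewrite mevalZ mevalXU mxE /jet mulrnAl.
by case: ltnP=> // h;rewrite bin_small.
Qed.
Lemma asub_O n a g : O a -> O g -> forall (i : 'I_n) m, O (tnth (asub n a g) i)@_m.
move=> ha hg i m;rewrite tnth_mktuple mcoeffD;apply: OD=> //.
 by rewrite mcoeffC;apply: OM=> //;[exact: (Oiter T)|exact: On].
rewrite raddf_sum /=;apply/dle1;apply: dle_sum=> // j _;apply/dle1.
rewrite mcoeffZ mcoeffX mxE;apply: OM=> //;last exact: On.
by rewrite -mulr_natr;apply: OM=> //;[exact: (Oiter T)|exact: On].
Qed.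
Definition xx := sval (cid2 (t_x T)).
Lemma k_xx : k xx. by rewrite /xx;case: cid2. Qed.
Lemma der_xx : der xx = 1. by rewrite /xx;case: cid2. Qed.
(** Natural combinations of divided powers. When [x0] has derivative 1, the derivation shifts the
    divided powers, so that their Wronskian matrix is unitriangular. *)
Definition xpol (x0 : K) (c : seq nat) : K := \sum_(j < size c) (x0 ^+ j / j`!%:R) *+ nth 0%N c j.

Section XPol.
Variable x0 : K.
Hypotheses (kx0 : k x0) (dx0 : der x0 = 1).
Let e j := x0 ^+ j / j`!%:R.
Let der_e0 : der (e 0) = 0. by rewrite /e fact0 expr0 divr1 der1. Qed.
Let der_e j : der (e j.+1) = e j.
rewrite /e derM // derX // /= dx0 mulr1.
have -> : der (j.+1`!%:R)^-1 = 0.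
 by rewrite derV ?pnatr_eq0 -?lt0n ?fact_gt0 // der_nat // oppr0 mul0r.
rewrite mulr0 addr0 factS natrM -mulr_natr.
by rewrite invfM mulrA mulfK ?pnatr_eq0.
Qed.
Let iter_e i j : iter i der (e j) = if (i <= j)%N then e (j - i) else 0.
elim: i j=> [|i IH] j;first by rewrite subn0.
rewrite iterSr;case: j=> [|j];first by rewrite der_e0 iter_der0.
by rewrite der_e IH ltnS subSS.
Qed.
Let Oe j : O (e j).
apply: OM=> //;first by apply: OX=> //;exact: (t_kO T).
have := fact_gt0 j;case: (j`!)=> // d _;apply/dle1.
rewrite -[X in dominated _ _ X]invr1;apply: dleV=> //;first exact: oner_neq0.
exact: (natS_asymp hO hc d).2.
Qed.
(** The matrix [U] of the jets of the divided powers of [x0] lies over [O] and has determinant 1.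
    After this change of variables the hypothesis concerns values at tuples of naturals. Thus the
    gaussian size of [P] is seen on bounded elements of any differential field containing [x0]. *)
Lemma mpoly_jet_small n (P : {mpoly K[n]}) z : z != 0 ->
 (forall c, P.@[jet (xpol x0 c)] <: z) -> forall m, P@_m <: z.
move=> z0;wlog -> : P z z0 / z = 1.
 move=> H h m;have := H (z^-1 *: P) 1 (oner_neq0 _) erefl _ m.
 rewrite mcoeffZ=> hh h2;apply: hh=> [c|].
 rewrite mevalZ -(mulVf z0)=> /(dle_M2l hO (invr_neq0 z0));exact: h.
 rewrite -(mulVf z0);exact: dleMl.
move=> h;pose U : 'M[K]_n := \matrix_(i, j) iter i der (e j).
have OU i j : O (U i j) by rewrite mxE;exact: (Oiter T).
have detU : \det U = 1.
 rewrite -det_tr det_trig;first by rewrite big1 // => i _;rewrite !mxE iter_e leqnn subnn /e fact0 expr0 divr1.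
 by apply/is_trig_mxP=> i j ij;rewrite !mxE iter_e leqNgt ij.
have OP := mcoeff_comp_lt hO (P := P \mPo linsub U) (q := linsub (\adj U)) (oner_neq0 _).
have -> : P = (P \mPo linsub U) \mPo linsub (\adj U).
 by rewrite linsub_comp mul_mx_adj detU linsub1.
have Olin (A : 'M[K]_n) : (forall i j, O (A i j)) -> forall i m, O (tnth (linsub A) i)@_m.
 move=> hA i m;rewrite tnth_mktuple raddf_sum /=;apply/dle1;apply: dle_sum=> // j _.
 apply/dle1;rewrite mcoeffZ;apply: OM=> //;rewrite mcoeffX;exact: On.
apply: OP;first by apply: Olin;exact: O_adj.
apply: mpoly_nat_small=> // c.
rewrite comp_mpoly_meval.
have <- : P.@[jet (xpol x0 [seq c i | i <- enum 'I_n])] =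
 P.@[fun i=> (tnth (linsub U) i).@[fun i0=> (c i0)%:R]];last exact: h.
apply: meval_eq=> i.
rewrite tnth_mktuple /jet /xpol size_map size_enum_ord raddf_sum /=.
elim/big_rec2: _=> [|j y y' _ hy];first by rewrite iter_der0.
rewrite iter_derD // hy;congr (_ + _);rewrite mevalZ mevalXU mxE.
rewrite (nth_map j) ?size_enum_ord // nth_ord_enum.
have -> : (x0 ^+ j / j`!%:R) *+ c j = e j *+ c j by [].
elim: (c j)=> [|d IH];first by rewrite mulr0n iter_der0 // mulr0.
by rewrite mulrS iter_derD // IH mulrSr mulrDr mulr1 addrC.
Qed.

End XPol.
(** A nonzero coefficient of the difference would have to be strictly below itself. Identities
    between conjugates can therefore be checked on values, as [asub_comp] is. *)
Lemma mpoly_jet_inj n (P Q : {mpoly K[n]}) :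
 (forall y, P.@[jet y] = Q.@[jet y]) -> P = Q.
move=> h;apply/mpolyP=> m;apply/eqP;rewrite -subr_eq0 -mcoeffB;apply/negP=> /negP ne.
have := mpoly_jet_small k_xx der_xx (P := P - Q) ne _ (m := m);case;last exact: dle_refl.
move=> c;rewrite mevalB h subrr;exact: dlt0x.
Qed.
Lemma asub_comp n (P : {mpoly K[n]}) a g b h :
 (P \mPo asub n a g) \mPo asub n b h = P \mPo asub n (a + g * b) (g * h).
by apply: mpoly_jet_inj=> y;rewrite !asub_eval mulrDr addrA mulrA. Qed.

Section Weight.
Variables (n : nat) (h nu : K).
Hypothesis h0 : h != 0.
Hypothesis nu1 : 1 <=: nu.
Hypothesis hnu : forall m, iter m der h <=: h * nu ^+ m.
Let nuX i j : (i <= j)%N -> nu ^+ i <=: nu ^+ j.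
move=> /subnK <-;rewrite exprD -{1}[nu ^+ i]mul1r;apply: dleMr=> //.
rewrite -(expr1n _ (j - i));exact: dleX.
Qed.
(** Conjugating the monomial m0 by [h] stays in one degree, has the leading coefficient
    [h ^+ mdeg m0], and otherwise moves derivatives from the variable to [h]. This lowers the
    weight, in which the variable of index i counts i+1, and each moved derivative costs at most a
    factor [nu]. *)
Let W (m0 : 'X_{1..n}) (H : {mpoly K[n]}) :=
 H@_m0 = h ^+ mdeg m0 /\ forall m, m != m0 -> H@_m != 0 ->
 [/\ mdeg m = mdeg m0, (mnmwgt m < mnmwgt m0)%N & H@_m <=: h ^+ mdeg m0 * nu ^+ mnmwgt m0].
Let W_le m0 H : W m0 H -> forall m, H@_m <=: h ^+ mdeg m0 * nu ^+ mnmwgt m0.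
move=> [h1 h2] m;have [->|mm0] := eqVneq m m0.
 rewrite h1 -{1}[h ^+ _]mulr1;apply: dleMl=> //;rewrite -(expr0 nu);exact: nuX.
have [->|Hm] := eqVneq H@_m 0;first exact: dle0x.
by have [] := h2 _ mm0 Hm.
Qed.
Let W_sub m0 H m : W m0 H -> H@_m != 0 -> mdeg m = mdeg m0 /\ (mnmwgt m <= mnmwgt m0)%N.
move=> [h1 h2] Hm;have [->//|mm0] := eqVneq m m0.
by have [-> /ltnW] := h2 _ mm0 Hm.
Qed.
Let W_mul m0 m1 H0 H1 : W m0 H0 -> W m1 H1 -> W (m0 + m1)%MM (H0 * H1).
move=> w0 w1;have key m : m != (m0 + m1)%MM -> (H0 * H1)@_m != 0 ->
 mdeg m = mdeg (m0 + m1) /\ (mnmwgt m < mnmwgt (m0 + m1))%N.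
 move=> ne;rewrite mcoeffM=> nz.
 have [[i j] /= hij] : exists i : 'X_{1..n < (mdeg m).+1, (mdeg m).+1}, (m == (i.1 + i.2)%MM) && (H0@_i.1 * H1@_i.2 != 0).
 apply/existsP;apply: contraNT nz;rewrite negb_exists=> /forallP hh.
 by rewrite big1 // => i hi;apply/eqP;have := hh i;rewrite hi /= negbK.
 move: hij=> /andP[/eqP em];rewrite mulf_eq0 negb_or=> /andP[hi hj].
 have [d0 wi] := W_sub w0 hi;have [d1 wj] := W_sub w1 hj.
 rewrite em !mdegD !mnmwgtD d0 d1;split=> //.
 have [e0|ne0] := eqVneq (val i) m0;last first.
 by have [_ lt _] := w0.2 _ ne0 hi;rewrite -addSn leq_add.
 have [e1|ne1] := eqVneq (val j) m1;first by rewrite em e0 e1 eqxx in ne.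
 by have [_ lt _] := w1.2 _ ne1 hj;rewrite -addnS leq_add // e0.
split;last first.
 move=> m ne nz;have [-> lt] := key m ne nz;split=> //.
 rewrite mdegD mnmwgtD !exprD mulrACA;apply: mcoeffM_le=> // m';exact: W_le.
rewrite mcoeffM.
have lt0 : (mdeg m0 < (mdeg (m0 + m1)).+1)%N by rewrite ltnS mdegD leq_addr.
have lt1 : (mdeg m1 < (mdeg (m0 + m1)).+1)%N by rewrite ltnS mdegD leq_addl.
rewrite (bigD1 (BMultinom lt0, BMultinom lt1)) //= w0.1 w1.1 -exprD -mdegD.
rewrite big1 ?addr0 // => -[i j] /= /andP[/eqP em ne].
apply/eqP;rewrite mulf_eq0;apply/negPn;rewrite negb_or;apply/negP=> /andP[hi hj].
have [d0 wi] := W_sub w0 hi;have [d1 wj] := W_sub w1 hj.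
have : (mnmwgt (i + j) < mnmwgt (m0 + m1))%N.
 rewrite !mnmwgtD.
 have [e0|ne0] := eqVneq (val i) m0;last first.
 by have [_ lt _] := w0.2 _ ne0 hi;rewrite -addSn leq_add.
 have [e1|ne1] := eqVneq (val j) m1;last first.
 by have [_ lt _] := w1.2 _ ne1 hj;rewrite -addnS leq_add // e0.
 by case/eqP: ne;congr (_, _);apply: val_inj.
by rewrite -em ltnn.
Qed.
(** Property [W] is multiplicative, so only single variables need a computation, namely one row of
    [Lmx]. *)
Let W_X (m : 'X_{1..n}) : W m ('X_[m] \mPo linsub (Lmx n h)).
move: {2}(mdeg m) (erefl (mdeg m))=> d;elim: d m=> [|d IH] m hm.
 have -> : m = 0%MM by apply/eqP;rewrite -mdeg_eq0 hm.
 rewrite mpolyX0 comp_mpoly1;split;first by rewrite mcoeff1 eqxx mdeg0 expr0.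
 by move=> m' ne;rewrite mcoeff1 (negPf ne) eqxx.
have [i0 hi0] : exists i, m i != 0%N.
 apply/existsP;rewrite -negb_forall;apply/negP=> /forallP hh.
 by move: hm;rewrite mdegE big1 // => i _;apply/eqP.
have e' : m = (U_(i0) + (m - U_(i0)))%MM.
 apply/mnmP=> i;rewrite mnmDE mnmBE mnm1E;case: eqP=> [<-|_];last by rewrite add0n subn0.
 by rewrite add1n subn1 prednK // lt0n.
have hdd : mdeg (m - U_(i0)) = d.
 by apply: succn_inj;rewrite -hm [in RHS]e' mdegD mdeg1.
rewrite {2}e' mpolyXD rmorphM /= {1}e';apply: W_mul;last exact: IH.
rewrite comp_mpolyXU -tnth_nth tnth_mktuple.
have cf m' : (\sum_j Lmx n h i0 j *: 'X_j)@_m' = \sum_j Lmx n h i0 j * (U_(j)%MM == m')%:R.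
 by rewrite raddf_sum;apply: eq_bigr=> j _ /=;rewrite mcoeffZ mcoeffX.
split.
 rewrite cf (bigD1 i0) //= eqxx mulr1 mxE subnn binn mulr1n mdeg1 expr1 big1 ?addr0 // => j ji.
 by rewrite mnm1_eq (negPf ji) mulr0.
move=> m' ne;rewrite cf=> nz.
have [j hj] : exists j, (U_(j)%MM == m') && (Lmx n h i0 j != 0).
 apply/existsP;apply: contraNT nz;rewrite negb_exists=> /forallP hh.
 rewrite big1 // => j _;have := hh j;case: (_ == m')=> /=;rewrite ?mulr0 // negbK=> /eqP ->.
 by rewrite mul0r.
have [/eqP em lj] := andP hj;rewrite -em in ne *.
have ji : (j < i0)%N.
 rewrite ltn_neqAle;apply/andP;split;first by apply: contraNN ne=> /eqP/val_inj ->.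
 rewrite leqNgt;apply: contraNN lj=> ij;by rewrite mxE bin_small.
rewrite !mdeg1 !mnmwgt1 ltnS;split=> //.
rewrite (bigD1 j) //= eqxx mulr1 big1 ?addr0=> [|l lj'];last by rewrite mnm1_eq (negPf lj') mulr0.
rewrite mxE expr1;apply: dleMn=> //;apply: (dle_trans hO (hnu _));apply: dleMl=> //.
by apply: nuX;rewrite (leq_trans (leq_subr _ _)).
Qed.
(** Apart from m itself, only monomials of the same degree and larger weight contribute to the
    coefficient at m; the hypothesis makes them negligible. *)
Lemma linsub_coef_lt (H : {mpoly K[n]}) m z : z != 0 ->
 (forall m', mdeg m' = mdeg m -> (mnmwgt m < mnmwgt m')%N ->
 h ^+ mdeg m * nu ^+ mnmwgt m' * H@_m' <: z) ->
 (H \mPo linsub (Lmx n h))@_m - h ^+ mdeg m * H@_m <: z.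
move=> z0 hz;rewrite mcoeff_comp.
have -> : h ^+ mdeg m * H@_m = \sum_(m' <- msupp H) H@_m' * (h ^+ mdeg m * (m' == m)%:R).
 rewrite [in LHS](mpolyE H) raddf_sum mulr_sumr /=;apply: eq_bigr=> m' _.
 by rewrite mcoeffZ mcoeffX mulrCA.
rewrite -sumrB;apply: dlt_sum=> // m' _;rewrite -mulrBr.
have [w1 w2] := W_X m';have [->|ne] := eqVneq m' m.
 rewrite (W_X m).1 mulr1 subrr mulr0;exact: dlt0x.
rewrite mulr0 subr0;have [->|nz] := eqVneq ('X_[m'] \mPo linsub (Lmx n h))@_m 0.
 rewrite mulr0;exact: dlt0x.
rewrite eq_sym in ne;have [dm wm le] := w2 _ ne nz.
apply: (dle_lt_trans hO _ (hz m' _ wm));last by [].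
by rewrite mulrC;apply: dleMr=> //;rewrite dm.
Qed.
Lemma linsub_coef_le (H : {mpoly K[n]}) m z :
 (forall m', mdeg m' = mdeg m -> h ^+ mdeg m * nu ^+ mnmwgt m' * H@_m' <=: z) ->
 (H \mPo linsub (Lmx n h))@_m <=: z.
move=> hz;rewrite mcoeff_comp;apply: dle_sum=> // m' _.
have [->|nz] := eqVneq ('X_[m'] \mPo linsub (Lmx n h))@_m 0;first by rewrite mulr0;exact: dle0x.
have [dm wm] := W_sub (W_X m') nz.
apply: (dle_trans hO _ (hz m' _));last by [].
rewrite mulrC;apply: dleMr=> //;rewrite dm;exact: W_le (W_X m') m.
Qed.
End Weight.
End Jets.

(** * Polynomials over subrings and subfields *)

Section Subrings.
Variables (R : comNzRingType) (A : set R).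
Hypotheses (A1 : A 1) (AB : forall a b, A a -> A b -> A (a - b))
 (AM : forall a b, A a -> A b -> A (a * b)).
Lemma A_0 : A 0. by rewrite -(subrr 1);exact: AB. Qed.
Lemma A_N a : A a -> A (- a). by rewrite -sub0r;apply: AB;exact: A_0. Qed.
Lemma A_D a b : A a -> A b -> A (a + b).
move=> ha hb;rewrite -(opprK b);apply: AB=> //;exact: A_N. Qed.
Lemma A_X a n : A a -> A (a ^+ n).
by move=> ha;elim: n=> [|n IH];rewrite ?expr0 ?exprS;[exact: A1|exact: AM]. Qed.
Lemma A_Mn a n : A a -> A (a *+ n).
by move=> ha;elim: n=> [|n IH];rewrite ?mulr0n ?mulrS;[exact: A_0|exact: A_D]. Qed.
Lemma A_sum (I : Type) (r : seq I) (P : pred I) (G : I -> R) :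
 (forall i, P i -> A (G i)) -> A (\sum_(i <- r | P i) G i).
by move=> h;elim/big_ind: _=> //;[exact: A_0|exact: A_D]. Qed.
Lemma A_prod (I : Type) (r : seq I) (P : pred I) (G : I -> R) :
 (forall i, P i -> A (G i)) -> A (\prod_(i <- r | P i) G i).
move=> h;elim/big_ind: _=> //;exact: AM. Qed.
Lemma A_meval n (P : {mpoly R[n]}) v :
 (forall m, A P@_m) -> (forall i, A (v i)) -> A P.@[v].
move=> hP hv;rewrite mevalE;apply: A_sum=> m _;apply: AM=> //.
apply: A_prod=> i _;exact: A_X.
Qed.
Lemma A_mpolyM n (P Q : {mpoly R[n]}) :
 (forall m, A P@_m) -> (forall m, A Q@_m) -> forall m, A (P * Q)@_m.
move=> hP hQ m;rewrite mcoeffM;apply: A_sum=> i _;exact: AM. Qed.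
Lemma A_mpolyX n (P : {mpoly R[n]}) e : (forall m, A P@_m) -> forall m, A (P ^+ e)@_m.
move=> hP;elim: e=> [|e IH] m;first by rewrite expr0 mcoeff1;exact: A_Mn.
rewrite exprS;exact: A_mpolyM.
Qed.
Lemma A_comp n l (P : {mpoly R[n]}) (q : n.-tuple {mpoly R[l]}) :
 (forall m, A P@_m) -> (forall i m, A (tnth q i)@_m) -> forall m, A (P \mPo q)@_m.
move=> hP hq m;rewrite (comp_mpolyEX P) raddf_sum /=;apply: A_sum=> m' _.
rewrite mcoeffZ;apply: AM=> //;rewrite comp_mpolyX.
elim/big_ind: _ m=> [m|x y hx hy m|i _ m];first by rewrite mcoeff1;exact: A_Mn.
 exact: A_mpolyM.
exact: A_mpolyX.
Qed.
Lemma A_asub n der a g : (forall a, A a -> A (der a)) -> A a -> A g ->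
 forall (i : 'I_n) m, A (tnth (asub der n a g) i)@_m.
move=> hder ha hg i m;have hit e b : A b -> A (iter e der b) by move=> hb;elim: e=> //= e;exact: hder.
rewrite tnth_mktuple mcoeffD;apply: A_D.
 by rewrite mcoeffC;apply: AM;[exact: hit|exact: A_Mn].
rewrite raddf_sum /=;apply: A_sum=> j _;rewrite mcoeffZ mcoeffX mxE;apply: AM;last exact: A_Mn.
apply: A_Mn;exact: hit.
Qed.
End Subrings.

Section Subfields.
Variables (K : fieldType) (F : set K).
Hypothesis hF : subfield F.
Lemma F1 : F 1. by case: hF. Qed.
Lemma FB a b : F a -> F b -> F (a - b). by case: hF=> _ h _;exact: h. Qed.
Lemma Fdv a b : F a -> F b -> F (a / b). by case: hF=> _ _;exact. Qed.
Lemma F0 : F 0. by rewrite -(subrr 1);apply: FB;exact: F1. Qed.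
Lemma FN a : F a -> F (- a). by rewrite -sub0r;apply: FB;exact: F0. Qed.
Lemma FD a b : F a -> F b -> F (a + b).
move=> ha hb;rewrite -(opprK b);apply: FB=> //;exact: FN. Qed.
Lemma FV a : F a -> F a^-1. by rewrite -div1r;apply: Fdv;exact: F1. Qed.
Lemma FM a b : F a -> F b -> F (a * b).
move=> ha hb;rewrite -(invrK b);apply: Fdv=> //;exact: FV. Qed.
Lemma FX a n : F a -> F (a ^+ n).
by move=> ha;elim: n=> [|n IH];rewrite ?expr0 ?exprS;[exact: F1|exact: FM]. Qed.
Lemma FMn a n : F a -> F (a *+ n).
by move=> ha;elim: n=> [|n IH];rewrite ?mulr0n ?mulrS;[exact: F0|exact: FD]. Qed.
Lemma Fsum (I : Type) (r : seq I) (P : pred I) (G : I -> K) :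
 (forall i, P i -> F (G i)) -> F (\sum_(i <- r | P i) G i).
by move=> h;elim/big_ind: _=> //;[exact: F0|exact: FD]. Qed.
Lemma Fprod (I : Type) (r : seq I) (P : pred I) (G : I -> K) :
 (forall i, P i -> F (G i)) -> F (\prod_(i <- r | P i) G i).
by move=> h;elim/big_ind: _=> //;[exact: F1|exact: FM]. Qed.
Lemma Fmeval n (P : {mpoly K[n]}) v :
 (forall m, F P@_m) -> (forall i, F (v i)) -> F P.@[v].
move=> hP hv;rewrite mevalE;apply: Fsum=> m _;apply: FM=> //.
apply: Fprod=> i _;exact: FX.
Qed.
End Subfields.

(** * Stability on balls, and dominance of the linear part in a cut *)

Section Dominance.
Variables (K : RF) (der : K -> K) (O k : set K).
Hypothesis T : tame der O k.
Notation "x <=: y" := (dominated O x y).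
Notation "x <: y" := (~ dominated O y x).
Notation "x =: y" := (asymp O x y).
Notation "x ~: y" := (~ dominated O y (x - y)).
Notation logd := (logder der).
Notation jet := (jet der).
Notation asub := (asub der).
Notation Lmx := (Lmx der).
Let hO := t_val T.
Let hd := t_der T.
Let hc := t_conv T.
Local Hint Resolve hO hd hc : core.
Lemma Oxpol x0 c : k x0 -> O (xpol x0 c).
move=> kx0;apply/dle1;apply: dle_sum=> // j _;apply: dleMn=> //;rewrite -[X in _ <=: X]mulr1.
apply: dleM=> //;apply/dle1;first by apply: OX=> //;exact: (t_kO T).
have := fact_gt0 j;case: (j`!)=> // d _;apply/dle1.
rewrite -[X in _ <=: X]invr1;apply: dleV=> //;first exact: oner_neq0.
exact: (natS_asymp hO hc d).2.
Qed.
Lemma meval_sub0 n (R : {mpoly K[n]}) v :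
 R.@[v] - R@_0 = \sum_(m <- msupp R | m != 0%MM) R@_m * \prod_i v i ^+ m i.
have -> : R@_0 = \sum_(m <- msupp R) R@_m * (m == 0%MM)%:R.
 by rewrite [in LHS](mpolyE R) raddf_sum /=;apply: eq_bigr=> m _;rewrite mcoeffZ mcoeffX.
rewrite mevalE -sumrB [RHS]big_mkcond /=;apply: eq_bigr=> m _;rewrite -mulrBr.
case: eqP=> [->|_] /=;last by rewrite subr0.
by rewrite big1 ?subrr ?mulr0 // => i _;rewrite mnm0E expr0.
Qed.
Let prodO n (v : 'I_n -> K) (m : 'X_{1..n}) : (forall i, O (v i)) -> \prod_i v i ^+ m i <=: 1.
move=> h;elim/big_ind: _=> [|x y hx hy|i _];first exact: dle_refl.
 rewrite -[X in _ <=: X]mulr1;exact: dleM.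
apply/dle1;exact: OX.
Qed.
Lemma meval_sub0_lt n (R : {mpoly K[n]}) v z : z != 0 -> (forall i, O (v i)) ->
 (forall m, m != 0%MM -> R@_m <: z) -> R.@[v] - R@_0 <: z.
move=> z0 hv h;rewrite meval_sub0;apply: dlt_sum=> // m /h hm.
rewrite -[X in ~ dominated _ X _]mulr1;apply: dltM=> //;[exact: oner_neq0|exact: prodO].
Qed.
Lemma meval_sub0_le n (R : {mpoly K[n]}) v z : (forall i, O (v i)) ->
 (forall m, m != 0%MM -> R@_m <=: z) -> R.@[v] - R@_0 <=: z.
move=> hv h;rewrite meval_sub0;apply: dle_sum=> // m /h hm.
rewrite -[X in _ <=: X]mulr1;apply: dleM=> //;exact: prodO.
Qed.
(** The Taylor expansion at [a] in the scale [s] is dominated by its constant term, so on the whole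
    ball [a + s O] the values are equivalent to the one at [a]. *)
Definition StabAt n (P : {mpoly K[n]}) a s :=
 P.@[jet a] != 0 /\ forall m, m != 0%MM -> (P \mPo asub n a s)@_m <: P.@[jet a].
Lemma asub_taylor n (P : {mpoly K[n]}) a s x : s != 0 ->
 P.@[jet x] = (P \mPo asub n a s).@[jet ((x - a) / s)].
by move=> s0;rewrite (asub_eval T) mulrC divfK // addrC subrK. Qed.
Lemma jet_O n y : O y -> forall i : 'I_n, O (jet y i).
move=> hy i;exact: (Oiter T). Qed.
Lemma StabAt_sim n (P : {mpoly K[n]}) a s x : s != 0 -> StabAt P a s -> x - a <=: s ->
 P.@[jet x] ~: P.@[jet a].
move=> s0 [P0 h] hx;rewrite (asub_taylor P a x s0) -[X in _ - X](asub_coef0 der P a s).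
by apply: meval_sub0_lt=> //;apply: jet_O;exact/dleP.
Qed.
(** Passing to another center and a smaller radius is a conjugation over [O]. The constant term of
    the old expansion does not influence nonconstant coefficients, so it can be removed first, and
    what remains is small. *)
Lemma StabAt_shift n (P : {mpoly K[n]}) a s x t : s != 0 -> StabAt P a s ->
 x - a <=: s -> t <=: s -> forall m, m != 0%MM -> (P \mPo asub n x t)@_m <: P.@[jet x].
move=> s0 st hx ht m m0;have sm := StabAt_sim s0 st hx;case: st=> P0 h.
apply: (dlt_le_trans hO _ (sim_asymp hO sm).2).
set R := P \mPo asub n a s in h.
have -> : P \mPo asub n x t = R \mPo asub n ((x - a) / s) (t / s).
 by rewrite (asub_comp T) ![s * _]mulrC !divfK // addrC subrK.
have -> : (R \mPo asub n ((x - a) / s) (t / s))@_m =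
 ((R - (R@_0)%:MP) \mPo asub n ((x - a) / s) (t / s))@_m.
 by rewrite raddfB /= comp_mpolyC mcoeffB mcoeffC (negPf m0) mulr0 subr0.
apply: mcoeff_comp_lt=> //;first by apply: (asub_O T);exact/dleP.
move=> m1;rewrite mcoeffB mcoeffC;have [->|ne] := eqVneq m1 0%MM.
 rewrite mulr1 subrr;exact: dlt0x.
rewrite mulr0 subr0;exact: h.
Qed.

Section Cut.
Variable F : set K.
Hypothesis hF : diff_subfield der F.
Hypothesis Fxx : exists x, [/\ k x, der x = 1 & F x].
Variable w : K.
Hypothesis himm : forall b, F b -> exists2 b1, F b1 & w - b1 <: w - b.
Let hsF := hF.1.
Local Hint Resolve hsF : core.
(** Here [himm] says that [w] has no best approximation in [F]. Stability asks for a ball over [F]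
    that contains [w], so it depends only on the cut of [w] and can be transported to another
    field. *)
Definition Stab n (P : {mpoly K[n]}) :=
 exists a s, [/\ F a, F s, s != 0, w - a <=: s & StabAt P a s].
Lemma Fiter n a : F a -> F (iter n der a).
move=> ha;elim: n=> //= n;exact: hF.2. Qed.
Lemma Fxpol x0 c : F x0 -> F (xpol x0 c).
move=> Fx0;apply: Fsum=> // j _;apply: FMn=> //;apply: FM=> //;first exact: FX.
apply: FV=> //;apply: FMn=> //;exact: F1.
Qed.
(** For a better approximation [b1], the difference [b1 - b] is equivalent to [w - b]. *)
Lemma cutF b : F b -> exists2 s, F s & s != 0 /\ s =: w - b.
move=> Fb;have [b1 Fb1 h] := himm Fb;exists (b1 - b);first exact: FB.
have e : b1 - b = (w - b) - (w - b1) by ring.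
have sm : b1 - b ~: w - b by rewrite e addrAC subrr add0r;exact: dltN.
by split;[exact: sim_neq0l sm|exact: sim_asymp sm].
Qed.
Lemma Stab_neq0 n (P : {mpoly K[n]}) : Stab P -> P.@[jet w] != 0.
move=> [a [s [_ _ s0 h st]]];exact: sim_neq0l (StabAt_sim s0 st h). Qed.
(** Otherwise all points of [F] in the ball have equivalent values. Then the values at
    [a + s * xpol x0 c] differ negligibly from the one at [a], and [mpoly_jet_small] makes every
    nonconstant coefficient small, which is stability. *)
Lemma unstable_witness n (P : {mpoly K[n]}) a s : ~ Stab P -> F a -> F s -> s != 0 ->
 w - a <=: s -> exists b, [/\ F b, w - b <=: s & ~ (P.@[jet b] ~: P.@[jet w])].
move=> nst Fa Fs s0 has;apply: contrapT=> nb.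
have {}nb b : F b -> w - b <=: s -> P.@[jet b] ~: P.@[jet w].
 by move=> Fb hb;apply: contrapT=> h;apply: nb;exists b.
have sa := nb a Fa has;have a0 := sim_neq0l hO sa.
apply: nst;exists a, s;split=> //;split=> // m m0.
have -> : (P \mPo asub n a s)@_m = (P \mPo asub n a s - (P.@[jet a])%:MP)@_m.
 by rewrite mcoeffB mcoeffC (negPf m0) mulr0 subr0.
have [x0 [kx0 dx0 Fx0]] := Fxx.
apply: (mpoly_jet_small T kx0 dx0)=> // c;rewrite mevalB mevalC (asub_eval T).
apply: (dlt_le_trans hO _ (sim_asymp hO sa).2).
have sb : P.@[jet (a + s * xpol x0 c)] ~: P.@[jet w].
 apply: nb;first by apply: FD=> //;apply: FM=> //;exact: Fxpol.
 rewrite opprD addrA;apply: dleB=> //;rewrite -[X in _ <=: X]mulr1;apply: dleMl=> //.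
 apply/dle1;exact: Oxpol.
have -> : P.@[jet (a + s * xpol x0 c)] - P.@[jet a] =
 (P.@[jet (a + s * xpol x0 c)] - P.@[jet w]) - (P.@[jet a] - P.@[jet w]) by ring.
exact: dltB.
Qed.

Hypothesis Fdiv : forall (e : K) n, F e -> e != 0 -> exists2 b, F b & b ^+ n.+1 =: e.
Variables (n : nat) (P : {mpoly K[n]}).
Hypothesis FP : forall m, F P@_m.
(** Conjugating this [Q] by [w] and [g] gives the j-th partial derivative of the conjugate of [P].
    For a minimal unstable [P] it has smaller degree, which is why it can be assumed stable. *)
Hypothesis hQ : forall (g : K) (j : 'I_n), F g -> g != 0 ->
 let Q := \sum_l Lmx n g l j *: P^`M(l) in Q = 0 \/ Stab Q.
Hypothesis hV : forall (g : K) (m : 'X_{1..n}), F g -> g != 0 -> m != 0%MM ->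
 (P \mPo asub n w g)@_m != 0 -> exists2 e, F e & (P \mPo asub n w g)@_m =: e.
Hypothesis Pnc : exists l, P^`M(l) != 0.
(** The element [t] is a scale filling the cut: below every [w - b], and above all elements of [F]
    that are below every [w - b]. Consequently [t / g] is never asymptotic to 1 for [g] in [F], and
    [nu g] is infinite. *)
Variable t : K.
Hypothesis t0 : t != 0.
Hypothesis t_lt : forall b, F b -> t <: w - b.
Hypothesis t_gt : forall s, F s -> s != 0 -> (forall b, F b -> s <: w - b) -> s <: t.
Let E m := (P \mPo asub n w t)@_m.
Let nu g := logd (t / g).
Let tg g : F g -> g != 0 -> ~ (t / g =: 1).
move=> Fg g0 [h1 h2].
have {}h1 : t <=: g by rewrite -(divfK g0 t) -[X in _ <=: X]mul1r;exact: dleMr.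
have {}h2 : g <=: t by rewrite -(divfK g0 t) -{1}[g]mul1r;exact: dleMr.
case: (pselect (exists2 b, F b & w - b <=: g))=> [[b Fb hb]|nb].
 apply: (t_lt Fb);exact: (dle_trans hO hb).
apply: (t_gt Fg g0)=> // b Fb hb;apply: nb;by exists b.
Qed.
Let tg0 g : g != 0 -> t / g != 0. by move=> g0;rewrite mulf_neq0 ?invr_neq0. Qed.
Let nu1 g : F g -> g != 0 -> 1 <: nu g.
by move=> Fg g0;apply: (logd_big T);[exact: tg0|exact: tg]. Qed.
Let nu_neq0 g : F g -> g != 0 -> nu g != 0.
move=> Fg g0;exact: dlt_neq0 (nu1 Fg g0). Qed.
Let nuX g i j : F g -> g != 0 -> (i <= j)%N -> nu g ^+ i <=: nu g ^+ j.
move=> Fg g0 /subnK <-;rewrite exprD -{1}[nu g ^+ i]mul1r;apply: dleMr=> //.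
rewrite -(expr1n _ (j - i));apply: dleX=> //;apply: dltW=> //;exact: nu1.
Qed.
Let nu_iter g m : F g -> g != 0 -> iter m der (t / g) <=: t / g * nu g ^+ m.
by move=> Fg g0;apply: (iter_der_le T);[exact: tg0|exact: tg]. Qed.
Let nu_iterV g m : F g -> g != 0 -> iter m der (g / t) <=: g / t * nu g ^+ m.
move=> Fg g0;rewrite -[g / t]invf_div;have h0 := tg0 g0.
have nh : ~ ((t / g)^-1 =: 1).
 move=> /(asympV hO (oner_neq0 _));rewrite invrK invr1;exact: tg.
have := iter_der_le T m (invr_neq0 h0) nh;rewrite logdV // => h.
apply: (dle_trans hO h);apply: dleMl=> //;apply: dleX=> //;exact/dleNE/dle_refl.
Qed.
Let R_g g : g != 0 -> P \mPo asub n w g = (P \mPo asub n w t) \mPo linsub (Lmx n (g / t)).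
by move=> g0;rewrite -(asub0 T) (asub_comp T) mulr0 addr0 mulrC divfK. Qed.
(** If the linear coefficients vanished in the scale [t], they would vanish in the scale 1 as well,
    where [Lmx] is the identity. A nonzero partial derivative of [P] would then vanish at [w], which
    stable polynomials do not. *)
Let E_lin : exists j1, E U_(j1) != 0 /\ forall j, E U_(j) <=: E U_(j1).
have [l hl] := Pnc.
have lin : l \in enum 'I_n by rewrite mem_enum.
have [i ih hi] := asymp_max hO (fun j=> E U_(j)) lin.
exists i;split;last by move=> j;apply: hi;rewrite mem_enum.
apply/eqP=> Ei0.
have z : (P \mPo asub n w 1)@_U_(l) = 0.
 apply: (@dlex0 _ O);rewrite (R_g (oner_neq0 _)).
 apply: (linsub_coef_le T (nu := nu 1)).
 - by apply: dltW=> //;apply: nu1;[exact: F1|exact: oner_neq0].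
 - by move=> m;apply: nu_iterV;[exact: F1|exact: oner_neq0].
 move=> m' /eqP;rewrite mdeg1=> /mdeg1P[j /eqP ->].
 have -> : (P \mPo asub n w t)@_U_(j) = 0.
 by apply: (@dlex0 _ O);rewrite -Ei0;apply: hi;rewrite mem_enum.
 rewrite mulr0;exact: dle0x.
have e1 : \sum_l0 Lmx n 1 l0 l *: P^`M(l0) = P^`M(l).
 rewrite (bigD1 l) //= mxE subnn binn scale1r big1 ?addr0 // => j jl;rewrite mxE.
 have [lt|gt|/val_inj eq] := ltngtP j l;first by rewrite bin_small ?scale0r.
 by rewrite -subn_gt0 in gt;case: (j - l)%N gt=> // d _;rewrite iterSr der1 // iter_der0 // mul0rn scale0r.
 by rewrite eq eqxx in jl.
have := hQ l (F1 hsF) (oner_neq0 _);rewrite /= e1=> -[P0|/Stab_neq0];first by rewrite P0 eqxx in hl.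
have := congr1 (mcoeff 0) (mderiv_asub der P w 1 l).
rewrite mcoeff_mderiv mnm0E mulr1n add0m z=> /esym.
have -> : \sum_i0 Lmx n 1 i0 l *: (P^`M(i0) \mPo asub n w 1) = (\sum_l0 Lmx n 1 l0 l *: P^`M(l0)) \mPo asub n w 1.
 by rewrite (raddf_sum (comp_mpoly _));apply: eq_bigr=> i0 _ /=;rewrite comp_mpolyZ.
by rewrite e1 asub_coef0=> ->;rewrite eqxx.
Qed.
(** Up to an integer factor, E m is a nonconstant coefficient of a partial derivative of the
    conjugate of [P], hence a combination of nonconstant coefficients of conjugates of the stable
    [Q l]. Those are below the value of [Q l] at [w], which is a linear coefficient in the scale
    [g]. Going from the scale [t] to [g] and back costs a factor [nu g ^+ n] each time. *)
Let E_small g m j1 : F g -> g != 0 -> E U_(j1) != 0 -> (forall j, E U_(j) <=: E U_(j1)) ->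
 (1 < mdeg m)%N -> E m <: E U_(j1) * nu g ^+ (n + n).
move=> Fg g0 r0 hr hm;set rho := E U_(j1) in r0 hr *;set h := t / g;have h0 := tg0 g0.
pose Q l := \sum_l0 Lmx n g l0 l *: P^`M(l0).
have n0 := nu_neq0 Fg g0;have nX := nuX Fg g0.
have Qw l : (Q l).@[jet w] <=: h^-1 * nu g ^+ n * rho.
 have -> : (Q l).@[jet w] = (P \mPo asub n w g)@_U_(l).
 have := congr1 (mcoeff 0) (mderiv_asub der P w g l).
 rewrite mcoeff_mderiv mnm0E mulr1n add0m=> ->.
 rewrite -(asub_coef0 der (Q l) w g) /Q (raddf_sum (comp_mpoly _)) /= !raddf_sum /=.
 by apply: eq_bigr=> i0 _;rewrite comp_mpolyZ.
 rewrite (R_g g0);apply: (linsub_coef_le T (nu := nu g)).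
 - apply: dltW=> //;exact: nu1.
 - move=> m';exact: nu_iterV.
 move=> m' /eqP;rewrite mdeg1=> /mdeg1P[j /eqP ->];rewrite expr1 mnmwgt1 /h invf_div.
 apply: dleM=> //;[apply: dleMl=> //;exact: nX|exact: hr].
have [j mj] : exists j, m j != 0%N.
 apply/existsP;rewrite -negb_forall;apply/negP=> /forallP hh.
 by move: hm;rewrite mdegE big1 // => i _;apply/eqP.
have em : m = ((m - U_(j)) + U_(j))%MM.
 apply/mnmP=> i;rewrite mnmDE mnmBE mnm1E;case: eqP=> [<-|_];last by rewrite subn0 addn0.
 by rewrite addn1 subn1 prednK // lt0n.
have mj0 : (m - U_(j))%MM != 0%MM.
 rewrite -mdeg_eq0 -lt0n;move: hm;rewrite {1}em mdegD mdeg1 addn1 ltnS;exact.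
have [e he] : exists e, ((P \mPo asub n w t)^`M(j))@_(m - U_(j)) = E m *+ e.+1.
 by rewrite mcoeff_mderiv -em;eexists.
apply: (dlt_nat hO hc (n := e));rewrite -he.
have -> : P \mPo asub n w t = (P \mPo asub n w g) \mPo asub n 0 h.
 by rewrite (asub_comp T) mulr0 addr0 /h mulrC divfK.
rewrite (mderiv_asub der) raddf_sum /=;apply: dlt_sum=> //.
 by rewrite mulf_neq0 // expf_neq0.
move=> l _;rewrite mcoeffZ.
have -> : (P \mPo asub n w g)^`M(l) \mPo asub n 0 h = Q l \mPo asub n w t.
 rewrite (mderiv_asub der) /Q !(raddf_sum (comp_mpoly _)) /=;apply: eq_bigr=> i0 _.
 by rewrite !comp_mpolyZ (asub_comp T) mulr0 addr0 /h [g * _]mulrC divfK.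
have LL : Lmx n h l j <=: h * nu g ^+ n.
 rewrite mxE;apply: dleMn=> //;apply: (dle_trans hO (nu_iter _ Fg g0));apply: dleMl=> //.
 by apply: nX;rewrite (leq_trans (leq_subr _ _)) // ltnW.
have -> : rho * nu g ^+ (n + n) = (h^-1 * nu g ^+ n * rho) * (h * nu g ^+ n).
 by rewrite exprD;field.
rewrite [Lmx n h l j * _]mulrC;apply: dltM=> //;first by rewrite mulf_neq0 // expf_neq0.
have /= := hQ l Fg g0;rewrite -/(Q l)=> -[Q0|[a [s [Fa Fs s0 has st]]]].
 by rewrite Q0 comp_mpoly0 mcoeff0;apply: dlt0x=> //;rewrite !mulf_neq0 ?invr_neq0 ?expf_neq0.
apply: (dlt_le_trans hO _ (Qw l));apply: (StabAt_shift s0 st has)=> //.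
apply: (dle_trans hO _ has);apply: dltW=> //;exact: t_lt.
Qed.
(** The largest coefficient of degree d+1 is [t ^+ d.+1] times an element of [F], up to powers of
    [nu g] for every [g]. Some monomial of nearly maximal coefficient can be read off in a scale [g]
    of [F], where [hV] puts its value in that of [F]. *)
Let Val d mt : mdeg mt = d.+1 -> E mt != 0 -> (forall m, mdeg m = d.+1 -> E m <=: E mt) ->
 exists2 e, F e & e != 0 /\ forall g, F g -> g != 0 -> exists N,
 E mt <=: t ^+ d.+1 * e * nu g ^+ N /\ t ^+ d.+1 * e <=: E mt * nu g ^+ N.
move=> dmt rt0 rmax;set rho := E mt in rt0 rmax *.
pose Xi x := forall g, F g -> g != 0 -> exists N, x <=: nu g ^+ N.
pose J m := [&& mdeg m == d.+1, E m != 0 & `[< Xi (rho / E m) >]].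
have Jmt : J mt.
 rewrite /J dmt eqxx rt0 /=;apply/asboolP=> g _ _;exists 0%N;rewrite expr0 mulfV //.
 exact: dle_refl.
pose supp := msupp (P \mPo asub n w t).
have Jsupp m : J m -> m \in supp by case/and3P=> _ h _;rewrite mcoeff_msupp.
(* Among the nearly maximal monomials the one of largest weight is chosen, because in a change of
   scale only monomials of larger weight disturb a coefficient. *)
have [m1 J1 m1max] : exists2 m1, J m1 & forall m, J m -> (mnmwgt m <= mnmwgt m1)%N.
 pose B := \max_(m <- supp) mnmwgt m.
 have ex : exists e, has (fun m=> J m && (mnmwgt m == e)) supp.
 exists (mnmwgt mt);apply/hasP;exists mt;rewrite ?Jmt ?eqxx //;exact: Jsupp.
 have bd e : has (fun m=> J m && (mnmwgt m == e)) supp -> (e <= B)%N.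
 move=> /hasP[m hm /andP[_ /eqP <-]];exact: leq_bigmax_seq.
 case: (ex_maxnP ex bd)=> e /hasP[m1 h1 /andP[J1 /eqP e1]] hmax.
 exists m1=> // m Jm;rewrite e1;apply: hmax;apply/hasP;exists m;rewrite ?Jm ?eqxx //.
 exact: Jsupp.
have /and3P[/eqP d1 E1 /asboolP X1] := J1.
pose bad := [seq m <- supp | (mdeg m == d.+1) && (mnmwgt m1 < mnmwgt m)%N].
have badg m : m \in bad -> exists g, [/\ F g, g != 0 & forall N, ~ (rho / E m <=: nu g ^+ N)].
 rewrite mem_filter=> /andP[/andP[dm wm] ms];apply: contrapT=> nb.
 suff : J m by move=> /m1max;rewrite leqNgt wm.
 rewrite /J dm /= -[E m != 0]mcoeff_msupp ms /=;apply/asboolP=> g Fg g0.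
 apply: contrapT=> nN;apply: nb;exists g;split=> // N hN;apply: nN;by exists N.
(* Each monomial of larger weight is negligible for some [g]. Only finitely many occur, so the [g]
   with the smallest [nu g] serves for all of them. *)
have [gs [hgs gF gsb]] : exists gs : seq K, [/\ 1 \in gs, forall g, g \in gs -> F g /\ g != 0 &
 forall m, m \in bad -> exists2 g, g \in gs & forall N, ~ (rho / E m <=: nu g ^+ N)].
 elim: bad badg=> [|m s IH] hb.
 by exists [:: 1];split=> // [|g];rewrite inE ?eqxx // => /eqP ->;split;[exact: F1|exact: oner_neq0].
 have [|gs [h1 h2 h3]] := IH;first by move=> m' hm';apply: hb;rewrite inE hm' orbT.
 have [g [Fg g0 hg]] := hb m (mem_head _ _).
 exists (g :: gs);split;first by rewrite inE h1 orbT.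
 by move=> g';rewrite inE=> /orP[/eqP ->|/h2].
 move=> m';rewrite inE=> /orP[/eqP ->|/h3[g' hg' hh]];first by exists g;rewrite ?mem_head.
 by exists g';rewrite ?inE ?hg' ?orbT.
have [g gin gmin] := asymp_max hO (fun g=> (nu g)^-1) hgs.
have [Fg g0] := gF _ gin;have n0 := nu_neq0 Fg g0.
have {}gmin g' : g' \in gs -> nu g <=: nu g'.
 move=> h;have [Fg' g0'] := gF _ h;have := gmin _ h.
 by move=> /(dleV hO (invr_neq0 (nu_neq0 Fg' g0')));rewrite !invrK.
have small m : mdeg m = d.+1 -> (mnmwgt m1 < mnmwgt m)%N -> forall N, E m * nu g ^+ N <: rho.
 move=> dm wm N;have [->|Em] := eqVneq (E m) 0;first by rewrite mul0r;exact: dlt0x.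
 have mb : m \in bad by rewrite mem_filter dm eqxx wm mcoeff_msupp.
 have [g' g'in hg'] := gsb _ mb;move=> h;apply: (hg' N).
 have /(dleMr hO (E m)^-1) := h;rewrite mulrAC mulfV // mul1r=> h'.
 apply: (dle_trans hO h');apply: dleX=> //;exact: gmin.
have [N0 hN0] := X1 g Fg g0;set h := g / t.
have h0 : h != 0 by rewrite mulf_neq0 ?invr_neq0.
have sm : (P \mPo asub n w g)@_m1 ~: h ^+ d.+1 * E m1.
 rewrite (R_g g0) -d1;apply: (linsub_coef_lt T (nu := nu g))=> //.
 - apply: dltW=> //;exact: nu1.
 - move=> m';exact: nu_iterV.
 - by rewrite mulf_neq0 // expf_neq0.
 move=> m' dm' wm';rewrite d1 -mulrA;apply: dltMl;rewrite ?expf_neq0 //.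
 have := small m' _ wm' (mnmwgt m' + N0)%N;rewrite dm' d1=> /(_ erefl) hs hs';apply: hs.
 have -> : E m' * nu g ^+ (mnmwgt m' + N0) = (nu g ^+ mnmwgt m' * E m') * nu g ^+ N0 by rewrite exprD;ring.
 have -> : rho = E m1 * (rho / E m1) by rewrite mulrC divfK.
 exact: dleM.
have m10 : m1 != 0%MM by rewrite -mdeg_eq0 d1.
have [e' Fe' he'] := hV Fg g0 m10 (sim_neq0l hO sm).
have e'0 : e' != 0 by exact: asymp_neq0 (asymp_sym he') (sim_neq0l hO sm).
have hE : E m1 =: t ^+ d.+1 * (e' / g ^+ d.+1).
 have -> : E m1 = (h ^+ d.+1 * E m1) * (h ^+ d.+1)^-1 by rewrite mulrAC mulfV ?mul1r // expf_neq0.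
 have -> : t ^+ d.+1 * (e' / g ^+ d.+1) = e' * (h ^+ d.+1)^-1.
 by rewrite /h expr_div_n invf_div;ring.
 apply: asympM=> //;last exact: asymp_refl.
 exact: asymp_trans (asymp_sym (sim_asymp hO sm)) he'.
exists (e' / g ^+ d.+1);first by apply: Fdv=> //;exact: FX.
split;first by rewrite mulf_neq0 ?invr_neq0 ?expf_neq0.
move=> g' Fg' g'0;have [N hN] := X1 g' Fg' g'0;exists N;split.
 rewrite -(divfK E1 rho) mulrC;apply: dleM=> //;exact: hE.1.
apply: (dle_trans hO hE.2);apply: (dle_trans hO (rmax _ d1)).
rewrite -{1}[rho]mulr1;apply: dleMl=> //;rewrite -(expr0 (nu g'));exact: nuX.
Qed.
(** If a coefficient of degree d+2 reached the largest linear one, [E_small] would make the largest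
    coefficients of degrees d+2 and 1 equal up to powers of [nu]. By [Val] they have the sizes
    [t ^+ d.+2 * e2] and [t * e1], again up to such powers, so [t] would be too close to an element
    of [F]. *)
Lemma dominance : exists j1, E U_(j1) != 0 /\ (forall j, E U_(j) <=: E U_(j1)) /\
 forall m, (1 < mdeg m)%N -> E m <: E U_(j1).
have [j1 [r0 hr]] := E_lin;exists j1;split=> //;split=> // m0 hm0 hbad.
have [d ed] : exists d, mdeg m0 = d.+2 by case: (mdeg m0) hm0=> [|[|d]] // _;exists d.
have Em0 : E m0 != 0 by apply/eqP=> e;rewrite e in hbad;move/dlex0: hbad=> z;rewrite z eqxx in r0.
pose r := [seq m <- msupp (P \mPo asub n w t) | mdeg m == d.+2].
have m0r : m0 \in r by rewrite mem_filter ed eqxx mcoeff_msupp.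
have [mt mtr mtmax] := asymp_max hO E m0r.
have dmt : mdeg mt = d.+2 by move: mtr;rewrite mem_filter=> /andP[/eqP].
have rt0 : E mt != 0 by move: mtr;rewrite mem_filter mcoeff_msupp=> /andP[].
have tmax m : mdeg m = d.+2 -> E m <=: E mt.
 move=> dm;have [->|Em] := eqVneq (E m) 0;first exact: dle0x.
 by apply: mtmax;rewrite mem_filter dm eqxx mcoeff_msupp.
have [e2 Fe2 [e20 h2]] := Val dmt rt0 tmax.
have lmax m : mdeg m = 1 -> E m <=: E U_(j1).
 move=> /eqP/mdeg1P[j /eqP ->];exact: hr.
have [e1 Fe1 [e10 h1]] := Val (mdeg1 j1) r0 lmax.
(* Divisibility of the value group of [F] solves [b ^+ d.+1 =: e1 / e2]. Both [t / b] and its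
   inverse are then bounded by powers of [logd (t / b)], against [logdX_small], as one of the two is
   infinite. *)
have [b Fb hb] := Fdiv d (Fdv hsF Fe1 Fe2) (mulf_neq0 e10 (invr_neq0 e20)).
have b0 : b != 0.
 apply/eqP=> bz;move: hb;rewrite bz expr0n /= => -[_ /dlex0 /eqP].
 by rewrite mulf_eq0 invr_eq0 (negPf e10) (negPf e20).
have [N2 [h21 h22]] := h2 b Fb b0;have [N1 [h11 h12]] := h1 b Fb b0.
set v := nu b in h21 h22 h11 h12 *;have v0 : v != 0 := nu_neq0 Fb b0.
have hS := E_small Fb b0 r0 hr (m := mt);rewrite dmt -/v in hS;have {}hS := dltW hO (hS isT).
have r1d : E U_(j1) <=: E mt by apply: (dle_trans hO hbad);exact: tmax.
have u1 : (t / b) ^+ d.+1 <=: v ^+ (N2 + (n + n) + N1).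
 have hh : t ^+ d.+2 * e2 <=: t * e1 * v ^+ (N2 + (n + n) + N1).
 apply: (dle_trans hO h22).
 rewrite (_ : t * e1 * v ^+ (N2 + (n + n) + N1) = (t ^+ 1 * e1 * v ^+ N1) * v ^+ (n + n) * v ^+ N2);last by rewrite expr1 !exprD;ring.
 by apply: dleMr=> //;apply: (dle_trans hO hS);apply: dleMr.
 have hh2 : t ^+ d.+1 <=: (e1 / e2) * v ^+ (N2 + (n + n) + N1).
 have t2 : t * e2 != 0 by rewrite mulf_neq0.
 apply: (dle_M2r hO t2);move: hh;rewrite exprSr=> hh.
 have -> : e1 / e2 * v ^+ (N2 + (n + n) + N1) * (t * e2) = t * e1 * v ^+ (N2 + (n + n) + N1) by field.
 by rewrite mulrA.
 have b1 : b ^+ d.+1 != 0 by rewrite expf_neq0.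
 apply: (dle_M2r hO b1);rewrite expr_div_n divfK //;apply: (dle_trans hO hh2).
 rewrite mulrC;apply: dleMl=> //;exact: hb.2.
have u2 : (b / t) ^+ d.+1 <=: v ^+ (N1 + N2).
 have hh : t * e1 <=: t ^+ d.+2 * e2 * v ^+ (N1 + N2).
 rewrite -{1}(expr1 t);apply: (dle_trans hO h12).
 rewrite (_ : t ^+ d.+2 * e2 * v ^+ (N1 + N2) = (t ^+ d.+2 * e2 * v ^+ N2) * v ^+ N1);last by rewrite exprD;ring.
 apply: dleMr=> //.
 exact: (dle_trans hO r1d).
 have hh2 : e1 / e2 <=: t ^+ d.+1 * v ^+ (N1 + N2).
 have t2 : t * e2 != 0 by rewrite mulf_neq0.
 apply: (dle_M2r hO t2);have -> : e1 / e2 * (t * e2) = t * e1 by field.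
 apply: (dle_trans hO hh);rewrite exprSr;have -> : t ^+ d.+1 * t * e2 * v ^+ (N1 + N2) = t ^+ d.+1 * v ^+ (N1 + N2) * (t * e2) by ring.
 exact: dle_refl.
 have t1 : t ^+ d.+1 != 0 by rewrite expf_neq0.
 apply: (dle_M2r hO t1);rewrite expr_div_n divfK //;apply: (dle_trans hO hb.1).
 by rewrite [v ^+ _ * _]mulrC.
have key u N : 1 <: u -> (u ^+ d.+1 <=: logd u ^+ N) -> False.
 move=> hu h;apply: (logdX_small T (N := N) hu);apply: (dle_trans hO _ h).
 rewrite exprS -{1}[u]mulr1;apply: dleMl=> //;rewrite -(expr1n _ d);apply: dleX=> //.
 exact: dltW.
have tb0 := tg0 b0;case: (pselect (t / b <=: 1))=> hu;last exact: key hu u1.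
have hu' : 1 <: b / t.
 rewrite -invf_div=> h;apply: (tg Fb b0);split=> //.
 by rewrite -(invrK (t / b)) -[X in X <=: _]invr1;apply: dleV;rewrite ?invr_neq0.
apply: (key _ (N1 + N2)%N hu');apply: (dle_trans hO u2);apply: dleX=> //.
rewrite -invf_div logdV // -/(nu b) -/v;apply/dleNr=> //;exact: dle_refl.
Qed.
End Cut.
End Dominance.

(** * Minimal unstable differential polynomials *)

Definition dlast (R : nzRingType) r (P : {mpoly R[r.+1]}) : nat :=
 \max_(m <- msupp P) m ord_max.
Lemma dlast_le (R : nzRingType) r (P : {mpoly R[r.+1]}) m : P@_m != 0 -> (m ord_max <= dlast P)%N.
rewrite -mcoeff_msupp=> h;exact: (@leq_bigmax_seq _ _ xpredT (fun m : 'X_{1..r.+1}=> m ord_max)). Qed.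
Lemma dlast_leP (R : nzRingType) r (P : {mpoly R[r.+1]}) d :
 (forall m, P@_m != 0 -> (m ord_max <= d)%N) -> (dlast P <= d)%N.
move=> h;apply/bigmax_leqP_seq=> m;rewrite mcoeff_msupp=> hm _;exact: h. Qed.
Lemma msize_leP (R : nzRingType) n (P : {mpoly R[n]}) d :
 (forall m, P@_m != 0 -> (mdeg m < d)%N) -> (msize P <= d)%N.
move=> h;rewrite msizeE;apply/bigmax_leqP_seq=> m;rewrite mcoeff_msupp=> hm _;exact: h. Qed.

Section MinUnstable.
Variables (K : RF) (der : K -> K) (O k : set K).
Hypothesis T : tame der O k.
Notation "x <=: y" := (dominated O x y).
Notation "x <: y" := (~ dominated O y x).
Notation "x =: y" := (asymp O x y).
Notation jet := (jet der).
Notation asub := (asub der).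
Notation Lmx := (Lmx der).
Let hO := t_val T.
Let hd := t_der T.
Let hc := t_conv T.
Local Hint Resolve hO hd hc : core.
Variable F : set K.
Hypothesis hF : diff_subfield der F.
Hypothesis Fxx : exists x, [/\ k x, der x = 1 & F x].
Hypothesis Fdiv : forall (e : K) n, F e -> e != 0 -> exists2 b, F b & b ^+ n.+1 =: e.
Variable w : K.
Hypothesis himm : forall b, F b -> exists2 b1, F b1 & w - b1 <: w - b.
Let hsF := hF.1.
Local Hint Resolve hsF : core.
Notation Stab := (Stab der O F w).
Definition Fp n (P : {mpoly K[n]}) := forall m, F P@_m.

(** Minimality is lexicographic in the order, the degree in the highest derivative, and the total
    degree. The second component makes pseudo-division by [P] possible; the third makes the
    derivatives of [P] stable. *)
Record MinUnst r (P : {mpoly K[r.+1]}) : Prop := {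
 mu_F : Fp P;mu_0 : P != 0;mu_un : ~ Stab P;
 mu_ord : forall Q : {mpoly K[r]}, Fp Q -> Q != 0 -> Stab Q;
 mu_deg : forall Q : {mpoly K[r.+1]}, Fp Q -> Q != 0 -> (dlast Q < dlast P)%N -> Stab Q;
 mu_size : forall Q : {mpoly K[r.+1]}, Fp Q -> Q != 0 -> (dlast Q <= dlast P)%N ->
 (msize Q < msize P)%N -> Stab Q }.
Lemma Stab_const n (c : K) : F c -> c != 0 -> Stab (c%:MP : {mpoly K[n]}).
move=> Fc c0;have [s Fs [s0 hs]] := cutF T hF himm (F0 hsF).
exists 0, s;split=> //;first exact: F0;first exact: hs.2.
split;first by rewrite mevalC.
move=> m m0;rewrite comp_mpolyC mcoeffC (negPf m0) mulr0 mevalC;exact: dlt0x.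
Qed.
Let minnat (A : nat -> Prop) : (exists n, A n) -> exists2 n, A n & forall m, A m -> (n <= m)%N.
move=> [n hn];have ex : exists n, `[< A n >] by exists n;apply/asboolP.
case: (ex_minnP ex)=> m /asboolP hm hmin;exists m=> // l hl;apply: hmin;exact/asboolP.
Qed.
(** Three successive minimizations. The number of variables cannot drop to 0, since nonzero
    constants are stable. *)
Lemma MinUnst_exists n (P : {mpoly K[n]}) : Fp P -> P != 0 -> ~ Stab P ->
 exists r (Q : {mpoly K[r.+1]}), MinUnst Q.
move=> FP P0 nst.
pose U n := exists P : {mpoly K[n]}, [/\ Fp P, P != 0 & ~ Stab P].
have [|n1 [P1 [FP1 P10 nst1]] min1] := @minnat U;first by exists n, P.
case: n1 P1 FP1 P10 nst1 min1=> [|r] P1 FP1 P10 nst1 min1.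
 case: nst1;have e : P1 = (P1@_0)%:MP.
 by apply/mpolyP=> m;rewrite mcoeffC (_ : m = 0%MM) ?eqxx ?mulr1 //;apply/mnmP=> -[].
 by rewrite e;apply: Stab_const=> //;apply: contraNneq P10=> z;rewrite e z mpolyC0.
pose U2 d := exists P : {mpoly K[r.+1]}, [/\ Fp P, P != 0, ~ Stab P & dlast P = d].
have [|d [P2 [FP2 P20 nst2 ed]] min2] := @minnat U2;first by exists (dlast P1), P1.
pose U3 e := exists P : {mpoly K[r.+1]}, [/\ Fp P, P != 0, ~ Stab P, dlast P = d & msize P = e].
have [|e [P3 [FP3 P30 nst3 ed3 es]] min3] := @minnat U3;first by exists (msize P2), P2.
exists r, P3;split=> //.
- move=> Q FQ Q0;apply: contrapT=> nQ;have := min1 r;rewrite ltnn=> h.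
 by have := h (ex_intro _ Q (And3 FQ Q0 nQ)).
- move=> Q FQ Q0;rewrite ed3=> lt;apply: contrapT=> nQ;have := min2 (dlast Q).
 by rewrite leqNgt lt=> h;have := h (ex_intro _ Q (And4 FQ Q0 nQ erefl)).
- move=> Q FQ Q0;rewrite ed3 es=> le lt;apply: contrapT=> nQ.
 have ge : (d <= dlast Q)%N by apply: min2;exists Q.
 have := min3 (msize Q);rewrite leqNgt lt=> h.
 have eQ : dlast Q = d by apply/eqP;rewrite eqn_leq le ge.
 by have := h (ex_intro _ Q (And5 FQ Q0 nQ eQ erefl)).
Qed.

Section WithP.
Variables (r : nat) (P : {mpoly K[r.+1]}).
Hypothesis mu : MinUnst P.
Let n := r.+1.
(** For [g] in [F] this operator lowers the total degree and does not raise the degree in the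
    highest derivative. Whatever is obtained from [P] by applying it at least once is thus zero or
    stable, which [low] keeps track of. *)
Let D g j (Q : {mpoly K[n]}) : {mpoly K[n]} := \sum_l Lmx n g l j *: Q^`M(l).
Let low d (Q : {mpoly K[n]}) := Fp Q /\ forall m, Q@_m != 0 ->
 (mdeg m + d < msize P)%N /\ (m ord_max <= dlast P)%N.
Let D_low g j d Q : F g -> low d Q -> low d.+1 (D g j Q).
move=> Fg [FQ hQ];split.
 move=> m;rewrite raddf_sum /=;apply: Fsum=> // l _;rewrite mcoeffZ mcoeff_mderiv.
 by apply: FM=> //;[rewrite mxE;apply: FMn=> //;exact: Fiter|exact: FMn].
move=> m;rewrite raddf_sum /= => nz.
have [l hl] : exists l, Q@_(m + U_(l)) != 0.
 apply/existsP;apply: contraNT nz;rewrite negb_exists=> /forallP hh.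
 rewrite big1 // => l _;have := hh l;rewrite negbK=> /eqP e.
 by rewrite mcoeffZ mcoeff_mderiv e mul0rn mulr0.
have [h1 h2] := hQ _ hl;rewrite mdegD mdeg1 in h1;rewrite mnmDE in h2;split.
 by rewrite addnS -addSn -(addn1 (mdeg m)).
exact: leq_trans (leq_addr _ _) h2.
Qed.
Let low_Stab d Q : (0 < d)%N -> low d Q -> Q != 0 -> Stab Q.
move=> d0 [FQ hQ] Q0;apply: (mu_size mu)=> //.
 by apply: dlast_leP=> m /hQ[].
have : (0 < msize P)%N by rewrite lt0n msize_poly_eq0;exact: mu_0 mu.
case e : (msize P)=> [//|s] _;rewrite ltnS;apply: msize_leP=> m /hQ[h _].
by rewrite e ltnS in h;apply: leq_trans h;rewrite -addn1 leq_add2l.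
Qed.
Let low0 : low 0 P.
split;first exact: mu_F mu.
by move=> m hm;rewrite addn0;split;[apply: msize_mdeg_lt;rewrite mcoeff_msupp|exact: dlast_le].
Qed.
Let D_comp g j Q : (Q \mPo asub n w g)^`M(j) = D g j Q \mPo asub n w g.
rewrite mderiv_asub /D (raddf_sum (comp_mpoly _)) /=;apply: eq_bigr=> l _.
by rewrite comp_mpolyZ.
Qed.
(** Taylor coefficients are, up to integer factors, values at [w] of iterated partial derivatives of
    the conjugate, hence of iterated [D]. *)
Let coefD g : F g -> forall e d Q m, low d Q -> mdeg m = e ->
 exists (S : {mpoly K[n]}) c, low (d + e) S /\ S.@[jet w] = (Q \mPo asub n w g)@_m *+ c.+1.
move=> Fg;elim=> [|e IH] d Q m lQ dm.
 have -> : m = 0%MM by apply/eqP;rewrite -mdeg_eq0 dm.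
 by exists Q, 0%N;rewrite addn0 mulr1n asub_coef0.
have [j mj] : exists j, m j != 0%N.
 apply/existsP;rewrite -negb_forall;apply/negP=> /forallP hh.
 by move: dm;rewrite mdegE big1 // => i _;apply/eqP.
have em : m = ((m - U_(j)) + U_(j))%MM.
 apply/mnmP=> i;rewrite mnmDE mnmBE mnm1E;case: eqP=> [<-|_];last by rewrite subn0 addn0.
 by rewrite addn1 subn1 prednK // lt0n.
have dm' : mdeg (m - U_(j)) = e.
 by apply: succn_inj;rewrite -dm [in RHS]em mdegD mdeg1 addn1.
have [S [c [lS hS]]] := IH d.+1 (D g j Q) (m - U_(j))%MM (D_low j Fg lQ) dm'.
move: hS;rewrite -D_comp mcoeff_mderiv -em -mulrnA mulnS /= => hS.
by exists S;eexists;split;[rewrite addnS -addSn;exact: lS|exact: hS].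
Qed.
Let hQ (g : K) (j : 'I_n) : F g -> g != 0 ->
 let Q := \sum_l Lmx n g l j *: P^`M(l) in Q = 0 \/ Stab Q.
move=> Fg g0 /=;have [Q0|Q0] := eqVneq (D g j P) 0;first by left.
right;apply: (low_Stab (d := 1))=> //;exact: D_low low0.
Qed.
Let hV (g : K) (m : 'X_{1..n}) : F g -> g != 0 -> m != 0%MM ->
 (P \mPo asub n w g)@_m != 0 -> exists2 e, F e & (P \mPo asub n w g)@_m =: e.
move=> Fg g0 m0 nz;have [S [c [lS hS]]] := coefD Fg low0 (erefl (mdeg m)).
have S0 : S != 0.
 apply: contraNneq nz=> z;move: hS;rewrite z meval0=> /esym /eqP.
 by rewrite mulrn_eq0.
have d0 : (0 < 0 + mdeg m)%N by rewrite add0n lt0n mdeg_eq0.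
have [a [s [Fa Fs s0 has st]]] := low_Stab d0 lS S0.
exists (S.@[jet a]);first by apply: Fmeval=> //;[exact: lS.1|move=> i;exact: Fiter].
apply: asymp_trans (sim_asymp hO (StabAt_sim T s0 st has))=> //;rewrite hS -mulr_natr.
rewrite -{1}[(P \mPo asub n w g)@_m]mulr1;apply: asympM=> //;first exact: asymp_refl.
apply: asymp_sym;exact: natS_asymp.
Qed.
Let Pnc : exists l, P^`M(l) != 0.
apply: contrapT=> hn;apply: (mu_un mu).
have z l : P^`M(l) = 0 by apply/eqP/negPn/negP=> h;apply: hn;exists l.
have e : P = (P@_0)%:MP.
 apply/mpolyP=> m;rewrite mcoeffC;have [->|m0] := eqVneq m 0%MM;first by rewrite mulr1.
 rewrite mulr0;have [j mj] : exists j, m j != 0%N.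
 apply/existsP;rewrite -negb_forall;apply: contraNN m0=> /forallP hh.
 by apply/eqP/mnmP=> i;rewrite mnm0E;apply/eqP.
 have em : m = ((m - U_(j)) + U_(j))%MM.
 apply/mnmP=> i;rewrite mnmDE mnmBE mnm1E;case: eqP=> [<-|_];last by rewrite subn0 addn0.
 by rewrite addn1 subn1 prednK // lt0n.
 have := congr1 (mcoeff (m - U_(j))) (z j);rewrite mcoeff_mderiv -em mcoeff0=> /eqP.
 by rewrite mulrn_eq0=> /eqP.
rewrite e;apply: Stab_const;first exact: (mu_F mu 0%MM).
by apply: contraNneq (mu_0 mu)=> z0;rewrite e z0 mpolyC0.
Qed.
Definition incut t := [/\ t != 0, forall b, F b -> t <: w - b &
 forall s, F s -> s != 0 -> (forall b, F b -> s <: w - b) -> s <: t].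
Definition Dom t := exists j1, (P \mPo asub n w t)@_U_(j1) != 0 /\
 (forall j, (P \mPo asub n w t)@_U_(j) <=: (P \mPo asub n w t)@_U_(j1)) /\
 forall m, (1 < mdeg m)%N -> (P \mPo asub n w t)@_m <: (P \mPo asub n w t)@_U_(j1).
Lemma incut_Dom t : incut t -> Dom t.
move=> [t0 h1 h2];rewrite /Dom.
exact (dominance T hF Fdiv hQ hV Pnc t0 h1 h2).
Qed.
(** Divided by its largest linear coefficient, the conjugate of [P] is linear modulo infinitesimals.
    The hypothesis keeps its constant term, the value of [P] at [w], bounded, so [t_DH2] applies. *)
Lemma Dom_zero t : t != 0 -> Dom t -> P.@[jet w] <=: P.@[jet (w + t)] - P.@[jet w] ->
 exists2 z, P.@[jet z] = 0 & z - w <=: t.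
move=> t0 [j1 [r0 [h1 h2]]] hP;set R := P \mPo asub n w t in r0 h1 h2.
set rho := R@_U_(j1) in r0 h1 h2.
have nc m : m != 0%MM -> R@_m <=: rho.
 rewrite -mdeg_eq0;case e : (mdeg m)=> [//|[|d]] _.
 move/eqP/mdeg1P: e=> [j /eqP ->];exact: h1.
 by apply: dltW=> //;apply: h2;rewrite e.
have hR0 : R@_0 <=: rho.
 rewrite asub_coef0;apply: (dle_trans hO hP).
 rewrite -[w + t]/(w + t) -(mulr1 t) -(asub_eval T) -(asub_coef0 der P w (t * 1)) mulr1.
 by apply: (meval_sub0_le T);[apply: (jet_O T);exact: O1|exact: nc].
have hR m : R@_m <=: rho by have [->//|/nc] := eqVneq m 0%MM.
have [|||y Oy hy] := t_DH2 T (R := rho^-1 *: R).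
- move=> m;rewrite mcoeffZ mulrC;apply/(dleP O)=> //;exact: hR.
- move=> m hm;rewrite mcoeffZ -(mulVf r0)=> /(dle_M2l hO (invr_neq0 r0));exact: h2.
- exists j1;rewrite mcoeffZ mulVf //;exact: dle_refl.
exists (w + t * y).
 by move: hy;rewrite mevalZ (asub_eval T)=> /eqP;rewrite mulf_eq0 invr_eq0 (negPf r0)=> /eqP.
by rewrite addrAC subrr add0r -{2}[t]mulr1;apply: dleMl=> //;exact/dle1.
Qed.
(** Instability on balls around ever better approximations gives points of [F] whose values are not
    equivalent to the value at [w]; this is the condition used by [Dom_zero]. *)
Lemma unstable_near b0 : F b0 -> exists2 b, F b & w - b <: w - b0 /\
 P.@[jet w] <=: P.@[jet b] - P.@[jet w].
move=> Fb0;have [b1 Fb1 h1] := himm Fb0;have [s Fs [s0 hs]] := cutF T hF himm Fb1.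
have [b [Fb hb nb]] := unstable_witness T hF Fxx (mu_un mu) Fb1 Fs s0 hs.2.
exists b=> //;split;last by apply: contrapT.
apply: (dle_lt_trans hO _ h1);apply: (dle_trans hO hb);exact: hs.1.
Qed.
End WithP.
End MinUnstable.

(* An operator of order less than r.+1 has at most r kernel elements of distinct
 valuations: substituting k0 * Y lowers the order. *)
Section Kernel.
Variables (K : RF) (der : K -> K) (O k : set K).
Hypothesis T : tame der O k.
Notation "x <: y" := (~ dominated O y x).
Let hO := t_val T.
Let hd := t_der T.
Lemma kernel_bound r (a : nat -> K) (z : nat -> K) :
 (exists2 i, (i <= r)%N & a i != 0) ->
 (forall i, \sum_(l < r.+1) a l * iter l der (z i) = 0) ->
 (forall i, z i != 0) -> (forall i j, (i < j)%N -> z j <: z i) -> False.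
elim: r a z=> [|r IH] a z [i0 i0r ai0] hz z0 zlt.
 move: i0r ai0;rewrite leqn0=> /eqP -> a00;have := hz 0%N;rewrite big_ord1 /= => /eqP.
 by rewrite mulf_eq0 (negPf a00) (negPf (z0 0%N)).
pose b j := \sum_(l < r.+2) a l * (iter (l - j) der (z 0%N) *+ 'C(l, j)).
have hb y : \sum_(l < r.+2) a l * iter l der (z 0%N * y) = \sum_(j < r.+2) b j * iter j der y.
 under [RHS]eq_bigr=> j _ do rewrite mulr_suml.
 rewrite exchange_big /=;apply: eq_bigr=> l _;rewrite iter_derM // mulr_sumr.
 rewrite (big_ord_widen _ (fun j=> a l * ((iter (l - j) der (z 0%N) * iter j der y) *+ 'C(l, j))) (ltn_ord l)).
 rewrite big_mkcond /=;apply: eq_bigr=> j _;case: ltnP=> h;first by rewrite -mulrA mulrnAl.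
 by rewrite bin_small // mulr0n mulr0 mul0r.
have b0 : b 0%N = 0.
 by rewrite /b -[RHS](hz 0%N);apply: eq_bigr=> l _;rewrite subn0 bin0.
have zz i : z i.+1 / z 0%N != 0 by rewrite mulf_neq0 ?invr_neq0.
have zs i : z i.+1 / z 0%N <: 1.
 move=> /(dleMr hO (z 0%N));rewrite divfK // mul1r;exact: zlt.
have nz1 i : ~ asymp O (z i.+1 / z 0%N) 1 by move=> [_ /zs].
(* The coefficient [b 0] vanishes because [z 0] is in the kernel, so the conjugated operator acts on
   derivatives and its order drops. None of the ratios is asymptotic to 1, so their derivatives
   still have distinct values. *)
apply: (IH (fun j=> b j.+1) (fun i=> der (z i.+1 / z 0%N))).
- have [l hl] : exists l : 'I_r.+2, (a l != 0) && [forall l' : 'I_r.+2, (l < l')%N ==> (a l' == 0)].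
 have ex : exists i, (i <= r.+1)%N && (a i != 0) by exists i0;rewrite i0r.
 have bd i : (i <= r.+1)%N && (a i != 0) -> (i <= r.+1)%N by case/andP.
 case: (ex_maxnP ex bd)=> l /andP[lr al] lmax;exists (Ordinal (lr : (l < r.+2)%N))=> /=.
 rewrite al /=;apply/forallP=> l';apply/implyP=> ll';apply: contraTT ll'=> al'.
 by rewrite -leqNgt;apply: lmax;rewrite al' -ltnS ltn_ord.
 have [al /forallP hmax] := andP hl.
 have bl : b l = a l * z 0%N.
 rewrite /b (bigD1 l) //= subnn binn mulr1n big1 ?addr0 // => l' l'l.
 have [lt|gt|/val_inj e] := ltngtP l' l;first by rewrite bin_small // mulr0.
 by have := hmax l';rewrite gt /= => /eqP ->;rewrite mul0r.
 by rewrite e eqxx in l'l.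
 have l0 : (0 < l)%N.
 rewrite lt0n;apply/eqP=> e;move: b0;rewrite -e bl=> /eqP.
 by rewrite mulf_eq0 (negPf al) (negPf (z0 0%N)).
 exists l.-1;first by rewrite -ltnS prednK // -ltnS ltn_ord.
 by rewrite prednK // bl mulf_neq0.
- move=> i;have := hb (z i.+1 / z 0%N);rewrite mulrC divfK // hz=> /esym.
 rewrite big_ord_recl b0 mul0r add0r=> h;rewrite -[RHS]h;apply: eq_bigr=> j _ /=.
 by rewrite add0n -iterSr.
- move=> i;apply/eqP=> e;have := logd_big T (zz i) (@nz1 i).
 rewrite /logder e mul0r;apply;exact: dle0x.
- move=> i j ij;apply: (der_dlt T)=> //.
 by apply: dltMr=> //;[rewrite invr_neq0|exact: zlt].
Qed.
End Kernel.

(** * Saturated elementary extensions in one step *)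

Definition set_of_list (T : Type) (l : list T) : set T := fun q=> List.In q l.
Lemma finite_set_of_list (T : Type) (l : list T) : finite_set (set_of_list l).
elim: l=> [|a l IH];first by rewrite (_ : set_of_list [::] = set0) //;apply/seteqP;split.
rewrite (_ : set_of_list (a :: l) = [set a] `|` set_of_list l).
 rewrite finite_setU;split=> //;exact: finite_set1.
by apply/seteqP;split=> q /= [->|h];[left|right|left|right].
Qed.

Section Saturation.
Variables (L : signature) (M : structure L) (X : Type) (a0 : M).
(** Parameter slots: one for each element of [X], and countably many for the variables of a single
    formula. *)
Let Z := (X + nat)%type.

(* Formal witnesses: [Wit A p] is meant to realize the type [p], a set of
 relations with parameters [A], over previously constructed elements. *)
Inductive Const : Type :=
| Base of M
| Wit of (Z -> Const) & set (M -> (Z -> M) -> Prop).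
Let Om := Const -> M.
Definition cev (rho : Om) (c : Const) : M := if c is Base a then a else rho c.
(** The event [E] is decided by the values of the constants in [Y]. *)
Let meas (Y : set Const) (E : set Om) :=
 forall rho rho' : Om, (forall c, Y c -> cev rho c = cev rho' c) -> E rho -> E rho'.
Let ex_set (A : Z -> Const) (l : list (M -> (Z -> M) -> Prop)) : set Om :=
 [set rho | exists x, forall R, List.In R l -> R x (cev rho \o A)].
Let real_set (c : Const) (A : Z -> Const) (R : M -> (Z -> M) -> Prop) : set Om :=
 [set rho | R (cev rho c) (cev rho \o A)].
Let FS (U : set_system Om) A (p : set (M -> (Z -> M) -> Prop)) :=
 forall l, set_of_list l `<=` p -> U (ex_set A l).

(** A stage of the construction of an ultrafilter on the assignments of all constants. Each treated
    witness realizes its type almost surely whenever the finite parts of the type are almost surely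
    satisfiable. The constants are closed under forming witnesses, so no transfinite chain of models
    is needed. *)
Record good := Good {
 gY : set Const;gU : set_system Om;
 g_ultra : UltraFilter gU;
 g_base : forall a, gY (Base a);
 g_closed : forall A p, gY (Wit A p) -> forall z, gY (A z);
 g_wit : forall A p, gY (Wit A p) -> FS gU A p -> forall R, p R -> gU (real_set (Wit A p) A R) }.
Let le (g h : good) := gY g `<=` gY h /\ forall E, meas (gY g) E -> gU g E -> gU h E.
Let ufT (U : set_system Om) : UltraFilter U -> U setT.
move=> h;have pf := @ultra_proper _ _ h;exact: filterT. Qed.
Let ufI (U : set_system Om) A B : UltraFilter U -> U A -> U B -> U (A `&` B).
move=> h;have pf := @ultra_proper _ _ h;exact: filterI. Qed.
Let ufS (U : set_system Om) A B : UltraFilter U -> A `<=` B -> U A -> U B.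
move=> h;have pf := @ultra_proper _ _ h;exact: filterS. Qed.
Let uf0 (U : set_system Om) : UltraFilter U -> ~ U set0.
move=> h;have pf := @ultra_proper _ _ h;exact: filter_not_empty. Qed.
Let ufC (U : set_system Om) A : UltraFilter U -> ~ U A -> U (~` A).
by move=> h nA;case: (in_ultra_setVsetC A h). Qed.
Let ufN (U : set_system Om) A : UltraFilter U -> U A -> U (~` A) -> False.
move=> h a b;apply: (uf0 h);rewrite -(setICr A);exact: ufI. Qed.
Let ufex (U : set_system Om) A : UltraFilter U -> U A -> exists rho, A rho.
move=> h hA;apply: contrapT=> nx;apply: (uf0 h);apply: ufS hA=> // rho hr.
by apply: nx;exists rho.
Qed.
Let measC Y E : meas Y E -> meas Y (~` E).
by move=> h rho rho' e nE E';apply: nE;apply: h E'=> c Yc;rewrite e. Qed.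
Let measI Y E E' : meas Y E -> meas Y E' -> meas Y (E `&` E').
by move=> h h' rho rho' e [a b];split;[exact: h a|exact: h' b]. Qed.
Let meas_sub Y Y' E : Y `<=` Y' -> meas Y E -> meas Y' E.
move=> s h rho rho' e;apply: h=> c /s;exact: e. Qed.
Let meas_ex Y A l : (forall z, Y (A z)) -> meas Y (ex_set A l).
move=> h rho rho' e [x hx];exists x=> R /hx.
rewrite (_ : cev rho \o A = cev rho' \o A) //;apply: funext=> z /=;exact: e.
Qed.
Let meas_real Y c A R : Y c -> (forall z, Y (A z)) -> meas Y (real_set c A R).
move=> Yc h rho rho' e;rewrite /real_set /= (e _ Yc).
rewrite (_ : cev rho \o A = cev rho' \o A) //;apply: funext=> z /=;exact: e.
Qed.
Let le_refl g : le g g. by split. Qed.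
Let le_trans g h k : le g h -> le h k -> le g k.
move=> [a b] [c d];split;first exact: subset_trans c.
by move=> E m hE;apply: d;[exact: meas_sub m|exact: b].
Qed.

Let extend_base (B : set (set Om)) : B setT -> (forall A A', B A -> B A' -> B (A `&` A')) ->
 (forall A, B A -> exists rho, A rho) -> exists2 U, UltraFilter U & B `<=` U.
move=> BT BI Bn;pose F : set_system Om := [set S | exists2 A, B A & A `<=` S].
have pF : ProperFilter F.
 apply: Build_ProperFilter.
 by move=> [A /Bn[rho hr] /(_ _ hr)].
 split;first by exists setT.
 by move=> P Q [A hA sA] [A' hA' sA'];exists (A `&` A');[exact: BI|move=> r [/sA ? /sA' ?]].
 move=> P Q PQ [A hA sA];exists A=> //;exact: subset_trans PQ.
have [U [uU sU]] := ultraFilterLemma pF.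
by exists U=> // A hA;apply: sU;exists A.
Qed.
(** The ultrafilters of a chain need not increase; only their traces on measurable events do. The
    union of the traces is a filter base, and an ultrafilter above it has the same traces, since the
    complement of a measurable event is measurable. *)
Let chain_bound (C : set good) : total_on C le -> (exists g, C g) -> exists h, forall g, C g -> le g h.
move=> tot [g0 Cg0].
pose Y : set Const := [set c | exists2 g, C g & gY g c].
pose B : set (set Om) := [set E | exists g, [/\ C g, meas (gY g) E & gU g E]].
have [|||U uU sU] := @extend_base B.
- exists g0;split=> //;exact: ufT (g_ultra g0).
- move=> A A' [g [Cg mg hg]] [g' [Cg' mg' hg']].
 case: (tot g g' Cg Cg')=> [[s l]|[s l]].
 exists g';split=> //;first by apply: measI=> //;exact: meas_sub mg.
 apply: ufI (g_ultra g') _ _=> //;exact: l.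
 exists g;split=> //;first by apply: measI=> //;exact: meas_sub mg'.
 apply: ufI (g_ultra g) _ _=> //;exact: l.
- move=> A [g [_ _ hg]];exact: ufex (g_ultra g) hg.
have agree g E : C g -> meas (gY g) E -> gU g E <-> U E.
 move=> Cg m;split;first by move=> h;apply: sU;exists g.
 move=> UE;apply: contrapT=> n;apply: (ufN uU UE);apply: sU;exists g;split=> //.
 exact: measC.
 exact: ufC (g_ultra g) n.
have b a : Y (Base a) by exists g0=> //;exact: g_base.
have c A p : Y (Wit A p) -> forall z, Y (A z).
 move=> [g Cg gc] z;exists g=> //;exact: g_closed gc z.
have w A p : Y (Wit A p) -> FS U A p -> forall R, p R -> U (real_set (Wit A p) A R).
 move=> [g Cg gc] fs R pR;have cl := g_closed gc.
 apply/(agree g)=> //;first exact: meas_real.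
 by apply: (g_wit gc)=> // l lp;apply/(agree g)=> //;[exact: meas_ex|exact: fs].
exists (@Good Y U uU b c w)=> g Cg;split=> /=;first by move=> d gd;exists g.
move=> E m /(agree g) h;exact: h.
Qed.
Let good0 : exists g : good, True.
have [||| U uU _] := @extend_base [set setT].
- by [].
- by move=> A A' -> ->;rewrite setIid.
- by move=> A ->;exists (fun=> a0).
pose Y : set Const := [set c | exists a, c = Base a].
have b a : Y (Base a) by exists a.
have c A p : Y (Wit A p) -> forall z, Y (A z) by case.
have w A p : Y (Wit A p) -> FS U A p -> forall R, p R -> U (real_set (Wit A p) A R) by case.
by exists (@Good Y U uU b c w).
Qed.
Let upd (rho : Om) (c : Const) x : Om := fun d=> if `[< d = c >] then x else rho d.
(** The constant [c] occurs in no event measurable over [gY g], so an assignment can be changed at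
    [c] alone. Requiring [c] to realize finitely many relations is therefore consistent with all
    earlier events. If the type is not almost surely finitely satisfiable, nothing is required and
    the ultrafilter is kept. *)
Let extend (g : good) A p : ~ gY g (Wit A p) -> (forall z, gY g (A z)) ->
 exists2 h, le g h & gY h (Wit A p).
move=> nc cl;set c := Wit A p in nc *.
pose Y : set Const := [set d | gY g d \/ d = c].
have b a : Y (Base a) by left;exact: g_base.
have cc A' p' : Y (Wit A' p') -> forall z, Y (A' z).
 by move=> [gc z|[-> _] z];left;[exact: g_closed gc z|exact: cl].
have neq d : gY g d -> d <> c by move=> gd e;apply: nc;rewrite -e.
have upd_Y rho x d : gY g d -> cev (upd rho c x) d = cev rho d.
 move=> gd;case: d gd=> //= A' p' gd;rewrite /upd asboolF //;exact: neq.
have updA rho x : cev (upd rho c x) \o A = cev rho \o A by apply: funext=> z /=;exact: upd_Y.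
case: (pselect (FS (gU g) A p))=> fs;last first.
 have w A' p' : Y (Wit A' p') -> FS (gU g) A' p' -> forall R, p' R -> gU g (real_set (Wit A' p') A' R).
 by move=> [gc|[-> ->]];[exact: g_wit|move/fs].
 by exists (@Good Y (gU g) (g_ultra g) b cc w);[split=> [d|] //=;left|right].
pose B : set (set Om) := [set S | exists E l, [/\ meas (gY g) E, gU g E, set_of_list l `<=` p
 & S = E `&` [set rho | forall R, List.In R l -> real_set c A R rho]]].
have [|||U uU sU] := @extend_base B.
- exists setT, [::];split=> //;first exact: ufT (g_ultra g).
 by apply/seteqP;split=> // rho _;split.
- move=> S S' [E [l [m hE lp ->]]] [E' [l' [m' hE' lp' ->]]].
 exists (E `&` E'), (List.app l l');split;first exact: measI.
 + exact: ufI (g_ultra g) _ _.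
 + by move=> R hR;case: (List.in_app_or _ _ _ hR)=> [/lp|/lp'].
 + apply/seteqP;split=> rho.
 by move=> [[? h] [? h']];split=> // R hR;case: (List.in_app_or _ _ _ hR)=> [/h|/h'].
 by move=> [[? ?] h];split;split=> // R hR;apply: h;apply: List.in_or_app;[left|right].
- move=> S [E [l [m hE lp ->]]].
 have [rho [hr [x hx]]] := ufex (g_ultra g) (ufI (g_ultra g) hE (fs l lp)).
 exists (upd rho c x);split;first by apply: m hr=> d gd;rewrite upd_Y.
 move=> R /hx;rewrite /real_set /= updA.
 by rewrite (_ : upd rho c x (Wit A p) = x) // /upd asboolT.
have agree E : meas (gY g) E -> gU g E <-> U E.
 have sub E' : meas (gY g) E' -> gU g E' -> U E'.
 move=> m hE;apply: sU;exists E', [::];split=> //.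
 by apply/seteqP;split=> rho;[move=> h;split|case].
 move=> m;split;first exact: sub.
 move=> UE;apply: contrapT=> n;apply: (ufN uU UE);apply: sub;first exact: measC.
 exact: ufC (g_ultra g) n.
have w A' p' : Y (Wit A' p') -> FS U A' p' -> forall R, p' R -> U (real_set (Wit A' p') A' R).
 move=> [gc fs' R pR|[-> ->] _ R pR].
 have cl' := g_closed gc;apply/agree;first exact: meas_real.
 by apply: (g_wit gc)=> // l lp;apply/agree;[exact: meas_ex|exact: fs'].
 apply: sU;exists setT, [:: R];split=> //;first exact: ufT (g_ultra g).
 by move=> R' [<-|[]].
 by apply/seteqP;split=> rho;[move=> h;split=> // R' [<-|[]]|case=> _;apply;left].
exists (@Good Y U uU b cc w);last by right.
by split=> [d|E m /agree h] /=;[left|exact: h].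
Qed.
(** A maximal stage contains all constants, by induction on their construction. *)
Lemma full_good : exists U : set_system Om, UltraFilter U /\
 forall A p, FS U A p -> forall R, p R -> U (real_set (Wit A p) A R).
have [g0 _] := good0.
have [||C tot|g gmax] := @ZL_preorder good g0 (fun g h=> `[< le g h >]).
- move=> g;apply/asboolP;exact: le_refl.
- move=> g h k' /asboolP a /asboolP b;apply/asboolP;exact: le_trans b.
- case: (pselect (exists g, C g))=> [ne|ne];last by exists g0=> s hs;case: ne;exists s.
 have [|h hh] := @chain_bound C _ ne;last by exists h=> s /hh;move/asboolP.
 by move=> g h hg hh;case: (tot g h hg hh)=> /asboolP;[left|right].
have all c : gY g c.
 elim: c=> [a|A IH p];first exact: g_base.
 apply: contrapT=> n;have [h gh hc] := extend n IH.
 have /asboolP[s _] := gmax h (asboolT gh);apply: n;exact: s.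
exists (gU g);split;first exact: g_ultra.
move=> A p;apply: g_wit;exact: all.
Qed.

Section Model.
Variable U : set_system Om.
Hypothesis uU : UltraFilter U.
Hypothesis hU : forall A p, FS U A p -> forall R, p R -> U (real_set (Wit A p) A R).
Let eqc (c d : Const) := U [set rho | cev rho c = cev rho d].
Let eqc_refl c : eqc c c.
by rewrite /eqc (_ : [set _ | _] = setT);[exact: ufT|apply/seteqP;split]. Qed.
Let eqc_sym c d : eqc c d -> eqc d c.
by apply: ufS=> // rho /= ->. Qed.
Let eqc_trans c d e : eqc c d -> eqc d e -> eqc c e.
by move=> h h';apply: ufS (ufI uU h h')=> // rho /= [-> ->]. Qed.
Let D := {S : set Const | exists c, S = eqc c}.
Let pr (c : Const) : D := exist _ (eqc c) (ex_intro _ c erefl).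
Let rp (x : D) : Const := sval (cid (svalP x)).
Let pr_eq c d : pr c = pr d <-> eqc c d.
split=> [[e]|h];first by rewrite e;exact: eqc_refl.
apply: eq_exist=> /=;apply/funext=> e;apply/propext;split=> h'.
 exact: eqc_trans (eqc_sym h) h'.
exact: eqc_trans h h'.
Qed.
Let rpK x : pr (rp x) = x.
by case: x=> S hS;rewrite /rp;case: cid=> c /= e;apply: eq_exist. Qed.
(** Single relations are types too, so the formal witnesses also act as Skolem functions. *)
Let witness (e : nat -> Const) (R : M -> (nat -> M) -> Prop) :
 U [set rho | exists x, R x (cev rho \o e)] -> exists c, U [set rho | R (cev rho c) (cev rho \o e)].
move=> h;pose A (z : Z) : Const := if z is inr i then e i else Base a0.
pose R' x (eta : Z -> M) := R x (eta \o inr).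
exists (Wit A [set R']);apply: (@hU A [set R'] _ R')=> // l lp.
by apply: ufS h=> // rho [x hx];exists x=> R'' /lp /= ->.
Qed.
Let fin_int n (F : 'I_n -> set Om) : (forall j, U (F j)) -> U [set rho | forall j, F j rho].
elim: n F=> [|n IH] F h;first by apply: ufS (ufT uU)=> // rho _ [].
apply: ufS (ufI uU (IH (fun j=> F (lift ord0 j)) (fun j=> h _)) (h ord0))=> //.
move=> rho [a b] j;case: (unliftP ord0 j)=> [j' ->|->] //;exact: a.
Qed.
Let fun_ex (f : fsym L) (xs : 'I_(farity f) -> Const) :
 exists c, U [set rho | cev rho c = @finterp L M f (fun j=> cev rho (xs j))].
pose e i : Const := if insub i is Some j then xs j else Base a0.
have [|c hc] := @witness e (fun x eta=> x = @finterp L M f (fun j=> eta (val j))).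
 by apply: ufS (ufT uU)=> // rho _;eexists.
exists c;apply: ufS hc=> // rho /= ->;congr finterp;apply: funext=> j.
by rewrite /e valK.
Qed.
Definition sat_ext : structure L := @Structure L D
 (fun f xs=> pr (sval (cid (fun_ex (rp \o xs)))))
 (fun r xs=> U [set rho | @rinterp L M r (fun j=> cev rho (rp (xs j)))]).
Let evalU (e : nat -> Const) (t : term L) (c : Const) :
 @eval_term L sat_ext (pr \o e) t = pr c <->
 U [set rho | @eval_term L M (cev rho \o e) t = cev rho c].
have main : forall t, exists2 c, @eval_term L sat_ext (pr \o e) t = pr c &
 U [set rho | @eval_term L M (cev rho \o e) t = cev rho c].
 elim=> [i|f ts IH];first by exists (e i)=> //;apply: ufS (ufT uU).
 have [cs hcs] := choice (fun j=> let: ex_intro2 c a b := IH j in ex_intro (fun c =>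
 @eval_term L sat_ext (pr \o e) (ts j) = pr c /\ U [set rho | @eval_term L M (cev rho \o e) (ts j) = cev rho c]) c (conj a b)).
 rewrite /=;case: cid=> c1 /= hc;exists c1=> //.
 have h1 := fin_int (fun j=> (hcs j).2).
 have h2 : U [set rho | forall j, cev rho (rp (@eval_term L sat_ext (pr \o e) (ts j))) = cev rho (cs j)].
 by apply: fin_int=> j;apply/pr_eq;rewrite rpK (hcs j).1.
 apply: ufS (ufI uU hc (ufI uU h1 h2))=> // rho [/= -> [a b]];congr finterp.
 by apply: funext=> j;rewrite (a j) (b j).
have [d -> hd] := main t;rewrite pr_eq;split=> h.
 by apply: ufS (ufI uU hd h)=> // rho /= [-> ->].
by apply: ufS (ufI uU hd h)=> // rho /= [<- <-].
Qed.
(** The theorem of Los, the domain being the constants modulo almost sure equality. In the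
    quantifier case a failing formula would have a formal witness of its negation. *)
Lemma satU phi (e : nat -> Const) :
 @sat L sat_ext (pr \o e) phi <-> U [set rho | @sat L M (cev rho \o e) phi].
elim: phi e=> [|t u|r ts|phi IH1 psi IH2|i phi IH] e /=.
- by split=> // h;apply: (uf0 uU);apply: ufS h.
- pose d := rp (@eval_term L sat_ext (pr \o e) u).
 have hu : U [set rho | @eval_term L M (cev rho \o e) u = cev rho d] by apply/evalU;rewrite rpK.
 rewrite -[X in _ = X](rpK (@eval_term L sat_ext (pr \o e) u)) evalU -/d;split=> h.
 by apply: ufS (ufI uU hu h)=> // rho /= [-> ->].
 by apply: ufS (ufI uU hu h)=> // rho /= [<- ->].
- have h : U [set rho | forall j, cev rho (rp (@eval_term L sat_ext (pr \o e) (ts j))) = @eval_term L M (cev rho \o e) (ts j)].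
 by apply: fin_int=> j;have := (evalU e (ts j) (rp (@eval_term L sat_ext (pr \o e) (ts j)))).1;rewrite rpK=> /(_ erefl);apply: ufS=> // rho /= ->.
 split=> h';apply: ufS (ufI uU h h')=> // rho /= [a].
 by rewrite (_ : (fun j=> cev rho _) = (fun j=> eval_term (cev rho \o e) (ts j))) //;apply: funext.
 by rewrite (_ : (fun j=> cev rho _) = (fun j=> eval_term (cev rho \o e) (ts j))) //;apply: funext.
- rewrite IH1 IH2;split=> h.
 case: (pselect (U [set rho | sat (cev rho \o e) phi]))=> h1.
 by apply: ufS (h h1)=> // rho /= hp _.
 by apply: ufS (ufC uU h1)=> // rho /= n /n.
 move=> h1;apply: ufS (ufI uU h h1)=> // rho /= [a b];exact: a.
- have upE (c : Const) : @update L sat_ext (pr \o e) i (pr c) = (pr \o (fun j=> if j == i then c else e j) : nat -> sat_ext).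
 by apply: funext=> j;rewrite /update /=;case: eqP.
 have upE' rho (c : Const) : cev rho \o (fun j=> if j == i then c else e j) = update (cev rho \o e) i (cev rho c).
 by apply: funext=> j;rewrite /update /=;case: eqP.
 split=> [h|h x].
 apply: contrapT=> n;have {}n := ufC uU n.
 have [|c hc] := @witness e (fun x eta=> ~ sat (update eta i x) phi).
 by apply: ufS n=> // rho /= n;apply: contrapT=> n';apply: n=> x;apply: contrapT=> n'';apply: n';exists x.
 have := h (pr c);rewrite upE IH=> h'.
 by apply: (uf0 uU);apply: ufS (ufI uU hc h')=> // rho /= [a];rewrite upE'.
 rewrite -(rpK x) upE IH;apply: ufS h=> // rho /= h;rewrite upE';exact: h.
Qed.
Definition base (a : M) : sat_ext := pr (Base a).
Lemma base_elementary : @elementary_embedding L M sat_ext base.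
move=> phi v;rewrite (satU phi (Base \o v));split=> h.
 by apply: ufS (ufT uU)=> // rho _.
by have [rho] := ufex uU h.
Qed.
(** Enumerating the parameters by [X] turns a type into a set of relations on [M], for which there
    is a formal witness. Finite satisfiability in the extension becomes almost sure satisfiability
    by [satU]. *)
Lemma sat_ext_saturated : @succ_card_saturated L sat_ext X.
move=> A p cA hA hfs.
case: (pselect (exists q, p q))=> [[q0 pq0]|np];last first.
 by exists (base a0)=> q pq;case: np;exists q.
have [a ha] : exists a : X -> sat_ext, forall x, A x -> exists z, a z = x.
 have [f] := @ocard_geP _ _ A [set: X] cA;pose d := q0.2 0%N.
 exists (fun z=> if f z is Some y then y else d)=> x Ax.
 have [z _ hz] : [set f z | z in [set: X]] (Some x) by apply: (@surj _ _ _ _ f)=> //;exists x.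
 by exists z;rewrite hz.
have lift_env (v : nat -> sat_ext) : (forall j, A (v j)) -> exists e : nat -> X, v = a \o e.
 move=> h;have [e he] := choice (fun j=> ha _ (h j));exists e;apply: funext=> j.
 by rewrite /= he.
pose AA (z : Z) : Const := if z is inl x then rp (a x) else Base a0.
pose rel phi (e : nat -> X) : M -> (Z -> M) -> Prop := fun x eta =>
 @sat L M (update (eta \o inl \o e) 0 x) phi.
pose pp : set (M -> (Z -> M) -> Prop) := [set R | exists phi e, p (phi, a \o e) /\ R = rel phi e].
have envE c rho e : update (cev rho \o AA \o inl \o e) 0 (cev rho c) =
 cev rho \o (fun j=> if j == 0%N then c else rp (a (e j))).
 by apply: funext=> j;rewrite /update /=;case: eqP.
have satE c phi e : @sat L sat_ext (update (a \o e) 0 (pr c)) phi <->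
 U [set rho | rel phi e (cev rho c) (cev rho \o AA)].
 rewrite (_ : @update L sat_ext (a \o e) 0 (pr c) = (pr \o (fun j=> if j == 0%N then c else rp (a (e j))) : nat -> sat_ext));last first.
 by apply: funext=> j;rewrite /update /=;case: eqP=> // _;rewrite rpK.
 by rewrite satU;split;apply: ufS=> // rho /=;rewrite /rel -envE.
exists (pr (Wit AA pp))=> -[phi v] pq /=.
have [e ev] := lift_env v (hA _ pq).
rewrite ev satE;apply: (hU (p := pp));last by exists phi, e;rewrite -ev.
move=> l lp.
have [l' hl'] : exists l' : list (formula L * (nat -> X)),
 (forall q, List.In q l' -> p (q.1, a \o q.2)) /\ forall R, List.In R l -> exists2 q, List.In q l' & R = rel q.1 q.2.
 elim: l lp=> [|R l IH] lp;first by exists [::].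
 have [|l' [h1 h2]] := IH;first by move=> R' h;apply: lp;right.
 have [f [e' [pf ->]]] := lp R (or_introl erefl).
 exists ((f, e') :: l');split;first by move=> q [<-|/h1].
 move=> R' [<-|/h2[q hq ->]];first by exists (f, e')=> //;left.
 by exists q=> //;right.
case: hl'=> h1 h2.
have [|q hq|x hx] := hfs (set_of_list (List.map (fun q=> (q.1, a \o q.2)) l')).
- exact: finite_set_of_list.
- by move/List.in_map_iff: hq=> [q' [<- /h1]].
have hall : U [set rho | forall q, List.In q l' -> rel q.1 q.2 (cev rho (rp x)) (cev rho \o AA)].
 have {}hx q : List.In q l' -> U [set rho | rel q.1 q.2 (cev rho (rp x)) (cev rho \o AA)].
 move=> hq;apply/satE;rewrite rpK;apply: (hx (q.1, a \o q.2)).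
 by apply/List.in_map_iff;exists q.
 elim: l' hx {h1 h2}=> [|q l' IH] hx;first by apply: ufS (ufT uU)=> // rho _ q [].
 apply: ufS (ufI uU (hx q (or_introl erefl)) (IH (fun q' h=> hx q' (or_intror h))))=> //.
 by move=> rho [u1 u2] q' [<-|/u2].
apply: ufS hall=> // rho h;exists (cev rho (rp x))=> R /h2[q hq ->];exact: h.
Qed.
End Model.

Theorem saturated_extension : exists (N : structure L) (i : M -> N),
 elementary_embedding i /\ succ_card_saturated N X.
have [U [uU hU]] := full_good.
exists (sat_ext uU hU), (base uU hU);split;[exact: base_elementary|exact: sat_ext_saturated].
Qed.
End Saturation.

(** * Renaming, binding and closing formulas *)

Section Syntax.
Variable L : signature.

Fixpoint trn (r : nat -> nat) (t : term L) : term L :=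
 match t with
 | Var i=> @Var L (r i)
 | App f ts=> @App L f (fun j=> trn r (ts j))
 end.

Fixpoint frn (r : nat -> nat) (phi : formula L) : formula L :=
 match phi with
 | FFalse=> @FFalse L
 | FEq t u=> FEq (trn r t) (trn r u)
 | FRel R ts=> @FRel L R (fun j=> trn r (ts j))
 | FImp a b=> FImp (frn r a) (frn r b)
 | FAll i a=> FAll (r i) (frn r a)
 end.
Lemma eval_trn (M : structure L) r (v : nat -> M) t : eval_term v (trn r t) = eval_term (v \o r) t.
by elim: t=> [i|f ts IH] //=;congr finterp;apply: funext. Qed.
Lemma update_ren (M : structure L) r (v : nat -> M) i a : injective r ->
 update v (r i) a \o r = update (v \o r) i a.
by move=> ri;apply: funext=> j;rewrite /update /= (inj_eq ri). Qed.
Lemma sat_frn (M : structure L) r phi (v : nat -> M) : injective r ->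
 sat v (frn r phi) <-> sat (v \o r) phi.
move=> ri;elim: phi v=> [|t u|R ts|a IHa b IHb|i a IHa] v /=.
- by [].
- by rewrite !eval_trn.
- rewrite (_ : (fun j=> _) = (fun j=> eval_term (v \o r) (ts j))) //;apply: funext=> j;exact: eval_trn.
- by rewrite IHa IHb.
- by split=> h x;have := h x;rewrite IHa update_ren.
Qed.
Lemma term_bound (t : term L) : exists N, forall (M : structure L) (v w : nat -> M),
 (forall j, (j < N)%N -> v j = w j) -> eval_term v t = eval_term w t.
elim: t=> [i|f ts IH];first by exists i.+1=> M v w;apply.
have [N hN] := choice IH;exists (\max_j N j)=> M v w h /=;congr finterp;apply: funext=> j.
apply: hN=> l hl;apply: h;apply: leq_trans hl _;exact: (leq_bigmax j).
Qed.
Lemma formula_bound (phi : formula L) : exists N, forall (M : structure L) (v w : nat -> M),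
 (forall j, (j < N)%N -> v j = w j) -> sat v phi <-> sat w phi.
elim: phi=> [|t u|R ts|a [N hN] b [N' hN']|i a [N hN]].
- by exists 0%N.
- have [N hN] := term_bound t;have [N' hN'] := term_bound u;exists (maxn N N')=> M v w h /=.
 by rewrite (hN _ v w) ?(hN' _ v w) // => j hj;apply: h;rewrite leq_max hj ?orbT.
- have [N hN] := choice (fun j=> term_bound (ts j));exists (\max_j N j)=> M v w h /=.
 rewrite (_ : (fun j=> _) = (fun j=> eval_term w (ts j))) //;apply: funext=> j.
 apply: hN=> l hl;apply: h;apply: leq_trans hl _;exact: (leq_bigmax j).
- exists (maxn N N')=> M v w h /=.
 by rewrite (hN _ v w) ?(hN' _ v w) // => j hj;apply: h;rewrite leq_max hj ?orbT.
- exists N=> M v w h /=;split=> hh x;have := hh x.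
 rewrite (hN _ _ (update w i x)) // => j hj;rewrite /update;case: eqP=> // _;exact: h.
 rewrite (hN _ (update v i x)  (update w i x)) // => j hj;rewrite /update;case: eqP=> // _;exact: h.
Qed.
Definition scons T (a : T) (v : nat -> T) : nat -> T := fun j=> if j is j'.+1 then v j' else a.
Lemma scons_update (M : structure L) (v : nat -> M) a b : update (scons b v) 0 a = scons a v.
by apply: funext=> -[|j]. Qed.
Lemma forall_scons (phi : formula L) : exists psi, forall (M : structure L) (v : nat -> M),
 sat v psi <-> forall a, sat (scons a v) phi.
have [N hN] := formula_bound phi.
pose r j := if j is j'.+1 then (if (j' < N)%N then j' else j) else N.
have ri : injective r.
 move=> [|i] [|j] //=;rewrite /r.
 - by case: ltnP=> [h e|h e];[rewrite -e ltnn in h|rewrite e ltnn in h].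
 - by case: ltnP=> [h e|h e];[rewrite e ltnn in h|rewrite -e ltnn in h].
 - case: ltnP=> h1;case: ltnP=> h2 e.
 + by rewrite e.
 + by rewrite e ltnNge (leq_trans h2) in h1.
 + by rewrite -e ltnNge (leq_trans h1) in h2.
 + exact: e.
exists (FAll N (frn r phi))=> M v /=;split=> h a;have := h a;rewrite sat_frn //;
 rewrite (hN _ _ (scons a v)) // => -[|j] hj;rewrite /update /= ?eqxx //;
 by rewrite (ltnW hj);case: eqP=> // e;rewrite e ltnNge leqnSn in hj.
Qed.

Fixpoint clos N (phi : formula L) := if N is N'.+1 then clos N' (FAll N' phi) else phi.
Lemma sat_clos (M : structure L) N phi (v : nat -> M) :
 sat v (clos N phi) <-> forall w, (forall j, (N <= j)%N -> w j = v j) -> sat w phi.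
elim: N phi v=> [|N IH] phi v /=.
 by split=> [h w e|];[rewrite (_ : w = v) //;apply: funext=> j;exact: e|apply].
rewrite IH;split=> h w e /=.
 have {}h : sat (update (fun j=> if j == N then v j else w j) N (w N)) phi.
 apply: h=> j;rewrite leq_eqVlt=> /orP[/eqP <-|hj];first by rewrite eqxx.
 case: eqP=> // _;exact: e.
 by move: h;congr sat;apply: funext=> j;rewrite /update;case: eqP=> [->|].
move=> a;apply: h=> j hj;rewrite /update;case: eqP=> [ej|_];first by rewrite ej ltnn in hj.
apply: e;exact: ltnW.
Qed.
End Syntax.
Lemma finite_set_list T (D : set T) : finite_set D -> exists l : list T, forall x, D x <-> List.In x l.
move=> fD;have [s hs] := (@finite_seqP {classic T} D).1 fD;exists s=> x.
rewrite hs /=;elim: s {hs}=> [|y s IH];first by split.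
rewrite inE;split=> [/orP[/eqP ->|/IH]|[->|/IH h]] //=;rewrite ?eqxx ?h ?orbT;[by left|by right|by []|by []].
Qed.

(** * Expressible predicates of models *)

Notation pst := pair_structure.
(** One formula must work in all structures at once; this uniformity is what allows a predicate to
    be carried along elementary and partial elementary maps. *)
Definition expr (P : forall (K : RF) (der : K -> K) (O k : set K), (nat -> K) -> Prop) :=
 exists phi : formula PS, forall (K : RF) der (O k : set K) v,
 @sat _ (pst der O k) v phi <-> P K der O k v.
Definition texpr (T : forall (K : RF) (der : K -> K), (nat -> K) -> K) :=
 exists t : term PS, forall (K : RF) der (O k : set K) v,
 @eval_term _ (pst der O k) v t = T K der v.
Definition args2 T (a b : T) : 'I_2 -> T := fun j=> if j == ord0 then a else b.

Section Expr.
Implicit Types T U : forall (K : RF) (der : K -> K), (nat -> K) -> K.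
Implicit Types P Q : forall (K : RF) (der : K -> K) (O k : set K), (nat -> K) -> Prop.
Lemma te_var i : texpr (fun _ _ v=> v i). by exists (@Var _ i). Qed.
Lemma te_0 : texpr (fun _ _ _=> 0). by exists (@App PS F_zero (fun=> @Var _ 0)). Qed.
Lemma te_1 : texpr (fun _ _ _=> 1). by exists (@App PS F_one (fun=> @Var _ 0)). Qed.
Lemma te_N T : texpr T -> texpr (fun K d v=> - T K d v).
by move=> [t h];exists (@App PS F_opp (fun=> t))=> K d O k v /=;rewrite h. Qed.
Lemma te_der T : texpr T -> texpr (fun K d v=> d (T K d v)).
by move=> [t h];exists (@App PS F_der (fun=> t))=> K d O k v /=;rewrite h. Qed.
Lemma te_D T U : texpr T -> texpr U -> texpr (fun K d v=> T K d v + U K d v).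
by move=> [t h] [u h'];exists (@App PS F_add (args2 t u))=> K d O k v /=;rewrite h h'. Qed.
Lemma te_M T U : texpr T -> texpr U -> texpr (fun K d v=> T K d v * U K d v).
by move=> [t h] [u h'];exists (@App PS F_mul (args2 t u))=> K d O k v /=;rewrite h h'. Qed.
Lemma te_B T U : texpr T -> texpr U -> texpr (fun K d v=> T K d v - U K d v).
move=> h h';apply: te_D=> //;exact: te_N. Qed.
Lemma te_ext T U : (forall K d v, T K d v = U K d v) -> texpr T -> texpr U.
by move=> e [t h];exists t=> K d O k v;rewrite h e. Qed.
Lemma te_iter n T : texpr T -> texpr (fun K d v=> iter n d (T K d v)).
elim: n=> //= n IH h;apply: te_der;exact: IH. Qed.
Lemma te_X n T : texpr T -> texpr (fun K d v=> T K d v ^+ n).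
move=> h;elim: n=> [|n IH];first by apply: te_ext te_1=> *;rewrite expr0.
by apply: te_ext (te_M h IH)=> *;rewrite exprS.
Qed.
Lemma te_Mn n T : texpr T -> texpr (fun K d v=> T K d v *+ n).
move=> h;elim: n=> [|n IH];first by apply: te_ext te_0=> *;rewrite mulr0n.
by apply: te_ext (te_D h IH)=> *;rewrite mulrS.
Qed.
Lemma te_sum (I : Type) (r : seq I) (T : I -> forall K : RF, (K -> K) -> (nat -> K) -> K) :
 (forall i, texpr (T i)) -> texpr (fun K d v=> \sum_(i <- r) T i K d v).
move=> h;elim: r=> [|i r IH];first by apply: te_ext te_0=> *;rewrite big_nil.
by apply: te_ext (te_D (h i) IH)=> *;rewrite big_cons.
Qed.
Lemma te_prod (I : Type) (r : seq I) (T : I -> forall K : RF, (K -> K) -> (nat -> K) -> K) :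
 (forall i, texpr (T i)) -> texpr (fun K d v=> \prod_(i <- r) T i K d v).
move=> h;elim: r=> [|i r IH];first by apply: te_ext te_1=> *;rewrite big_nil.
by apply: te_ext (te_M (h i) IH)=> *;rewrite big_cons.
Qed.
Lemma e_ext P Q : (forall K d O k v, P K d O k v <-> Q K d O k v) -> expr P -> expr Q.
by move=> e [t h];exists t=> K d O k v;rewrite h. Qed.
Lemma e_sat phi : expr (fun K d O k v=> @sat _ (pst d O k) v phi). by exists phi. Qed.
Lemma e_eq T U : texpr T -> texpr U -> expr (fun K d O k v=> T K d v = U K d v).
by move=> [t h] [u h'];exists (FEq t u)=> K d O k v /=;rewrite h h'. Qed.
Lemma e_le T U : texpr T -> texpr U -> expr (fun K d O k v=> T K d v <= U K d v).
by move=> [t h] [u h'];exists (@FRel PS R_le (args2 t u))=> K d O k v /=;rewrite h h'. Qed.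
Lemma e_dom T U : texpr T -> texpr U -> expr (fun K d O k v=> dominated O (T K d v) (U K d v)).
by move=> [t h] [u h'];exists (@FRel PS R_dom (args2 t u))=> K d O k v /=;rewrite h h'. Qed.
Lemma e_k T : texpr T -> expr (fun K d O k v=> k (T K d v)).
by move=> [t h];exists (@FRel PS R_lift (fun=> t))=> K d O k v /=;rewrite h. Qed.
Lemma e_false : expr (fun _ _ _ _ _=> False). by exists (@FFalse _). Qed.
Lemma e_imp P Q : expr P -> expr Q -> expr (fun K d O k v=> P K d O k v -> Q K d O k v).
by move=> [t h] [u h'];exists (FImp t u)=> K d O k v /=;rewrite h h'. Qed.
Lemma e_not P : expr P -> expr (fun K d O k v=> ~ P K d O k v).
move=> h;exact: e_imp h e_false. Qed.
Lemma e_and P Q : expr P -> expr Q -> expr (fun K d O k v=> P K d O k v /\ Q K d O k v).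
move=> h h';apply: e_ext (e_not (e_imp h (e_not h')))=> K d O k v;split=> [n|[p q] n];last exact: n.
by split;apply: contrapT=> m;apply: n.
Qed.
Lemma e_or P Q : expr P -> expr Q -> expr (fun K d O k v=> P K d O k v \/ Q K d O k v).
move=> h h';apply: e_ext (e_imp (e_not h) h')=> K d O k v;split=> [n|[p|q] n] //.
by case: (pselect (P K d O k v))=> p;[left|right;exact: n].
Qed.
Lemma e_iff P Q : expr P -> expr Q -> expr (fun K d O k v=> P K d O k v <-> Q K d O k v).
move=> h h';apply: e_and;exact: e_imp. Qed.
Lemma e_lt T U : texpr T -> texpr U -> expr (fun K d O k v=> T K d v < U K d v).
move=> h h';apply: e_ext (e_not (e_le h' h))=> K d O k v;rewrite ltNge;split=> [/negP//|].
by move/negP.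
Qed.
Lemma e_eqb T U : texpr T -> texpr U -> expr (fun K d O k v=> T K d v == U K d v).
by move=> h h';apply: e_ext (e_eq h h')=> K d O k v;split=> /eqP. Qed.
Lemma e_neq T U : texpr T -> texpr U -> expr (fun K d O k v=> T K d v != U K d v).
by move=> h h';apply: e_ext (e_not (e_eq h h'))=> K d O k v;split=> /eqP. Qed.
Lemma e_prop (A : Prop) : expr (fun _ _ _ _ _=> A).
case: (pselect A)=> a;last by apply: e_ext e_false=> *;split.
by apply: e_ext (e_not e_false)=> *;split=> // _ [].
Qed.
Lemma e_all (Q : forall (K : RF) (der : K -> K) (O k : set K), K -> (nat -> K) -> Prop) :
 expr (fun K d O k w=> Q K d O k (w 0) (fun j=> w j.+1)) ->
 expr (fun K d O k v=> forall a, Q K d O k a v).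
move=> [phi h];have [psi hp] := forall_scons phi;exists psi=> K d O k v.
by rewrite hp;split=> h' a;[have := (h _ _ _ _ _).1 (h' a)|apply/h;exact: h'].
Qed.
Lemma e_ex (Q : forall (K : RF) (der : K -> K) (O k : set K), K -> (nat -> K) -> Prop) :
 expr (fun K d O k w=> Q K d O k (w 0) (fun j=> w j.+1)) ->
 expr (fun K d O k v=> exists a, Q K d O k a v).
move=> h;apply: e_ext (e_not (e_all (Q := fun K d O k a v=> ~ Q K d O k a v) (e_not h))).
move=> K d O k v;split=> [n|[a ha] n];last exact: (n a).
by apply: contrapT=> m;apply: n=> a ha;apply: m;exists a.
Qed.
Lemma e_ex2 (P Q : forall (K : RF) (der : K -> K) (O k : set K), K -> (nat -> K) -> Prop) :
 expr (fun K d O k w=> P K d O k (w 0) (fun j=> w j.+1)) ->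
 expr (fun K d O k w=> Q K d O k (w 0) (fun j=> w j.+1)) ->
 expr (fun K d O k v=> exists2 a, P K d O k a v & Q K d O k a v).
move=> h h';apply: e_ext (e_ex (Q := fun K d O k a v=> P K d O k a v /\ Q K d O k a v) (e_and h h')).
by move=> K d O k v;split=> [[a [x y]]|[a x y]];exists a.
Qed.
Lemma e_ren P r : injective r -> expr P -> expr (fun K d O k v=> P K d O k (fun j=> v (r j))).
by move=> ri [phi h];exists (frn r phi)=> K d O k v;rewrite sat_frn // h. Qed.
Lemma e_all_seq (I : Type) (r : list I) (P : I -> forall (K : RF) (der : K -> K) (O k : set K), (nat -> K) -> Prop) :
 (forall i, expr (P i)) -> expr (fun K d O k v=> forall i, List.In i r -> P i K d O k v).
move=> h;elim: r=> [|i r IH].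
 by apply: e_ext (e_not e_false)=> *;split=> // _ [].
apply: e_ext (e_and (h i) IH)=> K d O k v;split=> [[a b] j [<-//|]|a];first exact: b.
by split=> [|j hj];apply: a;[left|right].
Qed.
Lemma e_all_fin (I : finType) (P : I -> forall (K : RF) (der : K -> K) (O k : set K), (nat -> K) -> Prop) :
 (forall i, expr (P i)) -> expr (fun K d O k v=> forall i, P i K d O k v).
move=> h;apply: e_ext (e_all_seq (enum I) h)=> K d O k v;split=> [a i|a i _] //;apply: a.
have : i \in enum I by rewrite mem_enum.
by elim: (enum I)=> //= j r IH;rewrite inE=> /orP[/eqP ->|/IH];[left|right].
Qed.
Lemma e_ex_fin (I : finType) (P : I -> forall (K : RF) (der : K -> K) (O k : set K), (nat -> K) -> Prop) :
 (forall i, expr (P i)) -> expr (fun K d O k v=> exists i, P i K d O k v).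
move=> h;apply: e_ext (e_not (e_all_fin (fun i=> e_not (h i))))=> K d O k v;split=> [n|[i hi] n].
 by apply: contrapT=> m;apply: n=> i hi;apply: m;exists i.
exact: n hi.
Qed.
Definition vcat n (K : Type) (s : 'I_n -> K) (v : nat -> K) : nat -> K :=
 fun j=> if insub j is Some i then s i else v (j - n)%N.
Lemma vcat_lt n (K : Type) (s : 'I_n -> K) v (i : 'I_n) : vcat s v i = s i.
by rewrite /vcat valK. Qed.
Lemma vcat_ge n (K : Type) (s : 'I_n -> K) v j : vcat s v (n + j) = v j.
by rewrite /vcat insubN ?ltnNge ?leq_addr //= addKn. Qed.
Lemma e_alln n P : expr P -> expr (fun K d O k v=> forall s : 'I_n -> K, P K d O k (vcat s v)).
elim: n P=> [|n IH] P h.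
 apply: e_ext h=> K d O k v;split=> [a s|/(_ (fun=> 0))];
 by rewrite (_ : vcat _ v = v) //;apply: funext=> j;rewrite /vcat insubN //= subn0.
have h1 : expr (fun K d O k v=> forall a, P K d O k (scons a v)).
 apply: (e_all (Q := fun K d O k a v=> P K d O k (scons a v))).
 by apply: e_ext h=> K d O k v;rewrite (_ : scons _ _ = v) //;apply: funext=> -[].
have cE (K : RF) a (s : 'I_n -> K) v : scons a (vcat s v) =
 vcat (fun i=> if unlift ord0 i is Some j then s j else a) v.
 apply: funext=> -[|j];rewrite /vcat /=.
 by case: insubP=> // i _ ei;rewrite (_ : i = ord0) ?unlift_none //;apply: val_inj.
 case: insubP=> [i lt ei|ge];case: insubP=> [i' lt' ei'|ge'] //.
 - by rewrite (_ : i' = lift ord0 i) ?liftK //;apply: val_inj;rewrite /= ei ei'.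
 - by rewrite ltnS lt in ge'.
 - by rewrite ltnS (negPf ge) in lt'.
apply: e_ext (IH _ h1)=> K d O k v;split=> hh s.
 have := hh (fun i=> s (lift ord0 i)) (s ord0);rewrite cE;congr (P K d O k (vcat _ v)).
 by apply: funext=> i;case: unliftP=> [j ->|->].
move=> a;rewrite cE;exact: hh.
Qed.
Lemma e_exn n P : expr P -> expr (fun K d O k v=> exists s : 'I_n -> K, P K d O k (vcat s v)).
move=> h;apply: e_ext (e_not (e_alln n (e_not h)))=> K d O k v;split=> [m|[s hs] m];last exact: m hs.
by apply: contrapT=> m';apply: m=> s hs;apply: m';exists s.
Qed.
End Expr.
Definition elem (K : RF) (der : K -> K) (O k : set K) (K' : RF)
 (der' : K' -> K') (O' k' : set K') (i : K -> K') :=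
 @elementary_embedding _ (pst der O k) (pst der' O' k') i.

Section Elem.
Variables (K : RF) (der : K -> K) (O k : set K) (K' : RF)
 (der' : K' -> K') (O' k' : set K') (i : K -> K').
Hypothesis hi : elem der O k der' O' k' i.
Lemma elem_expr P (v : nat -> K) : expr P -> P K der O k v <-> P K' der' O' k' (i \o v).
move=> [phi h];rewrite -!h;exact: hi. Qed.
(** The environment in the extension need not come from below, so validity is transferred as a
    sentence, the closure over the variables that occur. *)
Lemma elem_valid P : expr P -> (forall v, P K der O k v) -> forall v, P K' der' O' k' v.
move=> [phi h] hv v;have [N hN] := formula_bound phi.
have : @sat _ (pst der O k) (fun=> 0) (clos N phi) by apply/sat_clos=> w _;apply/h;exact: hv.
rewrite (hi _ (fun=> 0)) sat_clos=> /(_ (fun j=> if (j < N)%N then v j else i 0)) h'.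
apply/h;rewrite (hN (pst der' O' k') v (fun j=> if (j < N)%N then v j else i 0));last by move=> j ->.
by apply: h'=> j;rewrite ltnNge=> ->.
Qed.
Lemma elem_term T (v : nat -> K) : texpr T -> i (T K der v) = T K' der' (i \o v).
move=> hT;have h : expr (fun K d O k w=> T K d (fun j=> w j.+1) = w 0%N).
 apply: e_eq;last exact: te_var.
 have [t ht] := hT;exists (trn S t)=> K0 d O0 k0 w;by rewrite eval_trn ht.
by have := (elem_expr (scons (T K der v) v) h).1 erefl=> /= ->.
Qed.
End Elem.

Section Realize.
Variables (K : RF) (der : K -> K) (O k : set K).
Variables (X : Type) (A : set K).
Hypothesis hsat : @succ_card_saturated _ (pst der O k) X.
Hypothesis cA : (A #<= [set: X])%card.
Definition cond (C : K -> Prop) := exists P (v : nat -> K),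
 [/\ expr P, forall j, A (v j) & forall a, C a <-> P K der O k (scons a v)].
(** Saturation with semantic conditions in place of formulas. Finite satisfiability is stated on
    lists, so that it can be proved by induction. *)
Lemma realize (Cs : set (K -> Prop)) : (forall C, Cs C -> cond C) ->
 (forall l, (forall C, List.In C l -> Cs C) -> exists a, forall C, List.In C l -> C a) ->
 exists a, forall C, Cs C -> C a.
move=> hc hf.
pose p := [set q : formula PS * (nat -> K) | exists2 C, Cs C &
 (forall j, A (q.2 j)) /\ forall a, C a <-> @sat _ (pst der O k) (update (q.2 : nat -> pst der O k) 0 a) q.1].
have [|D fD Dp|a ha] := hsat (p := p) cA.
- by move=> q [C _ []].
- have [l hl] := finite_set_list fD.
 have [l' [h1 h2]] : exists l', (forall C, List.In C l' -> Cs C) /\ forall q, List.In q l -> exists2 C, List.In C l' &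
 forall a, C a <-> @sat _ (pst der O k) (update (q.2 : nat -> pst der O k) 0 a) q.1.
 have {}Dp q : List.In q l -> p q by move/hl/Dp.
 elim: l Dp {hl}=> [|q l IH] Dp;first by exists [::];split.
 have [|l' [h1 h2]] := IH;first by move=> q' h;apply: Dp;right.
 have [C hC [_ e]] := Dp q (or_introl erefl).
 exists (C :: l');split=> [C' [<-//|/h1//]|q' [<-|/h2[C' hC' e']]].
 by exists C=> //;left.
 by exists C'=> //;right.
 have [a ha] := hf l' h1;exists a=> q /hl/h2[C hC e];apply/e;exact: ha.
exists a=> C hC;have [P [v [[phi hphi] Av e]]] := hc C hC.
apply/e;apply/hphi;have := ha (phi, scons (v 0) v);rewrite /= (scons_update (M := pst der O k));apply.
exists C=> //;split=> [[|j]|b] //=;rewrite ?e ?(scons_update (M := pst der O k)) ?hphi //;exact: Av.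
Qed.
End Realize.
Lemma card_le_optP T X (A : set T) : (A #<= [set: X])%card <->
 exists h : X -> option T, forall a, A a -> exists y, h y = Some a.
split=> [/ocard_geP/surjPex[h hh]|[h hh]].
 by exists h=> a Aa;have [y _ <-] := hh (Some a) (ex_intro2 _ _ a Aa erefl);exists y.
apply/ocard_geP/surjPex;exists h=> _ [a Aa <-];have [y hy] := hh a Aa;by exists y.
Qed.
(** The new point takes the place of [g 0], and every [g n] moves on to [g n.+1]. *)
Lemma card_le_add T (X : Type) (A : set T) (x : T) (g : nat -> X) : injective g ->
 (A #<= [set: X])%card -> (A `|` [set x] #<= [set: X])%card.
move=> gi /card_le_optP[f hf];apply/card_le_optP.
pose idx y := if pselect (exists n, g n = y) is left h then Some (projT1 (cid h)) else None.
have idxK n : idx (g n) = Some n.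
 rewrite /idx;case: pselect=> [h|h];last by case: h;exists n.
 by case: cid=> m /= /gi ->.
have idxE y n : idx y = Some n -> y = g n.
 by rewrite /idx;case: pselect=> // h;case: cid=> m /= <- [->].
exists (fun y=> match idx y with Some 0%N=> Some x | Some n.+1=> f (g n) | None=> f y end).
move=> a [/hf[y hy]|->];last by exists (g 0%N);rewrite idxK.
case e : (idx y)=> [n|];last by exists y;rewrite e.
by exists (g n.+1);rewrite idxK -(idxE _ _ e).
Qed.
Lemma card_le_image T U X (A : set T) (f : T -> U) : (A #<= [set: X])%card ->
 ([set f a | a in A] #<= [set: X])%card.
move=> /card_le_optP[h hh];apply/card_le_optP;exists (fun y=> omap f (h y))=> _ [a Aa <-].
by have [y hy] := hh a Aa;exists y;rewrite hy.
Qed.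

(** * Partial elementary maps *)

(* With [b = true] all quantifiers are relativized to the lift of the residue field. *)
Fixpoint relf (b : bool) (phi : formula PS) : formula PS :=
 match phi with
 | FFalse=> @FFalse _
 | FEq t u=> FEq t u
 | FRel R ts=> @FRel PS R ts
 | FImp p q=> FImp (relf b p) (relf b q)
 | FAll i p=> if b then FAll i (FImp (@FRel PS R_lift (fun=> @Var _ i)) (relf b p))
 else FAll i (relf b p)
 end.
Lemma relf_false phi : relf false phi = phi.
by elim: phi=> //= [p -> q ->|i p ->]. Qed.
Lemma relf_frn b r phi : relf b (frn r phi) = frn r (relf b phi).
by elim: phi=> //= [p -> q ->|i p ->] //;case: b. Qed.
Lemma sat_relf_all (K : RF) der (O k : set K) b i phi v :
 @sat _ (pst der O k) v (relf b (FAll i phi)) <->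
 forall x : K, (b -> k x) -> @sat _ (pst der O k) (update (v : nat -> pst der O k) i x) (relf b phi).
case: b=> /=;last by split=> h x;[move=> _|];exact: h.
split=> h x;have := h x;rewrite /= /update eqxx=> h' h1;apply: h'=> //;exact: h1.
Qed.

Section PartialMaps.
Variables (K : RF) (der : K -> K) (O k : set K) (K' : RF)
 (der' : K' -> K') (O' k' : set K').
Variable b : bool.
Notation M := (pst der O k).
Notation N := (pst der' O' k').
Definition pmap (H : set (K * K')) := forall phi (v : nat -> K * K'), (forall j, H (v j)) ->
 @sat _ M (fst \o v) (relf b phi) <-> @sat _ N (snd \o v) (relf b phi).
Definition FAnd (p q : formula PS) := FImp (FImp p (FImp q (@FFalse _))) (@FFalse _).
Lemma sat_FAnd (Q : structure PS) (v : nat -> Q) p q : sat v (FAnd p q) <-> sat v p /\ sat v q.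
by split=> /= [h|[h h'] n];[split;apply: contrapT=> n;apply: h|exact: n]. Qed.
(** Conjunction of formulas with different parameters: the parameters are interleaved on odd and
    even variables, while variable 0 remains common. *)
Lemma merge_formulas (H : set (K * K')) h0 (l : list (formula PS * (nat -> K * K'))) : H h0 ->
 (forall q, List.In q l -> forall j, H (q.2 j)) ->
 exists phi v, (forall j, H (v j)) /\
 forall (R : RF) d (o c : set R) (f : K * K' -> R) a,
 @sat _ (pst d o c) (update (f \o v : nat -> pst d o c) 0 a) (relf b phi) <->
 forall q, List.In q l -> @sat _ (pst d o c) (update (f \o q.2 : nat -> pst d o c) 0 a) (relf b q.1).
move=> Hh0;elim: l=> [|[phi1 v1] l IH] hl.
 by exists (FImp (@FFalse _) (@FFalse _)), (fun=> h0);split=> //= R d o c f a;split.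
have [|phi2 [v2 [Hv2 h2]]] := IH;first by move=> q hq;apply: hl;right.
have Hv1 := hl _ (or_introl erefl).
pose r1 j := if j is j'.+1 then j'.*2.+1 else 0%N.
pose r2 j := if j is j'.+1 then j'.*2.+2 else 0%N.
have r1i : injective r1 by move=> [|i] [|j] //= [] /double_inj ->.
have r2i : injective r2 by move=> [|i] [|j] //= [] /double_inj ->.
pose v n := if n is n'.+1 then (if odd n then v1 n'./2.+1 else v2 n'./2.+1) else h0.
exists (FAnd (frn r1 phi1) (frn r2 phi2)), v;split.
 by case=> [//|n];rewrite /v;case: ifP=> _;[exact: Hv1|exact: Hv2].
move=> R d o c f a;rewrite [relf _ _]/= -/(FAnd _ _) sat_FAnd !relf_frn !sat_frn //.
have -> : update (f \o v : nat -> pst d o c) 0 a \o r1 = update (f \o v1 : nat -> pst d o c) 0 a.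
 by apply: funext=> -[|j] //;rewrite /update /v /= odd_double /= doubleK.
have -> : update (f \o v : nat -> pst d o c) 0 a \o r2 = update (f \o v2 : nat -> pst d o c) 0 a.
 by apply: funext=> -[|j] //;rewrite /update /v /= odd_double /= uphalf_double.
rewrite h2;split=> [[p q] q' [<-//|/q//]|h];split;first exact: h (or_introl erefl).
by move=> q hq;apply: h;right.
Qed.

(** Substitutes variable 0 for each variable n'+1 marked by [t], expressed by a quantifier and an
    equation. The relativized quantifier is correct as soon as the value of variable 0 lies in
    [k]. *)
Fixpoint sb (t : nat -> bool) n (phi : formula PS) :=
 if n is n'.+1 then
 sb t n' (if t n' then FAll n'.+1 (FImp (FEq (@Var _ n'.+1) (@Var _ 0)) phi) else phi)
 else phi.
Lemma sat_sb (R : RF) d (o c : set R) t n phi (w : nat -> pst d o c) : (b -> c (w 0%N)) ->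
 sat w (relf b (sb t n phi)) <->
 sat (fun j=> if j is j'.+1 then (if (j' < n)%N && t j' then w 0%N else w j) else w 0%N) (relf b phi).
move=> cw;elim: n phi=> [|n IH] phi /=.
 by rewrite (_ : (fun j=> _) = w) //;apply: funext=> -[].
rewrite IH;case tn : (t n);last first.
 rewrite (_ : (fun j=> _) = (fun j=> if j is j'.+1 then (if (j' < n)%N && t j' then w 0%N else w j) else w 0%N)) //.
 by apply: funext=> -[|j] //;rewrite ltnS leq_eqVlt;case: eqP=> [->|] //=;rewrite tn ltnn.
set e := (fun j=> _);set e' := (fun j=> _).
have ee : @update _ (pst d o c) e n.+1 (w 0%N) = e'.
 apply: funext=> -[|j] //;rewrite /update /e /e' eqSS.
 have [->|ne] := eqVneq j n;first by rewrite ltnSn tn.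
 by rewrite [(j < n.+1)%N]ltnS [in RHS]leq_eqVlt (negPf ne).
rewrite sat_relf_all;split=> [h|h x hx];last first.
 move=> ex;have ex' : x = w 0%N by move: ex;rewrite /= /update eqxx.
 by rewrite ex' ee.
by have := h (w 0%N) cw;rewrite ee /=;apply;rewrite /e' ltnSn tn.
Qed.
(** One step of back and forth: realize over the old images the type of [c]. Each finite part is an
    existential statement about old points, which the map preserves. *)
Lemma pmap_ext (X : Type) (H : set (K * K')) h0 c :
 @succ_card_saturated _ N X -> (snd @` H #<= [set: X])%card -> H h0 -> pmap H -> (b -> k c) ->
 exists2 c', (b -> k' c') & pmap (H `|` [set (c, c')]).
move=> hs cH Hh0 pH kc.
pose p := [set q : formula PS * (nat -> K') | exists phi v,
 [/\ forall j, H (v j), @sat _ M (update (fst \o v : nat -> M) 0 c) (relf b phi)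
 & q = (relf b phi, snd \o v)]].
have [|D fD Dp|c' hc'] := hs _ p cH.
- by move=> q [phi [v [Hv _ ->]]] j /=;exists (v j).
- have [l hl] := finite_set_list fD.
 have [l' [h1 h1' h2]] : exists l' : list (formula PS * (nat -> K * K')),
 [/\ forall q, List.In q l' -> forall j, H (q.2 j),
 forall q, List.In q l' -> @sat _ M (update (fst \o q.2 : nat -> M) 0 c) (relf b q.1)
 & forall q, List.In q l -> exists2 q', List.In q' l' & q = (relf b q'.1, snd \o q'.2)].
 have {}Dp q : List.In q l -> p q by move/hl/Dp.
 elim: l Dp {hl}=> [|q l IH] Dp;first by exists [::];split.
 have [|l' [h1 h1' h2]] := IH;first by move=> q' h;apply: Dp;right.
 have [phi [v [Hv hv e]]] := Dp q (or_introl erefl).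
 exists ((phi, v) :: l');split=> [q' [<-//|/h1//]|q' [<-//|/h1'//]|q' [<-|/h2[q1 i1 e1]]].
 by exists (phi, v)=> //;left.
 by exists q1=> //;right.
 have [phi [v [Hv hv]]] := merge_formulas Hh0 h1.
 have : ~ @sat _ M (fst \o v) (relf b (FAll 0 (FImp phi (@FFalse _)))).
 rewrite sat_relf_all=> /(_ c kc) /=;apply;apply/hv=> q hq;exact: h1'.
 rewrite pH // sat_relf_all=> n;apply: contrapT=> n';apply: n=> x hx /= hphi;apply: n'.
 by exists x=> q /hl/h2[q' hq' ->] /=;apply: (hv _ _ _ _ snd x).1 hq'.
exists c'.
 move=> bt;have := hc' (relf b (@FRel PS R_lift (fun=> @Var _ 0)), snd \o (fun=> h0)).
 rewrite /= /update /=;apply;exists (@FRel PS R_lift (fun=> @Var _ 0)), (fun=> h0).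
 split=> //=;rewrite /update /=;exact: kc.
move=> phi v Hv.
have kc' : b -> k' c'.
 move=> bt;have := hc' (relf b (@FRel PS R_lift (fun=> @Var _ 0)), snd \o (fun=> h0)).
 rewrite /= /update /=;apply;exists (@FRel PS R_lift (fun=> @Var _ 0)), (fun=> h0).
 split=> //=;rewrite /update /=;exact: kc.
(* A formula of the type mentions the new point only as variable 0, whereas here it may be the value
   of many variables. These are marked, replaced by the old point [h0], and reconnected by [sb]. *)
pose t j := `[< v j = (c, c') >];have [n hn] := formula_bound (relf b phi).
pose u j := if t j then h0 else v j.
have Hu j : H (u j) by rewrite /u /t;case: asboolP=> // ne;case: (Hv j).
have key (R : RF) d (o cc : set R) (f : K * K' -> R) : (b -> cc (f (c, c'))) ->
 @sat _ (pst d o cc) (scons (f (c, c')) (f \o u)) (relf b (sb t n (frn S phi))) <->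
 @sat _ (pst d o cc) (f \o v) (relf b phi).
 move=> hcc;rewrite sat_sb // relf_frn sat_frn;last by move=> i j [].
 apply: hn=> j jn /=;rewrite jn /= /u /t;by case: asboolP=> //= ->.
have kM := key _ der O k fst kc;have kN := key _ der' O' k' snd kc'.
rewrite -kM -kN /=.
pose psi := sb t n (frn S phi).
have e1 : scons c (fst \o u) = @update _ M (fst \o scons h0 u) 0 c by apply: funext=> -[].
have e2 : scons c' (snd \o u) = @update _ N (snd \o scons h0 u) 0 c' by apply: funext=> -[].
have Hs j : H (scons h0 u j) by case: j=> [|j] //=.
rewrite e1 e2 -/psi;split=> h.
 by apply: (hc' (relf b psi, snd \o scons h0 u));exists psi, (scons h0 u).
apply: contrapT=> nh.
have := hc' (relf b (FImp psi (@FFalse _)), snd \o scons h0 u);apply=> //.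
by exists (FImp psi (@FFalse _)), (scons h0 u).
Qed.
End PartialMaps.

(** * Differential polynomials as ordinary polynomials *)
Definition mdep (K : fieldType) (F : set K) p (u : 'I_p -> K) :=
 exists R : {mpoly K[p]}, [/\ forall m, F R@_m, R != 0 & R.@[u] = 0].

Section DPoly.
Variables (K : fieldType) (der : K -> K) (d : nat).
Import monalg.
Let I : choiceType := ('I_d * nat)%type.

Section Index.
Variables (p : nat) (s : 'I_p -> I).
Hypothesis si : injective s.
Definition cm (m : multinom p) : {cmonom I} :=
 \big[mulcm (I:=I)/onecm I]_(i < p) iter (m i) (mulcm (I:=I) (ucm (s i))) (onecm I).
Let cmE0 m u : cm m u = (\sum_i m i * (s i == u))%N.
rewrite /cm;elim/big_rec2: _=> [|i x y _ <-];first by rewrite onecmE.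
rewrite mulcmE;congr (_ + _)%N;elim: (m i)=> [|n IH];first by rewrite onecmE.
by rewrite iterS mulcmE ucmE IH mulSn.
Qed.
Lemma cm_in m i : cm m (s i) = m i.
rewrite cmE0 (bigD1 i) //= eqxx muln1 big1 ?addn0 // => j ne.
by rewrite (inj_eq si) (negPf ne) muln0.
Qed.
Lemma cm_out m u : (forall i, s i <> u) -> cm m u = 0%N.
by move=> h;rewrite cmE0 big1 // => i _;case: eqP=> [/h|_];rewrite ?muln0. Qed.
Lemma cm_inj : injective cm.
by move=> m m' e;apply/mnmP=> i;rewrite -!cm_in e. Qed.
Lemma cm_val (f : I -> K) m :
 \prod_(u <- finsupp (cmonom_val (cm m))) f u ^+ cm m u = \prod_i f (s i) ^+ m i.
have pe : perm_eq (finsupp (cmonom_val (cm m))) [seq s i | i <- enum 'I_p & m i != 0%N].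
 apply: uniq_perm=> [||u];first exact: fset_uniq.
 rewrite map_inj_uniq //;apply: filter_uniq;exact: enum_uniq.
 rewrite mem_finsupp;apply/idP/mapP=> [h|[i]].
 have [i ei] : exists i, s i = u.
 by apply: contrapT=> n;case/negP: h;apply/eqP;apply: cm_out=> i e;apply: n;exists i.
 by exists i=> //;rewrite mem_filter mem_enum andbT -cm_in ei.
 by rewrite mem_filter=> /andP[h _] ->;rewrite cm_in.
rewrite (perm_big _ pe) big_map big_filter big_enum_cond /= big_mkcond /=.
by apply: eq_bigr=> i _;rewrite cm_in;case: eqP=> //= ->;rewrite expr0.
Qed.
Lemma cm0 : cm (@mpoly.mnm0 p) = onecm I.
by apply/eqP/cmP=> u;rewrite onecmE cmE0 big1 // => i _;rewrite mnm0E.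
Qed.
Lemma cmU1 i : cm (mpoly.mnm1 i) = ucm (s i).
apply/eqP/cmP=> u;rewrite ucmE;case: (pselect (exists j, s j = u))=> [[j <-]|n].
 by rewrite cm_in mnm1E (inj_eq si).
rewrite cm_out=> [|j e];last by apply: n;exists j.
by case: eqP=> // e;case: n;exists i.
Qed.
(** The link between ordinary polynomials in finitely many chosen derivatives and the differential
    polynomials of the definitions; [s] tells which derivative a variable stands for. *)
Definition toD (R : mpoly.mpoly p K) : dpoly K d :=
 \sum_(m <- mpoly.msupp R) << mpoly.mcoeff m R *g cm m >>.
Lemma toD_coef R m : (toD R)@_(cm m) = mpoly.mcoeff m R.
rewrite raddf_sum /=;under eq_bigr do rewrite mcoeffU (inj_eq cm_inj).
have [h|h] := boolP (m \in mpoly.msupp R).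
 rewrite (bigD1_seq m) ?mpoly.msupp_uniq //= eqxx big1_seq ?addr0 // => m' /andP[/negPf -> _].
 by rewrite mulr0n.
rewrite big1_seq=> [|m' /andP[_ h']];first by rewrite (mpoly.memN_msupp_eq0 h).
by case: eqP=> [e|//];rewrite -e h' in h.
Qed.
Lemma toD_out R c : (forall m, cm m <> c) -> (toD R)@_c = 0.
move=> h;rewrite raddf_sum big1 // => m _ /=;rewrite mcoeffU;case: eqP=> // e.
by case: (h m).
Qed.
Lemma toD_over (F : set K) R : F 0 -> dpoly_over F (toD R) <-> forall m, F (mpoly.mcoeff m R).
move=> F0;split=> h m;first by have := h (cm m);rewrite toD_coef.
case: (pselect (exists m', cm m' = m))=> [[m' <-]|n];first by rewrite toD_coef.
by rewrite toD_out // => m' e;apply: n;exists m'.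
Qed.
Lemma toD_eq0 R : (toD R == 0) = (R == 0).
apply/eqP/eqP=> [h|->];last by rewrite /toD mpoly.msupp0 big_nil.
by apply/mpoly.mpolyP=> m;rewrite -toD_coef h mcoeff0 mpoly.mcoeff0.
Qed.
Lemma toD_eval R y : dpoly_eval der (toD R) y = mpoly.meval (fun i=> iter (s i).2 der (y (s i).1)) R.
pose f (u : I) := iter u.2 der (y u.1).
pose h (c : {cmonom I}) := \prod_(u <- finsupp (cmonom_val c)) f u ^+ c u.
have -> : dpoly_eval der (toD R) y = mmap idfun h (toD R) by [].
rewrite /toD raddf_sum mpoly.mevalE /=;apply: eq_bigr=> m _.
by rewrite mmapU /= /h cm_val.
Qed.
End Index.
(** The variables are the finitely many indeterminates that occur in [P], listed without
    repetition. *)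
Lemma fromD (P : dpoly K d) : exists p (s : 'I_p -> I) (R : mpoly.mpoly p K), injective s /\ P = toD s R.
pose D := undup (flatten [seq enum_fset (finsupp (cmonom_val c)) | c <- enum_fset (msupp P)]).
pose s (i : 'I_(size D)) := tnth (in_tuple D) i.
have si : injective s by apply/tuple_uniqP;exact: undup_uniq.
pose mc (c : {cmonom I}) : multinom (size D) := [multinom c (s i) | i < size D].
pose R : mpoly.mpoly (size D) K := \sum_(c <- msupp P) (mcoeff c P *: mpoly.mpolyX K (mc c)).
have cmc c : c \in msupp P -> cm s (mc c) = c.
 move=> hc;apply/eqP/cmP=> u;case: (pselect (exists i, s i = u))=> [[i <-]|n].
 by rewrite cm_in // mnmE.
 rewrite cm_out;last by move=> i e;apply: n;exists i.
 apply/esym/eqP;apply: contrapT=> /negP nz;apply: n.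
 have uD : u \in D.
 rewrite mem_undup;apply/flattenP;exists (enum_fset (finsupp (cmonom_val c))).
 by apply/mapP;exists c.
 by rewrite mem_finsupp.
 by have /tnthP[i ->] : u \in in_tuple D by [];exists i.
have Rc m : mpoly.mcoeff m R = P@_(cm s m).
 rewrite (raddf_sum (mpoly.mcoeff m)) /=;under eq_bigr do rewrite mpoly.mcoeffZ mpoly.mcoeffX.
 have [h|h] := boolP (cm s m \in msupp P).
 rewrite (bigD1_seq (cm s m)) ?fset_uniq //= (cm_inj si (cmc _ h)) eqxx mulr1.
 rewrite big1_seq ?addr0 // => c /andP[ne hc];case: eqP=> [e|_];last by rewrite mulr0.
 by case/eqP: ne;rewrite -e cmc.
 rewrite big1_seq ?mcoeff_outdom // => c /andP[_ hc];case: eqP=> [e|_];last by rewrite mulr0.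
 by case/negP: h;rewrite -e cmc.
exists (size D), s, R;split=> //;apply/malgP=> c.
case: (pselect (exists m, cm s m = c))=> [[m <-]|n];first by rewrite toD_coef // Rc.
rewrite toD_out;last by move=> m e;apply: n;exists m.
apply: mcoeff_outdom;apply/negP=> h;apply: n;exists (mc c);exact: cmc.
Qed.
Lemma d_indepP (F : set K) (b : 'I_d -> K) : F 0 -> d_alg_independent der F b <->
 forall p (s : 'I_p -> 'I_d * nat), injective s -> ~ mdep F (fun i=> iter (s i).2 der (b (s i).1)).
move=> F0;split=> [h p s si [R [FR R0 ev]]|h P FP ev].
 by case/eqP: R0;apply/eqP;rewrite -(toD_eq0 si);apply/eqP;apply: h;[exact/toD_over|rewrite toD_eval].
have [p [s [R [si e]]]] := fromD P;apply/eqP;apply: contrapT=> /negP nz;apply: (h p s si).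
by exists R;rewrite e toD_eq0 // in nz;split=> //;[apply/(toD_over si)=> //;rewrite -e|rewrite -toD_eval // -e].
Qed.
End DPoly.
Lemma d_algP (K : fieldType) der (F : set K) a : F 0 -> d_algebraic der F a <->
 exists p (s : 'I_p -> 'I_1 * nat), injective s /\ mdep F (fun i=> iter (s i).2 der a).
move=> F0;split=> [[P [FP P0 ev]]|[p [s [si [R [FR R0 ev]]]]]].
 have [p [s [R [si e]]]] := fromD P;exists p, s;split=> //;exists R.
 rewrite e toD_eq0 // in P0;split=> //;first by apply/(toD_over si)=> //;rewrite -e.
 by rewrite -(toD_eval der si R (fun=> a)) -e.
by exists (toD s R);split;[exact/toD_over|rewrite toD_eq0|rewrite toD_eval].
Qed.

(** * From the hypotheses to tameness *)

Section Tameness.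
Variables (K : RF) (der : K -> K) (O k : set K).
Hypothesis hpreH : pre_H_field der O.
Hypothesis hdhens : d_henselian der O.
Hypothesis hLiouville : liouville_closed der.
Hypothesis hproper : O <> [set: K].
Hypothesis hlift : residue_lift der O k.
Notation "x <=: y" := (dominated O x y).
Notation "x <: y" := (~ dominated O y x).
Let hd : derivation der. by case: hpreH. Qed.
Let hO : valuation_ring O. by case: hpreH. Qed.
Let hc : convex_ring O. by case: hpreH. Qed.
Let sdomE x y : sdominated O x y <-> x <: y.
split=> [[]//|h];split=> //;exact: dltW. Qed.
Let DH1 n (R : {mpoly K[n]}) : (forall m, O R@_m) ->
 (exists i, 1 <=: R@_U_(i)) -> R@_0 <: 1 ->
 exists2 y, y <: 1 & R.@[fun i=> iter i der y] = 0.
move=> OR [i hi] h0;case: hdhens=> _ _ dh.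
pose s (j : 'I_n) : 'I_1 * nat := (ord0, j : nat).
have si : injective s by move=> a b [] /val_inj.
have [|||y /sdomE hy ev] := dh (toD s R).
- apply/toD_over=> //;exact: O0.
- by rewrite -(cm0 s) toD_coef //;apply/sdomE.
- exists (monalg.ucm (s i));first by rewrite monalg.mdegU.
 by rewrite -(cmU1 si) toD_coef //;split=> //;apply/dle1.
by exists y=> //;rewrite -ev toD_eval.
Qed.
(** Linear surjectivity of the residue field solves the linear part up to an infinitesimal. After
    translation by this approximate solution [y] the constant term is small and [DH1] finishes. *)
Let DH2 n (R : {mpoly K[n]}) : (forall m, O R@_m) ->
 (forall m, (1 < mdeg m)%N -> R@_m <: 1) ->
 (exists i, 1 <=: R@_U_(i)) ->
 exists2 y, O y & R.@[fun i=> iter i der y] = 0.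
case: n R=> [|n] R OR h2 [i hi];first by case: i hi.
case: hdhens=> sm ls _.
have [|||y Oy hy] := ls n (fun j=> R@_U_(j)) (- R@_0).
- by move=> j.
- by exists i=> /sdomE;apply.
- exact: ON.
(* If the derivative of a bounded [x] were infinite, let g be its inverse. The pre-d-valued axiom
   gives [der x] strictly below [der g / g], that is, [der g] infinite, although g is
   infinitesimal. *)
have Oder x : O x -> O (der x).
 move=> Ox;have [_ _ pd _ _] := hpreH;case: (pselect (1 <=: x))=> x1;last first.
 by apply/dle1;apply: dltW=> //;apply/sdomE;apply: sm;apply/sdomE.
 apply: contrapT=> nO;have l1 : 1 <: der x by move=> /dle1.
 have d0 : der x != 0 by apply: contra_notN nO=> /eqP ->;exact: O0.
 have e1 : (der x)^-1 <: 1 by rewrite -invr1;apply: dltV=> //;exact: oner_neq0.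
 have := pd x (der x)^-1 ((dle1 _ _).2 Ox) (invr_neq0 d0) ((sdomE _ _).2 e1)=> /sdomE.
 have [_ s2] := sm _ ((sdomE _ _).2 e1);move=> l2;apply: l2.
 rewrite invrK;apply: dle_trans (_ : 1 * der x <=: _)=> //;last by rewrite mul1r;exact: dle_refl.
 apply: dleMr=> //;exact: (dltW hO).
have Oit j x : O x -> O (iter j der x) by move=> h;elim: j=> //= j;exact: Oder.
pose q := [tuple (iter i der y)%:MP + 'X_i : {mpoly K[n.+1]} | i < n.+1].
have Oq j m : O (tnth q j)@_m.
 rewrite tnth_mktuple mcoeffD mcoeffC mcoeffX;apply: OD=> //;last by case: eqP=> _;[exact: O1|exact: O0].
 by apply: OM=> //;[exact: Oit|case: eqP=> _;[exact: O1|exact: O0]].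
pose R1 : {mpoly K[n.+1]} := (R@_0)%:MP + \sum_j R@_U_(j) *: 'X_j.
pose R2 := R - R1.
have R2s m : R2@_m <: 1.
 have n01 j : (U_(j)%MM == 0%MM :> 'X_{1..n.+1}) = false by apply/negbTE;rewrite -mdeg_eq0 mdeg1.
 have z1 : (0 : K) <: 1 by apply: dlt0x;exact: oner_neq0.
 rewrite mcoeffB mcoeffD mcoeffC (raddf_sum (mcoeff m)) /=;under eq_bigr do rewrite mcoeffZ mcoeffX.
 case e : (mdeg m)=> [|[|dd]].
 - have -> : m = 0%MM by apply/eqP;rewrite -mdeg_eq0 e.
 rewrite eqxx mulr1 big1 ?addr0 ?subrr // => j _;by rewrite n01 mulr0.
 - move/eqP/mdeg1P: (e)=> [j /eqP ->];rewrite n01 mulr0 add0r (bigD1 j) //= eqxx mulr1 big1 ?addr0 ?subrr //.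
 by move=> l ne;rewrite mnm1_eq (negPf ne) mulr0.
 - have -> : (m == 0%MM) = false by apply/negbTE;rewrite -mdeg_eq0 e.
 rewrite mulr0 add0r big1 ?subr0;first by apply: h2;rewrite e.
 by move=> j _;case: eqP=> [ej|_];rewrite ?mulr0 //;rewrite -ej mdeg1 in e.
have Rq m : (R \mPo q)@_m = (R1 \mPo q)@_m + (R2 \mPo q)@_m by rewrite -mcoeffD -raddfD /= addrC subrK.
have R2q m : (R2 \mPo q)@_m <: 1 by apply: mcoeff_comp_lt=> //;exact: oner_neq0.
have R1q : R1 \mPo q = (R@_0 + \sum_j R@_U_(j) * iter j der y)%:MP + \sum_j R@_U_(j) *: 'X_j.
 rewrite raddfD /= comp_mpolyC (raddf_sum (comp_mpoly q)) /= mpolyCD -addrA;congr (_ + _).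
 rewrite (raddf_sum (@mpolyC _ _)) -big_split /=;apply: eq_bigr=> j _.
 by rewrite comp_mpolyZ comp_mpolyXU -tnth_nth tnth_mktuple scalerDr mpolyCM mul_mpolyC.
have [|||z hz ev] := @DH1 n.+1 (R \mPo q).
- move=> m;apply/dle1;apply: mcoeff_comp_le=> // m';exact/dle1.
- exists i;rewrite Rq R1q mcoeffD mcoeffC (raddf_sum (mcoeff _)) /=.
 have -> : (U_(i)%MM == 0%MM :> 'X_{1..n.+1}) = false by apply/negbTE;rewrite -mdeg_eq0 mdeg1.
 rewrite mulr0 add0r (bigD1 i) //= mcoeffZ mcoeffX eqxx mulr1 big1 ?addr0;last first.
 by move=> l ne;rewrite mcoeffZ mcoeffX mnm1_eq (negPf ne) mulr0.
 by apply: (dle_trans hO hi);apply: dle_addr=> //;apply: (dlt_le_trans hO) hi.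
- rewrite Rq R1q mcoeffD mcoeffC eqxx mulr1 (raddf_sum (mcoeff _)) /= [X in _ + X + _]big1 ?addr0.
 by apply: dltD=> //;move/sdomE: hy;rewrite opprK addrC.
 by move=> j _;rewrite mcoeffZ mcoeffX -mdeg_eq0 mdeg1 mulr0.
exists (y + z);first by apply: OD=> //;apply/dle1;exact: dltW.
move: ev;rewrite comp_mpoly_meval=> <-;congr meval;apply: funext=> j.
by rewrite tnth_mktuple mevalD mevalC mevalXU iter_derD.
Qed.
Lemma tame_of_hypotheses : tame der O k.
have [[kf kder] kO [kfun kinj ksurj]] := hlift;have [k1 kB kdv] := kf.
have [_ _ pd _ hH] := hpreH;have [sm ls _] := hdhens;have [rc _ lexp] := hLiouville.
have lift x : O x -> exists2 c, k c & x - c <: 1.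
 move=> Ox;have [c kc ec] := ksurj (residue_class O x) (ex_intro2 _ _ x Ox erefl).
 exists c=> //;apply/sdomE;have : residue_class O x x.
 apply/sdomE;rewrite subrr;apply: dlt0x;exact: oner_neq0.
 by rewrite -ec.
have cls0 c : c <: 1 -> residue_class O c = residue_class O 0.
 move=> hc1;apply/seteqP;split=> x /sdomE hx;apply/sdomE;last by apply: dltB=> //;rewrite -(subr0 x).
 by rewrite subr0 -(subrK c x);apply: dltD.
have k0' c : k c -> c <: 1 -> c = 0.
 move=> kc hc1;apply: kinj;rewrite ?inE //;first by rewrite -(subrr 1);exact: (kB).
 exact: cls0.
have kN' c : k c -> k (- c) by move=> kc;rewrite -sub0r;apply: (kB)=> //;rewrite -(subrr 1);exact: (kB).
have kM' a b : k a -> k b -> k (a * b).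
 move=> ka kb;rewrite -[b]invrK;apply: (kdv)=> //;rewrite -div1r;exact: (kdv).
(* Linear surjectivity for the equation Y' = 1 gives a solution up to an infinitesimal. For its
   representative in [k] the equation is exact, since 0 is the only infinitesimal of [k]. *)
have [x kx dx] : exists2 x, k x & der x = 1.
 have [|||y Oy hy] := ls 1%N (fun j=> if j == ord0 then 0 else 1) 1.
 - by move=> j;case: ifP=> _;[exact: O0|exact: O1].
 - exists ord_max=> /sdomE;apply;exact: dle_refl.
 - exact: O1.
 move: hy;rewrite !big_ord_recl big_ord0 /= mul0r add0r addr0 mul1r=> /sdomE hy.
 have [c kc hyc] := lift y Oy;exists c=> //;apply/eqP;rewrite -subr_eq0;apply/eqP/k0'.
 apply: (kB)=> //;exact: kder.
 have -> : der c - 1 = (der y - 1) - der (y - c) by rewrite derB //;ring.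
 by apply: dltB=> //;apply/sdomE;apply: sm;apply/sdomE.
split=> //.
- by move=> f /sdomE/sm/sdomE.
- move=> a ka;rewrite -div1r;exact: kdv.
- by exists x.
- apply: contrapT=> n;apply: hproper;apply/seteqP;split=> // a _;apply: contrapT=> na;apply: n.
 have a0 : a != 0 by apply: contra_notN na=> /eqP ->;exact: O0.
 exists a^-1;first by rewrite invr_neq0.
 by rewrite -invr1;apply: dltV=> //;[exact: oner_neq0|move/dle1].
- move=> e n e0;have [||y /andP[y0 _] ry] := rc ('X^(n.+1) - e%:P) 0 (1 + e).
 + by rewrite addr_ge0 // ltW.
 + rewrite !hornerE expr0n /= sub0r oppr_le0 ltW //= subr_ge0 exprS.
 have e1 : 0 <= 1 + e by rewrite addr_ge0 // ltW.
 apply: (le_trans (y := 1 + e));first by rewrite lerDr ler01.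
 by rewrite ler_peMr // exprn_ege1 // lerDl ltW.
 exists y;last by move: ry;rewrite rootE !hornerE subr_eq0=> /eqP.
 rewrite lt_neqAle y0 andbT eq_sym;apply: contraTneq ry=> ->.
 by rewrite rootE !hornerE expr0n /= sub0r oppr_eq0 gt_eqF.
- by move=> a;have [z z0 <-] := lexp a;exists z=> //;rewrite divfK.
(* As [x] has derivative 1, the axiom says that 1 is strictly below [der g / g]. *)
- move=> g g0 g1;have := pd x g ((dle1 _ _).2 (kO _ kx)) g0 ((sdomE _ _).2 g1).
 by rewrite dx=> /sdomE.
- move=> n R OR _ hi h0;exact: DH1.
Qed.
End Tameness.

(** * Models of the theory are again ordered valued differential fields *)

Record rf_data := RfData {
 rf_car : Type;
 rf_0 : rf_car;rf_1 : rf_car;rf_opp : rf_car -> rf_car;rf_inv : rf_car -> rf_car;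
 rf_add : rf_car -> rf_car -> rf_car;rf_mul : rf_car -> rf_car -> rf_car;
 rf_le : rf_car -> rf_car -> Prop;
 rf_addA : associative rf_add;rf_addC : commutative rf_add;rf_add0 : left_id rf_0 rf_add;
 rf_addN : left_inverse rf_0 rf_opp rf_add;
 rf_mulA : associative rf_mul;rf_mulC : commutative rf_mul;rf_mul1 : left_id rf_1 rf_mul;
 rf_mulDl : left_distributive rf_mul rf_add;
 rf_10 : rf_1 <> rf_0;
 rf_mulV : forall x, x <> rf_0 -> rf_mul (rf_inv x) x = rf_1;
 rf_inv0 : rf_inv rf_0 = rf_0;
 rf_le_add : forall x y, rf_le rf_0 x -> rf_le rf_0 y -> rf_le rf_0 (rf_add x y);
 rf_le_mul : forall x y, rf_le rf_0 x -> rf_le rf_0 y -> rf_le rf_0 (rf_mul x y);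
 rf_le_anti : forall x, rf_le rf_0 x -> rf_le x rf_0 -> x = rf_0;
 rf_sub : forall x y, rf_le rf_0 (rf_add y (rf_opp x)) <-> rf_le x y;
 rf_tot : forall x, rf_le rf_0 x \/ rf_le x rf_0 }.

Section Rf.
Variable D : rf_data.
Definition rf_type := rf_car D.
HB.instance Definition _ := gen_eqMixin rf_type.
HB.instance Definition _ := gen_choiceMixin rf_type.
HB.instance Definition _ := GRing.isZmodule.Build rf_type (@rf_addA D) (@rf_addC D) (@rf_add0 D) (@rf_addN D).
Let nz : rf_1 D != 0 :> rf_type. by apply/eqP;exact: rf_10. Qed.
HB.instance Definition _ := GRing.Zmodule_isComNzRing.Build rf_type
 (@rf_mulA D) (@rf_mulC D) (@rf_mul1 D) (@rf_mulDl D) nz.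
Let mulVf (x : rf_type) : x != 0 -> (rf_inv (x : rf_car D) : rf_type) * x = 1.
move/eqP;exact: rf_mulV. Qed.
HB.instance Definition _ := GRing.ComNzRing_isField.Build rf_type mulVf (@rf_inv0 D).
Let leb (x y : rf_type) : bool := `[< rf_le (x : rf_car D) y >].
Let ltb (x y : rf_type) : bool := (y != x) && leb x y.
Let nrm (x : rf_type) : rf_type := if leb 0 x then x else - x.
Let l1 x y : leb 0 x -> leb 0 y -> leb 0 (x + y).
move=> /asboolP h /asboolP h';apply/asboolP;exact: rf_le_add. Qed.
Let l2 x y : leb 0 x -> leb 0 y -> leb 0 (x * y).
move=> /asboolP h /asboolP h';apply/asboolP;exact: rf_le_mul. Qed.
Let l3 x : leb 0 x -> leb x 0 -> x = 0.
move=> /asboolP h /asboolP h';exact: rf_le_anti. Qed.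
Let l4 x y : leb 0 (y - x) = leb x y.
apply: asbool_equiv_eq;exact: rf_sub. Qed.
Let l5 x : leb 0 x || leb x 0.
by apply/orP;case: (rf_tot (x : rf_car D))=> h;[left|right];exact/asboolP. Qed.
Let l6 x : nrm (- x) = nrm x.
have e y : leb 0 (- y) = leb y 0 by rewrite -(l4 y 0) sub0r.
rewrite /nrm e;case h : (leb x 0);case h' : (leb 0 x)=> //;rewrite ?opprK //.
 by rewrite (l3 h' h) oppr0.
by have := l5 x;rewrite h h'.
Qed.
Let l7 x : leb 0 x -> nrm x = x. by rewrite /nrm=> ->. Qed.
HB.instance Definition _ := Num.IntegralDomain_isLeReal.Build rf_type l1 l2 l3 l4 l5 l6 l7 (fun _ _=> erefl).
Definition rf_field : RF := rf_type.
Lemma rf_leE (x y : rf_field) : x <= y <-> rf_le (x : rf_car D) y.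
by split=> [/asboolP|/asboolP]. Qed.
End Rf.

(** * Reducts of expansions by a predicate *)

Section Reduct.
Variables (L : signature) (n : nat).
Let L' := expand_signature L n.

Fixpoint tlft (t : term L) : term L' :=
 match t with Var i=> @Var L' i | App f ts=> @App L' f (fun j=> tlft (ts j)) end.
Fixpoint flft (phi : formula L) : formula L' :=
 match phi with
 | FFalse=> @FFalse L'
 | FEq t u=> FEq (tlft t) (tlft u)
 | FRel R ts=> @FRel L' (Some R) (fun j=> tlft (ts j))
 | FImp a b=> FImp (flft a) (flft b)
 | FAll i a=> FAll i (flft a)
 end.
Definition reduct (N : structure L') : structure L :=
 @Structure L N (@finterp L' N) (fun r=> @rinterp L' N (Some r)).
Lemma sat_flft (N : structure L') (v : nat -> N) phi : sat v (flft phi) <-> @sat L (reduct N) v phi.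
have et w t : eval_term w (tlft t) = @eval_term L (reduct N) w t.
 by elim: t=> [i|f ts IH] //=;congr finterp;apply: funext.
elim: phi v=> [|t u|R ts|a IHa b IHb|i a IHa] v /=.
- by [].
- by rewrite !et.
- by rewrite (_ : (fun j=> _) = (fun j=> @eval_term L (reduct N) v (ts j))) //;apply: funext.
- by rewrite IHa IHb.
- split=> h x;apply/IHa;exact: h.
Qed.
Lemma reduct_elem (M N : structure L') (i : M -> N) : elementary_embedding i ->
 @elementary_embedding L (reduct M) (reduct N) i.
move=> h phi v;rewrite -(@sat_flft M) -(@sat_flft N);exact: h. Qed.
Lemma reduct_sat (N : structure L') X : succ_card_saturated N X -> @succ_card_saturated L (reduct N) X.
move=> h A p cA hA hf.
pose q := [set r | exists2 s, p s & r = (flft s.1, s.2)].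
have [|D fD Dq|a ha] := h A q cA.
- move=> r [s ps ->] j /=;exact: hA.
- have [l hl] := finite_set_list fD.
 have [l' [h1 h2]] : exists l', (forall s, List.In s l' -> p s) /\
 forall r, List.In r l -> exists2 s, List.In s l' & r = (flft s.1, s.2).
 have {}Dq r : List.In r l -> q r by move/hl/Dq.
 elim: l Dq {hl}=> [|r l IH] Dq;first by exists [::];split.
 have [|l' [h1 h2]] := IH;first by move=> r' hr;apply: Dq;right.
 have [s ps e] := Dq r (or_introl erefl).
 exists (s :: l');split=> [s' [<-//|/h1//]|r' [<-|/h2[s' hs' e']]].
 by exists s=> //;left.
 by exists s'=> //;right.
 have [||a ha] := hf [set s | List.In s l'].
 + elim: (l')=> [|s l1 IH];first by rewrite (_ : [set s | _] = set0) //;apply/seteqP;split.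
 rewrite (_ : [set s0 | _] = [set s] `|` [set s | List.In s l1]) ?finite_setU;first by split=> //;exact: finite_set1.
 by apply/seteqP;split=> x;[case=> [<-|];[left|right]|case=> [->|];[left|right]].
 + by move=> s /h1.
 exists a=> r /hl/h2[s hs ->] /=;rewrite sat_flft;exact: ha.
exists a=> s ps;have := ha (flft s.1, s.2);rewrite /= sat_flft;apply;by exists s.
Qed.
End Reduct.
Lemma elem_valid_gen L (M N : structure L) (i : M -> N) phi : elementary_embedding i -> inhabited M ->
 (forall v : nat -> M, sat v phi) -> forall v : nat -> N, sat v phi.
move=> hi [m] hv v;have [B hB] := formula_bound phi.
have : sat (fun=> m) (clos B phi) by apply/sat_clos=> w _;exact: hv.
rewrite (hi _ (fun=> m)) sat_clos=> /(_ (fun j=> if (j < B)%N then v j else i m)) h'.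
rewrite (hB N v (fun j=> if (j < B)%N then v j else i m));last by move=> j ->.
by apply: h'=> j;rewrite ltnNge=> ->.
Qed.

Section Convert.
Variables (K : RF) (der : K -> K) (O k : set K).
Notation PS := PS.
Variables (D : Type) (fi : forall f : fsym PS, ('I_(farity f) -> D) -> D)
 (ri : forall r : rsym PS, set ('I_(rarity r) -> D)).
Let N : structure PS := @Structure PS D fi ri.
Variable (i : K -> D).
Hypothesis hi : @elementary_embedding PS (pst der O k) N i.
Let x_ j := @Var PS j.
Let tA t u := @App PS F_add (args2 t u).
Let tM t u := @App PS F_mul (args2 t u).
Let tN t := @App PS F_opp (fun=> t).
Let tZ := @App PS F_zero (fun=> x_ 0).
Let tI := @App PS F_one (fun=> x_ 0).
Let fL t u := @FRel PS R_le (args2 t u).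
Let fD t u := @FRel PS R_dom (args2 t u).
Let zero : D := @fi F_zero (fun=> i 0).
Let one : D := @fi F_one (fun=> i 0).
Let opp (x : D) : D := @fi F_opp (fun=> x).
Let add (x y : D) : D := @fi F_add (args2 x y).
Let mul (x y : D) : D := @fi F_mul (args2 x y).
Let le (x y : D) : Prop := @ri R_le (args2 x y).
Let dm (x y : D) : Prop := @ri R_dom (args2 x y).
Let ev0 v : @eval_term PS N v tZ = zero. by rewrite /=;congr fi;apply: funext=> -[]. Qed.
Let ev1 v : @eval_term PS N v tI = one. by rewrite /=;congr fi;apply: funext=> -[]. Qed.
Let evN v t : @eval_term PS N v (tN t) = opp (@eval_term PS N v t). by []. Qed.
Let args2_map T U (f : T -> U) a b : (fun j=> f (args2 a b j)) = args2 (f a) (f b).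
by apply: funext=> j;rewrite /args2;case: ifP. Qed.
Let evA v t u : @eval_term PS N v (tA t u) = add (@eval_term PS N v t) (@eval_term PS N v u).
by rewrite /= args2_map. Qed.
Let evM v t u : @eval_term PS N v (tM t u) = mul (@eval_term PS N v t) (@eval_term PS N v u).
by rewrite /= args2_map. Qed.
Let evL v t u : @sat PS N v (fL t u) = le (@eval_term PS N v t) (@eval_term PS N v u).
by rewrite /= args2_map. Qed.
Let evD v t u : @sat PS N v (fD t u) = dm (@eval_term PS N v t) (@eval_term PS N v u).
by rewrite /= args2_map. Qed.
Let evX v j : @eval_term PS N v (x_ j) = v j. by []. Qed.
Let evEq v t u : @sat PS N v (FEq t u) = (@eval_term PS N v t = @eval_term PS N v u). by []. Qed.
Let evI v p q : @sat PS N v (FImp p q) = (@sat PS N v p -> @sat PS N v q). by []. Qed.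
Let evF v : @sat PS N v (@FFalse PS) = False. by []. Qed.
Let evE := (evEq, evI, evF, ev0, ev1, evN, evA, evM, evL, evD, evX).
Let ax phi : (forall v : nat -> K, @sat PS (pst der O k) v phi) -> forall v : nat -> D, @sat PS N v phi.
exact: (elem_valid_gen hi (inhabits 0)). Qed.
Let env (x y z : D) : nat -> D := fun j=> match j with 0%N=> x | 1%N=> y | _=> z end.
Let addA : associative add.
move=> x y z;have := @ax (FEq (tA (x_ 0) (tA (x_ 1) (x_ 2))) (tA (tA (x_ 0) (x_ 1)) (x_ 2)))
 (fun v=> addrA (v 0%N) (v 1%N) (v 2%N)) (env x y z).
by rewrite !evE.
Qed.
Let addC : commutative add.
move=> x y;have := @ax (FEq (tA (x_ 0) (x_ 1)) (tA (x_ 1) (x_ 0))) (fun v=> addrC (v 0%N) (v 1%N)) (env x y x).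
by rewrite !evE.
Qed.
Let add0 : left_id zero add.
move=> x;have := @ax (FEq (tA tZ (x_ 0)) (x_ 0)) (fun v=> add0r (v 0%N)) (env x x x).
by rewrite !evE.
Qed.
Let addN : left_inverse zero opp add.
move=> x;have := @ax (FEq (tA (tN (x_ 0)) (x_ 0)) tZ) (fun v=> addNr (v 0%N)) (env x x x).
by rewrite !evE.
Qed.
Let mulA : associative mul.
move=> x y z;have := @ax (FEq (tM (x_ 0) (tM (x_ 1) (x_ 2))) (tM (tM (x_ 0) (x_ 1)) (x_ 2)))
 (fun v=> mulrA (v 0%N) (v 1%N) (v 2%N)) (env x y z).
by rewrite !evE.
Qed.
Let mulC : commutative mul.
move=> x y;have := @ax (FEq (tM (x_ 0) (x_ 1)) (tM (x_ 1) (x_ 0))) (fun v=> mulrC (v 0%N) (v 1%N)) (env x y x).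
by rewrite !evE.
Qed.
Let mul1 : left_id one mul.
move=> x;have := @ax (FEq (tM tI (x_ 0)) (x_ 0)) (fun v=> mul1r (v 0%N)) (env x x x).
by rewrite !evE.
Qed.
Let mulDl : left_distributive mul add.
move=> x y z;have := @ax (FEq (tM (tA (x_ 0) (x_ 1)) (x_ 2)) (tA (tM (x_ 0) (x_ 2)) (tM (x_ 1) (x_ 2))))
 (fun v=> mulrDl (v 0%N) (v 1%N) (v 2%N)) (env x y z).
by rewrite !evE.
Qed.
Let ne10 : one <> zero.
have h (v : nat -> K) : (1 : K) = 0 -> False by apply/eqP;exact: oner_neq0.
by have := @ax (FImp (FEq tI tZ) (@FFalse PS)) h (fun=> i 0);rewrite !evE.
Qed.
(** Inversion is not in the language. It is chosen from the first-order statement that nonzero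
    elements are invertible. *)
Let invE x : exists y, (x <> zero -> mul y x = one) /\ (x = zero -> y = zero).
case: (pselect (x = zero))=> [->|x0];first by exists zero.
have h (v : nat -> K) : @sat PS (pst der O k) v (FImp (FImp (FEq (x_ 0) tZ) (@FFalse PS))
 (FImp (FAll 1 (FImp (FEq (tM (x_ 1) (x_ 0)) tI) (@FFalse PS))) (@FFalse PS))).
 by move=> v0 h;apply: (h (v 0%N)^-1);apply: mulVf;apply/eqP.
have := ax h (env x x x);rewrite !evE=> {}h.
apply: contrapT=> n;apply: h=> // a;rewrite !evE=> e;apply: n;exists a;split=> // /x0 //.
Qed.
Let inv x := sval (cid (invE x)).
Let mulV x : x <> zero -> mul (inv x) x = one. by rewrite /inv;case: cid=> y /= []. Qed.
Let inv0 : inv zero = zero. by rewrite /inv;case: cid=> y /= [_];exact. Qed.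
Let le_add x y : le zero x -> le zero y -> le zero (add x y).
have := @ax (FImp (fL tZ (x_ 0)) (FImp (fL tZ (x_ 1)) (fL tZ (tA (x_ 0) (x_ 1)))))
 (fun v=> @addr_ge0 K (v 0%N) (v 1%N)) (env x y x).
by rewrite !evE.
Qed.
Let le_mul x y : le zero x -> le zero y -> le zero (mul x y).
have := @ax (FImp (fL tZ (x_ 0)) (FImp (fL tZ (x_ 1)) (fL tZ (tM (x_ 0) (x_ 1)))))
 (fun v=> @mulr_ge0 K (v 0%N) (v 1%N)) (env x y x).
by rewrite !evE.
Qed.
Let le_anti x : le zero x -> le x zero -> x = zero.
have h (v : nat -> K) : (0 <= v 0%N) -> v 0%N <= 0 -> v 0%N = 0.
 by move=> h h';apply/eqP;rewrite eq_le h h'.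
by have := @ax (FImp (fL tZ (x_ 0)) (FImp (fL (x_ 0) tZ) (FEq (x_ 0) tZ))) h (env x x x);rewrite !evE.
Qed.
Let le_sub x y : le zero (add y (opp x)) <-> le x y.
split.
 have h (v : nat -> K) : 0 <= v 1%N - v 0%N -> v 0%N <= v 1%N by rewrite subr_ge0.
 by have := @ax (FImp (fL tZ (tA (x_ 1) (tN (x_ 0)))) (fL (x_ 0) (x_ 1))) h (env x y x);rewrite !evE.
have h (v : nat -> K) : v 0%N <= v 1%N -> 0 <= v 1%N - v 0%N by rewrite subr_ge0.
by have := @ax (FImp (fL (x_ 0) (x_ 1)) (fL tZ (tA (x_ 1) (tN (x_ 0))))) h (env x y x);rewrite !evE.
Qed.
Let le_tot x : le zero x \/ le x zero.
have h (v : nat -> K) : (0 <= v 0%N -> False) -> v 0%N <= 0.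
 by move=> h;case: (ltP (v 0%N) 0)=> [/ltW //|/h].
have := @ax (FImp (FImp (fL tZ (x_ 0)) (@FFalse PS)) (fL (x_ 0) tZ)) h (env x x x).
rewrite !evE=> {}h;by case: (pselect (le zero x))=> n;[left|right;exact: h].
Qed.
Let data : rf_data := @RfData D zero one opp inv add mul le addA addC add0 addN mulA mulC mul1 mulDl
 ne10 mulV inv0 le_add le_mul le_anti le_sub le_tot.
Let K' : RF := rf_field data.
Let der' : K' -> K' := fun x=> @fi F_der (fun=> x).
Let O' : set K' := [set x | dm x one].
Let k' : set K' := [set x | @ri R_lift (fun=> x)].
(** The valuation ring is not in the language either. It is recovered as the elements dominated by
    1, and this equivalence shows that dominance in the model is the one it induces. *)
Let dmE (x y : D) : dm x y <-> exists2 a, dm a one & x = mul a y.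
split=> [h|[a h ->]].
 have hv (v : nat -> K) : @sat PS (pst der O k) v (FImp (fD (x_ 0) (x_ 1)) (FImp (FAll 2 (FImp (fD (x_ 2) tI) (FImp (FEq (x_ 0) (tM (x_ 2) (x_ 1))) (@FFalse PS)))) (@FFalse PS))).
 by move=> [a Oa e] h';apply: (h' a)=> //;exists a=> //=;rewrite mulr1.
 have := ax hv (env x y x);rewrite !evE=> h'.
 apply: contrapT=> n;apply: (h' h)=> a;rewrite !evE=> h1 h2;apply: n;exists a;last exact: h2.
 by have := h1 : @sat PS N (@update PS N (env x y x) 2 a) (fD (x_ 2) tI);rewrite evD ev1.
have hv (v : nat -> K) : dominated O (v 0%N) 1 -> dominated O (v 0%N * v 1%N) (v 1%N).
 by move=> [b Ob ->];exists b=> //;rewrite mulr1.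
by have := @ax (FImp (fD (x_ 0) tI) (fD (tM (x_ 0) (x_ 1)) (x_ 1))) hv (env a y y);rewrite !evE;apply.
Qed.
(** An equality of structures, so that elementarity and saturation are carried over by rewriting. *)
Lemma convert_structure : exists (K1 : RF) (der1 : K1 -> K1) (O1 k1 : set K1),
 @Structure PS D fi ri = pst der1 O1 k1.
exists K', der', O', k'.
have ef : fi = @finterp PS (pst der' O' k').
 apply: functional_extensionality_dep=> f;apply: funext=> xs;case: f xs=> xs /=.
 - by congr fi;apply: funext=> -[].
 - by congr fi;apply: funext=> -[].
 - by congr fi;apply: funext=> j;rewrite (ord1 j).
 - by congr fi;apply: funext=> j;rewrite /args2;case: eqP=> [->//|/eqP];case: j=> -[|[|]] //= lt _;congr xs;apply: val_inj.
 - by congr fi;apply: funext=> j;rewrite /args2;case: eqP=> [->//|/eqP];case: j=> -[|[|]] //= lt _;congr xs;apply: val_inj.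
 - by congr fi;apply: funext=> j;rewrite (ord1 j).
have a2 (xs : 'I_2 -> D) : xs = args2 (xs ord0) (xs ord_max).
 by apply: funext=> j;rewrite /args2;case: eqP=> [->//|/eqP];case: j=> -[|[|]] //= lt _;congr xs;apply: val_inj.
have er : ri = @rinterp PS (pst der' O' k').
 apply: functional_extensionality_dep=> r;apply: funext=> xs;apply: propext;case: r xs=> xs /=.
 - by rewrite (rf_leE (D := data)) /= [X in ri X]a2.
 - rewrite [X in ri X]a2;exact: dmE.
 - by rewrite /k' /= (_ : xs = fun=> xs ord0) //;apply: funext=> j;rewrite (ord1 j).
by rewrite ef er.
Qed.
End Convert.

Theorem expand_saturated_extension (K : RF) (der : K -> K) (O k : set K) n (S : set ('I_n -> K)) (X : Type) :
 exists (K' : RF) (der' : K' -> K') (O' k' : set K') (S' : set ('I_n -> K')) (i : K -> K'),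
 @elementary_embedding _ (@expand _ (pst der O k) n S) (@expand _ (pst der' O' k') n S') i /\
 @succ_card_saturated _ (@expand _ (pst der' O' k') n S') X.
have [N [i [hi hs]]] := @saturated_extension _ (@expand _ (pst der O k) n S) X 0.
case: N i hi hs=> D fi ri i hi hs.
have [K' [der' [O' [k' e]]]] := @convert_structure K der O k D fi (fun r=> ri (Some r)) i (reduct_elem hi).
pose S0 := ri None.
have [S' eS] : exists S' : set ('I_n -> domain (pst der' O' k')),
 @Structure (expand_signature PS n) D fi ri = @expand _ (pst der' O' k') n S'.
 rewrite -e;exists S0;rewrite /expand /=;congr Structure.
 by apply: functional_extensionality_dep=> -[].
move: i hi hs;rewrite eS=> i hi hs;by exists K', der', O', k', S', i.
Qed.
Lemma expand_elem (K : RF) (der : K -> K) (O k : set K) n (S : set ('I_n -> K))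
 (K' : RF) (der' : K' -> K') (O' k' : set K') (S' : set ('I_n -> K')) (i : K -> K') :
 @elementary_embedding _ (@expand _ (pst der O k) n S) (@expand _ (pst der' O' k') n S') i ->
 elem der O k der' O' k' i.
exact: reduct_elem. Qed.
Lemma expand_sat (K' : RF) (der' : K' -> K') (O' k' : set K') n (S' : set ('I_n -> K')) X :
 @succ_card_saturated _ (@expand _ (pst der' O' k') n S') X -> @succ_card_saturated _ (pst der' O' k') X.
exact: reduct_sat. Qed.
Lemma pair_saturated_extension (K : RF) (der : K -> K) (O k : set K) (X : Type) :
 exists (K' : RF) (der' : K' -> K') (O' k' : set K') (i : K -> K'),
 elem der O k der' O' k' i /\ @succ_card_saturated _ (pst der' O' k') X.
have [K' [der' [O' [k' [S' [i [h hs]]]]]]] := @expand_saturated_extension K der O k 0 set0 X.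
by exists K', der', O', k', i;split;[exact: expand_elem h|exact: expand_sat hs].
Qed.

(** * Tameness passes to elementary extensions *)

Ltac te := cbv beta;repeat first [ apply te_var | apply te_0 | apply te_1 | apply te_N | apply te_der
 | apply te_D | apply te_M | apply te_X | apply te_Mn | apply te_iter | (apply te_sum;intro) | (apply te_prod;intro) ].
Ltac ex := cbv beta;first
 [ apply e_and;ex | apply e_or;ex | apply e_iff;ex | apply e_eq;te | apply e_eqb;te | apply e_neq;te
 | apply e_le;te | apply e_lt;te | apply e_dom;te | apply e_k;te
 | apply e_false | apply e_not;ex | apply e_imp;ex | apply e_all;ex | apply e_ex2;ex | apply e_ex;ex
 | (apply e_all_fin;intro;ex) | (apply e_ex_fin;intro;ex) | apply e_prop | idtac ].

Section PolyTerm.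
Variables (n : nat) (ms : seq 'X_{1..n}).
(** The monomials are fixed and only the coefficients vary, so the value is a term of the language.
    Each instance of d-henselianity thereby becomes a first-order statement about the
    coefficients. *)
Definition pterm (K : RF) (der : K -> K) (c : 'I_(size ms) -> K) (y : K) : K :=
 \sum_(j < size ms) c j * \prod_(i < n) iter i der y ^+ (tnth (in_tuple ms) j i).
Lemma pterm_eval (K : RF) (der : K -> K) c y :
 (\sum_(j < size ms) c j *: 'X_[tnth (in_tuple ms) j] : {mpoly K[n]}).@[jet der y] = pterm der c y.
rewrite (raddf_sum (meval _)) /=;apply: eq_bigr=> j _.
by rewrite mevalZ mevalX.
Qed.

Hypothesis ums : uniq ms.
Lemma pterm_coef (K : RF) (c : 'I_(size ms) -> K) m :
 (exists2 j, m = tnth (in_tuple ms) j &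
 (\sum_(j < size ms) c j *: 'X_[tnth (in_tuple ms) j] : {mpoly K[n]})@_m = c j) \/
 (m \notin ms /\ (\sum_(j < size ms) c j *: 'X_[tnth (in_tuple ms) j] : {mpoly K[n]})@_m = 0).
rewrite (raddf_sum (mcoeff m)) /=;under eq_bigr do rewrite mcoeffZ mcoeffX.
have [h|h] := boolP (m \in ms);[left|right].
 have /tnthP[j ej] : m \in in_tuple ms by [].
 exists j=> //;rewrite (bigD1 j) //= -ej eqxx mulr1 big1 ?addr0 // => l ne.
 case: eqP=> [e|_];last by rewrite mulr0.
 by case/eqP: ne;apply: (tuple_uniqP (in_tuple ms) ums);rewrite e -ej.
split=> //;rewrite big1 // => j _;case: eqP=> [e|_];last by rewrite mulr0.
by case/negP: h;rewrite -e mem_tnth.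
Qed.
End PolyTerm.
Lemma mpoly_pterm (K : RF) n (R : {mpoly K[n]}) :
 R = \sum_(j < size (msupp R)) R@_(tnth (in_tuple (msupp R)) j) *: 'X_[tnth (in_tuple (msupp R)) j].
rewrite -(big_tuple _ _ (in_tuple (msupp R)) xpredT (fun m=> R@_m *: 'X_[m])) /=.
exact: mpolyE.
Qed.
Lemma te_pterm n (ms : seq 'X_{1..n}) (c : 'I_(size ms) -> forall K : RF, (K -> K) -> (nat -> K) -> K) y :
 (forall j, texpr (c j)) -> texpr y -> texpr (fun K d v=> pterm d (fun j=> c j K d v) (y K d v)).
move=> hc hy;rewrite /pterm;te=> //;exact: hy. Qed.

Section TameTransfer.
Variables (K : RF) (der : K -> K) (O k : set K) (K' : RF)
 (der' : K' -> K') (O' k' : set K') (i : K -> K').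
Hypothesis hi : elem der O k der' O' k' i.
Notation EV Q v := (elem_valid hi (P := Q) _ _ v).
Hypothesis T : tame der O k.
Let hO := t_val T.
Let hd := t_der T.

Notation e2 a b := (fun j : nat=> if j is 0%N then a else b).
(** The flag selects [t_DH1] or [t_DH2]. Only the coefficients at the monomials of [R] are
    mentioned, the others being zero. *)
Let DH (b : bool) n (R : {mpoly K'[n]}) : (forall m, O' R@_m) ->
 (forall m, (1 < mdeg m)%N -> ~ dominated O' 1 R@_m) ->
 (exists i, dominated O' 1 R@_U_(i)) -> (b -> ~ dominated O' 1 R@_0) ->
 exists2 y, (if b then ~ dominated O' 1 y else O' y) & R.@[fun i=> iter i der' y] = 0.
move=> h1 h2 h3 h4;set ms := msupp R.
pose P (K : RF) (d : K -> K) (O k : set K) (v : nat -> K) :=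
 (forall j : 'I_(size ms), dominated O (v j) 1) ->
 (forall j : 'I_(size ms), (1 < mdeg (tnth (in_tuple ms) j))%N -> ~ dominated O 1 (v j)) ->
 (exists j : 'I_(size ms), mdeg (tnth (in_tuple ms) j) = 1%N /\ dominated O 1 (v j)) ->
 (forall j : 'I_(size ms), b /\ tnth (in_tuple ms) j = 0%MM -> ~ dominated O 1 (v j)) ->
 exists y, (if b then ~ dominated O 1 y else dominated O y 1) /\ pterm d (fun j : 'I_(size ms)=> v j) y = 0.
have eP : expr P.
 rewrite /P;ex.
 by case: (b);ex.
have [|||||y [hy ev]] := elem_valid hi eP _ (fun j=> if insub j is Some j' then R@_(tnth (in_tuple ms) j') else 0).
- move=> v a1 a2 a3 a4.
 pose Q : {mpoly K[n]} := \sum_(j < size ms) v j *: 'X_[tnth (in_tuple ms) j].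
 have cf m := pterm_coef (msupp_uniq R) (fun j=> v j) m;rewrite -/ms -/Q in cf.
 have z1 : ~ dominated O 1 0 by apply: dlt0x;exact: oner_neq0.
 have q1 m : O Q@_m.
 by case: (cf m)=> [[j _ ->]|[_ ->]];[apply/dle1;exact: a1|exact: O0].
 have q2 m : (1 < mdeg m)%N -> ~ dominated O 1 Q@_m.
 by move=> hm;case: (cf m)=> [[j e ->]|[_ ->//]];apply: a2;rewrite -e.
 have q3 : exists l, dominated O 1 Q@_U_(l).
 have [j [/eqP/mdeg1P[l /eqP el] hj]] := a3;exists l;case: (cf U_(l)%MM)=> [[j' e ->]|[nin]].
 have -> : j' = j by apply: (tuple_uniqP (in_tuple ms) (msupp_uniq R));rewrite -e el.
 exact: hj.
 by rewrite -el mem_tnth in nin.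
 have q4 : b -> ~ dominated O 1 Q@_0.
 by move=> bt;case: (cf 0%MM)=> [[j e ->]|[_ ->//]];apply: a4.
 case: (b) q4=> [q4|_].
 have [y hy ev] := t_DH1 T q1 q2 q3 (q4 isT);exists y;split=> //.
 by rewrite -pterm_eval -ev.
 have [y hy ev] := t_DH2 T q1 q2 q3;exists y;split;first exact/dle1.
 by rewrite -pterm_eval -ev.
- by move=> j;rewrite valK;apply/dle1.
- by move=> j hj;rewrite valK;apply: h2.
- have [l hl] := h3;have lin : U_(l)%MM \in in_tuple ms.
 rewrite /= /ms mcoeff_msupp;apply: contraPneq hl=> ->;apply: contrapT=> h.
 have ez : dominated O' 1 0 by apply: contrapT=> /h.
 by have := @dlex0 _ O' _ ez=> /eqP;rewrite oner_eq0.
 have /tnthP[j ej] := lin.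
 by exists j;rewrite valK -ej mdeg1.
- by move=> j [bt e];rewrite valK e;apply: h4.
exists y;first by case: (b) hy=> // hy;apply/dle1.
rewrite -ev [R in LHS]mpoly_pterm -/ms -(pterm_eval der');congr meval.
by apply: eq_bigr=> j _;rewrite valK.
Qed.
Lemma tame_elem : tame der' O' k'.
have D1 : derivation der'.
 split=> a b.
 apply: (EV (fun K d O k v=> d (v 0%N + v 1%N) = d (v 0%N) + d (v 1%N)) (e2 a b));first by ex.
 move=> v;exact: derD.
 apply: (EV (fun K d O k v=> d (v 0%N * v 1%N) = d (v 0%N) * v 1%N + v 0%N * d (v 1%N)) (e2 a b));first by ex.
 move=> v;exact: derM.
have D2 : valuation_ring O'.
 split=> [|a b /dle1 h /dle1 h'|a b /dle1 h /dle1 h'|a].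
 - apply/dle1;apply: (EV (fun K d O k v=> dominated O 1 1) (fun=> 0));first by ex.
 move=> v;exact: dle_refl.
 - apply/dle1;move: h h';apply: (EV (fun K d O k v=> dominated O (v 0%N) 1 -> dominated O (v 1%N) 1 -> dominated O (v 0%N - v 1%N) 1) (e2 a b));first by ex.
 move=> v;exact: dleB.
 - apply/dle1;move: h h';apply: (EV (fun K d O k v=> dominated O (v 0%N) 1 -> dominated O (v 1%N) 1 -> dominated O (v 0%N * v 1%N) 1) (e2 a b));first by ex.
 move=> v /dle1 h /dle1 h';apply/dle1;exact: OM.
 - have [->|a0] := eqVneq a 0.
 left;apply/dle1;apply: (EV (fun K d O k v=> dominated O 0 1) (fun=> 0));first by ex.
 move=> v;exact: dle0x.
 have : dominated O' a 1 \/ dominated O' a^-1 1.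
 have := (EV (fun K d O k v=> v 0%N * v 1%N = 1 -> dominated O (v 0%N) 1 \/ dominated O (v 1%N) 1) (e2 a a^-1)).
 rewrite mulfV //;apply=> //;first by ex.
 move=> v e;have v0 : v 0%N != 0 by apply: contraTneq (oner_neq0 K)=> z;rewrite -e z mul0r eqxx.
 have -> : v 1%N = (v 0%N)^-1 by rewrite -[RHS]mulr1 -e mulrA mulVf // mul1r.
 by case: (OV hO (v 0%N))=> h;[left|right];apply/dle1.
 by case=> /dle1;[left|right].
split=> //.
- move=> a b c /dle1 ha /dle1 hc /andP[h1 h2];apply/dle1.
 move: ha hc h1 h2;apply: (EV (fun K d O k v=> dominated O (v 0%N) 1 -> dominated O (v 2%N) 1 -> v 0%N <= v 1%N -> v 1%N <= v 2%N -> dominated O (v 1%N) 1) (fun j=> match j with 0%N=> a | 1%N=> b | _=> c end));first by ex.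
 move=> v /dle1 h0 /dle1 h2 l1 l2;apply/dle1;apply: (t_conv T h0 h2);by rewrite l1 l2.
- move=> f hf;have := (EV (fun K d O k v=> (forall a, dominated O a 1 -> a < v 0%N) -> 0 < d (v 0%N)) (fun=> f));apply.
 + by ex.
 + move=> v h;apply: (t_H T)=> a /dle1;exact: h.
 + move=> a /dle1;exact: hf.
- move=> f;apply: (EV (fun K d O k v=> ~ dominated O 1 (v 0%N) -> ~ dominated O 1 (d (v 0%N))) (fun=> f));first by ex.
 move=> v;exact: (t_small T).
- apply: (EV (fun K d O k v=> k 1) (fun=> 0));first by ex.
 move=> v;exact: (t_k1 T).
- move=> a b;apply: (EV (fun K d O k v=> k (v 0%N) -> k (v 1%N) -> k (v 0%N - v 1%N)) (e2 a b));first by ex.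
 move=> v;exact: (t_kB T).
- move=> a b;apply: (EV (fun K d O k v=> k (v 0%N) -> k (v 1%N) -> k (v 0%N * v 1%N)) (e2 a b));first by ex.
 move=> v;exact: (t_kM T).
- move=> a ka;have [->|a0] := eqVneq a 0.
 rewrite invr0;apply: (EV (fun K d O k v=> k 0) (fun=> 0));first by ex.
 move=> v;exact: (k0 T).
 have := (EV (fun K d O k v=> k (v 0%N) -> v 0%N * v 1%N = 1 -> k (v 1%N)) (e2 a a^-1)).
 rewrite mulfV //;apply=> //;first by ex.
 move=> v kv e;have v0 : v 0%N != 0 by apply: contraTneq (oner_neq0 K)=> z;rewrite -e z mul0r eqxx.
 have -> : v 1%N = (v 0%N)^-1 by rewrite -[RHS]mulr1 -e mulrA mulVf // mul1r.
 exact: (t_kV T).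
- move=> a;apply: (EV (fun K d O k v=> k (v 0%N) -> k (d (v 0%N))) (fun=> a));first by ex.
 move=> v;exact: (t_kder T).
- move=> a ka;apply/dle1;move: ka;apply: (EV (fun K d O k v=> k (v 0%N) -> dominated O (v 0%N) 1) (fun=> a));first by ex.
 move=> v kv;apply/dle1;exact: (t_kO T).
- move=> x /dle1;apply: (EV (fun K d O k v=> dominated O (v 0%N) 1 -> exists2 c, k c & ~ dominated O 1 (v 0%N - c)) (fun=> x));first by ex.
 move=> v /dle1;exact: (t_lift T).
- move=> c;apply: (EV (fun K d O k v=> k (v 0%N) -> ~ dominated O 1 (v 0%N) -> v 0%N = 0) (fun=> c));first by ex.
 move=> v;exact: (t_k0 T).
- apply: (EV (fun K d O k v=> exists2 x, k x & d x = 1) (fun=> 0));first by ex.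
 move=> v;exact: (t_x T).
- apply: (EV (fun K d O k v=> exists2 e, e != 0 & ~ dominated O 1 e) (fun=> 0));first by ex.
 move=> v;exact: (t_ne T).
- move=> e n;apply: (EV (fun K d O k v=> 0 < v 0%N -> exists2 x, 0 < x & x ^+ n.+1 = v 0%N) (fun=> e));first by ex.
 move=> v;exact: (t_root T).
- move=> a;apply: (EV (fun K d O k v=> exists2 z, z != 0 & d z = v 0%N * z) (fun=> a));first by ex.
 move=> v;exact: (t_exp T).
- move=> g g0 g1 h.
 have := (EV (fun K d O k v=> v 0%N != 0 -> ~ dominated O 1 (v 0%N) -> ~ dominated O (d (v 0%N)) (v 0%N)) (fun=> g)).
 apply=> //;first by ex.
 move=> v v0 v1 h';apply: (t_psi T v0 v1);rewrite /logder -(mulfV v0).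
 exact: (dleMr hO).
 have := dleMr D2 g h;by rewrite mul1r divfK.
- move=> n R h1 h2 h3 h4;exact: (DH (b := true)).
- move=> n R h1 h2 h3;exact: (DH (b := false)).
Qed.
End TameTransfer.
Lemma zorn_sets T (P : set (set T)) H0 : P H0 ->
 (forall C : set (set T), C !=set0 -> C `<=` P ->
 (forall A B, C A -> C B -> A `<=` B \/ B `<=` A) -> P (\bigcup_(A in C) A)) ->
 exists H, [/\ P H, H0 `<=` H & forall H', P H' -> H `<=` H' -> H' `<=` H].
move=> PH0 hC;pose W := {H : set T | P H /\ H0 `<=` H}.
pose w0 : W := exist _ H0 (conj PH0 (fun x h=> h)).
have [|||[H [PH HH]] hmax] := @ZL_preorder W w0 (fun a b=> `[< sval a `<=` sval b >]).
- by move=> a;apply/asboolP.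
- by move=> b a c /asboolP h /asboolP h';apply/asboolP=> x /h/h'.
- move=> A tot;case: (pselect (A !=set0))=> [[a Aa]|ne];last by exists w0=> s As;case: ne;exists s.
 have PU : P (\bigcup_(B in [set sval s | s in A]) B).
 apply: hC;first by exists (sval a);exists a.
 move=> _ [s _ <-];exact: (svalP s).1.
 by move=> _ _ [s As <-] [t At <-];case: (tot s t As At)=> /asboolP;[left|right].
 have HU : H0 `<=` \bigcup_(B in [set sval s | s in A]) B.
 by move=> x hx;exists (sval a);[exists a|exact: (svalP a).2].
 exists (@exist (set T) (fun H=> P H /\ H0 `<=` H) _ (conj PU HU))=> s As;apply/asboolP=> x hx /=;by exists (sval s)=> //;exists s.
exists H;split=> // H' PH' sub.
have HH' : H0 `<=` H' by move=> x /HH/sub.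
by have /asboolP := hmax (@exist (set T) (fun H=> P H /\ H0 `<=` H) H' (conj PH' HH')) (asboolT sub).
Qed.

(** * Graphs of isomorphisms between ordered valued differential subfields *)

Section Graphs.
Variables (K : RF) (der : K -> K) (O k : set K) (K' : RF)
 (der' : K' -> K') (O' k' : set K').
Hypothesis T : tame der O k.
Hypothesis T' : tame der' O' k'.
Let hO := t_val T.
Let hO' := t_val T'.
Let hc := t_conv T.
Let hc' := t_conv T'.
Let hd := t_der T.
Let hd' := t_der T'.
Local Hint Resolve hO hO' hc hc' hd hd' : core.
Notation KK := (K * K')%type.
Notation "x <=: y" := (dominated O x y).
Notation "x <: y" := (~ dominated O y x).
Notation "x =: y" := (asymp O x y).
Notation "x ~: y" := (~ dominated O y (x - y)).
Notation "x <=:' y" := (dominated O' x y).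
Notation "x <:' y" := (~ dominated O' y x).
Notation "x ~:' y" := (~ dominated O' y (x - y)).
Definition dd (x : KK) : KK := (der x.1, der' x.2).
Definition vv (x : KK) : KK := (x.1^-1, x.2^-1).

(** An isomorphism is kept as its graph in the product ring, where identities are checked for both
    fields at once. [g_lift] says that residue classes of the domain have representatives in it
    lying in [k]. [g_el] asks for elementarity only for formulas with quantifiers over [k]; this is
    what relative elimination means. *)
Record good0 (G : set KK) : Prop := Good0 {
 g_1 : G 1;
 g_B : forall x y, G x -> G y -> G (x - y);
 g_M : forall x y, G x -> G y -> G (x * y);
 g_V : forall x, G x -> G (vv x);
 g_d : forall x, G x -> G (dd x);
 g_pos : forall x, G x -> (0 < x.1) = (0 < x.2);
 g_dom : forall x y, G x -> G y -> x.1 <=: y.1 <-> x.2 <=:' y.2;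
 g_lift : forall x, G x -> O x.1 -> exists2 d, G d & [/\ k d.1, k' d.2 & ~ dominated O 1 (x.1 - d.1)];
 g_el : pmap der O k der' O' k' true [set x | G x /\ k x.1] }.
Definition goodk G := good0 G /\ forall c, k c -> exists2 x, G x & x.1 = c.

Section Good0.
Variable G : set KK.
Hypothesis hG : good0 G.
Lemma G_0 : G 0. by rewrite -(subrr 1);apply: (g_B hG);exact: (g_1 hG). Qed.
Lemma G_N x : G x -> G (- x). by rewrite -sub0r;apply: (g_B hG);exact: G_0. Qed.
Lemma G_D x y : G x -> G y -> G (x + y).
move=> h h';rewrite -(opprK y);apply: (g_B hG)=> //;exact: G_N. Qed.
Lemma G_0P x : G x -> x.1 = 0 <-> x.2 = 0.
move=> Gx;have h1 := g_pos hG Gx;have := g_pos hG (G_N Gx);rewrite /= !oppr_gt0=> h2.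
split=> e;apply/eqP;first by rewrite eq_le !leNgt -h1 -h2 e !ltxx.
by rewrite eq_le !leNgt h1 h2 e !ltxx.
Qed.
Lemma G_eq x y : G x -> G y -> x.1 = y.1 -> x = y.
move=> Gx Gy e;have := G_0P (g_B hG Gx Gy);rewrite /= e subrr=> -[/(_ erefl)/eqP h _].
by rewrite [x]surjective_pairing [y]surjective_pairing e;congr pair;apply/eqP;rewrite -subr_eq0.
Qed.
Lemma G_k x : G x -> k x.1 <-> k' x.2.
move=> Gx.
have key d : G d -> x.1 - d.1 <: 1 -> x.2 - d.2 <:' 1.
 by move=> Gd h h';apply: h;apply/(g_dom hG (g_1 hG) (g_B hG Gx Gd)).
split=> kx.
 have [d Gd [kd kd' hd1]] := g_lift hG Gx (t_kO T kx).
 have e : x.1 - d.1 = 0 by apply: (t_k0 T)=> //;exact: (t_kB T).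
 by rewrite (G_eq Gx Gd (subr0_eq e)).
have Ox : O x.1 by apply/dle1;apply/(g_dom hG Gx (g_1 hG));apply/dle1;exact: (t_kO T').
have [d Gd [kd kd' hd1]] := g_lift hG Gx Ox.
have e : x.2 - d.2 = 0 by apply: (t_k0 T')=> //;[exact: (t_kB T')|exact: key].
by have /(G_0P (g_B hG Gx Gd)) := e=> /= /subr0_eq ->.
Qed.
End Good0.
Lemma pmap_sub b H H' : H' `<=` H -> pmap der O k der' O' k' b H -> pmap der O k der' O' k' b H'.
by move=> s h phi v hv;apply: h=> j;apply: s. Qed.
Definition Fr (R : set KK) : set KK := [set x | exists a b, [/\ R a, R b, b.1 != 0, b.2 != 0 & x = a * vv b]].

Section Criterion.
Variables (R H Mon : set KK).
Hypotheses (R1 : R 1) (RB : forall x y, R x -> R y -> R (x - y)) (RM : forall x y, R x -> R y -> R (x * y)).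
Hypothesis Rd : forall x, R x -> Fr R (dd x).
Hypothesis HR : H `<=` R.
Hypothesis Hk : forall c, k c -> exists2 x, H x & x.1 = c.
Hypothesis Hk' : forall x, H x -> k' x.2.
Hypothesis Hel : pmap der O k der' O' k' true H.
Hypothesis M_dom : forall u v, Mon u -> Mon v -> u.1 <=: v.1 <-> u.2 <=:' v.2.
Hypothesis M_pos : forall u, Mon u -> (0 < u.1) = (0 < u.2).
Hypothesis RMon : forall x, R x -> x = 0 \/ exists2 u, Mon u & x.1 ~: u.1 /\ x.2 ~:' u.2.
Let R0P x : R x -> x.1 = 0 <-> x.2 = 0.
move=> /RMon[-> //|[u Mu [s s']]].
by split=> /eqP e;exfalso;[move: (sim_neq0l hO s)|move: (sim_neq0l hO' s')];rewrite e.
Qed.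
Let Rnz x : R x -> x.1 != 0 -> x.2 != 0.
by move=> Rx;apply: contra_neq=> /(R0P Rx). Qed.
Let Rdom x y : R x -> R y -> x.1 <=: y.1 <-> x.2 <=:' y.2.
move=> Rx Ry;case: (RMon Rx)=> [->|[u Mu [s s']]];first by split=> _;exact: dle0x.
case: (RMon Ry)=> [->|[v Mv [t t']]].
 have x1 := sim_neq0l hO s;have x2 := sim_neq0l hO' s'.
 by split=> /dlex0/eqP;[rewrite (negPf x1)|rewrite (negPf x2)].
have [a1 a2] := sim_asymp hO s;have [b1 b2] := sim_asymp hO t.
have [c1 c2] := sim_asymp hO' s';have [d1 d2] := sim_asymp hO' t'.
split=> h.
 apply: (dle_trans hO' c1);apply: (dle_trans hO' _ d2);apply/(M_dom Mu Mv).
 by apply: (dle_trans hO a2);apply: (dle_trans hO h).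
apply: (dle_trans hO a1);apply: (dle_trans hO _ b2);apply/(M_dom Mu Mv).
by apply: (dle_trans hO' c2);apply: (dle_trans hO' h).
Qed.
Let Rpos x : R x -> (0 < x.1) = (0 < x.2).
move=> Rx;case: (RMon Rx)=> [->|[u Mu [s s']]];first by rewrite !ltxx.
by rewrite (sim_gt0 hO hc s) (sim_gt0 hO' hc' s') M_pos.
Qed.
Let R_0 : R 0. by rewrite -(subrr 1);exact: RB. Qed.
Lemma sub_Fr : R `<=` Fr R.
by move=> x Rx;exists x, 1;rewrite !oner_neq0;split=> //;rewrite [LHS]surjective_pairing /vv /= !invr1;congr pair;rewrite mulr1.
Qed.
Lemma FrB x y : Fr R x -> Fr R y -> Fr R (x - y).
move=> [a [b [Ra Rb b1 b2 ->]]] [c [e [Rc Re e1 e2 ->]]].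
exists (a * e - c * b), (b * e);split;[by apply: (RB);exact: RM|exact: RM|by rewrite mulf_neq0|by rewrite mulf_neq0|].
by congr pair=> /=;field;rewrite ?b1 ?b2 ?e1 ?e2.
Qed.
Lemma FrM x y : Fr R x -> Fr R y -> Fr R (x * y).
move=> [a [b [Ra Rb b1 b2 ->]]] [c [e [Rc Re e1 e2 ->]]].
exists (a * c), (b * e);split;[exact: RM|exact: RM|by rewrite mulf_neq0|by rewrite mulf_neq0|].
by congr pair=> /=;field;rewrite ?b1 ?b2 ?e1 ?e2.
Qed.
Let FrV x : Fr R x -> Fr R (vv x).
move=> [a [b [Ra Rb b1 b2 ->]]];have [a1|a1] := eqVneq a.1 0.
 have a2 := (R0P Ra).1 a1;rewrite (_ : vv _ = 0);first by apply: sub_Fr.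
 by rewrite /vv /= a1 a2 !mul0r !invr0.
exists b, a;split=> //;first exact: Rnz.
by congr pair=> /=;rewrite invfM invrK mulrC.
Qed.
(** Order and dominance between elements of [R] reduce to the monomials in [Mon] to which they are
    equivalent in both coordinates, and fractions reduce to [R] by clearing denominators. The
    residue part does not grow: an element of [Fr R] with first coordinate in [k] equals the one of
    [H] above it. *)
Lemma goodk_Fr : goodk (Fr R).
have hB := FrB;have hM := FrM.
have Fpos x : Fr R x -> (0 < x.1) = (0 < x.2).
 move=> [a [b [Ra Rb b1 b2 ->]]] /=;have := Rpos (RM Ra Rb)=> /=.
 have aux (L : RF) (u w : L) : w != 0 -> (0 < u * w) = (0 < u / w).
 move=> w0;rewrite -[u * w](_ : u / w * w ^+ 2 = _);last by field.
 by rewrite pmulr_lgt0 // exprn_even_gt0 //= w0.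
 by rewrite (aux K _ _ b1) (aux K' _ _ b2).
have F0P x : Fr R x -> x.1 = 0 <-> x.2 = 0.
 move=> [a [b [Ra Rb b1 b2 ->]]] /=.
 by split=> /eqP;rewrite mulf_eq0 invr_eq0 ?(negPf b1) ?(negPf b2) orbF=> /eqP /(R0P Ra) ->;rewrite mul0r.
have Feq x y : Fr R x -> Fr R y -> x.1 = y.1 -> x = y.
 move=> Fx Fy e;have := F0P _ (FrB Fx Fy);rewrite /= e subrr=> -[/(_ erefl)/eqP h _].
 by rewrite [x]surjective_pairing [y]surjective_pairing e;congr pair;apply/eqP;rewrite -subr_eq0.
have Fdom x y : Fr R x -> Fr R y -> x.1 <=: y.1 <-> x.2 <=:' y.2.
 move=> [a [b [Ra Rb b1 b2 ->]]] [c [e [Rc Re e1 e2 ->]]].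
 have := Rdom (RM Ra Re) (RM Rc Rb)=> /=.
 have aux (L : RF) (V : set L) (hV : valuation_ring V) (a0 b0 c0 e0 : L) : b0 != 0 -> e0 != 0 ->
 dominated V (a0 / b0) (c0 / e0) <-> dominated V (a0 * e0) (c0 * b0).
 move=> b00 e00;have be : b0 * e0 != 0 by rewrite mulf_neq0.
 have -> : a0 * e0 = a0 / b0 * (b0 * e0) by field.
 have -> : c0 * b0 = c0 / e0 * (b0 * e0) by field.
 by split;[exact: dleMr|exact: (dle_M2r hV be)].
 by rewrite (aux K O hO _ _ _ _ b1 e1) (aux K' O' hO' _ _ _ _ b2 e2).
have kpart x : Fr R x -> k x.1 -> H x.
 move=> Fx kx;have [h Hh e] := Hk kx.
 rewrite (_ : x = h) //;apply: Feq=> //;apply: sub_Fr;exact: HR.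
split;last by move=> c /Hk[x Hx e];exists x=> //;apply: sub_Fr;exact: HR.
split=> //.
- exact: sub_Fr.
- move=> x [a [b [Ra Rb b1 b2 ->]]].
 rewrite (_ : dd _ = (dd a * b - a * dd b) * vv (b * b));last first.
 rewrite /dd /vv /=;congr pair=> /=;rewrite der_div //;by rewrite expr2.
 apply: (FrM);last by apply: (FrV);apply: sub_Fr;exact: RM.
 by apply: (FrB);apply: (FrM);rewrite ?(Rd _) //;[exact: Rd|exact: sub_Fr|exact: sub_Fr|exact: Rd].
- move=> x Fx Ox;have [c kc hcx] := t_lift T Ox;have [d Hd ed] := Hk kc.
 by exists d;[apply: sub_Fr;exact: HR|split;[rewrite ed|exact: Hk'|rewrite ed]].
- apply: pmap_sub Hel=> x [Fx kx];exact: kpart.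
Qed.
End Criterion.

Section MonSum.
Variable Mon : set KK.
Hypothesis M_nz : forall u, Mon u -> u.1 != 0 /\ u.2 != 0.
Hypothesis M_dom : forall u v, Mon u -> Mon v -> u.1 <=: v.1 <-> u.2 <=:' v.2.
Hypothesis M_add : forall u v, Mon u -> Mon v -> u.1 =: v.1 -> u + v = 0 \/ Mon (u + v).
(** Take a dominant summand. If another one is asymptotic to it, [M_add] merges them and the sum
    becomes shorter; if not, it outweighs the rest in both fields. *)
Lemma mon_sum (l : seq KK) : (forall u, u \in l -> Mon u) ->
 \sum_(u <- l) u = 0 \/ exists2 u, Mon u & (\sum_(u <- l) u).1 ~: u.1 /\ (\sum_(u <- l) u).2 ~:' u.2.
move: {2}(size l) (leqnn (size l))=> n;elim: n l=> [|n IH] l.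
 by rewrite leqn0 size_eq0=> /eqP -> _;left;rewrite big_nil.
case: l=> [|u0 l0];first by move=> _ _;left;rewrite big_nil.
set l := u0 :: l0=> sz hl.
have [u ul umax] := asymp_max hO (fun u : KK=> u.1) (mem_head u0 l0 : u0 \in l).
have pe := perm_to_rem ul.
have -> : \sum_(w <- l) w = u + \sum_(w <- rem u l) w by rewrite (perm_big _ pe) big_cons.
have Mr v : v \in rem u l -> Mon v by move=> /mem_rem;exact: hl.
have szr : (size (rem u l) <= n)%N by rewrite size_rem //;rewrite -subn1 leq_subLR add1n.
case: (pselect (exists2 v, v \in rem u l & u.1 <=: v.1))=> [[v vl uv]|nv].
 have pe' := perm_to_rem vl.
 have -> : \sum_(w <- rem u l) w = v + \sum_(w <- rem v (rem u l)) w by rewrite (perm_big _ pe') big_cons.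
 rewrite addrA.
 have szr' : (size (rem v (rem u l)) < n)%N.
 by rewrite size_rem //;case: (size _) szr vl (perm_size pe')=> [|m] //=;rewrite size_rem.
 have Mr' w : w \in rem v (rem u l) -> Mon w by move=> /mem_rem;exact: Mr.
 have vu : v.1 <=: u.1 by apply: umax;exact: mem_rem vl.
 case: (M_add (hl _ ul) (Mr _ vl) (conj uv vu))=> [->|Mw].
 rewrite add0r;apply: IH=> //;exact: ltnW.
 have -> : u + v + \sum_(w <- rem v (rem u l)) w = \sum_(w <- u + v :: rem v (rem u l)) w by rewrite big_cons.
 apply: IH=> // w;rewrite inE=> /orP[/eqP ->//|];exact: Mr'.
right;exists u;first exact: hl.
have [u1 u2] := M_nz (hl _ ul).
have lt1 : (\sum_(j <- rem u l) j).1 <: u.1.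
 rewrite (raddf_sum (@fst K K')) /=;apply: dlt_sum_seq=> // v vl uv;by apply: nv;exists v.
have lt2 : (\sum_(j <- rem u l) j).2 <:' u.2.
 rewrite (raddf_sum (@snd K K')) /=;apply: dlt_sum_seq=> // v vl uv;apply: nv;exists v=> //.
 by apply/M_dom=> //;[exact: hl|exact: Mr].
by split;rewrite /= addrAC subrr add0r.
Qed.
End MonSum.
End Graphs.

(** * Extension of the residue part to all of [k] *)

Section Residue.
Variables (K : RF) (der : K -> K) (O k : set K) (K' : RF)
 (der' : K' -> K') (O' k' : set K').
Notation KK := (K * K')%type.
Notation pmap := (pmap der O k der' O' k').
Notation M := (pst der O k).
Notation N := (pst der' O' k').
Lemma pmap_chain b (C : set (set KK)) : (forall A, C A -> pmap b A) ->
 (forall A B, C A -> C B -> A `<=` B \/ B `<=` A) -> pmap b (\bigcup_(A in C) A).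
move=> hC tot phi v hv;have [n hn] := formula_bound (relf b phi).
have [A CA hA] : exists2 A, C A & forall j, (j < n.+1)%N -> A (v j).
 elim: n.+1=> [|m [A CA hA]];first by have [A CA _] := hv 0%N;exists A.
 have [B CB hB] := hv m;case: (tot A B CA CB)=> s.
 exists B=> // j;rewrite ltnS leq_eqVlt=> /orP[/eqP ->//|/hA/s];exact.
 exists A=> // j;rewrite ltnS leq_eqVlt=> /orP[/eqP ->|/hA//];exact: s.
pose w j := if (j < n)%N then v j else v 0%N.
have hw j : A (w j) by rewrite /w;case: ifP=> h;apply: hA=> //;exact: ltnW.
rewrite (hn M (fst \o v) (fst \o w));last by move=> j hj;rewrite /w /= hj.
rewrite (hn N (snd \o v) (snd \o w));last by move=> j hj;rewrite /w /= hj.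
exact: hC hw.
Qed.
Lemma graph_card (H : set KK) : (forall x y, H x -> H y -> x.1 = y.1 -> x.2 = y.2) ->
 ([set x.2 | x in H] #<= [set: K])%card.
move=> fH;apply/card_le_optP.
exists (fun c=> if pselect (exists2 x, H x & x.1 = c) is left h then Some (sval (cid2 h)).2 else None).
move=> _ [x Hx <-];exists x.1;case: pselect=> [h|[]];last by exists x.
congr Some;case: cid2=> y /= Hy e;exact: fH.
Qed.
Lemma pmap_fun b H x y : pmap b H -> H x -> H y -> x.1 = y.1 -> x.2 = y.2.
move=> hH Hx Hy;have := hH (FEq (@Var _ 0) (@Var _ 1)) (fun j=> if j == 0%N then x else y).
by move=> h;apply: (h _).1=> j;case: ifP.
Qed.

Hypothesis T : tame der O k.
Hypothesis T' : tame der' O' k'.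
Let hO := t_val T.
Let hO' := t_val T'.
Let hc := t_conv T.
Let hc' := t_conv T'.
Let hd := t_der T.
Let hd' := t_der T'.
Local Hint Resolve hO hO' hc hc' hd hd' : core.
Notation "x <: y" := (~ dominated O y x).
Notation "x ~: y" := (~ dominated O y (x - y)).
Notation "x <:' y" := (~ dominated O' y x).
Notation "x ~:' y" := (~ dominated O' y (x - y)).
Notation dd := (dd der der').

Section KMap.
Variable H : set KK.
Hypothesis Hel : pmap true H.
Hypothesis Hk : forall c, k c -> exists2 x, H x & x.1 = c.
Hypothesis Hkk : forall x, H x -> k x.1 /\ k' x.2.
(** The domain of [H] is all of [k], so the value of the term has an image, which elementarity
    identifies. *)
Lemma kmap_term (t : term PS) (v : nat -> KK) : (forall j, H (v j)) ->
 k (@eval_term _ M (fst \o v) t) -> H (@eval_term _ M (fst \o v) t, @eval_term _ N (snd \o v) t).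
move=> hv /Hk[z Hz ez];have := Hel (FEq (@Var _ 0) (trn S t)) (v := scons z v).
move=> h;have {}h := h (fun j=> if j is j'.+1 then hv j' else Hz).
rewrite /= !eval_trn in h.
have e2 : z.2 = @eval_term _ N (snd \o v) t by apply: (h.1 ez).
by rewrite -ez -e2 -surjective_pairing.
Qed.
Let x_ j := @Var PS j.
Lemma kmap_1 : H 1.
have [h0 Hh0 _] := Hk (t_k1 T).
exact: (@kmap_term (@App PS F_one (fun=> x_ 0)) (fun=> h0) (fun=> Hh0) (t_k1 T)).
Qed.
Lemma kmap_B x y : H x -> H y -> H (x - y).
move=> Hx Hy;have hv j : H (if j == 0%N then x else y) by case: ifP.
apply: (@kmap_term (@App PS F_add (args2 (x_ 0) (@App PS F_opp (fun=> x_ 1)))) _ hv).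
by apply: (t_kB T);[exact: (Hkk Hx).1|exact: (Hkk Hy).1].
Qed.
Lemma kmap_M x y : H x -> H y -> H (x * y).
move=> Hx Hy;have hv j : H (if j == 0%N then x else y) by case: ifP.
apply: (@kmap_term (@App PS F_mul (args2 (x_ 0) (x_ 1))) _ hv).
by apply: (t_kM T);[exact: (Hkk Hx).1|exact: (Hkk Hy).1].
Qed.
Lemma kmap_d x : H x -> H (dd x).
move=> Hx;apply: (@kmap_term (@App PS F_der (fun=> x_ 0)) (fun=> x) (fun=> Hx)).
apply: (t_kder T);exact: (Hkk Hx).1.
Qed.
Lemma kmap_0P x : H x -> x.1 = 0 <-> x.2 = 0.
move=> Hx;exact: (Hel (FEq (x_ 0) (@App PS F_zero (fun=> x_ 0))) (v := fun=> x) (fun=> Hx)).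
Qed.
Lemma kmap_pos x : H x -> (0 < x.1) = (0 < x.2).
move=> Hx;rewrite !ltNge;congr negb;apply/idP/idP=> h.
 exact: (Hel (@FRel PS R_le (args2 (x_ 0) (@App PS F_zero (fun=> x_ 0)))) (v := fun=> x) (fun=> Hx)).1.
exact: (Hel (@FRel PS R_le (args2 (x_ 0) (@App PS F_zero (fun=> x_ 0)))) (v := fun=> x) (fun=> Hx)).2.
Qed.

Section Product.
Variable G : set KK.
Hypothesis hG : good0 der O k der' O' k' G.
Hypothesis GH : forall x, G x -> k x.1 -> H x.
Definition prodR : set KK := [set x | exists l : seq (KK * KK),
 (forall q, q \in l -> G q.1 /\ H q.2) /\ x = \sum_(q <- l) q.1 * q.2].
Definition prodM : set KK := [set u | exists e h, [/\ G e, H h, e.1 != 0, h.1 != 0 & u = e * h]].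
Let H_0 : H 0. by rewrite -(subrr 1);apply: kmap_B;exact: kmap_1. Qed.
Let H_D x y : H x -> H y -> H (x + y).
move=> h h';rewrite -(opprK y);apply: kmap_B=> //;rewrite -sub0r;exact: kmap_B.
Qed.
Let H_sum (l : seq (KK * KK)) (f : KK * KK -> KK) : (forall q, q \in l -> H (f q)) -> H (\sum_(q <- l) f q).
move=> h;rewrite big_seq;elim/big_ind: _=> // *;exact: H_D. Qed.
Let H_unit x : H x -> x.1 != 0 -> asymp O x.1 1 /\ asymp O' x.2 1.
move=> Hx x1;have [a b] := Hkk Hx;split;first exact: (k_asymp1 T).
by apply: (k_asymp1 T')=> //;apply: contra_neq x1=> /(kmap_0P Hx).
Qed.
(** Divide by a summand [q] with dominant first factor; the quotients are bounded and have
    representatives [d] in both [G] and [H]. If the main part [Sd] is nonzero, it is a unit and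
    determines the sum. If it is zero, replacing each quotient by its difference from [d] leaves the
    sum unchanged and kills the summand of [q], so the sum gets shorter. *)
Lemma prodR_sim x : prodR x -> x = 0 \/ exists2 u, prodM u & x.1 ~: u.1 /\ x.2 ~:' u.2.
move=> [l [hl ->]].
move: {2}(size l) (leqnn (size l))=> n;elim: n l hl=> [|n IH] l hl.
 by rewrite leqn0 size_eq0=> /eqP ->;left;rewrite big_nil.
case: l hl=> [|q0 l0] hl;first by left;rewrite big_nil.
set l := q0 :: l0 in hl * => sz.
have [q ql qmax] := asymp_max hO (fun q : KK * KK=> q.1.1) (mem_head q0 l0 : q0 \in l).
have [Gq Hq] := hl q ql.
have [q1|q1] := eqVneq q.1.1 0.
 left;rewrite big_seq big1 // => r rl;have [Gr _] := hl r rl.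
 have r0 : r.1.1 = 0 by have := qmax r rl;rewrite q1=> /dlex0.
 have -> : r.1 = 0 by apply: (G_eq hG)=> //;exact: (G_0 hG).
 exact: mul0r.
have q2 : q.1.2 != 0 by apply: contra_neq q1=> /(G_0P hG Gq).
pose f (r : KK * KK) : KK := r.1 * vv q.1.
have Gf r : r \in l -> G (f r) by move=> /hl[Gr _];apply: (g_M hG)=> //;exact: (g_V hG).
have Of r : r \in l -> O (f r).1 by move=> rl;apply/(dleP O)=> //;exact: qmax.
have ex r : exists d, r \in l -> [/\ G d, H d & (f r).1 - d.1 <: 1].
 case: (boolP (r \in l))=> rl;last by exists 0.
 have [d Gd [kd kd' hd1]] := g_lift hG (Gf r rl) (Of r rl).
 exists d=> _;split=> //;exact: GH.
have [d hd1] := choice ex.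
have d' r : r \in l -> (f r).2 - (d r).2 <:' 1.
 move=> rl;have [Gd _ h] := hd1 r rl;move=> h';apply: h.
 exact/(g_dom hG (g_1 hG) (g_B hG (Gf r rl) Gd)).
pose Sd := \sum_(r <- l) d r * r.2.
have HS : H Sd by apply: H_sum=> r rl;apply: kmap_M;[case: (hd1 r rl)|case: (hl r rl)].
have eS : \sum_(r <- l) r.1 * r.2 = q.1 * (Sd + \sum_(r <- l) (f r - d r) * r.2).
 rewrite -big_split /= mulr_sumr;apply: eq_bigr=> r _.
 have -> : r.1 = q.1 * f r.
 by rewrite [LHS]surjective_pairing;congr pair;rewrite /f /= mulrC divfK.
 by rewrite -mulrDl [d r + _]addrC subrK mulrA.
have [s1|s1] := eqVneq Sd.1 0.
 have S0 : Sd = 0 by rewrite [Sd]surjective_pairing s1 ((kmap_0P HS).1 s1).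
 have fq : f q - d q = 0.
 have [Gd Hd h] := hd1 q ql;have e1 : f q = 1.
 by rewrite [f q]surjective_pairing;congr pair;rewrite /f /= mulfV.
 have : (1 - d q).1 = 0.
 apply: (t_k0 T);last by rewrite -e1.
 by apply: (t_kB T);[exact: (t_k1 T)|exact: (Hkk Hd).1].
 move=> /= h1;rewrite e1;apply: (G_eq hG)=> //;[apply: (g_B hG)=> //;exact: (g_1 hG)|exact: (G_0 hG)].
 pose l' : seq (KK * KK) := [seq (q.1 * (f r - d r), r.2) | r <- rem q l].
 have -> : \sum_(r <- l) r.1 * r.2 = \sum_(r <- l') r.1 * r.2.
 rewrite eS S0 add0r mulr_sumr (perm_big _ (perm_to_rem ql)) big_cons fq mul0r mulr0 [LHS]add0r big_map.
 by apply: eq_bigr=> r _;rewrite mulrA.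
 apply: IH=> [_ /mapP[r /mem_rem rl ->]|] /=;last by rewrite size_map size_rem // -subn1 leq_subLR add1n.
 by have [Gd _ _] := hd1 r rl;split;[apply: (g_M hG)=> //;apply: (g_B hG)=> //;exact: Gf|exact: (hl r rl).2].
right;exists (q.1 * Sd);first by exists q.1, Sd.
have [u1 u2] := H_unit HS s1.
set E := \sum_(r <- l) (f r - d r) * r.2 in eS.
have E1 : E.1 <: 1.
 rewrite /E (raddf_sum (@fst K K')) /=;apply: dlt_sum_seq=> //;first exact: oner_neq0.
 move=> r rl;have [_ _ h] := hd1 r rl;rewrite -[X in ~ dominated _ X _]mulr1.
 by apply: dltM=> //;[exact: oner_neq0|apply/dle1;apply: (t_kO T);exact: (Hkk (hl r rl).2).1].
have E2 : E.2 <:' 1.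
 rewrite /E (raddf_sum (@snd K K')) /=;apply: dlt_sum_seq=> //;first exact: oner_neq0.
 move=> r rl;have h := d' r rl;rewrite -[X in ~ dominated _ X _]mulr1.
 by apply: dltM=> //;[exact: oner_neq0|apply/dle1;apply: (t_kO T');exact: (Hkk (hl r rl).2).2].
rewrite eS;split=> /=;rewrite -mulrBr addrAC subrr add0r.
 apply: dltMl=> //;apply: (dlt_le_trans hO E1);exact: u1.2.
apply: dltMl=> //;apply: (dlt_le_trans hO' E2);exact: u2.2.
Qed.
Lemma goodk_prod : goodk der O k der' O' k' (Fr prodR) /\ G `<=` Fr prodR.
have R1 : prodR 1.
 exists [:: (1, 1)];split;last by rewrite big_seq1 mulr1.
 by move=> q;rewrite inE=> /eqP ->;split;[exact: (g_1 hG)|exact: kmap_1].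
have RB x y : prodR x -> prodR y -> prodR (x - y).
 move=> [l [hl ->]] [l' [hl' ->]];exists (l ++ [seq (- q.1, q.2) | q <- l']);split.
 move=> q;rewrite mem_cat=> /orP[/hl//|/mapP[r /hl'[Gr Hr] ->]];by split=> //=;exact: (G_N hG).
 by rewrite big_cat big_map /=;congr (_ + _);rewrite -sumrN;apply: eq_bigr=> q _ /=;rewrite mulNr.
have RM x y : prodR x -> prodR y -> prodR (x * y).
 move=> [l [hl ->]] [l' [hl' ->]];exists [seq (q.1 * r.1, q.2 * r.2) | q <- l, r <- l'];split.
 move=> _ /allpairsP[[q r] /= [/hl[? ?] /hl'[? ?] ->]];split=> /=;[exact: (g_M hG)|exact: kmap_M].
 rewrite mulr_suml big_allpairs_dep /=;apply: eq_bigr=> q _;rewrite mulr_sumr;apply: eq_bigr=> r _ /=.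
 exact: mulrACA.
have Rs x y : G x -> H y -> prodR (x * y).
 move=> Gx Hy;exists [:: (x, y)];split;last by rewrite big_seq1.
 by move=> q;rewrite inE=> /eqP ->.
have R0 : prodR 0 by rewrite -(subrr 1);exact: RB.
have RD x y : prodR x -> prodR y -> prodR (x + y).
 move=> h h';rewrite -(opprK y);apply: (RB)=> //;rewrite -sub0r;exact: RB.
have Rd x : prodR x -> prodR (dd x).
 move=> [l [hl ->]].
 have -> : dd (\sum_(q <- l) q.1 * q.2) = \sum_(q <- l) (dd q.1 * q.2 + q.1 * dd q.2).
 rewrite [RHS]surjective_pairing /dd (raddf_sum (@fst K K')) (raddf_sum (@snd K K')) /=;congr pair.
 by rewrite (raddf_sum (@fst K K')) der_sum //=;apply: eq_bigr=> q _;rewrite derM.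
 by rewrite (raddf_sum (@snd K K')) der_sum //=;apply: eq_bigr=> q _;rewrite derM.
 rewrite big_seq;elim/big_ind: _=> // q /hl[Gq Hq].
 by apply: (RD);apply: Rs=> //;[exact: (g_d hG)|exact: kmap_d].
have GR : G `<=` prodR by move=> x Gx;rewrite -[x]mulr1;apply: Rs=> //;exact: kmap_1.
split;last by move=> x /GR;exact: sub_Fr.
apply: (goodk_Fr T T' (H := H) (Mon := prodM))=> //.
- move=> x /Rd;exact: sub_Fr.
- move=> x Hx;rewrite -[x]mul1r;apply: Rs=> //;exact: (g_1 hG).
- by move=> x /Hkk[].
- move=> u v [e [h [Ge Hh e1 h1 ->]]] [e' [h' [Ge' Hh' e1' h1' ->]]] /=.
 have [[a1 a2] [b1 b2]] := H_unit Hh h1;have [[a1' a2'] [b1' b2']] := H_unit Hh' h1'.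
 have aux (L : RF) (V : set L) (hV : valuation_ring V) (x y c c' : L) :
 asymp V c 1 -> asymp V c' 1 -> dominated V (x * c) (y * c') <-> dominated V x y.
 move=> [p1 p2] [r1 r2];split=> h0.
 rewrite -[x]mulr1 -[y]mulr1;apply: (dle_trans hV (dleMl hV x p2)).
 apply: (dle_trans hV h0);exact: dleMl.
 by apply: (dleM hV h0);apply: (dle_trans hV p1).
 rewrite (aux K O hO _ _ _ _ (conj a1 a2) (conj a1' a2')) (aux K' O' hO' _ _ _ _ (conj b1 b2) (conj b1' b2')).
 exact: (g_dom hG).
- move=> u [e [h [Ge Hh e1 h1 ->]]] /=.
 have e2 : e.2 != 0 by apply: contra_neq e1=> /(G_0P hG Ge).
 have h2 : h.2 != 0 by apply: contra_neq h1=> /(kmap_0P Hh).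
 have aux (L : RF) (x y : L) : x != 0 -> y != 0 -> (0 < x * y) = ((0 < x) == (0 < y)).
 move=> x0 y0;case: (ltgtP 0 x) x0=> // x0 _;case: (ltgtP 0 y) y0=> // y0 _.
 - by rewrite mulr_gt0.
 - by apply/negbTE;rewrite -leNgt mulr_ge0_le0 ?ltW.
 - by apply/negbTE;rewrite -leNgt mulr_le0_ge0 ?ltW.
 - by rewrite nmulr_rgt0.
 by rewrite (aux K) // (aux K') // (g_pos hG Ge) (kmap_pos Hh).
- exact: prodR_sim.
Qed.
End Product.
End KMap.
(** A maximal elementary map between the lifts is defined on all of [k], by saturation alone. The
    compositum of the given field with [k] then carries the extended isomorphism. *)
Lemma residue_step G : good0 der O k der' O' k' G -> @succ_card_saturated _ N K ->
 exists2 G1, goodk der O k der' O' k' G1 & G `<=` G1.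
move=> hG hs.
pose P (H : set KK) := pmap true H /\ forall x, H x -> k x.1 /\ k' x.2.
have [||H [[Hel Hkk] H0 hmax]] := @zorn_sets _ P [set x | G x /\ k x.1].
- split;first exact: (g_el hG).
 by move=> x [Gx kx];split=> //;apply/(G_k T T' hG Gx).
- move=> C _ CP tot;split;first by apply: pmap_chain=> // A /CP[].
 by move=> x [A /CP[_ h] /h].
have Hk c : k c -> exists2 x, H x & x.1 = c.
 move=> kc;have H1 : H 1 by apply: H0;split;[exact: (g_1 hG)|exact: (t_k1 T)].
 have [c' kc' hp] := pmap_ext hs (graph_card (fun x y=> @pmap_fun _ _ x y Hel)) H1 Hel (fun _=> kc).
 exists (c, c')=> //;apply: (hmax (H `|` [set (c, c')]));last by right.
 split=> // x [/Hkk//|->] /=;by split=> //;exact: kc'.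
 by move=> x;left.
have [h1 h2] := goodk_prod Hel Hk Hkk hG (fun x Gx kx=> H0 x (conj Gx kx)).
by exists (Fr (prodR H G)).
Qed.
End Residue.

(** * Zeros of minimal unstable polynomials *)

Section MapMpoly.
Variables (R S : comNzRingType) (f : {rmorphism R -> S}).
Lemma map_mpoly_sum n (P : {mpoly R[n]}) : map_mpoly f P = \sum_(m <- msupp P) f P@_m *: 'X_[m].
apply/mpolyP=> m;rewrite mcoeff_map_mpoly [in LHS](mpolyE P) (raddf_sum (mcoeff m)) (raddf_sum f).
rewrite (raddf_sum (mcoeff m));apply: eq_bigr=> m' _ /=.
by rewrite !mcoeffZ !mcoeffX rmorphM rmorph_nat.
Qed.
Lemma map_mpoly_eval n (P : {mpoly R[n]}) v : f P.@[v] = (map_mpoly f P).@[f \o v].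
rewrite map_mpoly_sum mevalE (raddf_sum f) (raddf_sum (meval _));apply: eq_bigr=> m _ /=.
rewrite mevalZ mevalX rmorphM rmorph_prod;congr (_ * _).
by apply: eq_bigr=> i _;rewrite rmorphXn.
Qed.
Lemma map_mpoly_comp_mpoly n l (P : {mpoly R[n]}) (q : n.-tuple {mpoly R[l]}) :
 map_mpoly f (P \mPo q) = map_mpoly f P \mPo map_tuple (map_mpoly f) q.
rewrite [map_mpoly f P]map_mpoly_sum comp_mpolyEX (raddf_sum (map_mpoly f)) (raddf_sum (comp_mpoly _)).
apply: eq_bigr=> m _ /=;rewrite map_mpolyZ comp_mpolyZ;congr (_ *: _).
rewrite !comp_mpolyX rmorph_prod;apply: eq_bigr=> i _.
by rewrite rmorphXn tnth_map.
Qed.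

Variables (d : R -> R) (e : S -> S).
Hypothesis fd : forall x, f (d x) = e (f x).
Lemma iter_map n x : f (iter n d x) = iter n e (f x).
by elim: n=> //= n IH;rewrite fd IH. Qed.
Lemma map_mpoly_jet n (P : {mpoly R[n]}) a : f P.@[jet d a] = (map_mpoly f P).@[jet e (f a)].
by rewrite map_mpoly_eval;congr meval;apply: funext=> i /=;rewrite /jet iter_map. Qed.
Lemma map_mpoly_asub n (P : {mpoly R[n]}) a s :
 map_mpoly f (P \mPo asub d n a s) = map_mpoly f P \mPo asub e n (f a) (f s).
rewrite map_mpoly_comp_mpoly;congr comp_mpoly;apply: eq_from_tnth=> i.
rewrite tnth_map !tnth_mktuple (raddfD (map_mpoly f)) /=;congr (_ + _);first by rewrite map_mpolyC /= iter_map.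
by rewrite (raddf_sum (map_mpoly f)) /=;apply: eq_bigr=> j _;rewrite map_mpolyZ map_mpolyX !mxE /= rmorphMn /= iter_map.
Qed.
End MapMpoly.
Lemma lift_mpoly (R S : comNzRingType) (pi : R -> S) (G : set R) n (Q : {mpoly S[n]}) : G 0 -> pi 0 = 0 ->
 (forall m, exists2 x, G x & pi x = Q@_m) ->
 exists2 P : {mpoly R[n]}, forall m, G P@_m & forall m, pi P@_m = Q@_m.
move=> G0 p0 h.
have [psi hpsi] := choice (fun m=> let: ex_intro2 x a b := h m in ex_intro (fun x=> G x /\ pi x = Q@_m) x (conj a b)).
pose P : {mpoly R[n]} := \sum_(m <- msupp Q) psi m *: 'X_[m].
have cP m : (m \in msupp Q /\ P@_m = psi m) \/ (m \notin msupp Q /\ P@_m = 0).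
 rewrite (raddf_sum (mcoeff m)) /=;under eq_bigr do rewrite mcoeffZ mcoeffX.
 have [hm|hm] := boolP (m \in msupp Q);[left|right];split=> //.
 rewrite (bigD1_seq m) ?msupp_uniq //= eqxx mulr1 big1 ?addr0 // => m' /negPf ne.
 by rewrite ne mulr0.
 rewrite big1_seq // => m' /andP[_ h'];case: eqP=> [e|_];last by rewrite mulr0.
 by case/negP: hm;rewrite -e.
exists P=> m;case: (cP m)=> -[hm ->] //;try exact: (hpsi m).1;try exact: (hpsi m).2.
by rewrite p0 (memN_msupp_eq0 hm).
Qed.

(** * Transfer of stability along a graph *)

Section VGraph.
Variables (K : RF) (der : K -> K) (O k : set K) (K' : RF)
 (der' : K' -> K') (O' k' : set K').
Hypothesis T : tame der O k.
Hypothesis T' : tame der' O' k'.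
Let hO := t_val T.
Let hO' := t_val T'.
Let hd := t_der T.
Let hd' := t_der T'.
Local Hint Resolve hO hO' hd hd' : core.
Notation KK := (K * K')%type.
Notation "x <=: y" := (dominated O x y).
Notation "x <: y" := (~ dominated O y x).
Notation "x <=:' y" := (dominated O' x y).
Notation "x <:' y" := (~ dominated O' y x).
Notation dd := (dd der der').
Notation vv := (@vv K K').

(** Order and lift are left out. What remains suffices for stability and holds also for an
    elementary embedding restricted to a differential subfield. *)
Record vgraph (G : set KK) : Prop := VGraph {
 v_1 : G 1;v_B : forall x y, G x -> G y -> G (x - y);v_M : forall x y, G x -> G y -> G (x * y);
 v_V : forall x, G x -> G (vv x);v_d : forall x, G x -> G (dd x);
 v_0 : forall x, G x -> x.1 = 0 <-> x.2 = 0;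
 v_dom : forall x y, G x -> G y -> x.1 <=: y.1 <-> x.2 <=:' y.2 }.
Lemma good0_vgraph G : good0 der O k der' O' k' G -> vgraph G.
move=> h;split;[exact: (g_1 h)|exact: (g_B h)|exact: (g_M h)|exact: (g_V h)|exact: (g_d h)
|exact: (G_0P h)|exact: (g_dom h)].
Qed.

Variable G : set KK.
Hypothesis hG : vgraph G.
Let F : set K := [set x.1 | x in G].
Let F' : set K' := [set x.2 | x in G].
Let G0 : G 0. by rewrite -(subrr 1);apply: (v_B hG);exact: (v_1 hG). Qed.
Lemma vgraph_dom : diff_subfield der F.
split;first split;first by exists 1=> //;exact: (v_1 hG).
- move=> _ _ [x Gx <-] [y Gy <-];exists (x - y)=> //;exact: (v_B hG).
- move=> _ _ [x Gx <-] [y Gy <-];exists (x * vv y)=> //;apply: (v_M hG)=> //;exact: (v_V hG).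
- move=> _ [x Gx <-];exists (dd x)=> //;exact: (v_d hG).
Qed.
Lemma vgraph_rng : diff_subfield der' F'.
split;first split;first by exists 1=> //;exact: (v_1 hG).
- move=> _ _ [x Gx <-] [y Gy <-];exists (x - y)=> //;exact: (v_B hG).
- move=> _ _ [x Gx <-] [y Gy <-];exists (x * vv y)=> //;apply: (v_M hG)=> //;exact: (v_V hG).
- move=> _ [x Gx <-];exists (dd x)=> //;exact: (v_d hG).
Qed.
Definition pr1 n (Q : {mpoly KK[n]}) : {mpoly K[n]} := map_mpoly (@fst K K' : {rmorphism KK -> K}) Q.
Definition pr2 n (Q : {mpoly KK[n]}) : {mpoly K'[n]} := map_mpoly (@snd K K' : {rmorphism KK -> K'}) Q.
Definition overG n (Q : {mpoly KK[n]}) := forall m, G Q@_m.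
Lemma pr1_jet n (Q : {mpoly KK[n]}) a : (Q.@[jet dd a]).1 = (pr1 Q).@[jet der a.1].
exact: (map_mpoly_jet (f := @fst K K' : {rmorphism KK -> K})). Qed.
Lemma pr2_jet n (Q : {mpoly KK[n]}) a : (Q.@[jet dd a]).2 = (pr2 Q).@[jet der' a.2].
exact: (map_mpoly_jet (f := @snd K K' : {rmorphism KK -> K'})). Qed.
Lemma pr1_coef n (Q : {mpoly KK[n]}) m : (pr1 Q)@_m = (Q@_m).1. exact: mcoeff_map_mpoly. Qed.
Lemma pr2_coef n (Q : {mpoly KK[n]}) m : (pr2 Q)@_m = (Q@_m).2. exact: mcoeff_map_mpoly. Qed.
Lemma pr_eq0 n (Q : {mpoly KK[n]}) : overG Q -> (pr1 Q == 0) = (pr2 Q == 0).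
move=> hQ;apply/eqP/eqP=> h;apply/mpolyP=> m;rewrite ?pr1_coef ?pr2_coef mcoeff0;apply/(v_0 hG (hQ m)).
 by rewrite -pr1_coef h mcoeff0.
by rewrite -pr2_coef h mcoeff0.
Qed.
Lemma overG_eval n (Q : {mpoly KK[n]}) v : overG Q -> (forall i, G (v i)) -> G Q.@[v].
by move=> hQ hv;apply: A_meval=> //;[exact: v_1|exact: v_B|exact: v_M]. Qed.
Lemma G_iter n x : G x -> G (iter n dd x).
move=> h;elim: n=> //= n;exact: (v_d hG). Qed.
Lemma lift1 n (Q : {mpoly K[n]}) : (forall m, F Q@_m) -> exists2 P, overG P & pr1 P = Q.
move=> hQ;have [P hP e] := lift_mpoly (pi := @fst K K') G0 erefl (fun m=> hQ m).
by exists P=> //;apply/mpolyP=> m;rewrite pr1_coef e.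
Qed.
Lemma lift2 n (Q : {mpoly K'[n]}) : (forall m, F' Q@_m) -> exists2 P, overG P & pr2 P = Q.
move=> hQ;have [P hP e] := lift_mpoly (pi := @snd K K') G0 erefl (fun m=> hQ m).
by exists P=> //;apply/mpolyP=> m;rewrite pr2_coef e.
Qed.
Lemma StabAt_transfer n (Q : {mpoly KK[n]}) a s : overG Q -> G a -> G s ->
 StabAt der O (pr1 Q) a.1 s.1 <-> StabAt der' O' (pr2 Q) a.2 s.2.
move=> hQ Ga Gs.
have Gv : G Q.@[jet dd a] by apply: overG_eval=> // i;exact: G_iter.
have Gc m : G (Q \mPo asub dd n a s)@_m.
 by apply: A_comp=> //;rewrite ?A_asub //;try solve [exact: v_1|exact: v_B|exact: v_M];move=> i m';apply: A_asub=> //;[exact: v_1|exact: v_B|exact: v_M|exact: v_d].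
have e1 m : ((Q \mPo asub dd n a s)@_m).1 = (pr1 Q \mPo asub der n a.1 s.1)@_m.
 by rewrite -pr1_coef /pr1 (map_mpoly_asub (f := @fst K K' : {rmorphism KK -> K}) (e := der)).
have e2 m : ((Q \mPo asub dd n a s)@_m).2 = (pr2 Q \mPo asub der' n a.2 s.2)@_m.
 by rewrite -pr2_coef /pr2 (map_mpoly_asub (f := @snd K K' : {rmorphism KK -> K'}) (e := der')).
rewrite /StabAt -pr1_jet -pr2_jet;split=> -[h1 h2].
 split;first by apply: contra_neq h1=> /(v_0 hG Gv).
 by move=> m m0;rewrite -e2=> h;apply: (h2 m m0);rewrite -e1;exact/(v_dom hG Gv (Gc m)).
split;first by apply: contra_neq h1=> /(v_0 hG Gv).
by move=> m m0;rewrite -e1=> h;apply: (h2 m m0);rewrite -e2;exact/(v_dom hG Gv (Gc m)).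
Qed.
Definition cutrel y y' := forall a s, G a -> G s -> y - a.1 <=: s.1 <-> y' - a.2 <=:' s.2.

Section Cut.
Variables (y : K) (y' : K').
Hypothesis cr : cutrel y y'.
Hypothesis himm : forall b, F b -> exists2 b1, F b1 & y - b1 <: y - b.
Lemma cut_imm : forall b, F' b -> exists2 b1, F' b1 & y' - b1 <:' y' - b.
move=> _ [b Gb <-];have [_ [b1 Gb1 <-] h] := himm (ex_intro2 _ _ b Gb erefl).
exists b1.2;first by exists b1.
have [_ [s Gs <-] [s0 hs]] := cutF T vgraph_dom himm (ex_intro2 _ _ b1 Gb1 erefl).
apply: (dle_lt_trans hO' ((cr Gb1 Gs).1 hs.2))=> h';apply: h.
apply: (dle_trans hO ((cr Gb Gs).2 h'));exact: hs.1.
Qed.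
Lemma Stab_transfer n (Q : {mpoly KK[n]}) : overG Q ->
 Stab der O F y (pr1 Q) <-> Stab der' O' F' y' (pr2 Q).
move=> hQ;split=> [[_ [_ [[a Ga <-] [s Gs <-] s0 h st]]]|[_ [_ [[a Ga <-] [s Gs <-] s0 h st]]]].
 exists a.2, s.2;split;[by exists a|by exists s| |exact/(cr Ga Gs)|exact/(StabAt_transfer hQ Ga Gs)].
 by apply: contra_neq s0=> /(v_0 hG Gs).
exists a.1, s.1;split;[by exists a|by exists s| |exact/(cr Ga Gs)|exact/(StabAt_transfer hQ Ga Gs)].
by apply: contra_neq s0=> /(v_0 hG Gs).
Qed.
Lemma dlast_pr r (Q : {mpoly KK[r.+1]}) : overG Q -> dlast (pr1 Q) = dlast (pr2 Q).
move=> hQ;apply/eqP;rewrite eqn_leq;apply/andP;split;apply: dlast_leP=> m nz;apply: dlast_le.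
 by apply: contra_neq nz;rewrite pr1_coef pr2_coef=> /(v_0 hG (hQ m)).
by apply: contra_neq nz;rewrite pr1_coef pr2_coef=> /(v_0 hG (hQ m)).
Qed.
Lemma msize_pr n (Q : {mpoly KK[n]}) : overG Q -> msize (pr1 Q) = msize (pr2 Q).
move=> hQ;apply/eqP;rewrite eqn_leq;apply/andP;split;apply: msize_leP=> m nz;apply: msize_mdeg_lt;rewrite mcoeff_msupp.
 by apply: contra_neq nz;rewrite pr1_coef pr2_coef=> /(v_0 hG (hQ m)).
by apply: contra_neq nz;rewrite pr1_coef pr2_coef=> /(v_0 hG (hQ m)).
Qed.
Lemma MinUnst_transfer r (P : {mpoly KK[r.+1]}) : overG P ->
 MinUnst der O F y (pr1 P) -> MinUnst der' O' F' y' (pr2 P).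
move=> hP mu;split.
- by move=> m;rewrite pr2_coef;exists P@_m.
- rewrite -pr_eq0 //;exact: mu_0 mu.
- move/(Stab_transfer hP);exact: mu_un mu.
- move=> Q /lift2[Q1 hQ1 <-];rewrite -pr_eq0 // => Q0;apply/(Stab_transfer hQ1).
 by apply: (mu_ord mu)=> // m;rewrite pr1_coef;exists Q1@_m.
- move=> Q /lift2[Q1 hQ1 <-];rewrite -pr_eq0 // -!dlast_pr // => Q0 lt;apply/(Stab_transfer hQ1).
 by apply: (mu_deg mu)=> // m;rewrite pr1_coef;exists Q1@_m.
- move=> Q /lift2[Q1 hQ1 <-];rewrite -pr_eq0 // -!dlast_pr // -!msize_pr // => Q0 le lt;apply/(Stab_transfer hQ1).
 by apply: (mu_size mu)=> // m;rewrite pr1_coef;exists Q1@_m.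
Qed.
End Cut.
End VGraph.

Section ElemHom.
Variables (K : RF) (der : K -> K) (O k : set K) (K' : RF)
 (der' : K' -> K') (O' k' : set K') (i : K -> K').
Hypothesis hi : elem der O k der' O' k' i.
Notation e2 a b := (fun j : nat=> if j is 0%N then a else b).
Lemma iD x y : i (x + y) = i x + i y.
by apply: (elem_term hi (T := fun K d v=> v 0%N + v 1%N) (e2 x y));te. Qed.
Lemma iM x y : i (x * y) = i x * i y.
by apply: (elem_term hi (T := fun K d v=> v 0%N * v 1%N) (e2 x y));te. Qed.
Lemma iN x : i (- x) = - i x.
by apply: (elem_term hi (T := fun K d v=> - v 0%N) (fun=> x));te. Qed.
Lemma iB x y : i (x - y) = i x - i y. by rewrite iD iN. Qed.
Lemma i1 : i 1 = 1.
by apply: (elem_term hi (T := fun K d v=> 1) (fun=> 0));te. Qed.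
Lemma i0 : i 0 = 0.
by apply: (elem_term hi (T := fun K d v=> 0) (fun=> 0));te. Qed.
Lemma ider x : i (der x) = der' (i x).
by apply: (elem_term hi (T := fun K d v=> d (v 0%N)) (fun=> x));te. Qed.
Lemma i_inj : injective i.
move=> x y;apply: (elem_expr hi (P := fun K d O k v=> v 0%N = v 1%N) (e2 x y) _).2;by ex.
Qed.
Lemma i_eq0 x : (i x == 0) = (x == 0).
by rewrite -i0 (inj_eq i_inj). Qed.
Lemma iV x : i x^-1 = (i x)^-1.
have [->|x0] := eqVneq x 0;first by rewrite invr0 i0 invr0.
have ix : i x != 0 by rewrite i_eq0.
by apply: (mulfI ix);rewrite -iM !mulfV // i1.
Qed.
Lemma idom x y : dominated O x y <-> dominated O' (i x) (i y).
by apply: (elem_expr hi (P := fun K d O k v=> dominated O (v 0%N) (v 1%N)) (e2 x y) _);ex. Qed.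
Lemma i_lt x y : (x < y) = (i x < i y).
have q : x < y <-> i x < i y by apply: (elem_expr hi (P := fun K d O k v=> v 0%N < v 1%N) (e2 x y) _);ex.
by apply/idP/idP=> h;apply/q.
Qed.
Lemma i_le x y : (x <= y) = (i x <= i y). by rewrite !leNgt i_lt. Qed.
Lemma ik x : k x <-> k' (i x).
by apply: (elem_expr hi (P := fun K d O k v=> k (v 0%N)) (fun=> x) _);ex. Qed.
Lemma elem_vgraph (F : set K) : diff_subfield der F ->
 vgraph der O der' O' [set x | F x.1 /\ x.2 = i x.1].
move=> [hF Fd];have [F1 FB Fdv] := hF;split.
- by split=> //=;rewrite i1.
- by move=> x y [Fx ex] [Fy ey];split=> /=;[exact: FB|rewrite ex ey iB].
- by move=> x y [Fx ex] [Fy ey];split=> /=;[exact: FM|rewrite ex ey iM].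
- by move=> x [Fx ex];split=> /=;[exact: FV|rewrite ex iV].
- by move=> x [Fx ex];split=> /=;[exact: Fd|rewrite ex ider].
- by move=> x [Fx ->];split=> [->|/eqP];[rewrite i0|rewrite i_eq0=> /eqP].
- move=> x y [Fx ->] [Fy ->];exact: idom.
Qed.
End ElemHom.
(** First-order form of [Dom]. The [a l] stand for the partial derivatives at [w], the inner sums
    for the linear coefficients in the scale [t], and the smallness of the coefficients of higher
    degree is replaced by smallness of the values of the remainder on [O]. *)
Definition DomE (K : RF) (der : K -> K) (O : set K) n (ms : seq 'X_{1..n})
 (c : 'I_(size ms) -> K) (w : K) (a : 'I_n -> K) (t : K) :=
 exists j1 : 'I_n, [/\ \sum_(l < n) a l * (iter (l - j1) der t *+ 'C(l, j1)) != 0,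
 forall j : 'I_n, dominated O (\sum_(l < n) a l * (iter (l - j) der t *+ 'C(l, j)))
 (\sum_(l < n) a l * (iter (l - j1) der t *+ 'C(l, j1)))
 & forall u, dominated O u 1 ->
 ~ dominated O (\sum_(l < n) a l * (iter (l - j1) der t *+ 'C(l, j1)))
 (pterm der c (w + t * u) - pterm der c w - \sum_(l < n) a l * iter l der (t * u))].
Lemma e_DomE n (ms : seq 'X_{1..n}) c w a t : (forall j, texpr (c j)) -> texpr w -> (forall l, texpr (a l)) -> texpr t ->
 expr (fun K d O k v=> @DomE K d O n ms (fun j=> c j K d v) (w K d v) (fun l=> a l K d v) (t K d v)).
have sh T : texpr T -> texpr (fun K d v=> T K d (fun j=> v j.+1)).
 by move=> [u hu];exists (trn S u)=> K d O k v;rewrite eval_trn hu.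
move=> hc hw ha ht;rewrite /DomE;apply: e_ex_fin=> j1.
have hE (j : 'I_n) : texpr (fun K d v=> \sum_(l < n) a l K d v * (iter (l - j) d (t K d v) *+ 'C(l, j))).
 te=> //;exact: ht.
apply: (@e_ext (fun K d O k v=> (\sum_(l < n) a l K d v * (iter (l - j1) d (t K d v) *+ 'C(l, j1)) != 0) /\
 ((forall j : 'I_n, dominated O (\sum_(l < n) a l K d v * (iter (l - j) d (t K d v) *+ 'C(l, j)))
 (\sum_(l < n) a l K d v * (iter (l - j1) d (t K d v) *+ 'C(l, j1)))) /\
 forall u, dominated O u 1 ->
 ~ dominated O (\sum_(l < n) a l K d v * (iter (l - j1) d (t K d v) *+ 'C(l, j1)))
 (pterm d (fun j=> c j K d v) (w K d v + t K d v * u) - pterm d (fun j=> c j K d v) (w K d v) - \sum_(l < n) a l K d v * iter l d (t K d v * u))))).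
 by move=> K d O k v;split=> [[x [y z]]|[x y z]].
apply: e_and;first by apply: e_neq;[exact: hE|te].
apply: e_and;first by apply: e_all_fin=> j;apply: e_dom;exact: hE.
apply: e_all;apply: e_imp;first by ex.
apply: e_not;apply: e_dom;first exact: (sh _ (hE j1)).
have hc' j := sh _ (hc j);have ha' l := sh _ (ha l);have hw' := sh _ hw;have ht' := sh _ ht.
apply: te_D;first apply: te_D.
- apply: te_pterm=> //;apply: te_D=> //;apply: te_M=> //;exact: te_var.
- by apply: te_N;apply: te_pterm.
- apply: te_N;apply: te_sum=> l;apply: te_M=> //;apply: te_iter;apply: te_M=> //;exact: te_var.
Qed.

(** * The linear part of a conjugate as a differential operator *)

Section LinearPart.
Variables (K : RF) (der : K -> K) (O k : set K).
Hypothesis T : tame der O k.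
Notation "x <: y" := (~ dominated O y x).
Let hO := t_val T.
Let hd := t_der T.
Local Hint Resolve hO hd : core.
Lemma Lmx_jet n (t u : K) (l : 'I_n) : \sum_j Lmx der n t l j * iter j der u = iter l der (t * u).
have := asub_eval T ('X_l : {mpoly K[n]}) 0 t u;rewrite mevalXU /jet add0r=> <-.
rewrite comp_mpolyXU -tnth_nth tnth_mktuple mevalD mevalC iter_der0 // add0r (raddf_sum (meval _)) /=.
by apply: eq_bigr=> j _;rewrite mevalZ mevalXU.
Qed.
Lemma sum_Lmx n (a : 'I_n -> K) (t u : K) :
 \sum_(j < n) (\sum_(l < n) a l * (iter (l - j) der t *+ 'C(l, j))) * iter j der u =
 \sum_l a l * iter l der (t * u).
under eq_bigr do rewrite mulr_suml;rewrite exchange_big /=;apply: eq_bigr=> l _.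
rewrite -Lmx_jet mulr_sumr;apply: eq_bigr=> j _;by rewrite mxE mulrA.
Qed.
Lemma Dom_DomE r (P : {mpoly K[r.+1]}) w t : Dom der O w P t ->
 DomE der O (fun j : 'I_(size (msupp P))=> P@_(tnth (in_tuple (msupp P)) j)) w
 (fun l=> (P^`M(l)).@[jet der w]) t.
move=> [j1 [r0 [h1 h2]]];set R := P \mPo asub der r.+1 w t in r0 h1 h2.
have cE j : R@_U_(j) = \sum_(l < r.+1) (P^`M(l)).@[jet der w] * (iter (l - j) der t *+ 'C(l, j)).
 have := congr1 (mcoeff 0%MM) (mderiv_asub der P w t j).
 rewrite mcoeff_mderiv add0m mnm0E mulr1n=> ->;rewrite (raddf_sum (mcoeff _)) /=.
 by apply: eq_bigr=> l _;rewrite mcoeffZ asub_coef0 mxE mulrC.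
have pE x : pterm der (fun j : 'I_(size (msupp P))=> P@_(tnth (in_tuple (msupp P)) j)) x = P.@[jet der x].
 by rewrite -pterm_eval -mpoly_pterm.
exists j1;rewrite -!cE;split=> // [j|u hu];first by rewrite -cE.
rewrite !pE -sum_Lmx.
under eq_bigr do rewrite -cE.
pose R' := R - \sum_j R@_U_(j) *: 'X_j.
have R'c m : m != 0%MM -> R'@_m <: R@_U_(j1).
 have -> : R'@_m = R@_m - \sum_j R@_U_(j) * (U_(j)%MM == m)%:R.
 rewrite /R' mcoeffB;congr (_ - _);rewrite (raddf_sum (mcoeff m)) /=.
 by apply: eq_bigr=> j _;rewrite mcoeffZ mcoeffX.
 rewrite -mdeg_eq0;case e : (mdeg m)=> [//|[|d]] _.
 move/eqP/mdeg1P: e=> [j /eqP ->];rewrite (bigD1 j) //= eqxx mulr1 big1 ?addr0 ?subrr;first exact: dlt0x.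
 by move=> l ne;rewrite mnm1_eq (negPf ne) mulr0.
 rewrite big1 ?subr0;first by apply: h2;rewrite e.
 by move=> j _;case: eqP=> [ej|_];rewrite ?mulr0 //;rewrite -ej mdeg1 in e.
have Ou : O u by apply/dle1.
have := meval_sub0_lt T r0 (jet_O T (n := r.+1) Ou) R'c.
have e0 : R'@_0 = P.@[jet der w].
 have -> : R'@_0 = R@_0 - (\sum_(j < r.+1) R@_U_(j) *: 'X_j)@_0 by rewrite /R' mcoeffB.
 rewrite [X in _ - X](_ : _ = 0) ?subr0 ?asub_coef0 // (raddf_sum (mcoeff _)) /= big1 // => j _.
 by rewrite mcoeffZ mcoeffX -mdeg_eq0 mdeg1 mulr0.
rewrite e0 mevalB (asub_eval T) (raddf_sum (meval _)) /=.
under eq_bigr do rewrite mevalZ mevalXU.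
by rewrite addrAC.
Qed.

End LinearPart.

Section Zeros.
Variables (K : RF) (der : K -> K) (O k : set K).
Hypothesis T : tame der O k.
Notation "x <=: y" := (dominated O x y).
Notation "x <: y" := (~ dominated O y x).
Let hO := t_val T.
Let hd := t_der T.
Local Hint Resolve hO hd : core.
Variable F : set K.
Hypothesis hF : diff_subfield der F.
Hypothesis Fxx : exists x, [/\ k x, der x = 1 & F x].
Hypothesis Fdiv : forall (e : K) n, F e -> e != 0 -> exists2 b, F b & asymp O (b ^+ n.+1) e.
Variable w : K.
Hypothesis himm : forall b, F b -> exists2 b1, F b1 & w - b1 <: w - b.
Variables (r : nat) (P : {mpoly K[r.+1]}).
Hypothesis mu : MinUnst der O F w P.
Let ms := msupp P.
Let c (j : 'I_(size ms)) := P@_(tnth (in_tuple ms) j).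
Let pE x : P.@[jet der x] = pterm der c x. by rewrite -pterm_eval -mpoly_pterm. Qed.

Section Ext.
Variables (K' : RF) (der' : K' -> K') (O' k' : set K') (i : K -> K').
Hypothesis hi : elem der O k der' O' k' i.
Hypothesis hs : @succ_card_saturated _ (pst der' O' k') K.
Let T' : tame der' O' k' := tame_elem hi T.
Let hO' := t_val T'.
Notation "x <=:' y" := (dominated O' x y).
Notation "x <:' y" := (~ dominated O' y x).
Let G := [set x : K * K' | F x.1 /\ x.2 = i x.1].
Let hG : vgraph der O der' O' G := elem_vgraph hi hF.
Let F' := [set x.2 | x in G].
Let F1 : [set x.1 | x in G] = F.
apply/seteqP;split=> [_ [x [Fx _] <-]//|x Fx];by exists (x, i x).
Qed.
Let F'P x : F' x <-> exists2 b, F b & x = i b.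
by split=> [[y [Fy ey] <-]|[b Fb ->]];[exists y.1|exists (b, i b)]. Qed.
Let cr : cutrel O O' G w (i w).
move=> a s [Fa ->] [Fs ->];rewrite -(iB hi);exact: idom. Qed.
Let hF' : diff_subfield der' F' := vgraph_rng hG.
Let himm' b : F' b -> exists2 b1, F' b1 & i w - b1 <:' i w - b.
by apply: (cut_imm T T' hG cr);rewrite F1. Qed.
Let Fdiv' (e : K') n : F' e -> e != 0 -> exists2 b, F' b & asymp O' (b ^+ n.+1) e.
move=> /F'P[x Fx ->];rewrite (i_eq0 hi)=> x0;have [b Fb [h1 h2]] := Fdiv n Fx x0.
have iX m : i (b ^+ m) = i b ^+ m by elim: m=> [|m IH];rewrite ?expr0 ?(i1 hi) // !exprS (iM hi) IH.
by exists (i b);[apply/F'P;exists b|rewrite -iX;split;apply/(idom hi)].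
Qed.
Let liftP : exists2 P', overG G P' & pr1 P' = P.
apply: lift1 hG _ _ _;rewrite F1;exact: mu_F mu. Qed.
Let PP := sval (cid2 liftP).
Let PPG : overG G PP. by rewrite /PP;case: cid2. Qed.
Let PP1 : pr1 PP = P. by rewrite /PP;case: cid2. Qed.
Let P' := pr2 PP.
Let P'c m : P'@_m = i P@_m.
by rewrite pr2_coef -PP1 pr1_coef;have [_ ->] := PPG m. Qed.
Let mu' : MinUnst der' O' F' (i w) P'.
by have := MinUnst_transfer hG cr PPG;rewrite F1 PP1;apply. Qed.
Let p'E x : P'.@[jet der' x] = pterm der' (fun j=> i (c j)) x.
rewrite -pterm_eval;congr meval;apply/mpolyP=> m;rewrite P'c.
case: (pterm_coef (msupp_uniq P) (fun j=> i (c j)) m)=> [[j -> ->] //|[hm ->]].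
by rewrite (memN_msupp_eq0 hm) (i0 hi).
Qed.
Let a'E l : (P'^`M(l)).@[jet der' (i w)] = i (P^`M(l)).@[jet der w].
have em (x : K * K') n0 : (x *+ n0).1 = x.1 *+ n0 /\ (x *+ n0).2 = x.2 *+ n0.
 by elim: n0=> [|n0 [h1 h2]];rewrite ?mulr0n // !mulrS /= h1 h2.
have hA := elem_vgraph hi (F := setT) (conj (And3 I (fun _ _ _ _=> I) (fun _ _ _ _=> I)) (fun _ _=> I)).
have GA m : [set x : K * K' | setT x.1 /\ x.2 = i x.1] (PP^`M(l))@_m.
 split=> //=;rewrite mcoeff_mderiv.
 have [_ e] := PPG (m + U_(l))%MM.
 rewrite (em _ _).1 (em _ _).2 e;elim: ((m l).+1)=> [|n0 IH];first by rewrite !mulr0n (i0 hi).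
 by rewrite !mulrS (iD hi) IH.
have [] := overG_eval hA GA (v := jet (dd der der') (w, i w)).
 by move=> j;apply: (G_iter hA).
move=> _;rewrite pr1_jet pr2_jet /= => e.
have -> : P'^`M(l) = pr2 (PP^`M(l)).
 by apply/mpolyP=> m;rewrite pr2_coef !mcoeff_mderiv pr2_coef (em _ _).2.
rewrite e;congr (i (meval _ _)).
by apply/mpolyP=> m;rewrite pr1_coef !mcoeff_mderiv -PP1 pr1_coef (em _ _).1.
Qed.
Let A := range i.
Let cA : (A #<= [set: K])%card. by apply: card_le_image;exact: card_lexx. Qed.
(** No scale in [K] itself need fill the cut of [w], but by saturation one in [K'] does, and it
    inherits every condition satisfied by scales of [K] arbitrarily close to the cut. *)
Lemma realize_cut (Q : K' -> Prop) : cond der' O' k' A Q ->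
 (forall b0, F b0 -> exists t, [/\ t != 0, t <: w - b0, exists2 b1, F b1 & w - b1 <=: t & Q (i t)]) ->
 exists2 t, incut O' F' (i w) t & Q t.
move=> cQ hQ.
pose Cb b : K' -> Prop := fun t=> t != 0 /\ t <:' i w - i b.
pose Cs s : K' -> Prop := fun t=> i s <:' t.
pose small s := [/\ F s, s != 0 & forall b, F b -> s <: w - b].
pose Cset := [set C | C = Q \/ (exists2 b, F b & C = Cb b) \/ (exists2 s, small s & C = Cs s)].
have [C [->//|[[b Fb ->]|[s hs1 ->]]]|l hl|t ht] := @realize _ der' O' k' K A hs cA Cset.
- exists (fun K d O k v=> v 0%N != 0 /\ ~ dominated O (v 1%N - v 2%N) (v 0%N)), (fun j=> if j is 0%N then i w else i b).
 by split;[ex|case=> [|j];[exists w|exists b]|].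
- exists (fun K d O k v=> ~ dominated O (v 0%N) (v 1%N)), (fun=> i s).
 by split;[ex|move=> j;exists s|].
- have [b0 Fb0 hb0] : exists2 b0, F b0 & forall t, t != 0 -> t <: w - b0 -> (exists2 b1, F b1 & w - b1 <=: t) ->
 Q (i t) -> forall C, List.In C l -> C (i t).
 elim: l hl=> [|C l IH] hl;first by exists 0=> //;exact: (F0 hF.1).
 have [|b0 Fb0 h0] := IH;first by move=> C' h;apply: hl;right.
 have := hl C (or_introl erefl)=> -[eC|[[b Fb eC]|[s [Fs s0 sb] eC]]].
 + by exists b0=> // t t0 tb ht qt C' [<-|];[rewrite eC|exact: h0].
 + case: (dle_total hO (w - b0) (w - b))=> h.
 exists b0=> // t t0 tb ht qt C' [<-|];last exact: h0.
 rewrite eC;split;first by rewrite (i_eq0 hi).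
 rewrite -(iB hi);move/(idom hi)=> h';apply: tb;exact: (dle_trans hO h h').
 exists b=> // t t0 tb ht qt C' [<-|].
 rewrite eC;split;first by rewrite (i_eq0 hi).
 by rewrite -(iB hi);move/(idom hi).
 apply: h0=> //;move=> h';apply: tb;exact: (dle_trans hO h h').
 + exists b0=> // t t0 tb ht qt C' [<-|];last exact: h0.
 rewrite eC;move/(idom hi)=> h';have [b1 Fb1 h1] := ht;apply: (sb b1 Fb1).
 exact: (dle_trans hO h1 h').
 have [t [t0 tb ht qt]] := hQ b0 Fb0;exists (i t);exact: hb0.
exists t;last by apply: ht;left.
have t0 : t != 0.
 by have [] : Cb 0 t by apply: ht;right;left;exists 0=> //;exact: (F0 hF.1).
split=> // [_ /F'P[b Fb ->]|_ /F'P[s Fs ->]].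
 by have [] : Cb b t by apply: ht;right;left;exists b.
rewrite (i_eq0 hi)=> s0 sb;have : Cs s t;last by [].
apply: ht;right;right;exists s=> //;split=> // b Fb h;apply: (sb (i b));first by apply/F'P;exists b.
by rewrite -(iB hi);exact/(idom hi).
Qed.
(** In a scale of [K'] filling the cut the linear part dominates. The inequality needed for
    [Dom_zero] comes from [unstable_near], whose points [b1] provide the scales [b1 - w] near the
    cut. *)
Lemma zero_ext b : F b -> exists2 z, pterm der' (fun j=> i (c j)) z = 0 & z - i w <:' i w - i b.
move=> Fb.
have [||t ht hQ] := @realize_cut (fun t=> P'.@[jet der' (i w)] <=:' P'.@[jet der' (i w + t)] - P'.@[jet der' (i w)]).
- exists (fun K d O k v=> dominated O (pterm d (fun j : 'I_(size ms)=> v (j.+2)) (v 1%N))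
 (pterm d (fun j : 'I_(size ms)=> v (j.+2)) (v 1%N + v 0%N) - pterm d (fun j : 'I_(size ms)=> v (j.+2)) (v 1%N))).
 exists (scons (i w) (fun j=> if insub j is Some j' then i (c j') else i 0));split.
 + by ex.
 + by case=> [|j] /=;[exists w|case: insubP=> [j' _ _|_];[exists (c j')|exists 0]].
 + move=> t;rewrite !p'E /=;have -> : (fun j : 'I_(size ms)=> if insub (j : nat) is Some j' then i (c j') else i 0) = (fun j=> i (c j)).
 by apply: funext=> j;rewrite valK.
 by [].
- move=> b0 Fb0;have [b1 Fb1 [h1 h2]] := unstable_near T hF Fxx himm mu Fb0.
 have n0 : b1 - w != 0.
 by have [b2 _ h] := himm Fb1;have := dlt_neq0 hO h;apply: contra_neq=> /subr0_eq ->;rewrite subrr.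
 have e : w - b1 = - (b1 - w) by rewrite opprB.
 exists (b1 - w);split=> //.
 + by move: h1;rewrite e=> h1 h;apply: h1;apply/dleNr.
 + exists b1=> //;rewrite e;apply/(dleNE hO);exact: (dle_refl hO).
 + rewrite -(iD hi) [w + _]addrC subrK;have ev x : P'.@[jet der' (i x)] = i P.@[jet der x].
 rewrite p'E pE.
 have hT : texpr (fun K d v=> pterm d (fun j : 'I_(size ms)=> v j.+1) (v 0%N)) by te.
 have := elem_term hi (scons x (fun j=> if insub j is Some j' then c j' else 0)) hT;rewrite /=.
 have -> : (fun j : 'I_(size ms)=> if insub (j : nat) is Some j' then c j' else 0) = c.
 by apply: funext=> j;rewrite valK.
 move=> ->;congr pterm;apply: funext=> j /=;by rewrite valK.
 by rewrite !ev -(iB hi);apply/(idom hi).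
have [z hz zt] := Dom_zero T' (let: And3 t0 _ _ := ht in t0) (incut_Dom T' hF' Fdiv' himm' mu' ht) hQ.
exists z;first by rewrite -p'E.
have [_ tb _] := ht;apply: (dle_lt_trans hO' zt);apply: tb;by apply/F'P;exists b.
Qed.
(** Compactness: if the linear part failed to dominate in scales of [K] arbitrarily near the cut, it
    would fail in a scale of [K'] filling it. *)
Lemma DomE_region : exists2 b0, F b0 & forall t, t != 0 -> t <: w - b0 -> (exists2 b1, F b1 & w - b1 <=: t) ->
 DomE der O c w (fun l=> (P^`M(l)).@[jet der w]) t.
apply: contrapT=> nb.
pose a l := (P^`M(l)).@[jet der w].
pose v := scons w (vcat a (fun j=> if insub j is Some j' then c j' else 0)).
pose Pr (K : RF) (d : K -> K) (O k : set K) (v : nat -> K) :=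
 ~ @DomE K d O r.+1 ms (fun j=> v (r.+1 + j).+2) (v 1%N) (fun l : 'I_r.+1=> v l.+2) (v 0%N).
have ePr : expr Pr by apply: e_not;apply: e_DomE=> *;exact: te_var.
have PrE (R : RF) d (o k0 : set R) (f : K -> R) t : Pr R d o k0 (scons t (f \o v)) <->
 ~ DomE d o (fun j=> f (c j)) (f w) (fun l=> f (a l)) t.
 rewrite /Pr /=;have -> : (fun j : 'I_(size ms)=> f (vcat a (fun j=> if insub j is Some j' then c j' else 0) (r.+1 + j))) = (fun j=> f (c j)).
 by apply: funext=> j;rewrite vcat_ge valK.
 by have -> : (fun l : 'I_r.+1=> f (vcat a (fun j=> if insub j is Some j' then c j' else 0) l)) = (fun l=> f (a l)) by apply: funext=> l;rewrite vcat_lt.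
have [||t ht hQ] := @realize_cut (fun t=> ~ DomE der' O' (fun j=> i (c j)) (i w) (fun l=> i (a l)) t).
- exists Pr, (i \o v);split=> //;first by move=> j;exists (v j).
 by move=> t;rewrite PrE.
- move=> b0 Fb0;apply: contrapT=> n;apply: nb;exists b0=> // t t0 tb ht;apply: contrapT=> nD;apply: n.
 exists t;split=> //;have := (PrE _ der O k id t).2 nD=> /(elem_expr hi _ ePr).1.
 rewrite (_ : i \o scons t (id \o v) = scons (i t) (i \o v));last by apply: funext=> -[].
 by move/(PrE _ der' O' k' i (i t)).1.
apply: hQ;have := Dom_DomE T' (incut_Dom T' hF' Fdiv' himm' mu' ht).
rewrite (_ : (fun l=> (P'^`M(l)).@[jet der' (i w)]) = (fun l=> i (a l)));last by apply: funext=> l;exact: a'E.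
rewrite /DomE=> -[j1 [h1 h2 h3]];exists j1;split=> // u hu.
have ee x : pterm der' (fun j : 'I_(size (msupp P'))=> P'@_(tnth (in_tuple (msupp P')) j)) x = pterm der' (fun j=> i (c j)) x.
 by rewrite -pterm_eval -mpoly_pterm p'E.
by have := h3 u hu;rewrite !ee.
Qed.
End Ext.
Lemma zeros_near b : F b -> exists2 z, P.@[jet der z] = 0 & z - w <: w - b.
move=> Fb;have [K' [der' [O' [k' [i [hi hs]]]]]] := pair_saturated_extension der O k K.
have [z hz zb] := zero_ext hi hs Fb.
have eP : expr (fun K d O k v=> exists2 z, pterm d (fun j : 'I_(size ms)=> v (j.+2)) z = 0 & ~ dominated O (v 0%N - v 1%N) (z - v 0%N)) by ex.
have := (elem_expr hi (scons w (scons b (fun j=> if insub j is Some j' then c j' else 0))) eP).2=> /=.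
have -> : (fun j : 'I_(size ms)=> if insub (j : nat) is Some j' then c j' else 0) = c.
 by apply: funext=> j;rewrite valK.
have -> : (fun j : 'I_(size ms)=> i (if insub (j : nat) is Some j' then c j' else 0)) = (fun j=> i (c j)).
 by apply: funext=> j;rewrite valK.
by case;[exists z|move=> x hx hb;exists x=> //;rewrite pE].
Qed.
(** If every zero is at some distance visible from [F], there are infinitely many zeros [w + eta n]
    with [eta n] strictly decreasing in dominance, all in the region where the linear part
    dominates. Each [eta n] is then asymptotic to a kernel element of the linear part of [P] at [w],
    against [kernel_bound]. *)
Lemma pseudo_zero : exists2 z, P.@[jet der z] = 0 & forall b, F b -> z - w <: w - b.
have [K' [der' [O' [k' [i [hi hs]]]]]] := pair_saturated_extension der O k K.
have [b0 Fb0 reg] := DomE_region hi hs.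
pose a l := (P^`M(l)).@[jet der w];rewrite -/a in reg.
apply: contrapT=> np.
have nxt z : P.@[jet der z] = 0 -> exists2 b, F b & w - b <=: z - w.
 move=> hz;apply: contrapT=> n;apply: np;exists z=> // b Fb h;by apply: n;exists b.
have step (z : {z | P.@[jet der z] = 0 /\ z - w <: w - b0}) :
 exists z' : {z | P.@[jet der z] = 0 /\ z - w <: w - b0}, sval z' - w <: sval z - w.
 case: z=> z [hz zb];have [b Fb h] := nxt z hz.
 have [z' hz' zb'] := zeros_near Fb;have lt : z' - w <: z - w by exact: (dlt_le_trans hO zb' h).
 have zb0 : z' - w <: w - b0 by exact: (dlt_trans hO lt zb).
 by exists (exist _ z' (conj hz' zb0)).
have [f hf] := choice step.
have [z0 hz0 zb0] := zeros_near Fb0.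
pose s n := iter n f (exist _ z0 (conj hz0 zb0)).
pose eta n := sval (s n) - w.
have e0 n : P.@[jet der (w + eta n)] = 0 by rewrite /eta addrC subrK;exact: (svalP (s n)).1.
have eb n : eta n <: w - b0 by exact: (svalP (s n)).2.
have el n : eta n.+1 <: eta n by exact: hf.
have enz n : eta n != 0 by exact: (dlt_neq0 hO (el n)).
have eD n : DomE der O c w a (eta n).
 apply: reg=> //;have [b Fb h] := nxt _ (svalP (s n)).1;by exists b.
(* At two consecutive zeros the operator takes nearly the same value, minus that of [P] at [w]. So
   the difference [zeta], equivalent to [eta n], is nearly in the kernel, and [t_DH1] in the scale
   [eta n] makes it exact. *)
have ker n : exists2 x, \sum_(l < r.+1) a l * iter l der x = 0 & asymp O x (eta n).
 have [j1 [E0 Ej hu]] := eD n;set E := (fun j : 'I_r.+1=> \sum_(l < r.+1) a l * (iter (l - j) der (eta n) *+ 'C(l, j))) in E0 Ej hu.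
 have E0' : E j1 != 0 by [].
 pose u := eta n.+1 / eta n.
 have hu1 : u <=: 1 by apply/dle1;apply/(dleP O)=> //;exact: (dltW hO (el n)).
 have q1 := hu 1 (dle_refl hO 1);have q2 := hu u hu1.
 rewrite -!pE mulr1 e0 sub0r in q1;rewrite -!pE /u mulrCA divff // mulr1 e0 sub0r in q2.
 pose zeta := eta n - eta n.+1.
 pose AA x := \sum_(l < r.+1) a l * iter l der x.
 have AB x y : AA (x - y) = AA x - AA y.
 by rewrite /AA -sumrB;apply: eq_bigr=> l _;rewrite iter_derB // mulrBr.
 have AD x y : AA (x + y) = AA x + AA y.
 by rewrite /AA -big_split;apply: eq_bigr=> l _;rewrite iter_derD // mulrDr.
 have hz : AA zeta <: E j1.
 have -> : AA zeta = (- P.@[jet der w] - AA (eta n.+1)) - (- P.@[jet der w] - AA (eta n)).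
 by rewrite /zeta AB;ring.
 exact: dltB.
 pose R : {mpoly K[r.+1]} := (E j1)^-1 *: ((AA zeta)%:MP + \sum_j E j *: 'X_j).
 have Rc0 : R@_0 = (E j1)^-1 * AA zeta.
 rewrite mcoeffZ mcoeffD mcoeffC eqxx mulr1 (raddf_sum (mcoeff _)) /= big1 ?addr0 // => j _.
 by rewrite mcoeffZ mcoeffX -mdeg_eq0 mdeg1 mulr0.
 have Rc1 j : R@_U_(j) = (E j1)^-1 * E j.
 rewrite mcoeffZ mcoeffD mcoeffC -mdeg_eq0 mdeg1 /= mulr0 add0r (raddf_sum (mcoeff _)) /= (bigD1 j) //=.
 rewrite mcoeffZ mcoeffX eqxx mulr1 big1 ?addr0 // => l ne;by rewrite mcoeffZ mcoeffX mnm1_eq (negPf ne) mulr0.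
 have Rc2 m : (1 < mdeg m)%N -> R@_m = 0.
 move=> hm;rewrite mcoeffZ mcoeffD mcoeffC.
 have -> : (m == 0%MM) = false by apply/negbTE;rewrite -mdeg_eq0;case: (mdeg m) hm.
 rewrite mulr0 add0r (raddf_sum (mcoeff _)) /= big1 ?mulr0 // => j _;rewrite mcoeffZ mcoeffX.
 by case: eqP=> [ej|_];rewrite ?mulr0 //;move: hm;rewrite -ej mdeg1.
 have Rsm0 : (E j1)^-1 * AA zeta <: 1.
 by rewrite -(mulVf E0');apply: dltMl=> //;rewrite invr_neq0.
 have Rsm1 j : O ((E j1)^-1 * E j) by rewrite mulrC;apply/(dleP O)=> //;exact: Ej.
 have z1 : (0 : K) <: 1 by apply: dlt0x;exact: oner_neq0.
 have [|||| v hv ev] := t_DH1 T (R := R).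
 - move=> m;case e : (mdeg m)=> [|[|dm]].
 + have -> : m = 0%MM by apply/eqP;rewrite -mdeg_eq0 e.
 rewrite Rc0;apply/dle1;exact: (dltW hO).
 + by move/eqP/mdeg1P: e=> [j /eqP ->];rewrite Rc1.
 + rewrite Rc2 ?e //;exact: O0.
 - by move=> m hm;rewrite Rc2.
 - exists j1;rewrite Rc1 mulVf //;exact: dle_refl.
 - by rewrite Rc0.
 have ev' : AA (zeta + eta n * v) = 0.
 move: ev;rewrite mevalZ mevalD mevalC (raddf_sum (meval _)) /=.
 under eq_bigr do rewrite mevalZ mevalXU.
 rewrite (sum_Lmx T a (eta n) v)=> /eqP;rewrite mulf_eq0 invr_eq0 (negPf E0') /= => /eqP <-.
 by rewrite AD.
 exists (zeta + eta n * v)=> //;rewrite /zeta -addrA.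
 apply: sim_asymp=> //;apply: simDr;apply: dltD=> //;first exact: dltN.
 rewrite -[X in ~ dominated _ X _]mulr1;exact: dltMl.
have [x hx] := choice (fun n=> let: ex_intro2 x p q := ker n in ex_intro (fun x=> _ /\ _) x (conj p q)).
have dec m n : (m < n)%N -> eta n <: eta m.
 elim: n=> // n IH;rewrite ltnS leq_eqVlt=> /orP[/eqP ->//|/IH h];exact: (dlt_trans hO (el n) h).
apply: (@kernel_bound _ _ _ _ T r (fun l=> if insub l is Some l' then a l' else 0) x).
- have [j1 [E0 _ _]] := eD 0%N.
 have [l hl] : exists l, a l != 0.
 apply/existsP;apply: contraNT E0;rewrite negb_exists=> /forallP hh;apply/eqP.
 by rewrite big1 // => l _;have := hh l;rewrite negbK=> /eqP ->;rewrite mul0r.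
 by exists l;[rewrite -ltnS|rewrite valK].
- by move=> n;rewrite -[RHS](hx n).1;apply: eq_bigr=> l _;rewrite valK.
- by move=> n;apply: (asymp_neq0 (hx n).2).
- move=> m n mn;apply: (dle_lt_trans hO (hx n).2.1);apply: (dlt_le_trans hO (dec _ _ mn));exact: (hx m).2.2.
Qed.
End Zeros.

(** * Immediate extensions *)

Section Immediate.
Variables (K : RF) (der : K -> K) (O k : set K) (K' : RF)
 (der' : K' -> K') (O' k' : set K').
Hypothesis T : tame der O k.
Hypothesis T' : tame der' O' k'.
Let hO := t_val T.
Let hO' := t_val T'.
Let hd := t_der T.
Let hd' := t_der T'.
Local Hint Resolve hO hO' hd hd' : core.
Notation KK := (K * K')%type.
Notation "x <=: y" := (dominated O x y).
Notation "x <: y" := (~ dominated O y x).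
Notation "x ~: y" := (~ dominated O y (x - y)).
Notation "x <=:' y" := (dominated O' x y).
Notation "x <:' y" := (~ dominated O' y x).
Notation "x ~:' y" := (~ dominated O' y (x - y)).
Notation dd := (dd der der').
Notation vv := (@vv K K').
Notation goodk := (goodk der O k der' O' k').
Lemma pX1 (x : KK) n : (x ^+ n).1 = x.1 ^+ n. by elim: n=> // n IH;rewrite !exprS /= IH. Qed.
Lemma pX2 (x : KK) n : (x ^+ n).2 = x.2 ^+ n. by elim: n=> // n IH;rewrite !exprS /= IH. Qed.
Lemma pMn1 (x : KK) n : (x *+ n).1 = x.1 *+ n. by elim: n=> // n IH;rewrite !mulrS /= IH. Qed.
Lemma pMn2 (x : KK) n : (x *+ n).2 = x.2 *+ n. by elim: n=> // n IH;rewrite !mulrS /= IH. Qed.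
Lemma ddB x y : dd (x - y) = dd x - dd y.
by rewrite /dd /= !derB. Qed.
Lemma ddM x y : dd (x * y) = dd x * y + x * dd y.
by case: x y=> [x1 x2] [y1 y2];congr pair;[exact: (derM hd)|exact: (derM hd')]. Qed.
Lemma dd0 : dd 0 = 0. by rewrite /dd /= !der0. Qed.
Lemma ddD x y : dd (x + y) = dd x + dd y.
by rewrite /dd /= !derD. Qed.
Lemma dd_sum (I : Type) (s : seq I) (f : I -> KK) : dd (\sum_(j <- s) f j) = \sum_(j <- s) dd (f j).
by elim: s=> [|j s IH];rewrite ?big_nil ?dd0 // !big_cons ddD IH. Qed.
Lemma ddX x n : dd (x ^+ n) = (x ^+ n.-1 * dd x) *+ n.
elim: n=> [|n IH];first by rewrite expr0 mulr0n /dd /= !der1.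
rewrite exprS ddM IH /= mulrnAr mulrA mulrS;congr (_ + _);first exact: mulrC.
by case: n {IH}=> [|n];rewrite ?mulr0n //= -exprS.
Qed.

Section Step.
Variable G : set KK.
Hypothesis hG : goodk G.
Let hG0 := hG.1.
Let hv : vgraph der O der' O' G := good0_vgraph hG0.
Let F : set K := [set x.1 | x in G].
Let F' : set K' := [set x.2 | x in G].
Let hF : diff_subfield der F := vgraph_dom hv.
Let hF' : diff_subfield der' F' := vgraph_rng hv.
Lemma goodk_ext_mon (R Mon : set KK) : G `<=` R -> (forall x y, R x -> R y -> R (x - y)) ->
 (forall x y, R x -> R y -> R (x * y)) -> (forall x, R x -> Fr R (dd x)) ->
 (forall u v, Mon u -> Mon v -> u.1 <=: v.1 <-> u.2 <=:' v.2) ->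
 (forall u, Mon u -> (0 < u.1) = (0 < u.2)) ->
 (forall x, R x -> x = 0 \/ exists2 u, Mon u & x.1 ~: u.1 /\ x.2 ~:' u.2) ->
 goodk (Fr R) /\ R `<=` Fr R.
move=> GR RB RM Rd Md Mp Rm;split;last by apply: sub_Fr;apply: GR;exact: (g_1 hG0).
apply: (goodk_Fr T T' (H := [set x | G x /\ k x.1]) (Mon := Mon))=> //.
- apply: GR;exact: (g_1 hG0).
- move=> x [Gx _];exact: GR.
- by move=> c kc;have [x Gx e] := hG.2 c kc;exists x=> //;split=> //;rewrite e.
- by move=> x [Gx kx];apply/(G_k T T' hG0 Gx).
- exact: (g_el hG0).
Qed.
Lemma goodk_ext_sim (R : set KK) : G `<=` R -> (forall x y, R x -> R y -> R (x - y)) ->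
 (forall x y, R x -> R y -> R (x * y)) -> (forall x, R x -> Fr R (dd x)) ->
 (forall x, R x -> x = 0 \/ exists2 u, G u & x.1 ~: u.1 /\ x.2 ~:' u.2) ->
 goodk (Fr R) /\ R `<=` Fr R.
move=> h1 h2 h3 h4 h5;apply: (goodk_ext_mon (Mon := G))=> //;[exact: (g_dom hG0)|exact: (g_pos hG0)].
Qed.
Lemma F'card : (F' #<= [set: K])%card.
by apply: graph_card=> x y Gx Gy e;rewrite (G_eq hG0 Gx Gy e). Qed.
Let G1 := g_1 hG0.
Let GB := g_B hG0.
Let GM := g_M hG0.
Let G0 : G 0 := G_0 hG0.
(** The ring generated over [G] by the first n derivatives of [z], formed in the product of the two
    fields so that source and target grow together. *)
Definition Ev n (z : KK) : set KK := [set x | exists2 Q : {mpoly KK[n]}, overG G Q & x = Q.@[jet dd z]].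

Section Eval.
Variable z : KK.
Lemma EvG n x : G x -> Ev n z x.
move=> Gx;exists x%:MP;last by rewrite mevalC.
by move=> m;rewrite mcoeffC;case: eqP=> _;rewrite ?mulr1 ?mulr0.
Qed.
Lemma EvB n x y : Ev n z x -> Ev n z y -> Ev n z (x - y).
move=> [Q hQ ->] [Q' hQ' ->];exists (Q - Q');last by rewrite mevalB.
move=> m;rewrite mcoeffB;exact: GB.
Qed.
Lemma EvM n x y : Ev n z x -> Ev n z y -> Ev n z (x * y).
move=> [Q hQ ->] [Q' hQ' ->];exists (Q * Q');last by rewrite mevalM.
exact: A_mpolyM.
Qed.
Lemma Ev_jet n i : (i < n)%N -> Ev n z (iter i dd z).
move=> lt;exists 'X_(Ordinal lt);last by rewrite mevalXU.
by move=> m;rewrite mcoeffX;case: eqP.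
Qed.
Lemma Ev_le n m : (n <= m)%N -> Ev n z `<=` Ev m z.
move=> le x [Q hQ ->];apply: A_meval.
- exact: (EvG _ G1).
- exact: EvB.
- exact: EvM.
- move=> mm;exact: EvG.
- move=> i;apply: Ev_jet;exact: leq_trans le.
Qed.
Lemma Ev_d n x : Ev n z x -> Ev n.+1 z (dd x).
move=> [Q hQ ->];pose A := [set x | Ev n.+1 z x /\ Ev n.+1 z (dd x)].
suff [] : A Q.@[jet dd z] by [].
apply: A_meval.
- split;apply: EvG=> //;exact: (g_d hG0).
- move=> a b [a1 a2] [b1 b2];split;rewrite ?ddB;exact: EvB.
- move=> a b [a1 a2] [b1 b2];split;first exact: EvM.
 rewrite ddM -(opprK (a * dd b)) ;apply: EvB;first exact: EvM.
 rewrite -mulNr;apply: EvM=> //;rewrite -sub0r;apply: EvB=> //;exact: EvG.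
- move=> m;split;apply: EvG=> //;exact: (g_d hG0).
- move=> i;split;first by apply: Ev_jet;exact: ltnW (ltn_ord i).
 by rewrite /jet -iterS;apply: Ev_jet;rewrite ltnS.
Qed.
End Eval.

Variable y : K.
Hypothesis himm : forall b, F b -> exists2 b1, F b1 & y - b1 <: y - b.
Hypothesis Fdiv : forall (e : K) n, F e -> e != 0 -> exists2 b, F b & asymp O (b ^+ n.+1) e.
Hypothesis hs : @succ_card_saturated _ (pst der' O' k') K.
Definition cutlim (z : KK) := forall a s, G a -> G s -> y - a.1 <=: s.1 -> z.1 - a.1 <=: s.1 /\ z.2 - a.2 <=:' s.2.
Lemma Stab_sim z n (Q : {mpoly KK[n]}) : cutlim z -> overG G Q -> Stab der O F y (pr1 Q) ->
 exists2 u, G u & (Q.@[jet dd z]).1 ~: u.1 /\ (Q.@[jet dd z]).2 ~:' u.2.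
move=> cz hQ [_ [_ [[a Ga <-] [s Gs <-] s0 h st]]].
have [h1 h2] := cz a s Ga Gs h.
exists (Q.@[jet dd a]);first by apply: (overG_eval hv)=> // i;exact: (G_iter hv).
rewrite !pr1_jet !pr2_jet;split;first exact: (StabAt_sim T s0 st h1).
apply: (StabAt_sim T' _ ((StabAt_transfer hv hQ Ga Gs).1 st) h2).
by apply: contra_neq s0=> /(v_0 hv Gs).
Qed.
(** Finitely many balls containing [y] all contain a sufficiently good approximation in [G], whose
    image satisfies the corresponding conditions. *)
Lemma pseudo_limit : exists y', forall a s, G a -> G s -> y - a.1 <=: s.1 -> y' - a.2 <=:' s.2.
pose C a s : K' -> Prop := fun x=> x - a <=:' s.
pose Cs := [set D | exists a s : KK, [/\ G a, G s, y - a.1 <=: s.1 & D = C a.2 s.2]].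
have [D [a [s [Ga Gs h ->]]]|l hl|y' hy] := @realize _ der' O' k' K F' hs F'card Cs.
- exists (fun K d O k v=> dominated O (v 0%N - v 1%N) (v 2%N)), (fun j=> if j is 0%N then a.2 else s.2).
 by split;[ex|case=> [|j];[exists a|exists s]|].
- have [b Gb hb] : exists2 b, G b & forall D, List.In D l -> D b.2.
 suff [b Gb hb] : exists2 b, G b & forall b', G b' -> y - b'.1 <=: y - b.1 -> forall D, List.In D l -> D b'.2.
 exists b=> //;apply: hb=> //;exact: dle_refl.
 elim: l hl=> [|D l IH] hl;first by exists 0.
 have [|b Gb hb] := IH;first by move=> D' h;apply: hl;right.
 have [a [s [Ga Gs h eD]]] := hl D (or_introl erefl).
 have key b' : G b' -> y - b'.1 <=: y - a.1 -> D b'.2.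
 move=> Gb' h';rewrite eD /C;apply/(v_dom hv (v_B hv Gb' Ga) Gs)=> /=.
 have -> : b'.1 - a.1 = (y - a.1) - (y - b'.1) by ring.
 apply: (dle_trans hO _ h);apply: dleB=> //;exact: dle_refl.
 case: (dle_total hO (y - b.1) (y - a.1))=> le.
 exists b=> // b' Gb' h' D' [<-|];last exact: hb.
 apply: key=> //;exact: (dle_trans hO h' le).
 exists a=> // b' Gb' h' D' [<-|];first exact: key.
 apply: hb=> //;exact: (dle_trans hO h' le).
 by exists b.2.
by exists y'=> a s Ga Gs h;apply: (hy (C a.2 s.2));exists a, s.
Qed.
(** The converse holds because approximations improve: if [y] is outside a ball around [a], the
    difference of [a] from a better approximation [b1] already shows this inside [G]. *)
Lemma cutrel_of y' : (forall a s, G a -> G s -> y - a.1 <=: s.1 -> y' - a.2 <=:' s.2) -> cutrel O O' G y y'.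
move=> hy a s Ga Gs;split;first exact: hy.
move=> h';apply: contrapT=> h.
have [_ [b1 Gb1 <-] hb] := himm (ex_intro2 _ _ a Ga erefl : F a.1).
have [_ [t Gt <-] [t0 [ht1 ht2]]] := cutF T hF himm (ex_intro2 _ _ b1 Gb1 erefl : F b1.1).
have e1 : b1.1 - a.1 = (y - a.1) - (y - b1.1) by ring.
have ya : y - a.1 <=: b1.1 - a.1 by rewrite e1;apply: dle_addr=> //;exact: dltN.
have e2 : b1.2 - a.2 = (y' - a.2) - (y' - b1.2) by ring.
have tb := hy _ _ Gb1 Gt ht2.
have n1 : s.2 <:' b1.2 - a.2.
 move=> /(v_dom hv (v_B hv Gb1 Ga) Gs) h1;apply: h;exact: (dle_trans hO ya h1).
have n2 : t.2 <:' b1.2 - a.2.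
 move=> /(v_dom hv (v_B hv Gb1 Ga) Gt) h1;apply: hb;exact: (dle_trans hO ya (dle_trans hO h1 ht1)).
have : (y' - a.2) - (y' - b1.2) <:' b1.2 - a.2.
 by apply: dltB=> //;[exact: (dle_lt_trans hO' h' n1)|exact: (dle_lt_trans hO' tb n2)].
rewrite -e2;apply;exact: dle_refl.
Qed.
Lemma ratio_nF (z : K) : (forall b, F b -> z - y <: y - b) -> ~ F z.
move=> h Fz;apply: (h z Fz);rewrite -opprB;apply/(dleNE hO);exact: dle_refl. Qed.
(** Here [y] is differentially transcendental over [F], since stable polynomials do not vanish at
    [y], and any [y'] in the corresponding cut serves as image. *)
Lemma stepI_stable : (forall n (Q : {mpoly K[n]}), (forall m, F Q@_m) -> Q != 0 -> Stab der O F y Q) ->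
 exists G1, [/\ goodk G1, G `<=` G1 & exists2 x, G1 x & ~ F x.1].
move=> st;have [y' hy] := pseudo_limit;pose z : KK := (y, y').
have cz : cutlim z by move=> a s Ga Gs h;split=> //=;exact: hy.
pose R := [set x | exists n, Ev n z x].
have GR : G `<=` R by move=> x Gx;exists 0%N;exact: EvG.
have [|||||h1 h2] := goodk_ext_sim (R := R)=> //.
- move=> a b [n ha] [m hb];exists (maxn n m);apply: EvB;[by apply: Ev_le ha;exact: leq_maxl|idtac].
 apply: Ev_le hb;exact: leq_maxr.
- move=> a b [n ha] [m hb];exists (maxn n m);apply: EvM;[by apply: Ev_le ha;exact: leq_maxl|idtac].
 apply: Ev_le hb;exact: leq_maxr.
- by move=> x [n /Ev_d h];apply: sub_Fr;[exact: GR G1|exists n.+1].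
- move=> x [n [Q hQ ->]];have [e|nz] := eqVneq (pr1 Q) 0.
 left;have -> : Q = 0;last by rewrite meval0.
 apply/mpolyP=> m;rewrite mcoeff0;apply: (G_eq hG0)=> //;by rewrite -pr1_coef e mcoeff0.
 right;apply: Stab_sim=> //;apply: st=> // m;rewrite pr1_coef;by exists Q@_m.
exists (Fr R);split=> //;first by move=> x /GR/h2.
exists z;first by apply: h2;exists 1%N;exact: (@Ev_jet z 1 0).
move=> Fy;have [b1 _ h] := himm Fy;apply: h;rewrite subrr;exact: dle0x.
Qed.

Section Unstable.
Variables (r : nat) (P : {mpoly KK[r.+1]}).
Hypothesis PG : overG G P.
Hypothesis mu : MinUnst der O F y (pr1 P).
(** In [K] the zero comes from [pseudo_zero]. In [K'] it is realized by saturation: minimal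
    instability transfers along the graph, so [zeros_near] gives zeros as close to the cut as
    finitely many conditions require. *)
Lemma find_zero : exists z : KK, [/\ cutlim z, P.@[jet dd z] = 0 & ~ F z.1].
have [x0 Gx0 ex0] := hG.2 _ (k_xx T).
have Fxx : exists x, [/\ k x, der x = 1 & F x].
 by exists x0.1;split;[rewrite ex0;exact: (k_xx T)|rewrite ex0 (der_xx T)|exists x0].
have Fxx' : exists x, [/\ k' x, der' x = 1 & F' x].
 exists x0.2;split;[by apply/(G_k T T' hG0 Gx0);rewrite ex0;exact: (k_xx T)| |by exists x0].
 have -> : der' x0.2 = (dd x0).2 by [].
 by rewrite (G_eq hG0 (g_d hG0 Gx0) G1) //= ex0 (der_xx T).
have Fdiv' (e : K') n : F' e -> e != 0 -> exists2 b, F' b & asymp O' (b ^+ n.+1) e.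
 move=> [x Gx <-] nx;have nx1 : x.1 != 0 by apply: contra_neq nx=> /(v_0 hv Gx).
 have [_ [b Gb <-] [h1 h2]] := Fdiv n (ex_intro2 _ _ x Gx erefl) nx1.
 have Gbn : G (b ^+ n.+1) by apply: A_X.
 exists b.2;first by exists b.
 rewrite -pX2;split;[apply/(v_dom hv Gbn Gx)|apply/(v_dom hv Gx Gbn)];by rewrite pX1.
have [z hz zy] := pseudo_zero T hF Fxx Fdiv himm mu.
have [y' hy] := pseudo_limit;have cr := cutrel_of hy.
have himm' := cut_imm T T' hv cr himm.
have mu' := MinUnst_transfer hv cr PG mu.
pose ms := msupp (pr2 P);pose c (j : 'I_(size ms)) := (pr2 P)@_(tnth (in_tuple ms) j).
have pE x : (pr2 P).@[jet der' x] = pterm der' c x by rewrite -pterm_eval -mpoly_pterm.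
pose Z : K' -> Prop := fun x=> pterm der' c x = 0.
pose C a s : K' -> Prop := fun x=> x - a <=:' s.
pose Cs := [set D | D = Z \/ exists a s : KK, [/\ G a, G s, y - a.1 <=: s.1 & D = C a.2 s.2]].
have [D [->|[a [s [Ga Gs h ->]]]]|l hl|z' hz'] := @realize _ der' O' k' K F' hs F'card Cs.
- exists (fun K d O k v=> pterm d (fun j : 'I_(size ms)=> v j.+1) (v 0%N) = 0).
 exists (fun j=> if insub j is Some j' then c j' else 0);split.
 + by ex.
 + move=> j;case: insubP=> [j' _ _|_];last by exists 0.
 by rewrite /c pr2_coef;eexists;last reflexivity.
 + move=> x /=;rewrite /Z;have -> // : (fun j : 'I_(size ms)=> if insub (j : nat) is Some j' then c j' else 0) = c.
 by apply: funext=> j;rewrite valK.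
- exists (fun K d O k v=> dominated O (v 0%N - v 1%N) (v 2%N)), (fun j=> if j is 0%N then a.2 else s.2).
 by split;[ex|case=> [|j];[exists a|exists s]|].
- suff [b Gb hb] : exists2 b, G b & forall x, pterm der' c x = 0 -> x - y' <=:' y' - b.2 -> forall D, List.In D l -> D x.
 have [x hx xb] := zeros_near T' hF' Fxx' Fdiv' himm' mu' (ex_intro2 _ _ b Gb erefl : F' b.2).
 by exists x;apply: (hb);[rewrite -pE|exact: dltW].
 elim: l hl=> [|D l IH] hl;first by exists 0.
 have [|b Gb hb] := IH;first by move=> D' h;apply: hl;right.
 case: (hl D (or_introl erefl))=> [eD|[a [s [Ga Gs h eD]]]].
 by exists b=> // x px xb D' [<-|];[rewrite eD|exact: hb].
 have has := hy _ _ Ga Gs h.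
 have key x : x - y' <=:' y' - a.2 -> D x.
 move=> hx;rewrite eD /C;have -> : x - a.2 = (x - y') + (y' - a.2) by ring.
 apply: dleD=> //;exact: (dle_trans hO' hx).
 case: (dle_total hO' (y' - b.2) (y' - a.2))=> le.
 exists b=> // x px xb D' [<-|];last exact: hb.
 apply: key;exact: (dle_trans hO' xb le).
 exists a=> // x px xa D' [<-|];first exact: key.
 apply: hb=> //;exact: (dle_trans hO' xa le).
exists (z, z');split.
- move=> a s Ga Gs h;split;last by apply: (hz' (C a.2 s.2));right;exists a, s.
 have -> : (z, z').1 - a.1 = (z - y) + (y - a.1) by rewrite /=;ring.
 apply: dleD=> //;apply: (dle_trans hO _ h);apply: dltW=> //;apply: zy;by exists a.
- have h1 : (P.@[jet dd (z, z')]).1 = 0 by rewrite pr1_jet.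
 have h2 : (P.@[jet dd (z, z')]).2 = 0 by rewrite pr2_jet /= pE;apply: (hz' Z);left.
 by rewrite [LHS]surjective_pairing h1 h2.
- exact: ratio_nF.
Qed.

Section AtZero.
Variable z : KK.
Hypotheses (cz : cutlim z) (Pz : P.@[jet dd z] = 0).
Let zeta := iter r dd z.
Let p := dlast (pr1 P).
Let simG (x : KK) := exists2 u, G u & x.1 ~: u.1 /\ x.2 ~:' u.2.
Lemma over_pr1_eq0 n (Q : {mpoly KK[n]}) : overG G Q -> pr1 Q = 0 -> Q = 0.
by move=> hQ e;apply/mpolyP=> m;rewrite mcoeff0;apply: (G_eq hG0)=> //;rewrite -pr1_coef e mcoeff0.
Qed.
Lemma Fp_pr1 n (Q : {mpoly KK[n]}) : overG G Q -> Fp F (pr1 Q).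
by move=> hQ m;rewrite pr1_coef;exists Q@_m. Qed.
Lemma simG_low n (Q : {mpoly KK[n]}) : (n = r) -> overG G Q -> Q != 0 -> simG Q.@[jet dd z].
move=> e;subst n=> hQ Q0;apply: Stab_sim=> //;apply: (mu_ord mu);first exact: Fp_pr1.
apply: contra_neq Q0;exact: over_pr1_eq0.
Qed.
Definition Low N (x : KK) := exists2 c : nat -> {mpoly KK[r]}, (forall e, overG G (c e)) &
 x = \sum_(e < N) (c e).@[jet dd z] * zeta ^+ e.
(** The combination is the value at [z] of a polynomial of smaller degree in the highest derivative,
    hence stable by minimality of [P]. *)
Lemma Low_sim (c : nat -> {mpoly KK[r]}) e0 : (forall e, overG G (c e)) -> (e0 < p)%N -> c e0 != 0 ->
 simG (\sum_(e < p) (c e).@[jet dd z] * zeta ^+ e).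
move=> hc le0 nz.
pose Q : {mpoly KK[r.+1]} := \sum_(e < p) \sum_(m <- msupp (c e)) (c e)@_m *: 'X_[mext m e].
have mextE (m : 'X_{1..r}) e m' e' : (mext m e == mext m' e') = (m == m') && (e == e').
 apply/eqP/andP=> [h|[/eqP -> /eqP ->]] //;split;apply/eqP;last first.
 by have := congr1 (fun m : 'X_{1..r.+1}=> m ord_max) h;rewrite !mnmE !insubF //= ltnn.
 apply/mnmP=> i;have := congr1 (fun m : 'X_{1..r.+1}=> m (widen_ord (leqnSn r) i)) h.
 by rewrite !mnmE /= valK.
have cQ m' : Q@_m' = \sum_(e < p) \sum_(m <- msupp (c e)) (c e)@_m * (mext m e == m')%:R.
 rewrite (raddf_sum (mcoeff m')) /=;apply: eq_bigr=> e _;rewrite (raddf_sum (mcoeff m')) /=.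
 by apply: eq_bigr=> m _;rewrite mcoeffZ mcoeffX.
have hQ : overG G Q.
 move=> m';rewrite cQ;apply: A_sum=> // e _;apply: A_sum=> // m _;apply: GM;first exact: hc.
 by case: eqP.
have evQ : Q.@[jet dd z] = \sum_(e < p) (c e).@[jet dd z] * zeta ^+ e.
 rewrite (raddf_sum (meval _)) /=;apply: eq_bigr=> e _;rewrite (raddf_sum (meval _)) /= mevalE mulr_suml.
 apply: eq_bigr=> m _;rewrite mevalZ mevalX big_ord_recr /= -mulrA;congr (_ * _).
 congr (_ * _);last by rewrite /jet mnmE insubF //= ltnn.
 by apply: eq_bigr=> i _;rewrite /jet mnmE /= valK.
have nzQ : Q != 0.
 have [m hm] : exists m, (c e0)@_m != 0.
 apply: contrapT=> h;case/eqP: nz;apply/mpolyP=> m;rewrite mcoeff0;apply/eqP.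
 by apply: contrapT=> /negP hm;apply: h;exists m.
 apply: contra_neq hm=> q0;have := cQ (mext m e0);rewrite q0 mcoeff0.
 rewrite (bigD1 (Ordinal le0)) //= [X in _ + X]big1 ?addr0;last first.
 move=> e ne;rewrite big1 // => m' _;rewrite mextE andbC;case: eqP=> [h|_];last by rewrite mulr0.
 by case/eqP: ne;apply: val_inj.
 under eq_bigr do rewrite mextE eqxx andbT.
 have [hm|hm] := boolP (m \in msupp (c e0)).
 by rewrite (bigD1_seq m) ?msupp_uniq //= eqxx mulr1 big1 ?addr0 // => m' /negPf ->;rewrite mulr0.
 by rewrite (memN_msupp_eq0 hm).
rewrite -evQ;apply: Stab_sim=> //;apply: (mu_deg mu);first exact: Fp_pr1.
 apply: contra_neq nzQ;exact: over_pr1_eq0.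
rewrite -/p;case: (p) le0 cQ=> // p' _ cQ;rewrite ltnS;apply: dlast_leP=> m'.
rewrite pr1_coef cQ=> h;rewrite leqNgt;apply: contra_neqN h=> lt.
rewrite big1 // => e _;rewrite big1 // => m _;case: eqP=> [em|_];last by rewrite mulr0.
by move: lt;rewrite -em mnmE insubF //= ?ltnn // ltnNge -ltnS ltn_ord.
Qed.
Let a e : {mpoly KK[r]} := (muni P)`_e.
Let aG e : overG G (a e). by move=> m;rewrite /a muni_coef. Qed.
Lemma muni_Low n (Q : {mpoly KK[n.+1]}) N : (size (muni Q) <= N)%N ->
 Q.@[jet dd z] = \sum_(e < N) ((muni Q)`_e).@[jet dd z] * (iter n dd z) ^+ e.
move=> le;rewrite muni_eval (horner_coef_wide _ (leq_trans (size_poly _ _) le)).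
by apply: eq_bigr=> e _;rewrite coef_map.
Qed.
Let a_big e : (p < e)%N -> a e = 0.
move=> lt;apply: over_pr1_eq0=> //;apply/mpolyP=> m;rewrite mcoeff0 pr1_coef /a muni_coef -pr1_coef.
apply/eqP;apply: contraLR lt=> /dlast_le;rewrite mnmE insubF /= ?ltnn // -leqNgt;exact.
Qed.
Let ap : a p != 0.
have : (msupp (pr1 P) != [::]) by rewrite msupp_eq0;exact: (mu_0 mu).
case E : (msupp (pr1 P))=> [|m0 ms] // _.
have [m hm em] : exists2 m, m \in msupp (pr1 P) & m ord_max = p.
 have := @eq_bigmax_cond _ [pred i : 'I_(size (msupp (pr1 P))) | true] (fun i=> (tnth (in_tuple (msupp (pr1 P))) i) ord_max).
 case;first by rewrite card_ord E.
 move=> i _ hi;exists (tnth (in_tuple (msupp (pr1 P))) i);first exact: mem_tnth.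
 by rewrite -hi /p /dlast [RHS]big_tnth;apply: eq_bigl=> j;rewrite inE.
move: hm;rewrite mcoeff_msupp;apply: contra_neq=> e0;rewrite pr1_coef.
have -> : m = mext [multinom m (widen_ord (leqnSn r) i) | i < r] p.
 apply/mnmP=> i;rewrite mnmE;case: insubP=> [u ui vi|].
 by rewrite mnmE;congr (m _);apply: val_inj.
 rewrite -leqNgt -em=> ni;congr (m _);apply: val_inj=> /=;apply/eqP.
 by rewrite eqn_leq ni -ltnS ltn_ord.
by rewrite -muni_coef -/(a p) e0 mcoeff0.
Qed.
Let Psum : \sum_(e < p.+1) (a e).@[jet dd z] * zeta ^+ e = 0.
transitivity P.@[jet dd z];last exact: Pz.
have sz : (size (muni P) <= p.+1)%N by apply/leq_sizeP=> e lt;exact: a_big.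
by rewrite (muni_Low sz).
Qed.
Let nz_simG x : simG x -> x.1 != 0 /\ x.2 != 0.
by case=> u _ [h1 h2];split;[exact: sim_neq0l h1|exact: sim_neq0l h2]. Qed.
Let p_gt0 : (0 < p)%N.
rewrite lt0n;apply/eqP=> p0;have := Psum;rewrite p0 big_ord1 expr0 mulr1=> h.
have := ap;rewrite p0=> a0;have := nz_simG (simG_low erefl (aG 0) a0);by rewrite h eqxx=> -[].
Qed.
(** Pseudo-division: multiplying by the leading coefficient of [P] allows the top power of [zeta] to
    be eliminated with the relation [P = 0], shifted by N - p. *)
Lemma Low_step N x : (p <= N)%N -> Low N.+1 x -> Low N ((a p).@[jet dd z] * x).
move=> le [c hc ->].
pose c' e := a p * c e - (if (N - p <= e)%N then c N * a (e - (N - p))%N else 0).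
exists c'.
 move=> e m;rewrite mcoeffB;apply: GB;first exact: (A_mpolyM G1 GB GM (aG p) (hc e)).
 by case: ifP=> _;[exact: (A_mpolyM G1 GB GM (hc N) (aG _))|rewrite mcoeff0].
have eN : \sum_(e < N.+1) (if (N - p <= e)%N then (c N).@[jet dd z] * (a (e - (N - p))%N).@[jet dd z] else 0) * zeta ^+ e = 0.
 have -> : \sum_(e < N.+1) (if (N - p <= e)%N then (c N).@[jet dd z] * (a (e - (N - p))%N).@[jet dd z] else 0) * zeta ^+ e =
 \sum_(e < N.+1 | (N - p <= e)%N) (c N).@[jet dd z] * (a (e - (N - p))%N).@[jet dd z] * zeta ^+ e.
 by rewrite [RHS]big_mkcond /=;apply: eq_bigr=> e _;case: ifP=> // _;rewrite mul0r.
 rewrite -(big_mkord (fun e=> N - p <= e)%N (fun e=> (c N).@[jet dd z] * (a (e - (N - p))%N).@[jet dd z] * zeta ^+ e)).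
 have -> : \sum_(0 <= e < N.+1 | (N - p <= e)%N) (c N).@[jet dd z] * (a (e - (N - p))%N).@[jet dd z] * zeta ^+ e =
 \sum_(N - p <= e < N.+1) (c N).@[jet dd z] * (a (e - (N - p))%N).@[jet dd z] * zeta ^+ e.
 by rewrite [RHS](big_nat_widenl _ 0).
 rewrite -{1}[(N - p)%N]add0n big_addn.
 have -> : (N.+1 - (N - p) = p.+1)%N by rewrite subSn ?leq_subr // subKn.
 rewrite big_mkord;rewrite (eq_bigr (fun e : 'I_p.+1=> ((c N).@[jet dd z] * zeta ^+ (N - p)) * ((a e).@[jet dd z] * zeta ^+ e))).
 by rewrite -mulr_sumr Psum mulr0.
 move=> e _;rewrite addnK exprD [RHS]mulrACA;congr (_ * _);exact: mulrC.
rewrite mulr_sumr -[LHS]subr0 -[X in _ - X]eN -sumrB big_ord_recr /=.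
rewrite leq_subr (subKn le) [X in _ + X](_ : _ = 0) ?addr0;last first.
 by rewrite mulrA -mulrBl [(a p).@[_] * _]mulrC subrr mul0r.
apply: eq_bigr=> e _;rewrite /c' mevalB mevalM mulrA -mulrBl;congr ((_ - _) * _).
by case: ifP=> _;rewrite ?mevalM ?meval0.
Qed.
Lemma Low_reduce N x : Low N x -> exists2 l, overG G l /\ l != 0 & Low p ((l : {mpoly KK[r]}).@[jet dd z] * x).
case: (leqP N p)=> [le|/ltnW le].
 move=> [c hc ->];exists 1;first split;[|exact: oner_neq0|].
 by move=> m;rewrite mcoeff1;case: eqP.
 exists (fun e=> if (e < N)%N then c e else 0).
 by move=> e;case: ifP=> // _ m;rewrite mcoeff0.
 rewrite meval1 mul1r (big_ord_widen _ (fun e=> (c e).@[jet dd z] * zeta ^+ e) le) big_mkcond /=.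
 by apply: eq_bigr=> e _;case: ifP=> // _;rewrite meval0 mul0r.
elim: N le x=> [|N IH] le x.
 by move: le p_gt0;rewrite leqn0=> /eqP ->.
move: le;rewrite leq_eqVlt=> /orP[/eqP <-|lt] hx.
 exists 1;first split;[|exact: oner_neq0|by rewrite meval1 mul1r].
 by move=> m;rewrite mcoeff1;case: eqP.
have [l [lG l0] hl] := IH lt _ (Low_step lt hx).
exists (l * a p);last by rewrite mevalM -mulrA.
split;first exact: (A_mpolyM G1 GB GM lG (aG p)).
have nz1 := nz_simG (simG_low erefl lG l0);have nz2 := nz_simG (simG_low erefl (aG p) ap).
apply/eqP=> e;have : (l * a p).@[jet dd z] = 0 by rewrite e meval0.
rewrite mevalM=> /(congr1 fst)/eqP /=;rewrite mulf_eq0.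
by case: nz1 nz2=> /negPf -> _ [/negPf -> _].
Qed.
Lemma Low_dich x : Low p x -> x = 0 \/ simG x.
move=> [c hc ->];case: (pselect (exists2 e, (e < p)%N & c e != 0))=> [[e lt nz]|h].
 right;exact: Low_sim nz.
left;rewrite big1 // => e _;rewrite (_ : c e = 0) ?meval0 ?mul0r //.
by apply/eqP;apply: contrapT=> /negP nz;apply: h;exists e.
Qed.
Let R := Ev r.+1 z.
(** After multiplication by a nonzero [l] of lower order the element has small degree in [zeta],
    where minimality applies. Both [l] and the product are equivalent to elements of [G], hence so
    is the quotient. *)
Lemma R_dich x : R x -> x = 0 \/ simG x.
case=> Q hQ exQ;rewrite exQ.
have [|l [lG l0] hl] := @Low_reduce (size (muni Q)) Q.@[jet dd z].
 exists (fun e=> (muni Q)`_e);first by move=> e m;rewrite muni_coef.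
 by rewrite (muni_Low (leqnn _)).
have sl := simG_low erefl lG l0;have [l1 l2] := nz_simG sl.
rewrite -exQ in hl *;set L := l.@[_] in hl sl l1 l2.
have ex : x = vv L * (L * x).
 by rewrite mulrA [x]surjective_pairing;congr pair;rewrite /= mulVf // mul1r.
case: (Low_dich hl)=> [h0|[u Gu [u1 u2]]];first by left;rewrite ex h0 mulr0.
case: sl=> t Gt [t1 t2];right;exists (vv t * u).
 apply: GM=> //;exact: (g_V hG0).
rewrite ex;split=> /=;apply: simM=> //;exact: simV.
Qed.
Let RB : forall x y, R x -> R y -> R (x - y) := @EvB z r.+1.
Let RM : forall x y, R x -> R y -> R (x * y) := @EvM z r.+1.
Let RG : G `<=` R := @EvG z r.+1.
Let R0 : R 0 := RG G0.
Let R1 : R 1 := RG G1.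
Let Rz : R zeta := @Ev_jet z r.+1 r (ltnSn r).
Let Ra e : R (a e).@[jet dd z].
by apply: (@Ev_le z r r.+1 (leqnSn r));exists (a e). Qed.
Let Rda e : R (dd (a e).@[jet dd z]).
by apply: Ev_d;exists (a e). Qed.
(** Differentiating the equation of [zeta] gives [U + S * dd zeta = 0]. The separant [S] has degree
    below p in [zeta] and nonzero top coefficient, so it does not vanish. *)
Lemma Fr_ddzeta : Fr R (dd zeta).
pose S := \sum_(e < p) (a e.+1 *+ e.+1).@[jet dd z] * zeta ^+ e.
pose U := \sum_(e < p.+1) dd (a e).@[jet dd z] * zeta ^+ e.
have SU : U + S * dd zeta = 0.
 have := congr1 dd Psum;rewrite dd_sum dd0=> <-.
 rewrite [RHS](eq_bigr (fun e : 'I_p.+1=> dd (a e).@[jet dd z] * zeta ^+ e + (a e).@[jet dd z] * ((zeta ^+ e.-1 * dd zeta) *+ e)));last first.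
 by move=> e _;rewrite ddM ddX.
 rewrite big_split /=;congr (_ + _);rewrite big_ord_recl /= mulr0n mulr0 add0r /S mulr_suml.
 apply: eq_bigr=> e _;rewrite /bump /= add1n mevalMn.
 by rewrite add0n !mulrnAl mulrnAr mulrA.
have [s1 s2] : S.1 != 0 /\ S.2 != 0.
 apply: nz_simG;apply: (Low_sim (c := fun e=> a e.+1 *+ e.+1) (e0 := p.-1));rewrite ?prednK //.
 move=> e m;rewrite mcoeffMn;apply: A_Mn=> //;exact: aG.
 apply/eqP=> h;case/negP: ap;apply/eqP/mpolyP=> m.
 have := congr1 (fun Q : {mpoly KK[r]}=> Q@_m) h;rewrite mcoeff0 mcoeffMn=> hm.
 have Gm := aG p m;apply: (G_eq hG0)=> //.
 have : ((a p)@_m *+ p).1 = 0 by rewrite hm.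
 rewrite pMn1.
 by move/eqP;rewrite mulrn_eq0=> /orP[/eqP e|/eqP //];move: p_gt0;rewrite e.
exists (- U), S;split=> //.
- rewrite -sub0r;apply: RB=> //;apply: A_sum=> // e _;apply: RM=> //;exact: A_X.
- apply: A_sum=> // e _;apply: RM;last exact: A_X.
 rewrite mevalMn;apply: A_Mn=> //;exact: Ra.
have -> : - U = S * dd zeta by apply/eqP;rewrite eq_sym -addr_eq0 addrC SU.
rewrite mulrAC [LHS]surjective_pairing;congr pair;by rewrite /= mulfV // mul1r.
Qed.
Lemma stepI_at_zero : goodk (Fr R) /\ R `<=` Fr R.
have sFr := @sub_Fr K K' R R1.
have hB := @FrB K K' R RB RM;have hM := @FrM K K' R RM.
apply: goodk_ext_sim=> //;last exact: R_dich.
move=> x [Q hQ ->];pose A := [set x | R x /\ Fr R (dd x)].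
suff [] : A Q.@[jet dd z] by [].
apply: A_meval.
- split=> //;apply: sFr;apply: RG;exact: (g_d hG0).
- by move=> u v [u1 u2] [v1 v2];split;rewrite ?ddB;[exact: RB|exact: hB].
- move=> u v [u1 u2] [v1 v2];split;first exact: RM.
 have h : Fr R (- (u * dd v)) by rewrite -sub0r;apply: hB;[exact: sFr|apply: hM=> //;exact: sFr].
 rewrite ddM -(opprK (u * dd v));apply: hB=> //;apply: hM=> //;exact: sFr.
- by move=> m;split;[exact: RG|apply: sFr;apply: RG;exact: (g_d hG0)].
- move=> i;split;first exact: Ev_jet.
 have := ltn_ord i;rewrite ltnS leq_eqVlt=> /orP[/eqP ei|lt].
 have -> : jet dd z i = zeta by rewrite /jet ei.
 exact: Fr_ddzeta.
 by apply: sFr;rewrite /jet -iterS;apply: Ev_jet.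
Qed.
End AtZero.
End Unstable.
Lemma stepI : exists G1, [/\ goodk G1, G `<=` G1 & exists2 x, G1 x & ~ F x.1].
case: (pselect (forall n (Q : {mpoly K[n]}), (forall m, F Q@_m) -> Q != 0 -> Stab der O F y Q))=> [|h].
 exact: stepI_stable.
have [n [Q [hQ Q0 nst]]] : exists n (Q : {mpoly K[n]}), [/\ forall m, F Q@_m, Q != 0 & ~ Stab der O F y Q].
 apply: contrapT=> h';apply: h=> n Q hQ Q0;apply: contrapT=> nst;apply: h';by exists n, Q.
have [r [Q1 mu1]] := MinUnst_exists T hF himm hQ Q0 nst.
have [P PG eP] := lift1 hv (mu_F mu1);rewrite -eP in mu1.
have [z [cz Pz nFz]] := find_zero PG mu1.
have [h1 h2] := stepI_at_zero PG mu1 cz Pz.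
exists (Fr (Ev r.+1 z));split=> //;first by move=> x Gx;apply: h2;exact: EvG.
exists z=> //;apply: h2;exact: (@Ev_jet z r.+1 0).
Qed.
End Step.
End Immediate.
Lemma natS_mulK (L : RF) n (x : L) : n.+1%:R^-1 * (x *+ n.+1) = x.
by rewrite -[x *+ n.+1]mulr_natl mulKf // pnatr_eq0. Qed.
Lemma subr3ACA (V : zmodType) (a b c a' b' c' : V) :
 a + (b + c) - (a' + (b' + c')) = a - a' + (c - c') + (b - b').
rewrite -[RHS]addrA opprD addrACA;congr (_ + _).
by rewrite opprD addrACA addrC.
Qed.

Section LevExpr.
Variable C : forall (K : RF) (der : K -> K) (O k : set K), K -> K -> Prop.
Hypothesis hC : expr (fun K d O k v=> C d O k (v 0%N) (v 1%N)).

(* levE n y w: after n steps y |-> (y / w_j)† the result satisfies C _ w_n. *)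
Fixpoint levE n (K : RF) (d : K -> K) (O k : set K) (y : K) (w : nat -> K) : Prop :=
 if n is n'.+1 then exists x, (y != 0 /\ x * (y * w 0%N) = d y * w 0%N - y * d (w 0%N)) /\
 levE n' d O k x (fun j=> w j.+1)
 else C d O k y (w 0%N).
Lemma e_levE n : expr (fun K d O k v=> levE n d O k (v 0%N) (fun j=> v j.+1)).
elim: n=> [|n IH] //=.
apply: (@e_ex (fun K d O k a v=> (v 0%N != 0 /\ a * (v 0%N * v 1%N) = d (v 0%N) * v 1%N - v 0%N * d (v 1%N)) /\
 levE n d O k a (fun j=> v j.+2))).
apply: e_and;first by ex.
apply: (e_ren (r := fun j=> if j is j'.+1 then j'.+3 else 0%N) _ IH).
by move=> [|i] [|j] //= [->].
Qed.
End LevExpr.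
Definition cutC (s u : bool) (K : RF) (der : K -> K) (O k : set K) (y f : K) : Prop :=
 (if s then 0 < y else y < 0) /\ (if u then ~ dominated O y f else ~ dominated O f y).
Lemma e_cutC s u : expr (fun K d O k v=> @cutC s u K d O k (v 0%N) (v 1%N)).
by rewrite /cutC;case: s;case: u;ex. Qed.

(** * Positions of elements read off from logarithmic derivatives *)

Section Daggers.
Variables (K : RF) (der : K -> K) (O k : set K).
Hypothesis T : tame der O k.
Let hO := t_val T.
Let hd := t_der T.
Let hc := t_conv T.
Local Hint Resolve hO hd hc : core.
Notation "x <=: y" := (dominated O x y).
Notation "x <: y" := (~ dominated O y x).
Notation logd := (logder der).
Lemma dag_le1 w : w != 0 -> w <=: 1 <-> (logd w <=: 1 \/ logd w < 0).
move=> w0;split=> [h|[h|h]].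
- case: (pselect (1 <=: w))=> h1;first by left;apply: (logd_unit T).
 right;rewrite -(logd_abs T);apply: (logd_lt0 T);rewrite ?normr_gt0 //.
 by move=> /(dle_normr T).
- exact: (logd_leq1 T w0 h).1.
- apply: contrapT=> h1;have : 0 < logd w.
 rewrite -(logd_abs T);apply: (logd_gt0 T);rewrite ?normr_gt0 //.
 by move=> /(dle_norm T).
 by move/lt_gtF;rewrite h.
Qed.
(** [logd y] is the sum of [x] and [logd g], which do not cancel since they are not asymptotic. Thus
    [x] is at most [logd y], which is strictly below [y]. *)
Lemma logd_desc y g x : 1 <: y -> g != 0 -> x = logd (y / g) ->
 (~ (x <=: logd g) \/ ~ (logd g <=: x)) -> x <: y.
move=> hy g0 ex h;have y0 := dlt_neq0 hO hy.
have e : logd y = x + logd g by rewrite ex logd_div // subrK.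
have xy : x <=: logd y.
 rewrite e;case: h=> h;first by apply: dle_addr.
 by apply: (dle_trans hO (dltW hO h));rewrite addrC;apply: dle_addr.
by apply: (dle_lt_trans hO xy);have := logdX_small T (N := 1) hy;rewrite expr1.
Qed.
(** Between two classes the square root of the product lies strictly; at an open end an
    infinitesimal [e] provides the room. *)
Lemma finite_cut (A B : seq K) : (forall a, a \in A -> a != 0) -> (forall b, b \in B -> b != 0) ->
 (forall a b, a \in A -> b \in B -> a <: b) ->
 exists x, [/\ 0 < x, forall a, a \in A -> a <: x & forall b, b \in B -> x <: b].
move=> nA nB AB;have [e e0 he] := t_ne T.
wlog e1 : e e0 he / 0 < e.
 move=> H;apply: (H `|e|);rewrite ?normr_gt0 ?normr_eq0 //.
 by move=> /(dle_normr T).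
have eN0 : e != 0 by [].
have up (y : K) : y != 0 -> y <: y / e.
 move=> y0 h;apply: he;apply: (@dle_M2l _ _ hO (y / e));first by rewrite mulf_neq0 ?invr_neq0.
 by rewrite mulr1 divfK.
have dn (y : K) : y != 0 -> y * e <: y.
 by move=> y0 h;apply: he;apply: (@dle_M2l _ _ hO y)=> //;rewrite mulr1.
have hA : A = [::] \/ exists2 a, a \in A & forall a', a' \in A -> a' <=: a.
 case: (A)=> [|a0 s];first by left.
 right;exact: (asymp_max hO id (mem_head a0 s)).
have hB : B = [::] \/ exists2 b, b \in B & forall b', b' \in B -> b <=: b'.
 case: (B) nB=> [|b0 s] nB;first by left.
 right;have [b hb hm] := asymp_max hO (fun x=> x^-1) (mem_head b0 s);exists b=> // b' hb'.
 have := hm b' hb'=> /(dleV hO (invr_neq0 (nB _ hb')));by rewrite !invrK.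
case: hA=> [->|[a aA ha]];case: hB=> [->|[b bB hb]].
- by exists 1;split=> //.
- exists (`|b| * e);split=> //;first by rewrite mulr_gt0 // normr_gt0 nB.
 move=> b' hb';apply: (dlt_le_trans hO _ (hb _ hb')).
 rewrite -(ger0_norm (ltW e1)) -normrM=> /(dle_normr T);apply: dn;exact: nB.
- exists (`|a| / e);split=> //;first by rewrite divr_gt0 // normr_gt0 nA.
 move=> a' ha';apply: (dle_lt_trans hO (ha _ ha')).
 rewrite -(ger0_norm (ltW e1)) -normf_div=> /(dle_norm T);apply: up;exact: nA.
- have ab := AB _ _ aA bB;have a0 := nA _ aA;have b0 := nB _ bB.
 have [|c c0 ec] := t_root T 1 (e := `|a * b|);first by rewrite normr_gt0 mulf_neq0.
 have cc : asymp O (c ^+ 2) (a * b).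
 rewrite ec;split;[apply/(dle_norm T)|apply/(dle_normr T)];exact: dle_refl.
 exists c;split=> // [a' ha' h|b' hb' h].
 have ca : c <=: a := dle_trans hO h (ha _ ha').
 have := dle_trans hO cc.2 (dleX hO 2 ca);rewrite expr2=> /(dle_M2l hO a0);exact: ab.
 have bc : b <=: c := dle_trans hO (hb _ hb') h.
 have := dle_trans hO (dleX hO 2 bc) cc.1;rewrite expr2=> /(dle_M2r hO b0);exact: ab.
Qed.
End Daggers.

(** * Extensions of the value group and the embedding theorem *)

Section Values.
Variables (K : RF) (der : K -> K) (O k : set K) (K' : RF)
 (der' : K' -> K') (O' k' : set K').
Hypothesis T : tame der O k.
Hypothesis T' : tame der' O' k'.
Let hO := t_val T.
Let hO' := t_val T'.
Let hc := t_conv T.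
Let hc' := t_conv T'.
Let hd := t_der T.
Let hd' := t_der T'.
Local Hint Resolve hO hO' hd hd' hc hc' : core.
Notation KK := (K * K')%type.
Notation "x <=: y" := (dominated O x y).
Notation "x <: y" := (~ dominated O y x).
Notation "x =: y" := (asymp O x y).
Notation "x ~: y" := (~ dominated O y (x - y)).
Notation "x <=:' y" := (dominated O' x y).
Notation "x <:' y" := (~ dominated O' y x).
Notation "x ~:' y" := (~ dominated O' y (x - y)).
Notation dd := (dd der der').
Notation vv := (@vv K K').
Notation goodk := (goodk der O k der' O' k').
Notation logd := (logder der).
Notation logd' := (logder der').
Definition nz (x : KK) := x.1 != 0 /\ x.2 != 0.
Definition dag (x : KK) : KK := (logd x.1, logd' x.2).
Lemma nzM x y : nz x -> nz y -> nz (x * y).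
by move=> [a b] [c d];split;rewrite /= mulf_neq0. Qed.
Lemma nzX x n : nz x -> nz (x ^+ n).
by move=> h;elim: n=> [|n IH];[rewrite expr0;split;exact: oner_neq0|rewrite exprS;exact: nzM]. Qed.
Lemma dagM x y : nz x -> nz y -> dag (x * y) = dag x + dag y.
by move=> [a b] [c d];congr pair;rewrite /= logdM. Qed.
Lemma dagX x n : nz x -> dag (x ^+ n) = dag x *+ n.
move=> h;elim: n=> [|n IH];last by rewrite exprS mulrS dagM ?IH //;exact: nzX.
by rewrite expr0 mulr0n;congr pair;rewrite /= /logder der1 // mul0r.
Qed.
Lemma dd_dag x : nz x -> dd x = dag x * x.
by move=> [a b];congr pair;rewrite /= /logder divfK. Qed.
Lemma nz_vv x : nz x -> nz (vv x).
by move=> [a b];split;rewrite /= invr_neq0. Qed.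
Lemma dag_vv x : nz x -> dag (vv x) = - dag x.
by move=> [a b];congr pair;rewrite /= logdV. Qed.
Definition cmp (b : KK) := (b.1 <=: 1 <-> b.2 <=:' 1) /\ (b.1 < 0) = (b.2 < 0).
(** By [dag_le1], whether [u / v] is bounded depends only on size and sign of its logarithmic
    derivative. *)
Lemma dom_dag u v : nz u -> nz v -> cmp (dag u - dag v) -> u.1 <=: v.1 <-> u.2 <=:' v.2.
move=> nu nv [h1 h2];have nw := nzM nu (nz_vv nv).
have aux (L : RF) (V : set L) (hV : valuation_ring V) (x y : L) : y != 0 ->
 dominated V x y <-> dominated V (x / y) 1.
 by move=> y0;rewrite (dleP V) // (dle1 V).
rewrite (aux _ _ hO _ _ nv.1) (aux _ _ hO' _ _ nv.2).
have e : dag (u * vv v) = dag u - dag v by rewrite dagM // ?dag_vv //;exact: nz_vv.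
rewrite (dag_le1 T nw.1) (dag_le1 T' nw.2) -[logder der _]/((dag (u * vv v)).1) -[logder der' _]/((dag (u * vv v)).2).
by rewrite e h1 h2.
Qed.

Section Step.
Variable G : set KK.
Hypothesis hG : goodk G.
Let hG0 := hG.1.
Let F : set K := [set x.1 | x in G].
Let G1 := g_1 hG0.
Let GB := g_B hG0.
Let GM := g_M hG0.
Let G0 : G 0 := G_0 hG0.
Lemma G_nz x : G x -> x.1 != 0 -> nz x.
by move=> Gx x1;split=> //;apply: contra_neq x1=> /(G_0P hG0 Gx). Qed.
Lemma G_dag x : G x -> G (dag x).
by move=> Gx;have -> : dag x = dd x * vv x by [];apply: GM;[exact: (g_d hG0)|exact: (g_V hG0)].
Qed.
Lemma G_cmp b : G b -> cmp b.
move=> Gb;split;first exact: (g_dom hG0 Gb G1).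
by have := g_pos hG0 (G_N hG0 Gb);rewrite /= !oppr_gt0.
Qed.

Section Sums.
Variable Mon : set KK.
Definition SumR : set KK := [set x | exists l : seq KK, (forall u, u \in l -> Mon u) /\ x = \sum_(u <- l) u].
Hypothesis GMon : forall g, G g -> g.1 != 0 -> Mon g.
Hypothesis M_nz : forall u, Mon u -> nz u.
Hypothesis MM : forall u v, Mon u -> Mon v -> Mon (u * v).
Hypothesis M_dom : forall u v, Mon u -> Mon v -> u.1 <=: v.1 <-> u.2 <=:' v.2.
Hypothesis M_pos : forall u, Mon u -> (0 < u.1) = (0 < u.2).
Hypothesis M_add : forall u v, Mon u -> Mon v -> u.1 =: v.1 -> u + v = 0 \/ Mon (u + v).
Lemma SumR_G : G `<=` SumR.
move=> x Gx;have [e|ne] := eqVneq x.1 0.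
 exists [::];split=> //;rewrite big_nil;exact: (G_eq hG0).
by exists [:: x];split;[move=> u;rewrite inE=> /eqP ->;exact: GMon|rewrite big_seq1].
Qed.
Lemma SumR_Mon : Mon `<=` SumR.
by move=> u Mu;exists [:: u];split;[move=> v;rewrite inE=> /eqP ->|rewrite big_seq1]. Qed.
Lemma SumR_B x y : SumR x -> SumR y -> SumR (x - y).
move=> [l [hl ->]] [l' [hl' ->]];exists (l ++ [seq (-1) * u | u <- l']);split.
 move=> u;rewrite mem_cat=> /orP[/hl//|/mapP[v /hl' Mv ->]];apply: MM=> //;apply: GMon.
 by apply: (G_N hG0).
 by rewrite /= oppr_eq0 oner_neq0.
by rewrite big_cat big_map /=;congr (_ + _);rewrite -mulr_sumr mulN1r.
Qed.
Lemma SumR_M x y : SumR x -> SumR y -> SumR (x * y).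
move=> [l [hl ->]] [l' [hl' ->]];exists [seq u * v | u <- l, v <- l'];split.
 move=> _ /allpairsP[[u v] /= [/hl Mu /hl' Mv ->]];exact: MM.
by rewrite mulr_suml big_allpairs_dep /=;apply: eq_bigr=> u _;rewrite mulr_sumr.
Qed.
Lemma goodk_ext_sums : (forall u, Mon u -> SumR (dag u)) -> exists G1, [/\ goodk G1, G `<=` G1 & Mon `<=` G1].
move=> Mdag;exists (Fr SumR).
have [|||||h1 h2] := goodk_ext_mon T T' hG (R := SumR) (Mon := Mon) _ _ _ _ M_dom M_pos.
- exact: SumR_G.
- exact: SumR_B.
- exact: SumR_M.
- move=> _ [l [hl ->]];apply: sub_Fr;first exact: SumR_G.
 rewrite (dd_sum T T');elim: l hl=> [|u l IH] hl;first by rewrite big_nil;exact: SumR_G.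
 rewrite big_cons;apply: A_D;[exact: SumR_G|exact: SumR_B| |].
 have Mu := hl u (mem_head _ _);rewrite dd_dag;last exact: M_nz.
 by apply: SumR_M;[exact: Mdag|exact: SumR_Mon].
 by apply: IH=> v hv;apply: hl;rewrite inE hv orbT.
- move=> _ [l [hl ->]];exact: (mon_sum T T' M_nz M_dom M_add hl).
split=> //;first by move=> x /SumR_G/h2.
by move=> x /SumR_Mon/h2.
Qed.
End Sums.
(** The monomials are [g * z ^+ n]. Their logarithmic derivatives lie in [G], so dominance between
    them transfers. The last hypothesis covers the powers of [z] whose value is already taken: those
    must belong to [G], so that asymptotic monomials can be added. *)
Lemma stepA (z a : KK) : 0 < z.1 -> 0 < z.2 -> G a -> dd z = a * z ->
 (forall n f, G f -> f.1 != 0 -> asymp O (z.1 ^+ n.+1) f.1 -> G (z ^+ n.+1)) ->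
 exists G1, [/\ goodk G1, G `<=` G1 & G1 z].
move=> z1 z2 Ga dz hz;have nzz : nz z by split;rewrite gt_eqF.
have dagz : dag z = a.
 have e : dag z * z = a * z by rewrite -dd_dag.
 rewrite [dag z]surjective_pairing [a]surjective_pairing;congr pair.
 apply: (mulIf nzz.1);exact: (congr1 fst e).
 apply: (mulIf nzz.2);exact: (congr1 snd e).
pose Mon := [set u | exists g n, [/\ G g, g.1 != 0 & u = g * z ^+ n]].
have Mnz u : Mon u -> nz u.
 by move=> [g [n [Gg g1 ->]]];apply: nzM;[exact: G_nz|exact: nzX].
have Mdag u : Mon u -> G (dag u).
 move=> [g [n [Gg g1 ->]]];rewrite dagM;[|exact: G_nz|exact: nzX].
 by rewrite dagX // dagz;apply: (G_D hG0);[exact: G_dag|exact: A_Mn].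
have GMon g : G g -> g.1 != 0 -> Mon g by move=> Gg g1;exists g, 0%N;rewrite expr0 mulr1.
have [|||||H1 [h1 h2 h3]] := @goodk_ext_sums Mon GMon Mnz.
- move=> _ _ [g [n [Gg g1 ->]]] [h [m [Gh h1 ->]]];exists (g * h), (n + m)%N;split.
 + exact: GM.
 + by rewrite /= mulf_neq0.
 + by rewrite exprD mulrACA.
- move=> u v Mu Mv;apply: dom_dag;[exact: Mnz|exact: Mnz|].
 apply: G_cmp;apply: GB;exact: Mdag.
- move=> u [g [n [Gg g1 ->]]] /=;rewrite pX1 pX2 !pmulr_lgt0 ?exprn_gt0 //;exact: (g_pos hG0).
- have aux g n h m : G g -> g.1 != 0 -> G h -> h.1 != 0 -> (n <= m)%N ->
 (g * z ^+ n).1 =: (h * z ^+ m).1 -> g * z ^+ n + h * z ^+ m = 0 \/ Mon (g * z ^+ n + h * z ^+ m).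
 move=> Gg g1 Gh h1 le as1.
 have Gz : G (z ^+ (m - n)).
 case E : (m - n)%N=> [|d];first by rewrite expr0.
 apply: (hz d (g * vv h));first by apply: GM=> //;exact: (g_V hG0).
 by rewrite /= mulf_neq0 ?invr_neq0.
 have ez : (h * z ^+ m).1 = h.1 * z.1 ^+ n * z.1 ^+ d.+1 by rewrite -E /= pX1 -mulrA -exprD subnKC.
 rewrite ez /= pX1 in as1;have zn : z.1 ^+ n != 0 by rewrite expf_neq0 // nzz.1.
 have e1 : z.1 ^+ d.+1 = h.1 * z.1 ^+ n * z.1 ^+ d.+1 * (h.1 * z.1 ^+ n)^-1.
 by rewrite mulrAC mulfV ?mul1r // mulf_neq0.
 have e2 : (g * vv h).1 = g.1 * z.1 ^+ n * (h.1 * z.1 ^+ n)^-1 by rewrite /=;field;rewrite zn h1.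
 by rewrite e1 e2;apply: asympM=> //;[exact: asymp_sym|exact: asymp_refl].
 have -> : g * z ^+ n + h * z ^+ m = (g + h * z ^+ (m - n)) * z ^+ n.
 by rewrite mulrDl -mulrA -exprD subnK.
 set q := g + _;have Gq : G q by apply: (G_D hG0)=> //;exact: GM.
 have [q0|q0] := eqVneq q.1 0;last by right;exists q, n.
 left;rewrite (_ : q = 0) ?mul0r //;exact: (G_eq hG0).
 move=> u v [g [n [Gg g1 ->]]] [h [m [Gh h1 ->]]] as1.
 case: (leqP n m)=> [le|/ltnW le];first exact: aux.
 rewrite addrC;apply: aux=> //;exact: asymp_sym.
- move=> u /Mdag;exact: SumR_G.
by exists H1;split=> //;apply: h3;exists 1, 1%N;split=> //;[exact: oner_neq0|rewrite expr1 mul1r].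
Qed.

Section Max.
Hypothesis hmax : forall G1, goodk G1 -> G `<=` G1 -> G1 `<=` G.
(** If no power of [y] has a value in [G], adjoin [y] together with any solution of the same
    equation in the target. Otherwise take the least power n+1 whose value is that of some [f], and
    adjoin the root of [f] of that order, which is asymptotic to [y]. Maximality puts the adjoined
    element in [G]. *)
Lemma expclosed y a : y != 0 -> G a -> der y = a.1 * y -> exists2 f, G f & f.1 != 0 /\ y =: f.1.
wlog y0 : y / 0 < y.
 move=> H yn Ga dy;have [||||f Gf [f0 [h1 h2]]] := H `|y| => //;rewrite ?normr_gt0 ?normr_eq0 //.
 case: (ltrgt0P y) yn=> // h _;rewrite ?(derN hd) dy ?mulrN //.
 by exists f=> //;split=> //;split;[apply/(dle_norm T)|apply/(dle_normr T)].
move=> yn Ga dy.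
case: (pselect (exists n, exists f, [/\ G f, f.1 != 0 & y ^+ n.+1 =: f.1]))=> [ex|nex];last first.
 have [w w0 dw] := t_exp T' a.2.
 have w1 : 0 < `|w| by rewrite normr_gt0.
 have dw' : der' `|w| = a.2 * `|w|.
 by case: (ltrgt0P w) w0=> // h _;rewrite ?(derN hd') dw ?mulrN //.
 have [|n f Gf f1 h|H1 [h1 h2 h3]] := @stepA (y, `|w|) a y0 w1 Ga.
 - by congr pair.
 - by case: nex;exists n, f.
 exists (y, `|w|);first exact: (hmax h1 h2).
 split=> //=;exact: asymp_refl.
have exb : exists n, `[< exists f, [/\ G f, f.1 != 0 & y ^+ n.+1 =: f.1] >].
 by case: ex=> n h;exists n;apply/asboolP.
case: (ex_minnP exb)=> n /asboolP[f [Gf f1 hf]] hmin.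
wlog f0 : f Gf f1 hf / 0 < f.1.
 move=> H;move: (f1);case: (ltrgt0P f.1)=> // h _;first exact: (H f).
 apply: (H (- f));rewrite /= ?oppr_eq0 ?oppr_gt0 //;first exact: (G_N hG0).
 by case: hf=> p q;split;[apply/(dleNr hO)|apply/(dleNE hO)].
have f2 : 0 < f.2 by rewrite -(g_pos hG0 Gf).
have [z1 z1p ez1] := t_root T n f0;have [z2 z2p ez2] := t_root T' n f2.
have nf := G_nz Gf f1.
pose z : KK := (z1, z2);have nzz : nz z by split;rewrite gt_eqF.
have ez : z ^+ n.+1 = f by rewrite [LHS]surjective_pairing pX1 pX2 /= ez1 ez2 -surjective_pairing.
have yz : y =: z1.
 by case: hf;rewrite -ez1=> p q;split;exact: (dleX_inv hO) p || exact: (dleX_inv hO) q.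
pose c : KK := (n.+1%:R^-1, n.+1%:R^-1).
have Gc : G c.
 have -> : c = vv (1 *+ n.+1).
 by rewrite /vv pMn1 pMn2.
 apply: (g_V hG0);exact: A_Mn.
have dz : dag z = c * dag f.
 rewrite -ez dagX //.
 rewrite [LHS]surjective_pairing;congr pair;by rewrite /= ?pMn1 ?pMn2 natS_mulK.
have [|m g Gg g1 hg|H1 [h1 h2 h3]] := @stepA z (c * dag f) z1p z2p (GM Gc (G_dag Gf)).
- by rewrite dd_dag // dz.
- have hy : y ^+ m.+1 =: g.1 by apply: (asymp_trans hO (asympX hO _ yz)).
 rewrite (divn_eq m.+1 n.+1) exprD mulnC exprM ez;apply: GM;first exact: A_X.
 case E : (m.+1 %% n.+1)%N=> [|q];first by rewrite expr0.
 have lt : (q < n)%N by rewrite -ltnS -E ltn_mod.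
 exfalso;move: (hmin q);rewrite leqNgt lt=> h;suff: false by [];apply: h.
 apply/asboolP;exists (g * vv (f ^+ (m.+1 %/ n.+1)));split.
 + apply: GM=> //;apply: (g_V hG0);exact: A_X.
 + by rewrite /= pX1 mulf_neq0 // invr_neq0 // expf_neq0.
 rewrite /= pX1;have yq : y ^+ q.+1 = y ^+ m.+1 / (y ^+ n.+1) ^+ (m.+1 %/ n.+1).
 rewrite -exprM {1}(divn_eq m.+1 n.+1) E exprD mulnC mulrAC mulfV ?mul1r // expf_neq0 //.
 rewrite yq;apply: asympM=> //;apply: asympV=> //;first by rewrite expf_neq0.
 exact: asympX.
exists z;first exact: (hmax h1 h2 h3).
split=> //;exact: nzz.1.
Qed.
Lemma Fdiv_max (e : K) n : F e -> e != 0 -> exists2 b, F b & asymp O (b ^+ n.+1) e.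
move=> [g Gg <-] g1;have [|y y0 ey] := t_root T n (e := `|g.1|);first by rewrite normr_gt0.
have yn : y != 0 by rewrite gt_eqF.
pose c : KK := (n.+1%:R^-1, n.+1%:R^-1).
have Gc : G c.
 have -> : c = vv (1 *+ n.+1).
 by rewrite /vv pMn1 pMn2.
 apply: (g_V hG0);exact: A_Mn.
have [|f Gf [f1 hf]] := expclosed yn (GM Gc (G_dag Gg)).
 have e1 : logd g.1 = logd y *+ n.+1 by rewrite -(logd_abs T) -ey logdX.
 change (der y = n.+1%:R^-1 * logd g.1 * y).
 by rewrite e1 natS_mulK /logder divfK.
exists f.1;first by exists f.
apply: (asymp_trans hO (asympX hO n.+1 (asymp_sym hf)));rewrite ey.
split;[apply/(dle_norm T)|apply/(dle_normr T)];exact: dle_refl.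
Qed.

Hypothesis hs : @succ_card_saturated _ (pst der' O' k') K.
(** Without a best approximation the immediate step would properly extend [G]. *)
Lemma best_approx y : ~ F y -> exists2 b, G b & forall b1, G b1 -> y - b.1 <=: y - b1.1.
move=> nF;apply: contrapT=> h.
have himm b : F b -> exists2 b1, F b1 & y - b1 <: y - b.
 move=> [x Gx <-];apply: contrapT=> h1;apply: h;exists x=> // b1 Gb1;apply: contrapT=> h2.
 by apply: h1;exists b1.1=> //;exists b1.
have [H1 [h1 h2 [x H1x nFx]]] := stepI T T' hG himm Fdiv_max hs.
apply: nFx;exists x=> //;exact: (hmax h1 h2).
Qed.
Lemma sim_F y f : G f -> y != 0 -> y =: f.1 -> exists2 g, G g & y - g.1 <: y.
move=> Gf y0 [h1 h2];have f0 : f.1 != 0 by apply: contra_neq y0=> e;move: h1;rewrite e=> /dlex0.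
have [c kc hcc] := t_lift T ((dleP O y f0).1 h1);have [x Gx ex] := hG.2 c kc.
exists (f * x);first exact: GM.
have -> : y - (f * x).1 = (y / f.1 - c) * f.1 by rewrite /= ex;field.
by apply: (dlt_le_trans hO _ h2);rewrite -[X in ~ dominated _ X _]mul1r;apply: dltMr.
Qed.
Definition newval z := z != 0 /\ forall f, G f -> ~ (z =: f.1).
Lemma ex_newval y : ~ F y -> exists z, newval z.
move=> nF;have [b Gb hb] := best_approx nF;exists (y - b.1).
have n0 : y - b.1 != 0 by apply/eqP=> /subr0_eq e;apply: nF;exists b.
split=> // f Gf /(sim_F Gf n0)[g Gg h];apply: h.
by have := hb (b + g) (G_D hG0 Gb Gg);rewrite /= opprD addrA.
Qed.
(** By [expclosed] the logarithmic derivative of [z] is not in the field. Let [b] be its best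
    approximation and [g0] a solution of [logd g0 = b.1], replaced by an asymptotic [f] of [G]. Then
    [logd (z / f)] is equivalent to [logd z - b.1], whose value is new because otherwise [b] could
    be improved. *)
Lemma next_newval z : newval z -> exists2 g, G g & [/\ g.1 != 0, newval (logd (z / g.1)) & 1 <: logd (z / g.1)].
move=> [z0 hz].
have nF : ~ F (logd z).
 move=> [a Ga ea];have [|f Gf [f1 hf]] := expclosed z0 Ga;last exact: hz hf.
 by rewrite ea /logder divfK.
have [b Gb hb] := best_approx nF;have [g0 g00 dg0] := t_exp T b.1.
have [f Gf [f1 hf]] := expclosed g00 Gb dg0.
have lg0 : logd g0 = b.1 by rewrite /logder dg0 mulfK.
have big : 1 <: logd z - b.1.
 rewrite -lg0 -logd_div //;apply: (logd_big T);first by rewrite mulf_neq0 ?invr_neq0.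
 move=> h;apply: (hz f Gf);apply: (asymp_trans hO _ hf).
 have e0 : z = z / g0 * g0 by rewrite divfK.
 rewrite e0 -[X in asymp _ _ X]mul1r;exact: (asympM hO h (asymp_refl hO g0)).
have sm : logd f.1 - b.1 <=: 1.
 rewrite -lg0 -logd_div //;apply: (logd_unit T).
 by rewrite -(mulfV g00);apply: asympM=> //;[exact: asymp_sym|exact: asymp_refl].
have e : logd (z / f.1) = (logd z - b.1) - (logd f.1 - b.1) by rewrite logd_div //;ring.
have sim : logd (z / f.1) ~: logd z - b.1.
 rewrite e addrAC subrr add0r;apply: dltN=> //;exact: (dle_lt_trans hO sm).
have as1 := sim_asymp hO sim.
exists f=> //;split=> //;last by apply: (dlt_le_trans hO big);exact: as1.2.
split;first exact: (sim_neq0l hO sim).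
move=> h Gh hh;have n0 := dlt_neq0 hO big.
have [g Gg hg] := sim_F Gh n0 (asymp_trans hO (asymp_sym as1) hh).
by apply: hg;have := hb (b + g) (G_D hG0 Gb Gg);rewrite /= opprD addrA.
Qed.
Lemma G_dagdiv g f : G g -> G f -> nz g -> nz f -> G (dag (g * vv f)).
move=> Gg Gf _ _;apply: G_dag;apply: GM=> //;exact: (g_V hG0). Qed.

Section Sequence.
Variables (z : nat -> K) (g : nat -> KK).
Hypothesis zn : forall i, newval (z i).
Hypothesis Gg : forall i, G (g i).
Hypothesis g0 : forall i, (g i).1 != 0.
Hypothesis zS : forall i, z i.+1 = logd (z i / (g i).1).
Hypothesis z_big : forall i, 1 <: z i.+1.
Let ng i := G_nz (Gg i) (g0 i).
Definition ok i (f : KK) (x : K') := [/\ x != 0, (0 < z i) = (0 < x),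
 f.1 <: z i -> f.2 <:' x & z i <: f.1 -> x <:' f.2].

Fixpoint lv i j (x : K') : K' := if j is j'.+1 then lv i.+1 j' (logd' (x / (g i).2)) else x.

(* The position of x relative to f is read off from the sign of (x/f)†,
 which is determined by the position of (x/g)† relative to (g/f)†. *)
Lemma ok_down i f x : G f -> f.1 != 0 -> ok i.+1 1 (logd' (x / (g i).2)) ->
 ok i.+1 (dag (g i * vv f)) (logd' (x / (g i).2)) -> x != 0 -> (0 < z i) = (0 < x) -> ok i f x.
move=> Gf f1 [y0 ys yb _] [_ _ ya yc] x0 sg;set y := logd' _ in y0 ys yb ya yc.
have nf := G_nz Gf f1;have [zi0 hzi] := zn i.
set b := dag (g i * vv f) in ya yc *.
have Gb : G b by apply: G_dagdiv.
have e1 : logd (z i / f.1) = z i.+1 + b.1.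
 rewrite /b dagM // ?dag_vv //;last exact: nz_vv.
 by rewrite zS /= !logd_div // ?(g0 i) //;ring.
have e2 : logd' (x / f.2) = y + b.2.
 rewrite /b dagM // ?dag_vv //;last exact: nz_vv.
 by rewrite /y /= !logd_div // ?(ng i).2 ?nf.2 //;ring.
have zb : 1 <: z i.+1 by exact: z_big.
have yb1 : 1 <:' y by apply: yb;exact: z_big.
have [w [w1 w2 sw s1 s2]] : exists w : KK, [/\ 1 <: w.1, 1 <:' w.2, (0 < w.1) = (0 < w.2),
 z i.+1 + b.1 ~: w.1 & y + b.2 ~:' w.2].
 case: (pselect (b.1 <: z i.+1))=> h.
 exists (z i.+1, y);split=> //=;rewrite addrAC subrr add0r //;exact: ya.
 have {}h : z i.+1 <: b.1 by move=> h';apply: ((zn i.+1).2 b Gb);split=> //;apply: contrapT.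
 exists b;split.
 - exact: (dlt_trans hO zb h).
 - apply: (dlt_trans hO' yb1);exact: yc.
 - exact: (g_pos hG0).
 - by rewrite addrK.
 - rewrite addrK;exact: yc.
have p1 := sim_gt0 hO hc s1;have p2 := sim_gt0 hO' hc' s2;rewrite -e1 in p1;rewrite -e2 in p2.
have b1 : 1 <: logd (z i / f.1) by rewrite e1;apply: (dlt_le_trans hO w1);exact: (sim_asymp hO s1).2.
have b2 : 1 <:' logd' (x / f.2) by rewrite e2;apply: (dlt_le_trans hO' w2);exact: (sim_asymp hO' s2).2.
have zf0 : z i / f.1 != 0 by rewrite mulf_neq0 ?invr_neq0.
have xf0 : x / f.2 != 0 by rewrite mulf_neq0 ?invr_neq0 ?nf.2.
have d1 := dag_le1 T zf0;have d2 := dag_le1 T' xf0.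
have key : z i / f.1 <=: 1 <-> x / f.2 <=:' 1.
 rewrite d1 d2;have l1 := dlt_neq0 hO b1;have l2 := dlt_neq0 hO' b2.
 have e : (logd (z i / f.1) < 0) = (logd' (x / f.2) < 0).
 by rewrite !lt_neqAle l1 l2 /= !leNgt p1 p2 sw.
 by split=> -[//|h];right;rewrite ?e // -e.
rewrite (dle1 O) -(dleP O) // (dle1 O') -(dleP O') ?nf.2 // in key.
split=> //.
- by move=> h h';apply: h;apply/key.
- move=> h h';have xf : x <=:' f.2 by apply/key;exact: dltW.
 have : x / f.2 <=:' 1 by apply/(dle1 O')/(dleP O');rewrite ?nf.2.
 have as1 : asymp O' (x / f.2) 1.
 rewrite -(mulfV nf.2);split;exact: dleMr.
 by have := logd_unit T' as1=> /b2.
Qed.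

(* Finite satisfiability: pick a value at the last level, then integrate
 logarithmic derivatives back to level i. *)
Lemma lv_finite m i (Phi : nat -> seq KK) : (forall j f, f \in Phi j -> G f /\ f.1 != 0) ->
 exists x, forall j f, (j <= m)%N -> f \in Phi j -> x != 0 /\ ok (i + j) f (lv i j x).
elim: m i Phi=> [|m IH] i Phi hP.
 pose A := [seq f.2 | f <- Phi 0%N & `[< f.1 <: z i >]].
 pose B := [seq f.2 | f <- Phi 0%N & `[< z i <: f.1 >]].
 have [||a b|x [x0 hA hB]] := @finite_cut K' der' O' k' T' A B.
 - move=> a /mapP[f];rewrite mem_filter=> /andP[_ /hP[Gf f1]] ->;exact: (G_nz Gf f1).2.
 - move=> a /mapP[f];rewrite mem_filter=> /andP[_ /hP[Gf f1]] ->;exact: (G_nz Gf f1).2.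
 - move=> /mapP[f];rewrite mem_filter=> /andP[/asboolP h1 /hP[Gf f1]] -> /mapP[f'].
 rewrite mem_filter=> /andP[/asboolP h2 /hP[Gf' f1']] -> h.
 by apply: (dlt_trans hO h1 h2);apply/(g_dom hG0 Gf' Gf).
 exists (if 0 < z i then x else - x)=> -[|//] f _ hf;rewrite addn0 /=.
 have n0 : (if 0 < z i then x else - x) != 0 by case: ifP;rewrite ?oppr_eq0 gt_eqF.
 split=> //;split=> //.
 - by case: ifP=> // _;rewrite oppr_gt0 ltNge ltW.
 - move=> h;have := hA f.2;have -> : f.2 \in A.
 by apply/mapP;exists f=> //;rewrite mem_filter hf andbT;apply/asboolP.
 by move=> /(_ isT) h';case: ifP=> // _ /(dleNE hO').
 - move=> h;have := hB f.2;have -> : f.2 \in B.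
 by apply/mapP;exists f=> //;rewrite mem_filter hf andbT;apply/asboolP.
 by move=> /(_ isT) h';case: ifP=> // _ /(dleNr hO').
pose Phi' j := if j is 0%N then 1 :: [seq dag (g i * vv f) | f <- Phi 0%N & (dag (g i * vv f)).1 != 0] ++ Phi 1%N else Phi j.+1.
have [|y hy] := IH i.+1 Phi'.
 move=> [|j] f;last exact: hP.
 rewrite inE mem_cat=> /or3P[/eqP ->|/mapP[f']|];[by split=> //;exact: oner_neq0| |exact: hP].
 rewrite mem_filter=> /andP[n1 /hP[Gf' f1']] ->;split=> //.
 apply: G_dagdiv=> //;exact: G_nz.
have [y0 ok1] := hy 0%N 1 isT (mem_head _ _).
have [w w0 dw] := t_exp T' y.
have lw : logd' w = y by rewrite /logder dw mulfK.
pose x1 := w * (g i).2.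
have x10 : x1 != 0 by rewrite mulf_neq0 // (ng i).2.
pose x := if (0 < z i) == (0 < x1) then x1 else - x1.
have x0 : x != 0 by rewrite /x;case: ifP;rewrite ?oppr_eq0.
have sx : (0 < z i) = (0 < x).
 rewrite /x;case: ifP=> [/eqP //|];have := (zn i).1.
 rewrite oppr_gt0;move: x10;by case: (ltgtP 0 x1)=> //;case: (ltgtP 0 (z i)).
have lx : logd' (x / (g i).2) = y.
 rewrite -lw /x;case: ifP=> _;rewrite ?mulNr ?logdN /x1 ?mulfK ?(ng i).2 //.
exists x=> -[|j] f hj hf;last first.
 split=> //;rewrite /= lx addnS -addSn.
 have [|_ //] := hy j f hj;rewrite /Phi';case: (j) hf=> // hf;by rewrite inE mem_cat hf !orbT.
split=> //;rewrite addn0 /=;have [Gf f1] := hP _ _ hf.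
apply: ok_down=> //;rewrite lx;rewrite addn0 in ok1=> //.
have nb := G_nz Gf f1;set b := dag _.
have [b1|b1] := eqVneq b.1 0.
 have -> : b = 0 by apply: (G_eq hG0)=> //;apply: G_dagdiv.
 case: ok1=> p q _ _;split=> //;first by move=> _;exact: dlt0x.
 move=> h;exfalso;apply: h;exact: dle0x.
have [|_] := hy 0%N b isT;last by rewrite addn0.
rewrite /Phi' inE mem_cat;apply/or3P;apply: Or32;apply/mapP;exists f=> //;by rewrite mem_filter b1.
Qed.
Lemma lvS i j x : lv i j.+1 x = logd' (lv i j x / (g (i + j)%N).2).
elim: j i x=> [|j IH] i x;first by rewrite addn0.
by have -> : lv i j.+2 x = lv i.+1 j.+1 (logd' (x / (g i).2));[|rewrite IH addSnnS].
Qed.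
Lemma cutCP m f x : G f -> f.1 != 0 -> cutC (0 < z m) `[< f.1 <: z m >] der' O' k' x f.2 <-> ok m f x.
move=> Gf f1;have [z0 hz] := zn m;rewrite /cutC;split=> [[h1 h2]|[x0 h1 h2 h3]].
 have x0 : x != 0 by move: h1;case: ifP=> _ h;[rewrite gt_eqF|rewrite lt_eqF].
 split=> //.
 - by move: h1;case: ifP=> // _ h;rewrite ltNge (ltW h).
 - by move=> h;move: h2;case: asboolP.
 - move=> h;move: h2;case: asboolP=> // h';exfalso;exact: (h' (dltW hO h)).
split;first by rewrite h1;case: ifP=> // /negbT;rewrite -leNgt lt_neqAle x0.
case: asboolP=> h;first exact: h2.
by apply: h3=> h';apply: (hz f Gf);split=> //;apply: contrapT.
Qed.
(** Environment for [levE]: the divisors of the levels i, ..., i+m-1, followed by the element of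
    comparison. *)
Definition wv i m (c : K') : nat -> K' := fun j=> if (j < m)%N then (g (i + j)%N).2 else c.
Lemma levE_lv C m i x c : (levE C m der' O' k' x (wv i m c) -> C K' der' O' k' (lv i m x) c) /\
 ((forall j, (j < m)%N -> lv i j x != 0) -> C K' der' O' k' (lv i m x) c -> levE C m der' O' k' x (wv i m c)).
elim: m i x=> [|m IH] i x //=.
have -> : (fun j=> wv i m.+1 c j.+1) = wv i.+1 m c.
 by apply: funext=> j;rewrite /wv ltnS addSnnS.
have w0 : wv i m.+1 c 0%N = (g i).2 by rewrite /wv /= addn0.
rewrite w0;have gi := (ng i).2.
split=> [[x1 [[x0 e] h]]|h1 h2].
 have -> : logd' (x / (g i).2) = x1;last exact: (IH i.+1 x1).1.
 rewrite logd_div // /logder;have -> : x1 = (der' x * (g i).2 - x * der' (g i).2) / (x * (g i).2).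
 by rewrite -e mulfK // mulf_neq0.
 by field;rewrite gi x0.
have x0 := h1 0%N isT;exists (logd' (x / (g i).2));split.
 by split=> //;rewrite logd_div // /logder;field;rewrite gi x0.
apply: (IH i.+1 _).2=> // j hj;exact: (h1 j.+1).
Qed.
(** A single [y] has to satisfy the position and sign conditions of all levels. They are expressed
    by [levE]; finitely many of them reach only some level M, where [lv_finite] applies. *)
Lemma realize_seq : exists y, forall m f, G f -> f.1 != 0 -> ok m f (lv 0 m y).
pose F' : set K' := [set x.2 | x in G].
pose cc m f : K' -> Prop := fun x=> levE (cutC (0 < z m) `[< f.1 <: z m >]) m der' O' k' x (wv 0 m f.2).
pose Cs := [set D | exists m f, [/\ G f, f.1 != 0 & D = cc m f]].
have [D [m [f [Gf f1 ->]]]|l hl|y hy] := @realize _ der' O' k' K F' hs (F'card hG) Cs.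
- exists (fun K d O k v=> levE (cutC (0 < z m) `[< f.1 <: z m >]) m d O k (v 0%N) (fun j=> v j.+1)), (wv 0 m f.2).
 split=> //;first by apply: e_levE;exact: e_cutC.
 by move=> j;rewrite /wv;case: ifP=> _;[exists (g (0 + j)%N)|exists f].
- have [M [Phi [hP hD]]] : exists M (Phi : nat -> seq KK), (forall j f, f \in Phi j -> G f /\ f.1 != 0) /\
 forall D, List.In D l -> exists m f, [/\ (m <= M)%N, f \in Phi m & D = cc m f].
 elim: l hl=> [|D l IH] hl;first by exists 0%N, (fun=> [::]).
 have [|M [Phi [hP hD]]] := IH;first by move=> D' h;apply: hl;right.
 have [m [f [Gf f1 eD]]] := hl D (or_introl erefl).
 exists (maxn m M), (fun j=> if j == m then f :: Phi j else Phi j);split.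
 move=> j f';case: eqP=> _;last exact: hP.
 by rewrite inE=> /orP[/eqP ->|/hP].
 move=> D' [<-|/hD[m' [f' [h1 h2 h3]]]].
 by exists m, f;rewrite leq_maxl eqxx mem_head.
 exists m', f';split=> //;first by rewrite (leq_trans h1) // leq_maxr.
 by case: eqP=> // _;rewrite inE h2 orbT.
 have [|x hx] := @lv_finite M 0%N (fun j=> 1 :: Phi j).
 move=> j f;rewrite inE=> /orP[/eqP ->|/hP//];split=> //;exact: oner_neq0.
 exists x=> D /hD[m [f [mM fP ->]]];have [Gf f1] := hP _ _ fP.
 apply: (levE_lv _ _ _ _ _).2.
 by move=> j jm;have [_ []] := hx j 1 (leq_trans (ltnW jm) mM) (mem_head _ _).
 by apply/cutCP=> //;have [|_] := hx m f mM;rewrite ?add0n // inE fP orbT.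
exists y=> m f Gf f1;apply/cutCP=> //;apply: (levE_lv _ _ 0%N _ _).1.
by apply: (hy (cc m f));exists m, f.
Qed.

Section Realized.
Variable y : K'.
Hypothesis hy : forall m f, G f -> f.1 != 0 -> ok m f (lv 0 m y).
Let zz m : KK := (z m, lv 0 m y).
Let zz_nz m : nz (zz m).
by split;[exact: (zn m).1|have [] := @hy m 1 G1 (oner_neq0 _)].
Qed.
Let zz_sg m : (0 < (zz m).1) = (0 < (zz m).2).
by have [] := @hy m 1 G1 (oner_neq0 _). Qed.
Let zzS m : zz m.+1 = dag (zz m) - dag (g m).
have [n1 n2] := zz_nz m;have [q1 q2] := ng m;rewrite [RHS]surjective_pairing /zz;congr pair.
 by rewrite /= zS logd_div.
by rewrite lvS add0n /= logd_div.
Qed.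
Let cutS m f : G f -> (f.1 <=: (zz m).1 <-> f.2 <=:' (zz m).2) /\ ((zz m).1 <=: f.1 <-> (zz m).2 <=:' f.2).
move=> Gf;have [z0 hz] := zn m;have [f1|f1] := eqVneq f.1 0.
 have -> : f = 0 by exact: (G_eq hG0).
 split;first by split=> _;exact: dle0x.
 by split=> /dlex0/eqP;rewrite ?(negPf (zz_nz m).1) ?(negPf (zz_nz m).2).
have [_ _ h1 h2] := hy m Gf f1;case: (pselect (f.1 <: z m))=> h.
 have h' := h1 h;split;split=> //.
 - move=> _;exact: dltW.
 - move=> _;exact: dltW.
have {}h : z m <: f.1 by move=> h';apply: (hz f Gf);split=> //;apply: contrapT.
have h' := h2 h;split;split=> //.
- move=> _;exact: dltW.
- move=> _;exact: dltW.
Qed.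
Let cut_or m f : G f -> (f.1 <: (zz m).1 /\ f.2 <:' (zz m).2) \/ ((zz m).1 <: f.1 /\ (zz m).2 <:' f.2).
move=> Gf;have [c1 c2] := cutS m Gf;case: (pselect (f.1 <: z m))=> h.
 by left;split=> // /c2.
have {}h : z m <: f.1 by move=> h';apply: ((zn m).2 f Gf);split=> //;apply: contrapT.
by right;split=> // /c1.
Qed.
Let big m : 1 <: (zz m.+1).1 /\ 1 <:' (zz m.+1).2.
have h1 : 1 <: z m.+1 by exact: z_big.
split=> // h;apply: h1;exact: ((cutS m.+1 G1).2.2 h).
Qed.
Let desc1 m : (zz m.+2).1 <: (zz m.+1).1 /\ (zz m.+2).2 <:' (zz m.+1).2.
have h := cut_or m.+2 (G_dag (Gg m.+1)).
split;[apply: (logd_desc T (big m).1 (ng m.+1).1)|apply: (logd_desc T' (big m).2 (ng m.+1).2)].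
- exact: zS.
- by case: h=> -[? ?];[left|right].
- by rewrite /zz /snd lvS add0n.
- by case: h=> -[? ?];[left|right].
Qed.
Let desc i j : (i < j)%N -> (zz j.+1).1 <: (zz i.+1).1 /\ (zz j.+1).2 <:' (zz i.+1).2.
elim: j=> // j IH;rewrite ltnS leq_eqVlt=> /orP[/eqP ->|/IH[h1 h2]];first exact: desc1.
by split;[exact: (dlt_trans hO (desc1 j).1)|exact: (dlt_trans hO' (desc1 j).2)].
Qed.
Let prod_nz n (e : nat -> nat) : nz (\prod_(i < n) zz i ^+ e i).
by elim/big_ind: _=> [|a b|i _];[split;exact: oner_neq0|exact: nzM|exact: nzX]. Qed.
Lemma dag_prod n (e : nat -> nat) : dag (\prod_(i < n) zz i ^+ e i) = \sum_(i < n) (zz i.+1 + dag (g i)) *+ e i.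
elim: n=> [|n IH].
 by rewrite !big_ord0 -(expr0 (zz 0%N)) dagX // mulr0n.
rewrite !big_ord_recr /= dagM;[|exact: prod_nz|exact: nzX].
rewrite IH;by congr (_ + _);rewrite dagX // zzS subrK.
Qed.
(** Natural exponents suffice, since inverses appear when fractions are taken. *)
Definition Mn n (u : KK) := exists h (e : nat -> nat), [/\ G h, h.1 != 0 & u = h * \prod_(i < n) zz i ^+ e i].
Lemma Mn_widen n m u : (n <= m)%N -> Mn n u -> Mn m u.
move=> le [h [e [Gh h1 ->]]];exists h, (fun i=> if (i < n)%N then e i else 0%N);split=> //.
rewrite (big_ord_widen m (fun i=> zz i ^+ e i) le) big_mkcond /=;congr (_ * _).
by apply: eq_bigr=> i _;case: ifP.
Qed.
Lemma Mn_nz n u : Mn n u -> nz u.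
by move=> [h [e [Gh h1 ->]]];apply: nzM;[exact: G_nz|exact: prod_nz]. Qed.
Lemma mulrn_diff (L : RF) (V : set L) (hV : valuation_ring V) (cV : convex_ring V) (x : L) a b :
 x != 0 -> a != b -> asymp V (x *+ a - x *+ b) x /\ (0 < x *+ a - x *+ b) = ((0 < x) == (b < a)%N).
move=> x0;have pos d : asymp V (x *+ d.+1) x.
 by split;[apply: dleMn=> //;exact: dle_refl|apply: (dle_nat hV cV (n := d));exact: dle_refl].
rewrite neq_ltn=> /orP[lt|lt].
 have e : x *+ a - x *+ b = - (x *+ (b - a).-1.+1) by rewrite prednK ?subn_gt0 // mulrnBr ?opprB // ltnW.
 rewrite e ltnNge (ltnW lt) /= oppr_gt0 pmulrn_llt0 //;split.
 by case: (pos (b - a).-1)=> p q;split;[apply/dleNE|apply/dleNr].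
 by case: (ltgtP 0 x) x0.
have e : x *+ a - x *+ b = x *+ (a - b).-1.+1 by rewrite prednK ?subn_gt0 // mulrnBr // ltnW.
by rewrite e lt;split;[exact: pos|rewrite pmulrn_lgt0 //;case: (0 < x)].
Qed.
(** The difference of logarithmic derivatives is an [f] in [G] plus integer multiples of the
    [zz i.+1]. These decrease strictly in dominance, so the first index with different exponents
    prevails among them. Its value is new, so it does not tie with [f], and the winner is the same
    in both fields. *)
Lemma Mn_diff n u v h (e : nat -> nat) h' (e' : nat -> nat) : G h -> h.1 != 0 -> u = h * \prod_(i < n) zz i ^+ e i ->
 G h' -> h'.1 != 0 -> v = h' * \prod_(i < n) zz i ^+ e' i ->
 (forall i, (i < n)%N -> e i = e' i) \/ exists w : KK, [/\ 1 <: w.1, 1 <:' w.2, (0 < w.1) = (0 < w.2),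
 (dag u - dag v).1 ~: w.1 & (dag u - dag v).2 ~:' w.2].
move=> Gh h1 -> Gh' h1' ->.
rewrite dagM;[|exact: G_nz|exact: prod_nz].
rewrite dagM;[|exact: G_nz|exact: prod_nz].
rewrite !dag_prod.
pose t i : KK := zz i.+1 *+ e i - zz i.+1 *+ e' i.
pose f : KK := dag h - dag h' + (\sum_(i < n) dag (g i) *+ e i - \sum_(i < n) dag (g i) *+ e' i).
have Gf : G f.
 apply: (G_D hG0);first by apply: GB;exact: G_dag.
 apply: GB;apply: A_sum=> // i _;apply: A_Mn=> //;exact: G_dag.
have -> : dag h + \sum_(i < n) (zz i.+1 + dag (g i)) *+ e i -
 (dag h' + \sum_(i < n) (zz i.+1 + dag (g i)) *+ e' i) = f + \sum_(i < n) t i.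
 have -> : \sum_(i < n) t i = \sum_(i < n) zz i.+1 *+ e i - \sum_(i < n) zz i.+1 *+ e' i by rewrite -sumrB.
 have sp (c : nat -> nat) : \sum_(i < n) (zz i.+1 + dag (g i)) *+ c i = \sum_(i < n) zz i.+1 *+ c i + \sum_(i < n) dag (g i) *+ c i.
 by rewrite -big_split;apply: eq_bigr=> i _;rewrite mulrnDl.
 rewrite !sp /f;exact: subr3ACA.
case: (pselect (exists i, (i < n)%N && (e i != e' i)))=> [exj|nex];last first.
 by left=> i hi;apply/eqP;apply: contrapT=> /negP ne;apply: nex;exists i;rewrite hi.
right;case: (ex_minnP exj)=> j /andP[jn ne] jmin.
have tn (L : RF) (V : set L) (pr : {additive KK -> L}) : valuation_ring V ->
 (forall i, pr (zz i.+1) != 0) -> asymp V (pr (t j)) (pr (zz j.+1)) ->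
 (forall i i', (i < i')%N -> ~ dominated V (pr (zz i.+1)) (pr (zz i'.+1))) ->
 ~ dominated V (pr (t j)) (pr (\sum_(i < n) t i) - pr (t j)).
 move=> hV n0 as1 ds;have -> : \sum_(i < n) t i = t j + \sum_(i < n | i != Ordinal jn) t i by rewrite (bigD1 (Ordinal jn)).
 rewrite (raddfD pr (t j) (\sum_(i < n | i != Ordinal jn) t i)) addrAC subrr add0r (raddf_sum pr).
 apply: dlt_sum=> //;first exact: asymp_neq0 as1 (n0 j).
 move=> i nij;apply: (dlt_le_trans hV _ as1.2).
 case: (ltngtP i j)=> [lt|gt|eq];last by case/eqP: nij;exact: val_inj.
 have -> : t i = 0.
 have : ~~ ((i < n)%N && (e i != e' i)) by apply: contraL lt=> /jmin;rewrite -leqNgt.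
 by rewrite ltn_ord /= negbK=> /eqP ee;rewrite /t ee subrr.
 rewrite raddf0;exact: dlt0x.
 apply: (dle_lt_trans hV _ (ds _ _ gt));rewrite /t (raddfB pr) (raddfMn pr) [pr (_ *+ e' i)](raddfMn pr).
 apply: dleB=> //;apply: dleMn=> //;exact: dle_refl.
have [a1 s1] := mulrn_diff hO hc (zz_nz j.+1).1 ne.
have [a2 s2] := mulrn_diff hO' hc' (zz_nz j.+1).2 ne.
rewrite -!pMn1 in a1 s1;rewrite -!pMn2 in a2 s2.
have t1 := tn K O (@fst K K' : {additive KK -> K}) hO (fun i=> (zz_nz i.+1).1) a1 (fun i i' h=> (desc h).1).
have t2 := tn K' O' (@snd K K' : {additive KK -> K'}) hO' (fun i=> (zz_nz i.+1).2) a2 (fun i i' h=> (desc h).2).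
case: (cut_or j.+1 Gf)=> -[f1 f2].
 exists (t j);split.
 - exact: (dlt_le_trans hO (big j).1 a1.2).
 - exact: (dlt_le_trans hO' (big j).2 a2.2).
 - by rewrite [LHS]s1 [RHS]s2 zz_sg.
 - have -> : (f + \sum_(i < n) t i).1 - (t j).1 = f.1 + ((\sum_(i < n) t i).1 - (t j).1).
 exact: esym (addrA f.1 (\sum_(i < n) t i).1 (- (t j).1)).
 apply: dltD=> //;apply: (dlt_le_trans hO f1);exact: a1.2.
 - have -> : (f + \sum_(i < n) t i).2 - (t j).2 = f.2 + ((\sum_(i < n) t i).2 - (t j).2).
 exact: esym (addrA f.2 (\sum_(i < n) t i).2 (- (t j).2)).
 apply: dltD=> //;apply: (dlt_le_trans hO' f2);exact: a2.2.
exists f;split.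
- exact: (dlt_trans hO (big j).1).
- exact: (dlt_trans hO' (big j).2).
- exact: (g_pos hG0).
- have -> : (f + \sum_(i < n) t i).1 - f.1 = (\sum_(i < n) t i).1.
 by rewrite -[LHS]/(f.1 + (\sum_(i < n) t i).1 - f.1) [f.1 + _]addrC addrK.
 by apply: (dle_lt_trans hO (dle_trans hO (sim_asymp hO t1).1 a1.1)).
- have -> : (f + \sum_(i < n) t i).2 - f.2 = (\sum_(i < n) t i).2.
 by rewrite -[LHS]/(f.2 + (\sum_(i < n) t i).2 - f.2) [f.2 + _]addrC addrK.
 by apply: (dle_lt_trans hO' (dle_trans hO' (sim_asymp hO' t2).1 a2.1)).
Qed.
Lemma stepV : exists G1, [/\ goodk G1, G `<=` G1 & G1 (zz 0%N)].
pose Mon : set KK := [set u | exists n, Mn n u].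
have two u v : Mon u -> Mon v -> exists n h (e : nat -> nat) h' (e' : nat -> nat), [/\ [/\ G h, h.1 != 0 & u = h * \prod_(i < n) zz i ^+ e i],
 G h', h'.1 != 0 & v = h' * \prod_(i < n) zz i ^+ e' i].
 move=> [n Mu] [m Mv];have [h [e [? ? ?]]] := Mn_widen (leq_maxl n m) Mu.
 have [h' [e' [? ? ?]]] := Mn_widen (leq_maxr n m) Mv.
 by exists (maxn n m), h, e, h', e'.
have Mnz u : Mon u -> nz u by move=> [n /Mn_nz].
have GMon h : G h -> h.1 != 0 -> Mon h.
 by move=> Gh h1;exists 0%N, h, (fun=> 0%N);split=> //;rewrite big_ord0 mulr1.
have [|||||H1 [h1 h2 h3]] := @goodk_ext_sums Mon GMon Mnz.
- move=> u v Mu Mv;have [n [h [e [h' [e' [[Gh h1 ->] Gh' h1' ->]]]]]] := two u v Mu Mv.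
 exists n, (h * h'), (fun i=> (e i + e' i)%N);split.
 + exact: GM.
 + by rewrite /= mulf_neq0.
 + by rewrite mulrACA -big_split /=;congr (_ * _);apply: eq_bigr=> i _;rewrite exprD.
- move=> u v Mu Mv;have [n [h [e [h' [e' [[Gh h1 eu] Gh' h1' ev]]]]]] := two u v Mu Mv.
 apply: dom_dag;[exact: Mnz|exact: Mnz|].
 have [ee|[w [w1 w2 sw s1 s2]]] := Mn_diff Gh h1 eu Gh' h1' ev.
 have -> : dag u - dag v = dag h - dag h'.
 have ep : \prod_(i < n) zz i ^+ e i = \prod_(i < n) zz i ^+ e' i by apply: eq_bigr=> i _;rewrite ee.
 rewrite eu ev ep dagM;[|exact: G_nz|exact: prod_nz].
 by rewrite dagM;[rewrite opprD addrACA subrr addr0|exact: G_nz|exact: prod_nz].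
 apply: G_cmp;apply: GB;exact: G_dag.
 set b := dag u - dag v in s1 s2 *.
 have b1 : 1 <: b.1 by apply: (dlt_le_trans hO w1);exact: (sim_asymp hO s1).2.
 have b2 : 1 <:' b.2 by apply: (dlt_le_trans hO' w2);exact: (sim_asymp hO' s2).2.
 split;first by split.
 by rewrite !lt_neqAle (dlt_neq0 hO b1) (dlt_neq0 hO' b2) /= !leNgt (sim_gt0 hO hc s1) (sim_gt0 hO' hc' s2) sw.
- have aux (L : RF) (x y0 : L) : x != 0 -> y0 != 0 -> (0 < x * y0) = ((0 < x) == (0 < y0)).
 move=> x0 yn0;case: (ltgtP 0 x) x0=> // x0 _;case: (ltgtP 0 y0) yn0=> // yn0 _.
 + by rewrite mulr_gt0.
 + by apply/negbTE;rewrite -leNgt mulr_ge0_le0 ?ltW.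
 + by apply/negbTE;rewrite -leNgt mulr_le0_ge0 ?ltW.
 + by rewrite nmulr_rgt0.
 pose sg (x : KK) := nz x /\ (0 < x.1) = (0 < x.2).
 have sgM a b : sg a -> sg b -> sg (a * b).
 by move=> [na sa] [nb sb];split;[exact: nzM|rewrite /= (aux K) ?na.1 ?nb.1 // (aux K') ?na.2 ?nb.2 // sa sb].
 move=> u [n [h [e [Gh h1 ->]]]];suff [] : sg (h * \prod_(i < n) zz i ^+ e i) by [].
 apply: (sgM);first by split;[exact: G_nz|exact: (g_pos hG0)].
 have sg1 : sg 1 by split;[split;exact: oner_neq0|rewrite !ltr01].
 elim/big_ind: _=> // i _;elim: (e i)=> [|d IH];rewrite ?expr0 // exprS;apply: (sgM)=> //.
- move=> u v Mu Mv as1;have [n [h [e [h' [e' [[Gh h1 eu] Gh' h1' ev]]]]]] := two u v Mu Mv.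
 have [ee|[w [w1 w2 sw s1 s2]]] := Mn_diff Gh h1 eu Gh' h1' ev;last first.
 have nu := Mnz _ Mu;have nv := Mnz _ Mv.
 exfalso;apply: (dlt_le_trans hO w1 (sim_asymp hO s1).2).
 have -> : (dag u - dag v).1 = logd (u.1 / v.1) by rewrite logd_div ?nu.1 ?nv.1.
 apply: (logd_unit T);rewrite -(mulfV nv.1);apply: asympM=> //;exact: asymp_refl.
 have ep : \prod_(i < n) zz i ^+ e i = \prod_(i < n) zz i ^+ e' i by apply: eq_bigr=> i _;rewrite ee.
 rewrite eu ev ep -mulrDl;have Gq := G_D hG0 Gh Gh'.
 have [q0|q0] := eqVneq (h + h').1 0;last by right;exists n, (h + h'), e'.
 left;rewrite (_ : h + h' = 0) ?mul0r //;exact: (G_eq hG0).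
- move=> u [n [h [e [Gh h1 ->]]]];rewrite dagM;[|exact: G_nz|exact: prod_nz].
 have MM a b : Mon a -> Mon b -> Mon (a * b).
 move=> Ma Mb;have [m [q [c [q' [c' [[Gq q1 ->] Gq' q1' ->]]]]]] := two a b Ma Mb.
 exists m, (q * q'), (fun i=> (c i + c' i)%N);split;[exact: GM|by rewrite /= mulf_neq0|].
 by rewrite mulrACA -big_split /=;congr (_ * _);apply: eq_bigr=> i _;rewrite exprD.
 have RG := SumR_G GMon;have RB := SumR_B GMon MM;have R1 := RG _ G1.
 have RD := A_D R1 RB.
 apply: (RD);first by apply: RG;exact: G_dag.
 rewrite dag_prod;apply: A_sum=> // i _;apply: A_Mn=> //;apply: (RD);last by apply: RG;exact: G_dag.
 apply: SumR_Mon;exists i.+2, 1, (fun j=> (j == i.+1) : nat);split=> //;first exact: oner_neq0.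
 by rewrite mul1r big_ord_recr /= eqxx expr1 big1 ?mul1r // => j _;rewrite ltn_eqF.
exists H1;split=> //;apply: h3;exists 1%N, 1, (fun=> 1%N);split=> //;first exact: oner_neq0.
by rewrite big_ord1 mul1r expr1.
Qed.
End Realized.

End Sequence.
(** A missing element produces a new value, then the whole sequence of corrected logarithmic
    derivatives, each again a new value. Adjoining the sequence contradicts maximality. *)
Lemma max_total y : F y.
apply: contrapT=> nF;have [z0 nz0] := ex_newval nF.
have ex w : exists g, newval w -> [/\ G g, g.1 != 0, newval (logd (w / g.1)) & 1 <: logd (w / g.1)].
 case: (pselect (newval w))=> h;last by exists 0.
 by have [g Gg [? ? ?]] := next_newval h;exists g.
have [gf hgf] := choice ex.
pose z := fix z i := if i is i'.+1 then logd (z i' / (gf (z i')).1) else z0.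
have zn i : newval (z i) by elim: i=> //= i /hgf[].
have Gg i : G (gf (z i)) by have [] := hgf _ (zn i).
have g0 i : (gf (z i)).1 != 0 by have [] := hgf _ (zn i).
have zb i : 1 <: z i.+1 by have [] := hgf _ (zn i).
have [x hx] := realize_seq zn Gg g0 (fun i=> erefl) zb.
have [H1 [h1 h2 h3]] := stepV zn Gg g0 (fun i=> erefl) zb hx.
apply: (nz0.2 _ (hmax h1 h2 h3));exact: asymp_refl.
Qed.
End Max.
End Step.
Lemma goodk_chain (C : set (set KK)) : C !=set0 -> C `<=` goodk ->
 (forall A B, C A -> C B -> A `<=` B \/ B `<=` A) -> goodk (\bigcup_(A in C) A).
move=> [A0 CA0] hC tot.
have two x y : (\bigcup_(A in C) A) x -> (\bigcup_(A in C) A) y -> exists A, [/\ C A, A x & A y].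
 move=> [A CA Ax] [B CB By];case: (tot A B CA CB)=> h;first by exists B;split=> //;exact: h.
 exists A;split=> //;exact: h.
have g A : C A -> good0 der O k der' O' k' A by move=> /hC[].
split;last by move=> c kc;have [x Ax e] := (hC _ CA0).2 c kc;exists x=> //;exists A0.
split.
- exists A0=> //;exact: (g_1 (g _ CA0)).
- move=> x y hx hy;have [A [CA Ax Ay]] := two x y hx hy;exists A=> //;exact: (g_B (g _ CA)).
- move=> x y hx hy;have [A [CA Ax Ay]] := two x y hx hy;exists A=> //;exact: (g_M (g _ CA)).
- move=> x [A CA Ax];exists A=> //;exact: (g_V (g _ CA)).
- move=> x [A CA Ax];exists A=> //;exact: (g_d (g _ CA)).
- move=> x [A CA Ax];exact: (g_pos (g _ CA)).
- move=> x y hx hy;have [A [CA Ax Ay]] := two x y hx hy;exact: (g_dom (g _ CA)).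
- move=> x [A CA Ax] Ox;have [d Ad h] := g_lift (g _ CA) Ax Ox;by exists d=> //;exists A.
- apply: (@pmap_sub K der O k K' der' O' k' true (\bigcup_(B in [set [set x | A x /\ k x.1] | A in C]) B)).
 + move=> x [[A CA Ax] kx];by exists [set x | A x /\ k x.1] => //;exists A.
 + apply: pmap_chain;first by move=> _ [A CA <-];exact: (g_el (g _ CA)).
 move=> _ _ [A CA <-] [B CB <-];case: (tot A B CA CB)=> h;[left|right] => x [? ?];split=> //;exact: h.
Qed.

Theorem embedding G : good0 der O k der' O' k' G -> @succ_card_saturated _ (pst der' O' k') K ->
 exists G1, [/\ goodk G1, G `<=` G1 & forall y, exists2 x, G1 x & x.1 = y].
move=> hG hs;have [G1 hG1 GG1] := residue_step T T' hG hs.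
have [|G2 [h1 h2 h3]] := zorn_sets hG1;first exact: goodk_chain.
exists G2;split=> //;first by move=> x /GG1/h2.
by move=> y;have [x Gx e] := max_total h1 h3 hs y;exists x.
Qed.
End Values.

(** * Relative quantifier elimination *)

Section GoodOps.
Variables (K : RF) (der : K -> K) (O k : set K) (K' : RF)
 (der' : K' -> K') (O' k' : set K').
Variable G : set (K * K').
Hypothesis hG : good0 der O k der' O' k' G.
Lemma good0_inv (T : tame der O k) (T' : tame der' O' k') : good0 der' O' k' der O k [set x | G (x.2, x.1)].
have hO := t_val T;have hO' := t_val T'.
split=> /=.
- exact: (g_1 hG).
- move=> x y hx hy;exact: (g_B hG hx hy).
- move=> x y hx hy;exact: (g_M hG hx hy).
- move=> x hx;exact: (g_V hG hx).
- move=> x hx;exact: (g_d hG hx).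
- by move=> x hx;exact/esym/(g_pos hG hx).
- by move=> x y hx hy;have := g_dom hG hx hy=> /= h;rewrite -h.
- move=> x hx Ox;have Ox' : O x.2.
 by apply/(dle1 O);apply/(g_dom hG hx (g_1 hG))=> /=;apply/(dle1 O').
 have [d Gd [kd kd' h]] := g_lift hG hx Ox'.
 exists (d.2, d.1);first by rewrite /= -surjective_pairing.
 split=> //= h';apply: h;exact/(g_dom hG (g_1 hG) (g_B hG hx Gd)).
- move=> phi v hv;have hv' j : G ((v j).2, (v j).1) /\ k (v j).2.
 by have [h1 h2] := hv j;split=> //;apply/(G_k T T' hG h1).
 by have := g_el hG phi (v := fun j=> ((v j).2, (v j).1)) hv'=> h;rewrite -h.
Qed.

Variables (K1 : RF) (der1 : K1 -> K1) (O1 k1 : set K1) (i : K' -> K1).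
Hypothesis hi : elem der' O' k' der1 O1 k1 i.
Lemma good0_comp : good0 der O k der1 O1 k1 [set y | exists2 x, G x & y = (x.1, i x.2)].
split.
- by exists 1;[exact: (g_1 hG)|rewrite /= (i1 hi)].
- by move=> _ _ [x Gx ->] [y Gy ->];exists (x - y);[exact: (g_B hG)|rewrite /= (iB hi)].
- by move=> _ _ [x Gx ->] [y Gy ->];exists (x * y);[exact: (g_M hG)|rewrite /= (iM hi)].
- by move=> _ [x Gx ->];exists (vv x);[exact: (g_V hG)|rewrite /= (iV hi)].
- by move=> _ [x Gx ->];exists (dd der der' x);[exact: (g_d hG)|rewrite /= (ider hi)].
- by move=> _ [x Gx ->] /=;rewrite (g_pos hG Gx) (i_lt hi) (i0 hi).
- by move=> _ _ [x Gx ->] [y Gy ->] /=;rewrite (g_dom hG Gx Gy) (idom hi).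
- move=> _ [x Gx ->] /= Ox;have [d Gd [kd kd' h]] := g_lift hG Gx Ox.
 by exists (d.1, i d.2);[exists d|split=> //=;apply/(ik hi)].
- move=> phi v hv.
 have ex j : exists w : K * K', (G w /\ k w.1) /\ v j = (w.1, i w.2).
 by have [[x Gx e] kx] := hv j;exists x;rewrite e in kx *.
 have [w hw] := choice ex.
 have -> : fst \o v = fst \o w by apply: funext=> j /=;rewrite (hw j).2.
 have -> : snd \o v = i \o (snd \o w) by apply: funext=> j /=;rewrite (hw j).2.
 rewrite (g_el hG phi (fun j=> (hw j).1));exact: hi.
Qed.
End GoodOps.
Lemma good0_term (K : RF) (der : K -> K) (O k : set K) (K' : RF)
 (der' : K' -> K') (O' k' : set K') G (t : term PS) (v : nat -> K * K') :
 good0 der O k der' O' k' G -> (forall j, G (v j)) ->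
 G (@eval_term _ (pst der O k) (fst \o v) t, @eval_term _ (pst der' O' k') (snd \o v) t).
move=> hG hv;elim: t=> [j|f ts IH] /=;first by rewrite -surjective_pairing.
case: f ts IH=> ts IH /=.
- exact: (G_0 hG).
- exact: (g_1 hG).
- exact: (G_N hG (IH ord0)).
- exact: (G_D hG (IH ord0) (IH ord_max)).
- exact: (g_M hG (IH ord0) (IH ord_max)).
- exact: (g_d hG (IH ord0)).
Qed.

(** For a quantifier let [b] be a point of the second field. Embed that field, over the inverse
    graph, into a saturated elementary extension [C] of the first. The image of [b] satisfies the
    formula in [C], and the induction hypothesis for the extended graph brings it back. The
    statement thus has to range over all pairs of fields. *)
Theorem relative_QE phi (K : RF) (der : K -> K) (O k : set K) (K' : RF)
 (der' : K' -> K') (O' k' : set K') (T : tame der O k) (T' : tame der' O' k') G (v : nat -> K * K') :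
 good0 der O k der' O' k' G -> (forall j, G (v j)) ->
 @sat _ (pst der O k) (fst \o v) phi <-> @sat _ (pst der' O' k') (snd \o v) phi.
elim: phi K der O k K' der' O' k' T T' G v=> [|t u|R ts|p IHp q IHq|i p IHp]
 K der O k K' der' O' k' T T' G v hG hv.
- by [].
- have h := G_0P hG (g_B hG (good0_term t hG hv) (good0_term u hG hv)).
 by split=> /= e;apply/subr0_eq;apply/h;rewrite /= e subrr.
- case: R ts=> ts /=.
 + have := g_pos hG (g_B hG (good0_term (ts ord0) hG hv) (good0_term (ts ord_max) hG hv)).
 by rewrite /= !subr_gt0 !ltNge=> /negb_inj ->.
 + exact: (g_dom hG (good0_term (ts ord0) hG hv) (good0_term (ts ord_max) hG hv)).
 + exact: (G_k T T' hG (good0_term (ts ord0) hG hv)).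
- by split=> h /(IHp _ _ _ _ _ _ _ _ T T' _ _ hG hv)/h/(IHq _ _ _ _ _ _ _ _ T T' _ _ hG hv).
have key (A : RF) (dA : A -> A) (OA kA : set A) (B : RF)
 (dB : B -> B) (OB kB : set B) (TA : tame dA OA kA) (TB : tame dB OB kB) H (w : nat -> A * B) :
 good0 dA OA kA dB OB kB H -> (forall j, H (w j)) ->
 @sat _ (pst dA OA kA) (fst \o w) (FAll i p) -> @sat _ (pst dB OB kB) (snd \o w) (FAll i p).
 move=> hH hw hall b.
 have [C [dC [OC [kC [j [hj hs]]]]]] := @pair_saturated_extension A dA OA kA B.
 have TC := tame_elem hj TA.
 have hH1 := good0_comp (good0_inv hH TA TB) hj.
 have [G1 [[hG1 _] sub /(_ b)[x G1x ex]]] := embedding TB TC hH1 hs.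
 pose w1 l : B * C := if l == i then x else ((w l).2, j (w l).1).
 have hw1 l : G1 (w1 l).
 rewrite /w1;case: eqP=> // _;apply: sub;exists ((w l).2, (w l).1)=> //=.
 by rewrite -surjective_pairing.
 have := IHp _ _ _ _ _ _ _ _ TB TC _ _ hG1 hw1.
 have -> : fst \o w1 = @update _ (pst dB OB kB) (snd \o w) i b.
 by apply: funext=> l;rewrite /w1 /update /=;case: eqP.
 move=> hiff;apply: hiff.2.
 have -> : snd \o w1 = @update _ (pst dC OC kC) (j \o (fst \o w)) i x.2.
 by apply: funext=> l;rewrite /w1 /update /=;case: eqP.
 exact: ((hj (FAll i p) (fst \o w)).1 hall).
have hv' j : [set x | G (x.2, x.1)] ((v j).2, (v j).1) by rewrite /= -surjective_pairing.
split;first exact: (key _ _ _ _ _ _ _ _ T T' _ _ hG hv).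
exact: (key _ _ _ _ _ _ _ _ T' T _ (fun j=> ((v j).2, (v j).1)) (good0_inv hG T T') hv').
Qed.

(** * Algebraic and differential-algebraic dependence *)

Section FieldGen.
Variable K : fieldType.
Implicit Types A B F : set K.
Lemma fg_sub A : A `<=` field_gen A.
move=> x Ax B [_ sB];exact: sB. Qed.
Lemma fg_subfield A : subfield (field_gen A).
split=> [B [hB _]|x y hx hy B hB|x y hx hy B hB];first exact: (F1 hB).
 by apply: (FB hB.1);[exact: hx|exact: hy].
by apply: (Fdv hB.1);[exact: hx|exact: hy].
Qed.
Lemma fg_min A B : subfield B -> A `<=` B -> field_gen A `<=` B.
by move=> hB sB x;apply;split. Qed.
Lemma fg_mono A B : A `<=` B -> field_gen A `<=` field_gen B.
move=> s;apply: (fg_min (fg_subfield _))=> x /s;exact: fg_sub. Qed.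
Lemma fg_fin A (B : nat -> set K) x : (forall n m, (n <= m)%N -> B n `<=` B m) ->
 field_gen (A `|` [set y | exists n, B n y]) x -> exists n, field_gen (A `|` B n) x.
move=> hB;apply: (@fg_min _ [set x | exists n, field_gen (A `|` B n) x]).
 have up n m y : (n <= m)%N -> field_gen (A `|` B n) y -> field_gen (A `|` B m) y.
 by move=> le;apply: fg_mono=> z [Az|/(hB _ _ le)];[left|right].
 split;first by exists 0%N;exact: (F1 (fg_subfield _)).
 move=> y z [n hy] [m hz];exists (maxn n m);apply: (FB (fg_subfield _)).
 exact: up (leq_maxl n m) hy.
 exact: up (leq_maxr n m) hz.
 move=> y z [n hy] [m hz];exists (maxn n m);apply: (Fdv (fg_subfield _)).
 exact: up (leq_maxl n m) hy.
 exact: up (leq_maxr n m) hz.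
by move=> y [Ay|[n By]];[exists 0%N|exists n];apply: fg_sub;[left|right].
Qed.
Lemma fgP F q (v : 'I_q -> K) x : subfield F -> field_gen (F `|` range v) x ->
 exists P Q : {mpoly K[q]}, [/\ forall m, F P@_m, forall m, F Q@_m, Q.@[v] != 0 & x = P.@[v] / Q.@[v]].
move=> hF;have F1 := F1 hF;have FB := FB hF;have FM := FM hF;have F0 := F0 hF.
have MM := A_mpolyM F1 FB FM.
have one m : F (1 : {mpoly K[q]})@_m by rewrite mcoeff1;case: eqP.
apply: (@fg_min _ [set x | exists P Q : {mpoly K[q]}, [/\ forall m, F P@_m, forall m, F Q@_m, Q.@[v] != 0 & x = P.@[v] / Q.@[v]]]).
 split.
 - by exists 1, 1;split=> //;rewrite meval1 ?oner_neq0 // divr1.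
 - move=> _ _ [P [Q [hP hQ Q0 ->]]] [P' [Q' [hP' hQ' Q0' ->]]].
 exists (P * Q' - P' * Q), (Q * Q');split;[|exact: MM|by rewrite mevalM mulf_neq0|].
 move=> m;rewrite mcoeffB;apply: (FB);exact: MM.
 by rewrite mevalB !mevalM;field;rewrite Q0 Q0'.
 - move=> _ _ [P [Q [hP hQ Q0 ->]]] [P' [Q' [hP' hQ' Q0' ->]]].
 have [e|ne] := eqVneq P'.@[v] 0.
 exists 0, 1;split=> //;first by move=> m;rewrite mcoeff0.
 by rewrite meval1 oner_neq0.
 by rewrite e mul0r invr0 mulr0 meval0 mul0r.
 exists (P * Q'), (Q * P');split;[exact: MM|exact: MM|by rewrite mevalM mulf_neq0|].
 by rewrite !mevalM;field;rewrite Q0 Q0' ne.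
move=> y [Fy|[i _ <-]].
 exists y%:MP, 1;split=> //;last by rewrite mevalC meval1 divr1.
 by move=> m;rewrite mcoeffC;case: eqP=> _;rewrite ?mulr1 ?mulr0.
 by rewrite meval1 oner_neq0.
exists 'X_i, 1;split=> //;last by rewrite mevalXU meval1 divr1.
 by move=> m;rewrite mcoeffX;case: eqP.
by rewrite meval1 oner_neq0.
Qed.
(** Gaussian elimination of the last column with a pivot, which keeps the solution inside [F]. *)
Lemma lin_dep F n m (A : 'I_m -> 'I_n -> K) : subfield F -> (n < m)%N -> (forall i j, F (A i j)) ->
 exists x : 'I_m -> K, [/\ forall i, F (x i), exists i, x i != 0 & forall j, \sum_i x i * A i j = 0].
move=> hF;elim: n m A=> [|n IH] [|m] A // lt hA.
 exists (fun=> 1);split;[by move=> _;exact: (F1 hF)|by exists ord0;exact: oner_neq0|by case].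
case: (pselect (exists i, A i ord_max != 0))=> [[i0 a0]|na];last first.
 have [x [Fx x0 hx]] := IH m.+1 (fun i j=> A i (lift ord_max j)) (ltnW lt) (fun i j=> hA _ _).
 exists x;split=> // j;case: (unliftP ord_max j)=> [j' ->|->];first exact: hx.
 rewrite big1 // => i _;suff -> : A i ord_max = 0 by rewrite mulr0.
 by apply/eqP;apply: contrapT=> /negP h;apply: na;exists i.
set a := A i0 ord_max in a0;pose r i := A (lift i0 i) ord_max / a.
have Fr i : F (r i) by apply: (Fdv hF);exact: hA.
have [|x [Fx [i1 x0] hx]] := IH m (fun i j=> A (lift i0 i) (lift ord_max j) - r i * A i0 (lift ord_max j)) lt.
 move=> i j;apply: (FB hF)=> //;exact: (FM hF).
exists (fun i=> if unlift i0 i is Some i' then x i' else - \sum_i x i * r i);split.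
- move=> i;case: unliftP=> [i' _|_] //;apply: (FN hF);apply: (Fsum hF)=> i' _;exact: (FM hF).
- by exists (lift i0 i1);rewrite liftK.
move=> j;rewrite (bigD1_ord i0) //= unlift_none.
rewrite [X in _ + X](eq_bigr (fun i=> x i * A (lift i0 i) j));last by move=> i _;rewrite liftK.
rewrite mulNr mulr_suml addrC -sumrB;case: (unliftP ord_max j)=> [j' ->|->].
 by rewrite -[RHS](hx j');apply: eq_bigr=> i _;rewrite mulrBr (mulrA (x i) (r i)).
by rewrite big1 // => i _;rewrite /r -mulrA -mulrA mulVf // mulr1 subrr.
Qed.
Let dg q (P : {mpoly K[q]}) D := (msize P <= D.+1)%N.
Let dgM q (P Q : {mpoly K[q]}) a b : dg P a -> dg Q b -> dg (P * Q) (a + b).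
rewrite /dg;have [->|P0] := eqVneq P 0;first by rewrite mul0r msize0.
have [->|Q0] := eqVneq Q 0;first by rewrite mulr0 msize0.
move=> h h';rewrite msizeM //;apply: leq_trans (_ : (a.+1 + b.+1).-1 <= _)%N;last by rewrite addnS.
by rewrite -!subn1 leq_sub2r // leq_add.
Qed.
Let dg1 q : dg (1 : {mpoly K[q]}) 0. by rewrite /dg msize1. Qed.
Let dgX q (P : {mpoly K[q]}) a n : dg P a -> dg (P ^+ n) (n * a).
move=> h;elim: n=> [|n IH];rewrite ?expr0 // exprS mulSn;exact: dgM. Qed.
Let dg_prod q p (f : 'I_p -> {mpoly K[q]}) (a : 'I_p -> nat) : (forall i, dg (f i) (a i)) ->
 dg (\prod_i f i) (\sum_i a i).
by move=> h;elim/big_rec2: _=> [|i x y _ hy];[exact: dg1|exact: dgM]. Qed.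

(* There are M^p monomials of exponents below M in the u_i, but after clearing
 denominators they span a space of dimension O(M^q). *)
Lemma steinitz F q p (v : 'I_q -> K) (u : 'I_p -> K) : subfield F -> (q < p)%N ->
 (forall i, field_gen (F `|` range v) (u i)) -> mdep F u.
move=> hF lt hu;have F1 := F1 hF;have FB := FB hF;have FM := FM hF.
have [PQ hPQ] : exists PQ : 'I_p -> {mpoly K[q]} * {mpoly K[q]}, forall i,
 [/\ forall m, F (PQ i).1@_m, forall m, F (PQ i).2@_m, (PQ i).2.@[v] != 0 & u i = (PQ i).1.@[v] / (PQ i).2.@[v]].
 have ex i : exists PQ : {mpoly K[q]} * {mpoly K[q]},
 [/\ forall m, F PQ.1@_m, forall m, F PQ.2@_m, PQ.2.@[v] != 0 & u i = PQ.1.@[v] / PQ.2.@[v]].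
 by have [P [Q h]] := fgP hF (hu i);exists (P, Q).
 by have [f hf] := choice ex;exists f.
pose Q := \prod_i (PQ i).2;pose P i := (PQ i).1 * \prod_(j | j != i) (PQ j).2.
have prodF (C : pred 'I_p) m : F (\prod_(j | C j) (PQ j).2)@_m.
 elim/big_ind: _ m=> [m|a b ha hb m|i _ m];first by rewrite mcoeff1;case: eqP=> _;[exact: F1|exact: F0].
 exact: (A_mpolyM F1 FB FM ha hb).
 by have [] := hPQ i.
have QF m : F Q@_m by exact: prodF.
have PF i m : F (P i)@_m by apply: (A_mpolyM F1 FB FM)=> // m';have [] := hPQ i.
have Qv : Q.@[v] != 0.
 by rewrite /Q rmorph_prod /=;apply/prodf_neq0=> i _;have [] := hPQ i.
have uP i : (P i).@[v] = Q.@[v] * u i.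
 have eQ : Q = (PQ i).2 * \prod_(j | j != i) (PQ j).2 by rewrite /Q (bigD1 i).
 have [_ _ n0 ->] := hPQ i;rewrite eQ /P !mevalM;field;exact: n0.
pose D := (\sum_i msize (P i) + msize Q)%N.
have dP i : dg (P i) D.
 by rewrite /dg (leq_trans _ (leqnSn _)) // /D (bigD1 i) //= -!addnA leq_addr.
have dQ : dg Q D by rewrite /dg (leq_trans _ (leqnSn _)) // leq_addl.
(* All cleared monomials have degree at most B, so at most (M(pD+1))^q polynomial monomials matter.
   As M exceeds (pD+1)^q, this is below M^(q+1), hence below the number M^p of exponent vectors. *)
pose M := ((p * D).+1 ^ q).+1;pose B := (p * M * D)%N.
pose U := {ffun 'I_p -> 'I_M};pose W : finType := bmultinom q B.+1.
(* The power of [Q] pads every product to the common denominator [Q] to the p*M. *)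
pose T (m : U) := \prod_i P i ^+ m i * Q ^+ (p * M - \sum_i m i).
have sm (m : U) : (\sum_i m i <= p * M)%N.
 apply: leq_trans (_ : \sum_(i < p) M <= _)%N;last by rewrite sum_nat_const card_ord.
 apply: leq_sum=> i _;exact: ltnW (ltn_ord _).
have TF m mm : F (T m)@_mm.
 apply: (A_mpolyM F1 FB FM)=> [m'|];last exact: (A_mpolyX F1 FB FM).
 elim/big_ind: _ m'=> [m'|a b ha hb m'|i _ m'];first by rewrite mcoeff1;case: eqP=> _;[exact: F1|exact: F0].
 exact: (A_mpolyM F1 FB FM ha hb).
 exact: (A_mpolyX F1 FB FM).
have Tv m : (T m).@[v] = Q.@[v] ^+ (p * M) * \prod_i u i ^+ m i.
 rewrite mevalM rmorphXn /= rmorph_prod /=.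
 rewrite (eq_bigr (fun i=> Q.@[v] ^+ m i * u i ^+ m i));last first.
 by move=> i _;rewrite rmorphXn /= uP exprMn.
 by rewrite big_split /= prodrXr mulrAC -exprD subnKC.
have dT m : (msize (T m) <= B.+1)%N.
 have h : dg (T m) (\sum_i m i * D + (p * M - \sum_i m i) * D).
 apply: dgM;[apply: dg_prod=> i|];exact: dgX.
 by move: h;rewrite -big_distrl -mulnDl subnKC.
have cW : (#|W| < #|U|)%N.
 rewrite card_ffun !card_ord.
 apply: leq_ltn_trans (_ : (B.+1 ^ q < _)%N).
 have <- : #|{ffun 'I_q -> 'I_B.+1}| = (B.+1 ^ q)%N by rewrite card_ffun !card_ord.
 pose f (w : W) : {ffun 'I_q -> 'I_B.+1} := [ffun i=> inord (bmnm w i)].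
 apply: (@leq_card _ _ f)=> w w' /ffunP e;apply/val_inj/mnmP=> i.
 have b (x : W) : (bmnm x i < B.+1)%N.
 apply: leq_ltn_trans (bmdeg x);by rewrite mdegE (bigD1 i) //= leq_addr.
 by have := congr1 val (e i);rewrite !ffunE /= !inordK.
 apply: leq_ltn_trans (_ : (M * (p * D).+1) ^ q < _)%N.
 have le : (B.+1 <= M * (p * D).+1)%N by rewrite /B mulnS -mulnA mulnCA -addn1 addnC leq_add2r.
 by case: (q)=> [|q'] //;rewrite leq_exp2r.
 rewrite expnMn;apply: leq_trans (_ : M ^ q * M <= _)%N;last by rewrite -expnSr leq_pexp2l.
 by rewrite ltn_pmul2l // expn_gt0.
have [x [Fx [i0 x0] hx]] := @lin_dep F #|W| #|U| (fun i j=> (T (enum_val i))@_(bmnm (enum_val j))) hF cW (fun i j=> TF _ _).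
pose mm (m : U) : 'X_{1..p} := [multinom (m i : nat) | i < p].
have mmi (m m' : U) : (mm m == mm m') = (m == m').
 apply/eqP/eqP=> [e|->//];apply/ffunP=> i;apply/val_inj.
 by have /mnmP/(_ i) := e;rewrite !mnmE.
pose R : {mpoly K[p]} := \sum_(i < #|U|) x i *: 'X_[mm (enum_val i)].
have RE m : R@_m = \sum_(i < #|U|) x i * (mm (enum_val i) == m)%:R.
 by rewrite (raddf_sum (mcoeff m)) /=;apply: eq_bigr=> i _;rewrite mcoeffZ mcoeffX.
exists R;split.
- move=> m;rewrite RE;apply: (Fsum hF)=> i _;apply: (FM)=> //;case: eqP=> _;[exact: F1|exact: (F0 hF)].
- apply: contraNneq x0=> R0;have := RE (mm (enum_val i0));rewrite R0 mcoeff0 (bigD1 i0) //= eqxx mulr1.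
 rewrite big1 ?addr0=> [<-//|i ne];rewrite mmi (inj_eq enum_val_inj) (negPf ne) mulr0 //.
have Qn : Q.@[v] ^+ (p * M) != 0 by rewrite expf_neq0.
apply: (mulfI Qn);rewrite mulr0 /R (raddf_sum (meval u)) /= mulr_sumr.
have tw i : Q.@[v] ^+ (p * M) * (x i *: 'X_[mm (enum_val i)]).@[u] =
 \sum_(j < #|W|) x i * (T (enum_val i))@_(bmnm (enum_val j)) * \prod_l v l ^+ (bmnm (enum_val j) l).
 rewrite mevalZ mevalX mulrCA.
 have -> : Q.@[v] ^+ (p * M) * \prod_i0 u i0 ^+ (mm (enum_val i)) i0 = (T (enum_val i)).@[v].
 by rewrite Tv;congr (_ * _);apply: eq_bigr=> l _;rewrite mnmE.
 rewrite [in LHS](mpolywE (dT (enum_val i))) (raddf_sum (meval v)) /= mulr_sumr.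
 rewrite (reindex (@enum_val W predT)) /=;last by exists enum_rank=> w _;rewrite ?enum_rankK ?enum_valK.
 by apply: eq_bigr=> j _;rewrite mevalZ mevalX mulrA.
under eq_bigr do rewrite tw.
rewrite exchange_big /= big1 // => j _;by rewrite -mulr_suml hx mul0r.
Qed.
End FieldGen.

Section Dependence.
Variable K : fieldType.
Implicit Types F : set K.
Lemma mdep_mono F F' p (u : 'I_p -> K) : F `<=` F' -> mdep F u -> mdep F' u.
by move=> s [R [hR R0 e]];exists R;split=> // m;apply: s. Qed.
Lemma mdep0 F p (u : 'I_p -> K) : p = 0%N -> ~ mdep F u.
move=> p0 [R [_ R0 ev]];case/eqP: R0;have e : R = (R@_0)%:MP.
 apply/mpolyP=> m;rewrite mcoeffC (_ : m = 0%MM) ?eqxx ?mulr1 //;apply/mnmP=> i.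
 by move: (ltn_ord i);rewrite {2}p0.
by move: ev;rewrite e mevalC=> ->;rewrite mpolyC0.
Qed.
Lemma mdep_ren F p q (u : 'I_p -> K) (w : 'I_q -> K) (sg : 'I_p -> 'I_q) : subfield F ->
 injective sg -> (forall i, u i = w (sg i)) -> mdep F u -> mdep F w.
move=> hF si e [R [hR R0 ev]].
pose a : p.-tuple {mpoly K[q]} := [tuple 'X_(sg i) | i < p].
pose b : q.-tuple {mpoly K[p]} := [tuple if [pick i | sg i == j] is Some i then 'X_i else 0 | j < q].
exists (R \mPo a);split.
- apply: (A_comp (F1 hF) (FB hF) (FM hF))=> // i m;rewrite tnth_mktuple mcoeffX.
 by case: eqP=> _;[exact: (F1 hF)|exact: (F0 hF)].
- apply: contra_neq R0=> z;have : (R \mPo a) \mPo b = 0 by rewrite z comp_mpoly0.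
 rewrite comp_mpolyA=> <-;rewrite -[LHS]comp_mpoly_id;congr comp_mpoly;apply: eq_from_tnth=> i.
 rewrite !tnth_mktuple comp_mpolyXU -tnth_nth tnth_mktuple.
 by case: pickP=> [i' /eqP/si ->|/(_ i)];rewrite ?eqxx.
- rewrite comp_mpoly_meval -ev;congr meval;apply: funext=> i.
 by rewrite tnth_mktuple mevalXU e.
Qed.
(** Specialize the first block in the relation. Either a nonzero relation for the second block
    remains, or all its coefficients vanish, and any of them that is a nonzero polynomial relates
    the first block. *)
Lemma mdep_split F p1 p2 (u : 'I_(p1 + p2) -> K) : subfield F -> mdep F u ->
 mdep F (fun i=> u (lshift p2 i)) \/
 mdep (field_gen (F `|` range (fun i=> u (lshift p2 i)))) (fun i=> u (rshift p1 i)).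
move=> hF [R [hR R0 ev]].
pose m1 (m : 'X_{1..p1 + p2}) : 'X_{1..p1} := [multinom m (lshift p2 i) | i < p1].
pose m2 (m : 'X_{1..p1 + p2}) : 'X_{1..p2} := [multinom m (rshift p1 i) | i < p2].
have mi m m' : (m1 m == m1 m') && (m2 m == m2 m') = (m == m').
 apply/andP/eqP=> [[/eqP e1 /eqP e2]|->//];apply/mnmP=> i;rewrite -(splitK i).
 case: (fintype.split i)=> j /=;[have /mnmP/(_ j) := e1|have /mnmP/(_ j) := e2];by rewrite !mnmE.
pose C b : {mpoly K[p1]} := \sum_(m <- msupp R | m2 m == b) R@_m *: 'X_[m1 m].
pose c m := \prod_i u (lshift p2 i) ^+ m1 m i.
pose R2 : {mpoly K[p2]} := \sum_(m <- msupp R) (R@_m * c m) *: 'X_[m2 m].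
have R2E b : R2@_b = (C b).@[fun i=> u (lshift p2 i)].
 rewrite (raddf_sum (mcoeff b)) (raddf_sum (meval _)) [RHS]big_mkcond /=;apply: eq_bigr=> m _.
 by rewrite mcoeffZ mcoeffX mevalZ mevalX;case: eqP=> _;rewrite ?mulr1 ?mulr0.
have R2v : R2.@[fun i=> u (rshift p1 i)] = 0.
 rewrite -ev [RHS]mevalE (raddf_sum (meval _)) /=;apply: eq_bigr=> m _.
 rewrite mevalZ mevalX -mulrA big_split_ord /=;congr (_ * (_ * _)).
 by apply: eq_bigr=> i _;rewrite mnmE.
 by apply: eq_bigr=> i _;rewrite mnmE.
have [z|nz] := eqVneq R2 0;last first.
 right;exists R2;split=> // b;rewrite R2E;have fF := fg_subfield (F `|` range (fun i=> u (lshift p2 i))).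
 apply: (A_meval (F1 fF) (FB fF) (FM fF));last by move=> i;apply: fg_sub;right;exists i.
 move=> a;rewrite (raddf_sum (mcoeff a)) /=;apply: (Fsum fF)=> m _;rewrite mcoeffZ mcoeffX.
 by apply: (FM fF);[apply: fg_sub;left|apply: (FMn fF);exact: (F1 fF)].
left;case E : (msupp R)=> [|m0 s];first by move: R0;rewrite -msupp_eq0 E.
have m0R : m0 \in msupp R by rewrite E mem_head.
exists (C (m2 m0));split;last by rewrite -R2E z mcoeff0.
 move=> a;rewrite (raddf_sum (mcoeff a)) /=;apply: (Fsum hF)=> m _;rewrite mcoeffZ mcoeffX.
 apply: (FM hF)=> //;apply: (FMn hF);exact: (F1 hF).
have : R@_m0 != 0 by rewrite -mcoeff_msupp.
apply: contra_neq=> z0;have : (C (m2 m0))@_(m1 m0) = 0 by rewrite z0 mcoeff0.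
rewrite (raddf_sum (mcoeff _)) /= big_mkcond /= (bigD1_seq m0) ?msupp_uniq //= eqxx mcoeffZ mcoeffX eqxx mulr1.
rewrite big1 ?addr0 // => m ne;case: eqP=> // e2;rewrite mcoeffZ mcoeffX;case: eqP=> e1;last by rewrite mulr0.
by move: ne;rewrite -mi e1 e2 !eqxx.
Qed.
End Dependence.

Section DAlg.
Variables (K : RF) (der : K -> K).
Hypothesis hd : derivation der.
Implicit Types F : set K.
Lemma fg_der2 A B : A `<=` field_gen B -> (forall a, A a -> field_gen B (der a)) ->
 forall x, field_gen A x -> field_gen B (der x).
move=> AB hA x;have fB := fg_subfield B.
suff h : field_gen A `<=` [set x | field_gen B x /\ field_gen B (der x)] by move=> /h[].
apply: fg_min;last by move=> a Aa;split;[exact: AB|exact: hA].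
split;first by split;[exact: (F1 fB)|rewrite der1 //;exact: (F0 fB)].
 move=> a b [a1 a2] [b1 b2];split;rewrite ?derB //;exact: (FB fB).
move=> a b [a1 a2] [b1 b2];split;first exact: (Fdv fB).
have [->|b0] := eqVneq b 0;first by rewrite invr0 mulr0 der0 //;exact: (F0 fB).
rewrite der_div //;apply: (Fdv fB);last exact: (FX fB).
apply: (FB fB);exact: (FM fB).
Qed.
Lemma fg_der A : (forall a, A a -> field_gen A (der a)) -> forall x, field_gen A x -> field_gen A (der x).
move=> hA;apply: fg_der2=> // a;exact: fg_sub. Qed.
Lemma dg_sub A : A `<=` diff_field_gen der A.
move=> x Ax B [_ sB];exact: sB. Qed.
Lemma dg_diff A : diff_subfield der (diff_field_gen der A).
split;last by move=> x hx B hB;apply: hB.1.2;exact: hx.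
split=> [B [hB _]|x y hx hy B hB|x y hx hy B hB];first exact: (F1 hB.1).
 by apply: (FB hB.1.1);[exact: hx|exact: hy].
by apply: (Fdv hB.1.1);[exact: hx|exact: hy].
Qed.
Lemma dg_min A B : diff_subfield der B -> A `<=` B -> diff_field_gen der A `<=` B.
by move=> hB sB x;apply;split. Qed.
Lemma dg_iter A n x : diff_field_gen der A x -> diff_field_gen der A (iter n der x).
move=> h;elim: n=> //= n;exact: (dg_diff A).2. Qed.
Definition jets N (a : K) (i : 'I_N) := iter i der a.
Lemma d_alg_jets F a : subfield F -> d_algebraic der F a <-> exists N, mdep F (@jets N a).
move=> hF;rewrite d_algP;last exact: (F0 hF).
split=> [[p [s [si h]]]|[N h]];last first.
 by exists N, (fun i=> (ord0, i : nat));split=> // i j [/val_inj].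
pose N := (\max_i (s i).2).+1.
have lt i : ((s i).2 < N)%N by rewrite ltnS;exact: (@leq_bigmax _ (fun i=> (s i).2)).
exists N;apply: (mdep_ren (sg := fun i=> Ordinal (lt i)) hF _ _ h)=> // i j [e];apply: si.
by move: e;case: (s i)=> a1 b1;case: (s j)=> a2 b2 /= ->;rewrite !ord1.
Qed.
Definition below F a r := F `|` [set y | exists2 i, (i < r)%N & y = iter i der a].
(** Read the relation as a polynomial in the last derivative. If it vanishes identically after
    specialization, one of its coefficients is a nonzero relation among fewer derivatives. *)
Lemma jets_alg F a N : subfield F -> mdep F (@jets N a) -> exists r (q : {poly K}),
 [/\ forall e, field_gen (below F a r) q`_e, q != 0 & root q (iter r der a)].
move=> hF;elim: N=> [/mdep0-/(_ erefl)//|N IH] [R [hR R0 ev]].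
pose q := map_poly (meval (@jets N a)) (muni R).
have [q0|q0] := eqVneq q 0;last first.
 exists N, q;split=> //;last by rewrite /root -ev muni_eval.
 move=> e;rewrite coef_map /=;have fF := fg_subfield (below F a N).
 apply: (A_meval (F1 fF) (FB fF) (FM fF));last by move=> i;apply: fg_sub;right;exists i.
 by move=> m;rewrite muni_coef;apply: fg_sub;left.
apply: IH;case E : (msupp R)=> [|m s];first by move: R0;rewrite -msupp_eq0 E.
have mR : R@_m != 0 by rewrite -mcoeff_msupp E mem_head.
exists (muni R)`_(m ord_max);split.
- by move=> m';rewrite muni_coef.
- apply: contra_neq mR=> z.
 have -> : m = mext [multinom m (widen_ord (leqnSn N) i) | i < N] (m ord_max).
 apply/mnmP=> i;rewrite mnmE;case: insubP=> [j ji vj|].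
 by rewrite mnmE;congr (m _);apply: val_inj.
 rewrite -leqNgt=> ni;congr (m _);apply: val_inj=> /=;apply/eqP.
 by rewrite eqn_leq ni -ltnS ltn_ord.
 by rewrite -muni_coef z mcoeff0.
- by have := congr1 (fun p : {poly K}=> p`_(m ord_max)) q0;rewrite coef_map coef0.
Qed.

(* Differentiating the minimal equation of the first algebraic derivative
 expresses the next derivative rationally. *)
Lemma d_alg_fg F a : diff_subfield der F -> d_algebraic der F a -> exists V : seq K,
 a \in V /\ forall x, x \in V -> field_gen (F `|` [set` V]) (der x).
move=> hF /(d_alg_jets _ hF.1)[N /(jets_alg hF.1)[r [q0 [hq0 q00 rq0]]]].
pose A := field_gen (below F a r).
pose S n := exists q : {poly K}, [/\ forall e, A q`_e, q != 0, root q (iter r der a) & size q = n].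
have ex : exists n, `[< S n >] by exists (size q0);apply/asboolP;exists q0.
case: (ex_minnP ex)=> n /asboolP[q [hq qn rq sq]] qmin.
pose V := [seq iter i der a | i <- iota 0 r.+1].
have inV i : (i < r.+1)%N -> iter i der a \in V by move=> lt;apply/mapP;exists i;rewrite // mem_iota.
exists V;split;first exact: (inV 0%N).
pose B := field_gen (F `|` [set` V]);have fB : subfield B := fg_subfield _.
have AB : A `<=` B.
 by apply: fg_mono=> x [Fx|[i lt ->]];[left|right;apply: inV;exact: ltnW].
have dAB x : A x -> B (der x).
 apply: fg_der2=> y [Fy|[i lt ->]].
 - by apply: fg_sub;left.
 - apply: fg_sub;right;apply: inV;exact: ltnW.
 - apply: fg_sub;left;exact: hF.2.
 - by apply: fg_sub;right;rewrite -iterS;apply: inV.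
move=> x /mapP[i];rewrite mem_iota add0n=> /andP[_ lt] ->.
move: lt;rewrite ltnS leq_eqVlt=> /orP[/eqP ->|lt];last first.
 by apply: fg_sub;right;rewrite -iterS;apply: inV.
set z := iter r der a in rq *;have Bz : B z by apply: fg_sub;right;apply: inV.
have dq (p : {poly K}) : (forall e, A p`_e) -> B p.[z] /\ exists2 y, B y & der p.[z] = y + p^`().[z] * der z.
 elim/poly_ind: p=> [|p c IH] hp.
 rewrite horner0 derivC horner0 der0 //;split;first exact: (F0 fB).
 by exists 0;[exact: (F0 fB)|rewrite mul0r addr0].
 have [|Bp [y By ey]] := IH;first by move=> e;have := hp e.+1;rewrite coefD coefMX coefC addr0.
 have Ac : A c by have := hp 0%N;rewrite coefD coefMX coefC add0r.
 rewrite derivD derivM derivX derivC addr0 mulr1 !hornerE;split.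
 by apply: (FD fB);[exact: (FM fB)|exact: AB].
 exists (y * z + der c);first by apply: (FD fB);[exact: (FM fB)|exact: dAB].
 by rewrite derD // derM // ey;ring.
have rz : q.[z] = 0 by exact/rootP.
have [_ [y By]] := dq q hq;rewrite rz der0 // => /esym/eqP.
rewrite addrC addr_eq0=> /eqP e.
have sq1 : (1 < size q)%N.
 have [//|] := ltnP 1 (size q);rewrite leq_eqVlt ltnS leqn0 size_poly_eq0 (negPf qn) orbF=> /size_poly1P[c c0 ec].
 by move: rz;rewrite ec hornerC=> /eqP;rewrite (negPf c0).
(* The separant does not vanish: in characteristic 0 the derivative of [q] would be a nonzero
   polynomial of smaller degree with the same root. *)
have dn : q^`().[z] != 0.
 apply/negP=> /eqP z0;have : (n <= size q^`())%N.
 apply: qmin;apply/asboolP;exists q^`();split=> //;last exact/rootP.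
 move=> j;rewrite coef_deriv;apply: (FMn (fg_subfield _));exact: hq.
 apply/eqP=> d0;have := congr1 (fun p : {poly K}=> p`_(size q).-2) d0.
 rewrite coef_deriv coef0=> /eqP;rewrite mulrn_eq0 /=.
 have -> : (size q).-2.+1 = (size q).-1 by case: (size q) sq1=> [|[|?]].
 by rewrite -lead_coefE lead_coef_eq0 (negPf qn).
 rewrite -sq=> h;have := leq_trans h (size_poly _ _);by case: (size q) sq1=> [|[|m]] //;rewrite ltnn.
have -> : der z = - y / q^`().[z] by rewrite -e mulrC mulKf.
have Bd : B q^`().[z].
 apply: (dq q^`() _).1=> j;rewrite coef_deriv;apply: (FMn (fg_subfield _));exact: hq.
apply: (Fdv fB)=> //;exact: (FN fB).
Qed.
Lemma d_alg_fg_fin F n (s : 'I_n -> K) : diff_subfield der F -> (forall i, d_algebraic der F (s i)) ->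
 exists V : seq K, (forall i, s i \in V) /\ forall x, x \in V -> field_gen (F `|` [set` V]) (der x).
move=> hF hs;have [V hV] := choice (fun i=> d_alg_fg hF (hs i)).
exists (flatten [seq V i | i <- enum 'I_n]);split.
 by move=> i;apply/flatten_mapP;exists i;[rewrite mem_enum|exact: (hV i).1].
move=> x /flatten_mapP[i _ hx];apply: fg_mono ((hV i).2 x hx)=> y [Fy|Vy];[by left|right].
by apply/flatten_mapP;exists i;rewrite ?mem_enum.
Qed.
Lemma steinitz_seq F (V : seq K) p (u : 'I_p -> K) : subfield F -> (size V < p)%N ->
 (forall i, field_gen (F `|` [set` V]) (u i)) -> mdep F u.
move=> hF lt h;apply: (steinitz (v := fun i=> tnth (in_tuple V) i) hF lt)=> i.
apply: fg_mono (h i)=> x [Fx|/= Vx];[by left|right].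
have := Vx;rewrite -index_mem=> hi;exists (Ordinal hi)=> //.
by rewrite (tnth_nth x) /= nth_index.
Qed.
(** The generated differential field lies in a finitely generated field, where sufficiently many
    derivatives of [x] are dependent by [steinitz]. *)
Lemma d_alg_gen F n (s : 'I_n -> K) x : diff_subfield der F -> (forall i, d_algebraic der F (s i)) ->
 diff_field_gen der (F `|` range s) x -> d_algebraic der F x.
move=> hF hs hx;have [V [sV dV]] := d_alg_fg_fin hF hs.
have sub : diff_field_gen der (F `|` range s) `<=` field_gen (F `|` [set` V]).
 apply: dg_min;last by move=> y [Fy|[i _ <-]];apply: fg_sub;[left|right;exact: sV].
 split;first exact: fg_subfield.
 by apply: fg_der=> y [Fy|/= Vy];[apply: fg_sub;left;exact: hF.2|exact: dV].
apply/(d_alg_jets _ hF.1);exists (size V).+1;apply: (steinitz_seq (V := V) hF.1)=> // i.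
apply: sub;exact: dg_iter.
Qed.
Lemma d_alg_sub F x : subfield F -> F x -> d_algebraic der F x.
move=> hF Fx;apply/(d_alg_jets _ hF);exists 1%N;apply: (steinitz_seq (V := [::]) hF)=> // i.
by rewrite ord1;apply: fg_sub;left.
Qed.
Definition fam N d (b : 'I_d -> K) (l : 'I_#|{: 'I_d * 'I_N}|) := iter (enum_val l).2 der (b (enum_val l).1).
Definition indep F d (b : 'I_d -> K) := forall N, ~ mdep F (@fam N d b).
Lemma indepP F d (b : 'I_d -> K) : subfield F -> d_alg_independent der F b <-> indep F b.
move=> hF;rewrite d_indepP;last exact: (F0 hF).
split=> [h N hm|h p s si hm].
 apply: (h _ (fun l : 'I_#|{: 'I_d * 'I_N}| => ((enum_val l).1, (enum_val l).2 : nat)) _ hm)=> l l' [e1 /val_inj e2].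
 by apply: enum_val_inj;rewrite [LHS]surjective_pairing e1 e2 -surjective_pairing.
pose N := (\max_i (s i).2).+1.
have lt i : ((s i).2 < N)%N by rewrite ltnS;exact: (@leq_bigmax _ (fun i=> (s i).2)).
apply: (h N);apply: (mdep_ren (sg := fun i=> enum_rank ((s i).1, Ordinal (lt i))) hF _ _ hm).
 move=> i j /enum_rank_inj[e1 e2];apply: si.
 by rewrite [LHS]surjective_pairing [RHS]surjective_pairing e1 e2.
by move=> i;rewrite /fam enum_rankK.
Qed.
Lemma indep_sub F d e (b : 'I_d -> K) (sg : 'I_e -> 'I_d) : subfield F -> injective sg ->
 indep F b -> indep F (b \o sg).
move=> hF si h N hm;apply: (h N).
apply: (mdep_ren (sg := fun l=> enum_rank (sg (enum_val l).1, (enum_val l).2)) hF _ _ hm).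
 move=> l l' /enum_rank_inj[/si e1 e2];apply: enum_val_inj.
 by rewrite [LHS]surjective_pairing e1 e2 -surjective_pairing.
by move=> l;rewrite /fam enum_rankK.
Qed.
Lemma indep_last F d (b : 'I_d.+1 -> K) : subfield F -> indep F (fun i=> b (lift ord_max i)) ->
 ~ d_algebraic der (diff_field_gen der (F `|` range (fun i=> b (lift ord_max i)))) (b ord_max) -> indep F b.
set b' := (fun i=> b (lift ord_max i))=> hF h na N hm.
pose p1 := #|{: 'I_d * 'I_N}|.
pose u (l : 'I_(p1 + N)) := match fintype.split l with inl i=> @fam N d b' i | inr i=> iter i der (b ord_max) end.
pose sg (l : 'I_#|{: 'I_d.+1 * 'I_N}|) : 'I_(p1 + N) :=
 if unlift ord_max (enum_val l).1 is Some i then lshift N (enum_rank (i, (enum_val l).2)) else rshift p1 (enum_val l).2.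
have ul i : u (lshift N i) = @fam N d b' i.
 by rewrite /u;case: splitP=> [j /= e|j /= e];[congr fam;apply: val_inj|move: (ltn_ord i);rewrite e ltnNge leq_addr].
have ur i : u (rshift p1 i) = iter i der (b ord_max).
 rewrite /u;case: splitP=> [j /= e|j /= e];first by move: (ltn_ord j);rewrite -e ltnNge leq_addr.
 by move/addnI: e=> ->.
have hu : mdep F u.
 apply: (mdep_ren (sg := sg) hF _ _ hm).
 move=> l l';rewrite /sg;case: unliftP=> [i ei|ei];case: unliftP=> [i' ei'|ei'] e.
 - have /lshift_inj/enum_rank_inj[e1 e2] := e;apply: enum_val_inj.
 by rewrite [LHS]surjective_pairing [RHS]surjective_pairing ei ei' e1 e2.
 - by have /eqP := e;rewrite eq_lrshift.
 - by have /eqP := e;rewrite eq_rlshift.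
 - have /rshift_inj e2 := e;apply: enum_val_inj.
 by rewrite [LHS]surjective_pairing [RHS]surjective_pairing ei ei' e2.
 move=> l;rewrite /sg;case: unliftP=> [i ei|ei];first by rewrite ul /fam enum_rankK ei.
 by rewrite ur /fam ei.
case: (mdep_split hF hu)=> [h1|h1].
 by apply: (h N);move: h1;under eq_fun do rewrite ul.
apply: na;apply/d_alg_jets;first exact: (dg_diff _).1.
exists N;move: h1;under [in X in mdep _ X]eq_fun do rewrite ur;apply: mdep_mono.
apply: fg_min;first exact: (dg_diff _).1.
move=> x [Fx|[i _ <-]];first by apply: dg_sub;left.
by rewrite ul;apply: dg_iter;apply: dg_sub;right;eexists;last reflexivity.
Qed.
(** Counting: the first N derivatives of the [b i] lie in the field generated by a fixed finite [V]
    and the derivatives of the [c i] below order [N0 + N]. If e exceeds q, the e*N elements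
    outnumber the |V| + q*(N0+N) generators once N is larger than |V| + q*N0. *)
Lemma indep_bound F e q (b : 'I_e -> K) (c : 'I_q -> K) : diff_subfield der F -> indep F b ->
 (forall i, d_algebraic der (diff_field_gen der (F `|` range c)) (b i)) -> (e <= q)%N.
move=> hF ib hb;rewrite leqNgt;apply/negP=> lt.
have [V [bV dV]] := d_alg_fg_fin (dg_diff _) hb.
pose C N := [seq iter j der (c i) | i <- enum 'I_q, j <- iota 0 N].
have CS N M : (N <= M)%N -> [set` C N] `<=` [set` C M].
 move=> le x /allpairsP[[i j] /= [_ hj ->]];apply/allpairsP;exists (i, j);rewrite mem_enum;split=> //=.
 by move: hj;rewrite !mem_iota !add0n=> /leq_trans;apply.
have inC N i j : (j < N)%N -> iter j der (c i) \in C N.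
 by move=> h;apply/allpairsP;exists (i, j);rewrite mem_enum mem_iota.
pose E N := field_gen ((F `|` [set` V]) `|` [set` C N]).
have EfN x : field_gen (diff_field_gen der (F `|` range c) `|` [set` V]) x -> exists N, E N x.
 move=> hx;apply: fg_fin;first exact: CS.
 apply: fg_min hx;first exact: fg_subfield.
 move=> y [hy|Vy];last by apply: fg_sub;left;right.
 suff : field_gen (F `|` [set y | exists n, [set` C n] y]) y.
 by apply: fg_mono=> z [Fz|?];[left;left|right].
 apply: dg_min y hy;last first.
 move=> z [Fz|[i _ <-]];apply: fg_sub;[by left|right;exists 1%N].
 exact: (inC 1%N i 0%N).
 split;first exact: fg_subfield.
 apply: fg_der=> z [Fz|[n /= /allpairsP[[i j] /= [_ hj ->]]]];apply: fg_sub;first by left;exact: hF.2.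
 right;exists j.+2;rewrite -iterS;exact: inC.
have Emono N M x : (N <= M)%N -> E N x -> E M x.
 by move=> le;apply: fg_mono=> y [?|/(CS _ _ le)?];[left|right].
have [N0 hN0] : exists N0, forall x, x \in V -> E N0 (der x).
 suff aux (W : seq K) : (forall x, x \in W -> exists N, E N (der x)) -> exists N0, forall x, x \in W -> E N0 (der x).
 by apply: aux=> x /dV/EfN.
 elim: W=> [|x W IH] hW;first by exists 0%N.
 have [N hN] := hW x (mem_head _ _).
 have [|M hM] := IH;first by move=> y hy;apply: hW;rewrite inE hy orbT.
 exists (maxn N M)=> y;rewrite inE=> /orP[/eqP ->|/hM h].
 exact: (Emono _ _ _ (leq_maxl N M) hN).
 exact: (Emono _ _ _ (leq_maxr N M) h).
have dE N x : (N0 <= N)%N -> E N x -> E N.+1 (der x).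
 move=> le;apply: fg_der2=> y [[Fy|Vy]|Cy].
 - by apply: fg_sub;left;left.
 - by apply: fg_sub;left;right.
 - by apply: fg_sub;right;apply: CS Cy.
 - apply: fg_sub;left;left;exact: hF.2.
 - apply: Emono (hN0 y Vy);exact: leq_trans le (leqnSn _).
 - move: Cy=> /= /allpairsP[[i j] /= [_ hj ->]];apply: fg_sub;right;rewrite -iterS;apply: inC.
 by move: hj;rewrite mem_iota.
have bE i j : E (N0 + j)%N (iter j der (b i)).
 elim: j=> [|j IH];first by apply: fg_sub;left;right;exact: bV.
 rewrite addnS iterS;apply: dE=> //;exact: leq_addr.
pose N := (size V + q * N0).+1.
apply: (ib N);apply: (steinitz_seq (V := V ++ C (N0 + N)%N) hF.1).
 rewrite size_cat size_allpairs size_enum_ord size_iota card_prod !card_ord mulnDr.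
 have h : (q.+1 * N <= e * N)%N by rewrite leq_mul2r lt orbT.
 by apply: leq_trans h;rewrite mulSn addnA ltn_add2r.
move=> l;rewrite /fam;apply: fg_mono (Emono _ (N0 + N)%N _ _ (bE _ (enum_val l).2));last first.
 by rewrite leq_add2l ltnW.
move=> y [[Fy|Vy]|Cy];[by left| |];right;rewrite /= mem_cat;apply/orP;[by left|by right].
Qed.
(** Take an independent family of coordinates of the largest size, which is at least d0; a
    coordinate that is not algebraic over it could be added. *)
Lemma trans_basis F n (s : 'I_n -> K) d0 (j0 : 'I_d0 -> 'I_n) : diff_subfield der F -> injective j0 ->
 indep F (s \o j0) -> exists d (j : 'I_d -> 'I_n), [/\ (d0 <= d)%N, injective j, indep F (s \o j)
 & d_trans_basis der F (diff_field_gen der (F `|` range s)) (s \o j)].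
move=> hF j0i ij0.
pose P d := `[< exists j : 'I_d -> 'I_n, injective j /\ indep F (s \o j) >].
have exP : exists d, P d by exists d0;apply/asboolP;exists j0.
have bP d : P d -> (d <= n)%N by move=> /asboolP[j [ji _]];have := leq_card j ji;rewrite !card_ord.
case: (ex_maxnP exP bP)=> d /asboolP[j [ji ij]] dmax.
have d0d : (d0 <= d)%N by apply: dmax;apply/asboolP;exists j0.
exists d, j;split=> //;split.
- by move=> i;apply: dg_sub;right;exists (j i).
- exact/(indepP _ hF.1).
set F1 := diff_field_gen der (F `|` range (s \o j)).
have key i : d_algebraic der F1 (s i).
 apply: contrapT=> na.
 have ni l : j l != i.
 apply/negP=> /eqP e;apply: na;apply: d_alg_sub;first exact: (dg_diff _).1.
 by rewrite -e;apply: dg_sub;right;exists l.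
 pose j' (l : 'I_d.+1) := if unlift ord_max l is Some l' then j l' else i.
 suff : (d.+1 <= d)%N by rewrite ltnn.
 apply: dmax;apply/asboolP;exists j';split.
 move=> l l';rewrite /j';case: unliftP=> [a ->|->];case: unliftP=> [a' ->|->] //.
 - by move=> /ji ->.
 - by move=> e;have := ni a;rewrite e eqxx.
 - by move=> e;have := ni a';rewrite e eqxx.
 have e1 : (fun l=> (s \o j') (lift ord_max l)) = s \o j by apply: funext=> l;rewrite /= /j' liftK.
 have e2 : (s \o j') ord_max = s i by rewrite /= /j' unlift_none.
 apply: indep_last;rewrite ?e1 ?e2 //;exact: hF.1.
move=> a ha;apply: (d_alg_gen (s := s) (dg_diff _) key).
apply: dg_min a ha;first exact: dg_diff.
by move=> y [Fy|sy];apply: dg_sub;[left;apply: dg_sub;left|right].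
Qed.
Lemma dtrdeg_indep F n (s : 'I_n -> K) e : diff_subfield der F ->
 is_dtrdeg der F (diff_field_gen der (F `|` range s)) e ->
 exists j : 'I_e -> 'I_n, injective j /\ indep F (s \o j).
move=> hF [b [bE /(indepP _ hF.1) ib _]].
pose j0 (i : 'I_0) : 'I_n := let: Ordinal m h := i in False_rect _ (notF h).
have [||d [j [_ ji ij [_ _ hj]]]] := @trans_basis F n s 0 j0 hF;first by case.
 by move=> N;apply: mdep0;rewrite card_prod card_ord mul0n.
have ed : (e <= d)%N by apply: (indep_bound hF ib)=> i;exact: hj.
exists (j \o widen_ord ed);split;first by move=> a a' /= /ji/(congr1 val) /= /val_inj.
by apply: (indep_sub hF.1 _ ij)=> a a' /(congr1 val) /= /val_inj.
Qed.
End DAlg.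

(** * Elements infinitesimal over an elementary submodel *)

Section Tiny.
Variables (L : RF) (derL : L -> L) (OL kL : set L) (K : RF) (der : K -> K) (O k : set K).
Variable j : L -> K.
Hypothesis TL : tame derL OL kL.
Hypothesis T : tame der O k.
Hypothesis hj : elem derL OL kL der O k j.
Let hO := t_val T.
Let hd := t_der T.
Let hc := t_conv T.
Local Hint Resolve hO hd hc : core.
Notation "x <: y" := (~ dominated O y x).
Notation "x =: y" := (asymp O x y).
Notation "x ~: y" := (~ dominated O y (x - y)).
Notation logd := (logder der).
Let E := field_gen (range j `|` k).
Lemma fgk_diff : diff_subfield der E.
split;first exact: fg_subfield.
apply: fg_der=> // a [[x _ <-]|ka];apply: fg_sub;last by right;exact: (t_kder T).
left;exists (derL x)=> //;exact: (ider hj).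
Qed.
(** Adjoining [k] creates no new values. Apply the compositum of the residue step to the identities
    of [L] and of [k]: sums of products are equivalent to a product of an element of [L] and a unit
    of [k]. *)
Lemma fgk_asymp t : E t -> t != 0 -> exists2 a, a != 0 & t =: j a.
pose G : set (K * K) := [set x | exists a, x = (j a, j a)].
pose H : set (K * K) := [set x | exists2 c, k c & x = (c, c)].
have hG : good0 der O k der O k G.
 split.
 - by exists 1;rewrite (i1 hj).
 - by move=> _ _ [a ->] [b ->];exists (a - b);rewrite (iB hj).
 - by move=> _ _ [a ->] [b ->];exists (a * b);rewrite (iM hj).
 - by move=> _ [a ->];exists a^-1;rewrite (iV hj).
 - by move=> _ [a ->];exists (derL a);rewrite (ider hj).
 - by move=> _ [a ->].
 - by move=> _ _ [a ->] [b ->].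
 - move=> _ [a ->] /= /(dle1 O);rewrite -(i1 hj)=> /(idom hj)/(dle1 OL)/(t_lift TL)[c kc hcc].
 exists (j c, j c);first by exists c.
 split;[exact/(ik hj)|exact/(ik hj)|rewrite /= -(iB hj)=> h;apply: hcc;exact/(idom hj)].
 - move=> phi v hv;have -> : snd \o v = fst \o v;last by [].
 by apply: funext=> l;have [[a e] _] := hv l;rewrite /= e.
have Hel : pmap der O k der O k true H.
 move=> phi v hv;have -> : snd \o v = fst \o v;last by [].
 by apply: funext=> l;have [a _ e] := hv l;rewrite /= e.
have Hk c : k c -> exists2 x, H x & x.1 = c by move=> kc;exists (c, c)=> //;exists c.
have Hkk x : H x -> k x.1 /\ k x.2 by move=> [c kc ->].
have GH x : G x -> k x.1 -> H x by move=> [a ->] /= ka;exists (j a).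
have [[g0 gk] GR] := goodk_prod T T Hel Hk Hkk hG GH.
have sub : E `<=` [set t | Fr (prodR H G) (t, t)].
 apply: fg_min.
 split;first exact: (g_1 g0).
 move=> a b ha hb;exact: (g_B g0 ha hb).
 move=> a b ha hb;exact: (g_M g0 ha (g_V g0 hb)).
 move=> a [[x _ <-]|ka];first by apply: GR;exists x.
 have [x Fx ex] := gk _ ka;have hx := G_k T T g0 Fx.
 apply: sub_Fr;last first.
 exists [:: (1, (a, a))];split;last by rewrite big_seq1 mul1r.
 by move=> q;rewrite inE=> /eqP ->;split;[exact: (g_1 hG)|exists a].
 exists [:: (1, 1)];split;last by rewrite big_seq1 mulr1.
 by move=> q;rewrite inE=> /eqP ->;split;[exact: (g_1 hG)|exists 1=> //;exact: (t_k1 T)].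
have key x : prodR H G x -> x.1 != 0 -> exists2 a, a != 0 & x.1 =: j a.
 move=> /(prodR_sim T T Hel Hk Hkk hG GH)[->|[u [e [h [[a ea] Hh e1 h1 ->]]] [s _]]].
 by rewrite eqxx.
 move=> _;exists a;first by apply: contra_neq e1=> a0;rewrite ea a0 (i0 hj).
 apply: (asymp_trans hO (sim_asymp hO s));rewrite /= ea /= -[X in asymp _ _ X]mulr1.
 by apply: asympM=> //;[exact: asymp_refl|apply: (k_asymp1 T)=> //;exact: (Hkk _ Hh).1].
move=> /sub[a [b [Ra Rb b1 _ /(congr1 fst) /= et]]] t0.
have a1 : a.1 != 0 by apply: contra_neq t0=> z;rewrite et z mul0r.
have [x x0 hx] := key a Ra a1;have [y y0 hy] := key b Rb b1.
exists (x / y);first by rewrite mulf_neq0 ?invr_neq0.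
by rewrite et (iM hj) (iV hj);apply: asympM=> //;apply: asympV=> //;rewrite (i_eq0 hj).
Qed.

(* Each coordinate dominates the field generated by the preceding ones. *)
Lemma lex_eval p (w : 'I_p -> K) (R : {mpoly K[p]}) t :
 (forall i l : 'I_p, (i < l)%N -> forall n, w i ^+ n <: w l) -> (forall i e, E e -> e <: w i) ->
 (forall m, E R@_m) -> R != 0 -> (forall e, E e -> e <: t) -> (forall i n, w i ^+ n <: t) ->
 R.@[w] <: t /\ t^-1 <: R.@[w].
have fE : subfield E := fg_subfield _.
elim: p w R t=> [|p IH] w R t ww wE RE R0 tE wt.
 have e : R = (R@_0)%:MP.
 by apply/mpolyP=> m;rewrite mcoeffC (_ : m = 0%MM) ?eqxx ?mulr1 //;apply/mnmP=> -[].
 have r0 : R@_0 != 0 by apply: contra_neq R0=> z;rewrite e z mpolyC0.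
 rewrite e mevalC;split;first exact: tE.
 rewrite -[X in ~ dominated _ X _]invrK;apply: (dltV hO);first exact: invr_neq0.
 apply: tE;exact: (FV fE).
pose w' (i : 'I_p) := w (widen_ord (leqnSn p) i);pose z := w ord_max.
have one : 1 <: z by apply: wE;exact: (F1 fE).
have z0 : z != 0 := dlt_neq0 hO one.
have low (C : {mpoly K[p]}) : (forall m, E C@_m) -> C != 0 -> C.@[w'] <: z /\ z^-1 <: C.@[w'].
 move=> hC C0;apply: IH=> //.
 - by move=> i l il n;apply: ww.
 - move=> i e;exact: wE.
 - move=> e;exact: wE.
 - by move=> i n;apply: ww;rewrite /= ltn_ord.
pose D := (size (muni R)).-1;pose lc := (muni R)`_D.
have cE e m : E ((muni R)`_e)@_m by rewrite muni_coef.
have mR0 : muni R != 0.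
 apply: contra_neq R0=> h;apply/mpolyP=> m;rewrite mcoeff0.
 have -> : m = mext [multinom m (widen_ord (leqnSn p) i) | i < p] (m ord_max).
 apply/mnmP=> i;rewrite mnmE;case: insubP=> [l li vl|].
 by rewrite mnmE;congr (m _);apply: val_inj.
 rewrite -leqNgt=> ni;congr (m _);apply: val_inj=> /=;apply/eqP.
 by rewrite eqn_leq ni -ltnS ltn_ord.
 by rewrite -muni_coef h coef0 mcoeff0.
have L0 : lc != 0 by rewrite /lc -lead_coefE lead_coef_eq0.
have sz : size (muni R) = D.+1 by rewrite /D prednK // lt0n size_poly_eq0.
have ev : R.@[w] = \sum_(e < D.+1) ((muni R)`_e).@[w'] * z ^+ e.
 have le : (size (map_poly (meval w') (muni R)) <= D.+1)%N by rewrite -sz size_poly.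
 rewrite muni_eval (horner_coef_wide _ le).
 by apply: eq_bigr=> e _;rewrite coef_map.
have [Lz zL] := low lc (cE D) L0;have Lv0 : lc.@[w'] != 0 := dlt_neq0 hO zL.
(* Applying the bounds to squares leaves room of a square root: a lower coefficient is below the
   root of [z] and the leading one above its inverse, so one more factor [z] always decides. *)
have sq (C : {mpoly K[p]}) : (forall m, E C@_m) -> C != 0 -> C.@[w'] ^+ 2 <: z /\ z^-1 <: C.@[w'] ^+ 2.
 move=> hC C0;have := low (C * C);rewrite mevalM -expr2;apply;last by rewrite mulf_neq0.
 exact: (A_mpolyM (F1 fE) (FB fE) (FM fE)).
have small e : (e < D)%N -> ((muni R)`_e).@[w'] * z ^+ e <: lc.@[w'] * z ^+ D.
 move=> lt;have nz : lc.@[w'] * z ^+ D != 0 by rewrite mulf_neq0 // expf_neq0.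
 have [c0|c0] := eqVneq (muni R)`_e 0;first by rewrite c0 meval0 mul0r;exact: dlt0x.
 have [h1 _] := sq _ (cE e) c0;have [_ h2] := sq _ (cE D) L0.
 have h3 : ((muni R)`_e).@[w'] <: lc.@[w'] * z.
 move=> h;have := dleX hO 2 h;rewrite exprMn=> h4.
 have : z^-1 * z ^+ 2 <: lc.@[w'] ^+ 2 * z ^+ 2 by apply: dltMr=> //;rewrite expf_neq0.
 by rewrite expr2 mulKf // => h5;apply: h5;apply: (dle_trans hO _ (dltW hO h1)).
 have eD : z ^+ D = z ^+ (D - e.+1) * (z * z ^+ e) by rewrite -exprS -exprD subnK.
 have -> : lc.@[w'] * z ^+ D = z ^+ (D - e.+1) * (lc.@[w'] * z * z ^+ e) by rewrite eD mulrCA;congr (_ * _);exact: mulrA.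
 apply: (dlt_le_trans hO (y := lc.@[w'] * z * z ^+ e));first by apply: dltMr=> //;rewrite expf_neq0.
 rewrite -{1}[lc.@[w'] * z * z ^+ e]mul1r;apply: dleMr=> //;rewrite -(expr1n _ (D - e.+1)).
 apply: dleX=> //;exact: dltW.
have sim : R.@[w] ~: lc.@[w'] * z ^+ D.
 rewrite ev big_ord_recr /= addrK;apply: dlt_sum=> //;first by rewrite mulf_neq0 // expf_neq0.
 move=> e _;exact: small.
have as1 := sim_asymp hO sim.
split.
 apply: (dle_lt_trans hO as1.1);apply: (dlt_trans hO (y := z * z ^+ D)).
 by apply: dltMr=> //;rewrite expf_neq0.
 rewrite -exprS;exact: wt.
have zt : z <: t by have := wt ord_max 1%N;rewrite expr1.
apply: (dlt_le_trans hO _ as1.2);apply: (dlt_trans hO (dltV hO z0 zt)).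
apply: (dlt_le_trans hO zL);rewrite -{1}[lc.@[w']]mulr1;apply: dleMl=> //.
rewrite -(expr1n _ D);apply: dleX=> //;exact: dltW.
Qed.
(** The iterated logarithmic derivatives [Z i] of the inverse of [y] are all infinite over [L], and
    each dominates all powers of the next. If [y] were differentially algebraic, they would lie in a
    finitely generated field and be dependent, against [lex_eval]. *)
Lemma tiny_not_alg y : y != 0 -> (forall a, 0 < a -> `|y| < j a) -> ~ d_algebraic der E y.
move=> y0 ty alg.
have fE : subfield E := fg_subfield _.
pose Z i := iter i logd `|y|^-1.
have [e0 e00 he0] := t_ne TL.
have gt a : exists2 a', j a <: j a' & a' != 0 /\ 0 < a'.
 have [->|a0] := eqVneq a 0;first by exists 1;rewrite ?oner_neq0 ?ltr01 // (i0 hj) (i1 hj);apply: dlt0x;exact: oner_neq0.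
 have n0 : a / e0 != 0 by rewrite mulf_neq0 ?invr_neq0.
 exists `|a / e0|;last by rewrite normr_eq0 normr_gt0.
 move=> /(idom hj)/(dle_norm TL) h;apply: he0;apply: (@dle_M2l _ _ (t_val TL) (a / e0))=> //.
 by rewrite mulr1 divfK.
(* In the induction step an infinite bound [b] from [L] is the logarithmic derivative of some [f] of
   [L]. One of [f] and its inverse is infinite and below [Z i], so monotonicity of logarithmic
   derivatives puts [b] below the next level. *)
have big i a : j a <: Z i.
 elim: i a=> [|i IH] a.
 have [a' h [a0' p]] := gt a;apply: (dlt_le_trans hO h);apply: (dle_pos hO hc).
 by rewrite -(i0 hj) -(i_le hj) ltW.
 have := ty a'^-1;rewrite invr_gt0=> /(_ p) /ltW;rewrite (iV hj)=> h'.
 by rewrite -[j a']invrK lef_pV2 // posrE ?invr_gt0 ?normr_gt0 // -(i0 hj) -(i_lt hj).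
 have [b hb1 hb2] : exists2 b, j a <: j b & 1 <: j b.
 have [a1 h1 _] := gt a;have [a2 h2 _] := gt 1;rewrite (i1 hj) in h2.
 case: (pselect (1 <: j a1))=> h;first by exists a1.
 by exists a2=> //;apply: (dlt_trans hO _ h2);apply: (dlt_le_trans hO h1);apply: contrapT.
 have [f f0 df] := t_exp TL b.
 have jf0 : j f != 0 by rewrite (i_eq0 hj).
 have lf : logd (j f) = j b by rewrite /logder -(ider hj) df (iM hj) mulfK.
 apply: (dlt_le_trans hO hb1);case: (pselect (1 <: j f))=> h.
 rewrite -lf;apply: (logd_mono T h);apply: dltW=> //;exact: IH.
 have h' : 1 <: j f^-1.
 rewrite (iV hj) -[X in ~ dominated _ _ X]invr1;apply: dltV=> // h1.
 by apply: hb2;rewrite -lf;apply: (logd_unit T);split=> //;apply: contrapT.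
 have := logd_mono T h' (dltW hO (IH f^-1));rewrite (iV hj) logdV // lf=> h2.
 exact/(dleNE hO).
have ZX i n : Z i.+1 ^+ n <: Z i.
 apply: (logdX_small T);rewrite -(i1 hj);exact: big.
have Zn i : Z i != 0 by have h := big i 1;exact: (dlt_neq0 hO h).
have Zlt a b n : (a < b)%N -> Z b ^+ n <: Z a.
 elim: b n=> // b IH n;rewrite ltnS leq_eqVlt=> /orP[/eqP ->|/(IH 1%N)];first exact: ZX.
 rewrite expr1;apply: dlt_trans=> //;exact: ZX.
have [V [yV dV]] := d_alg_fg hd fgk_diff alg.
pose S := field_gen (E `|` [set` V]);have fS : subfield S := fg_subfield _.
have dS x : S x -> S (der x).
 apply: fg_der=> // z [Ez|Vz];last exact: dV.
 apply: fg_sub;left;exact: fgk_diff.2.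
have ZS i : S (Z i).
 elim: i=> [|i IH];last by apply: (Fdv fS)=> //;exact: dS.
 have Sy : S y by apply: fg_sub;right.
 have -> : Z 0%N = `|y|^-1 by [].
 apply: (FV fS);have [->|->] : `|y| = y \/ `|y| = - y.
 by case: (lerP 0 y)=> h;[left;rewrite ger0_norm|right;rewrite ltr0_norm].
 - exact: Sy.
 exact: (FN fS Sy).
pose N := size V;pose w (i : 'I_N.+1) := Z (N - i).+1.
have [R [RE R0 ev]] : mdep E w by apply: (steinitz_seq fE (V := V))=> // i;exact: ZS.
have EZ i e : E e -> e <: Z i.
 move=> Ee;have [->|e1] := eqVneq e 0;first exact: dlt0x.
 have [a _ h] := fgk_asymp Ee e1;apply: (dle_lt_trans hO h.1);exact: big.
have [||||||_] := @lex_eval _ w R (Z 0%N)=> //.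
- move=> i l il n;apply: Zlt;rewrite ltnS ltn_sub2l //;exact: leq_trans il (leq_ord l).
- move=> i e;exact: EZ.
- move=> e;exact: EZ.
- move=> i n;exact: Zlt.
rewrite ev;apply;exact: dle0x.
Qed.
End Tiny.
Lemma pmap_expr (K : RF) (der : K -> K) (O k : set K) (K' : RF)
 (der' : K' -> K') (O' k' : set K') H P (v : nat -> K * K') : pmap der O k der' O' k' false H ->
 expr P -> (forall i, H (v i)) -> P K der O k (fst \o v) <-> P K' der' O' k' (snd \o v).
by move=> hH [phi h] hv;rewrite -!h;have := hH phi v hv;rewrite relf_false. Qed.
Lemma vcat_comp n (A B : Type) (f : A -> B) (s : 'I_n -> A) v : f \o vcat s v = vcat (f \o s) (f \o v).
by apply: funext=> i;rewrite /vcat /=;case: insubP. Qed.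

(** * Independence and elementary maps *)

Section Transfer.
Variables (K : RF) (der : K -> K) (O k : set K) (K' : RF)
 (der' : K' -> K') (O' k' : set K').
Hypothesis T' : tame der' O' k'.
Variable H : set (K * K').
Hypothesis hH : pmap der O k der' O' k' false H.
Variables (A : set K) (A' : set K').
Hypothesis hA' : subfield A'.
Hypothesis AH : forall a', A' a' -> exists2 a, A a & H (a, a').
Definition sums (x : K') := exists t : seq (K' * K'),
 (forall q, q \in t -> A' q.1 /\ k' q.2) /\ x = \sum_(q <- t) q.1 * q.2.
Let sums_B x y : sums x -> sums y -> sums (x - y).
move=> [t [ht ->]] [t' [ht' ->]];exists (t ++ [seq (- q.1, q.2) | q <- t']);split.
 move=> q;rewrite mem_cat=> /orP[/ht//|/mapP[r /ht'[r1 r2] ->]];by split=> //=;exact: (FN hA').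
by rewrite big_cat big_map /= -sumrN;congr (_ + _);apply: eq_bigr=> q _;rewrite mulNr.
Qed.
Let sums_M x y : sums x -> sums y -> sums (x * y).
move=> [t [ht ->]] [t' [ht' ->]];exists [seq (q.1 * r.1, q.2 * r.2) | q <- t, r <- t'];split.
 move=> _ /allpairsP[[q r] /= [/ht[? ?] /ht'[? ?] ->]];by split=> /=;[exact: (FM hA')|exact: (t_kM T')].
rewrite mulr_suml big_allpairs_dep /=;apply: eq_bigr=> q _;rewrite mulr_sumr;apply: eq_bigr=> r _ /=.
exact: mulrACA.
Qed.
Let sums_g a c : A' a -> k' c -> sums (a * c).
by move=> ha kc;exists [:: (a, c)];split;[move=> q;rewrite inE=> /eqP ->|rewrite big_seq1]. Qed.
Let sums_1 : sums 1. by rewrite -[1]mulr1;apply: sums_g;[exact: (F1 hA')|exact: (t_k1 T')]. Qed.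
Let sums_0 : sums 0. by rewrite -(subrr 1);exact: sums_B. Qed.
Lemma fg_sums x : field_gen (A' `|` k') x -> exists2 s, sums s & s != 0 /\ sums (s * x).
apply: (@fg_min _ _ [set x | exists2 s, sums s & s != 0 /\ sums (s * x)]).
 split;first by exists 1=> //;rewrite oner_neq0 mulr1.
 move=> a b [s hs [s0 sa]] [r hr [r0 rb]];exists (s * r);first exact: sums_M.
 rewrite mulf_neq0 //;split=> //.
 have -> : s * r * (a - b) = (s * a) * r - s * (r * b) by ring.
 apply: sums_B;exact: sums_M.
 move=> a b [s hs [s0 sa]] [r hr [r0 rb]];have [->|b0] := eqVneq b 0.
 by exists 1=> //;rewrite oner_neq0 invr0 !mulr0.
 exists (s * (r * b));first exact: sums_M.
 rewrite !mulf_neq0 //;split=> //.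
 have -> : s * (r * b) * (a / b) = (s * a) * r by field.
 exact: sums_M.
move=> a [Aa|ka];exists 1=> //;rewrite oner_neq0 mul1r;split=> //.
 rewrite -[a]mulr1;apply: sums_g=> //;exact: (t_k1 T').
rewrite -[a]mul1r;apply: sums_g=> //;exact: (F1 hA').
Qed.
Lemma common_denom (l : seq K') : (forall x, x \in l -> field_gen (A' `|` k') x) ->
 exists2 s, sums s & s != 0 /\ forall x, x \in l -> sums (s * x).
elim: l=> [|x l IH] hl;first by exists 1=> //;rewrite oner_neq0.
have [s hs [s0 sx]] := fg_sums (hl x (mem_head _ _)).
have [|r hr [r0 rl]] := IH;first by move=> y hy;apply: hl;rewrite inE hy orbT.
exists (s * r);first exact: sums_M.
rewrite mulf_neq0 //;split=> // y;rewrite inE=> /orP[/eqP ->|hy].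
 rewrite mulrAC;exact: sums_M.
rewrite -mulrA;apply: sums_M=> //;exact: rl.
Qed.
(** After clearing denominators the coefficients are sums of products of elements of [A'] and [k'].
    The factors in [k'] are quantified existentially, since only those in [A'] have counterparts;
    nonvanishing of one chosen coefficient is part of the formula. *)
Lemma dep_transfer N d (b : 'I_d -> K) (b' : 'I_d -> K') : (forall i, H (b i, b' i)) ->
 mdep (field_gen (A' `|` k')) (@fam _ der' N d b') -> mdep (field_gen (A `|` k)) (@fam _ der N d b).
move=> Hb [R [hR R0 ev]];set p := #|_| in R hR R0 ev.
have [|s hs [s0 sR]] := @common_denom [seq R@_m | m <- msupp R].
 by move=> _ /mapP[m _ ->].
have [t [ht eR]] : exists t : seq (K' * K' * 'X_{1..p}), (forall q, q \in t -> A' q.1.1 /\ k' q.1.2) /\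
 s *: R = \sum_(q <- t) (q.1.1 * q.1.2) *: 'X_[q.2].
 rewrite [in s *: R](mpolyE R) scaler_sumr;elim: (msupp R) (fun m (h : m \in msupp R)=> sR _ (map_f (fun m=> R@_m) h))=> [|m l IH] hl.
 by exists [::];rewrite !big_nil.
 have [|t [ht et]] := IH;first by move=> m' h;apply: hl;rewrite inE h orbT.
 have [t1 [ht1 e1]] := hl m (mem_head _ _).
 exists ([seq (q, m) | q <- t1] ++ t);split.
 by move=> q;rewrite mem_cat=> /orP[/mapP[r /ht1 ? ->]|/ht].
 by rewrite big_cons big_cat big_map /= et scalerA e1 scaler_suml.
case E : (msupp R)=> [|m0 l];first by move: R0;rewrite -msupp_eq0 E.
have m0R : R@_m0 != 0 by rewrite -mcoeff_msupp E mem_head.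
pose n := size t;pose q0 : K' * K' * 'X_{1..p} := (0, 0, 0%MM).
pose a' (i : 'I_n) := (nth q0 t i).1.1;pose c' (i : 'I_n) := (nth q0 t i).1.2;pose ms (i : 'I_n) := (nth q0 t i).2.
have sum_t (V : nmodType) (f : K' * K' * 'X_{1..p} -> V) : \sum_(q <- t) f q = \sum_(i < n) f (a' i, c' i, ms i).
 rewrite (big_nth q0) big_mkord;apply: eq_bigr=> i _;congr f.
 by rewrite [LHS]surjective_pairing [in LHS](surjective_pairing (nth q0 t i).1).
have hac i : A' (a' i) /\ k' (c' i) by apply: ht;exact: mem_nth.
have [a ha] := choice (fun i=> let: ex_intro2 x y z := AH (hac i).1 in ex_intro (fun x=> A x /\ H (x, a' i)) x (conj y z)).
have [h0 _ Hh0] := AH (F1 hA').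
pose P (F : RF) (dF : F -> F) (OF kF : set F) (v : nat -> F) := exists c : 'I_n -> F,
 [/\ forall i, kF (c i), \sum_(i < n) v i * c i * \prod_(l < p) iter (enum_val l).2 dF (v (n + (enum_val l).1)%N) ^+ ms i l = 0
 & \sum_(i < n) (v i * c i) *+ (ms i == m0) != 0].
have eP : expr P.
 have h : expr (fun F dF OF kF v=> (forall i : 'I_n, kF (v i)) /\ (\sum_(i < n) v (n + i)%N * v i *
 \prod_(l < p) iter (enum_val l).2 dF (v (n + (n + (enum_val l).1))%N) ^+ ms i l = 0 /\
 \sum_(i < n) (v (n + i)%N * v i) *+ (ms i == m0) != 0)) by ex.
 apply: e_ext (e_exn n h)=> F dF OF kF v;split=> -[c hcc];exists c;move: hcc.
 move=> [h1 [h2 h3]];split.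
 - by move=> i;have := h1 i;rewrite vcat_lt.
 - rewrite -[RHS]h2;apply: eq_bigr=> i _;rewrite vcat_lt vcat_ge;congr (_ * _).
 by apply: eq_bigr=> l' _;rewrite vcat_ge.
 - apply: contra_neq h3=> h3';rewrite -[RHS]h3';by apply: eq_bigr=> i _;rewrite vcat_lt vcat_ge.
 move=> [h1 h2 h3];split;first by move=> i;rewrite vcat_lt.
 split.
 rewrite -[RHS]h2;apply: eq_bigr=> i _;rewrite vcat_lt vcat_ge;congr (_ * _).
 by apply: eq_bigr=> l' _;rewrite vcat_ge.
 apply: contra_neq h3=> h3';rewrite -[RHS]h3';by apply: eq_bigr=> i _;rewrite vcat_lt vcat_ge.
pose v := vcat (fun i=> (a i, a' i)) (vcat (fun i=> (b i, b' i)) (fun=> (h0, 1))).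
have Hv i : H (v i).
 by rewrite /v /vcat;case: insubP=> [l' _ _|_];[exact: (ha l').2|case: insubP=> [l' _ _|_]].
have v1 : fst \o v = vcat a (vcat b (fun=> h0)) by rewrite /v !vcat_comp.
have v2 : snd \o v = vcat a' (vcat b' (fun=> 1)) by rewrite /v !vcat_comp.
have : P K' der' O' k' (snd \o v).
 exists c';rewrite v2;split;first by move=> i;exact: (hac i).2.
 have := congr1 (meval (@fam _ der' N d b')) eR;rewrite mevalZ ev mulr0 (raddf_sum (meval _)) /= sum_t=> hz;rewrite [RHS]hz.
 apply: eq_bigr=> i _;rewrite mevalZ mevalX vcat_lt;congr (_ * _).
 by apply: eq_bigr=> l' _;rewrite vcat_ge vcat_lt.
 have : s * R@_m0 != 0 by rewrite mulf_neq0.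
 rewrite -mcoeffZ eR (raddf_sum (mcoeff _)) /= sum_t;apply: contra_neq=> hz;rewrite -[RHS]hz.
 by apply: eq_bigr=> i _;rewrite mcoeffZ mcoeffX vcat_lt mulr_natr.
move/(pmap_expr hH eP Hv).2;rewrite v1=> -[c [kc h1 h2]].
have fF := fg_subfield (A `|` k).
have RE m : (\sum_(i < n) (a i * c i) *: 'X_[ms i] : {mpoly K[p]})@_m = \sum_(i < n) (a i * c i) *+ (ms i == m).
 by rewrite (raddf_sum (mcoeff _)) /=;apply: eq_bigr=> i _;rewrite mcoeffZ mcoeffX mulr_natr.
exists (\sum_(i < n) (a i * c i) *: 'X_[ms i]);split.
- move=> m;rewrite RE;apply: (Fsum fF)=> i _;apply: (FMn fF);apply: (FM fF);apply: fg_sub.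
 left;exact: (ha i).1.
 by right.
- apply/eqP=> z;have := RE m0;rewrite z mcoeff0=> z';case/eqP: h2;rewrite [RHS]z'.
 by apply: eq_bigr=> i _;rewrite vcat_lt.
- rewrite (raddf_sum (meval _)) /= -[RHS]h1;apply: eq_bigr=> i _;rewrite mevalZ mevalX vcat_lt;congr (_ * _).
 by apply: eq_bigr=> l' _;rewrite vcat_ge vcat_lt.
Qed.
End Transfer.
Lemma elem_comp (K : RF) (der : K -> K) (O k : set K) (K1 : RF) (der1 : K1 -> K1)
 (O1 k1 : set K1) (K2 : RF) (der2 : K2 -> K2) (O2 k2 : set K2) (i : K -> K1) (j : K1 -> K2) :
 elem der O k der1 O1 k1 i -> elem der1 O1 k1 der2 O2 k2 j -> elem der O k der2 O2 k2 (j \o i).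
move=> hi hj phi v;rewrite (hi phi v);exact: (hj phi (i \o v)). Qed.

Section Elementary.
Variables (K : RF) (der : K -> K) (O k : set K) (K' : RF) (der' : K' -> K')
 (O' k' : set K') (i : K -> K').
Hypothesis hi : elem der O k der' O' k' i.
Lemma elem_pmap : pmap der O k der' O' k' false [set x | x.2 = i x.1].
move=> phi v hv;have -> : snd \o v = i \o (fst \o v) by apply: funext=> l;exact: hv.
exact: hi.
Qed.
Lemma elem_subfield (A : set K) : subfield A -> subfield (i @` A).
move=> hA;split;first by exists 1;[exact: (F1 hA)|exact: (i1 hi)].
 by move=> _ _ [a Aa <-] [b Ab <-];exists (a - b);[exact: (FB hA)|exact: (iB hi)].
by move=> _ _ [a Aa <-] [b Ab <-];exists (a / b);[exact: (Fdv hA)|rewrite (iM hi) (iV hi)].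
Qed.
Lemma indep_elem (T' : tame der' O' k') (A : set K) d (b : 'I_d -> K) : subfield A ->
 indep der (field_gen (A `|` k)) b -> indep der' (field_gen (i @` A `|` k')) (i \o b).
move=> hA ib N hm;apply: (ib N).
apply: (dep_transfer T' elem_pmap (elem_subfield hA) (A := A) _ (b' := i \o b))=> //.
by move=> _ [a Aa <-];exists a.
Qed.
Lemma subfield_range : subfield (range i).
exact: elem_subfield. Qed.
End Elementary.
Lemma indep_cat (K : RF) (der : K -> K) (hd : derivation der) (F F1 : set K) d m (b : 'I_d -> K) (c : 'I_m -> K) :
 subfield F -> diff_subfield der F1 -> F `<=` F1 -> (forall i, F1 (b i)) ->
 indep der F b -> indep der F1 c ->
 indep der F (fun l : 'I_(d + m)=> match fintype.split l with inl i=> b i | inr i=> c i end).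
move=> hF hF1 sF bF ib ic N hm.
pose p1 := #|{: 'I_d * 'I_N}|;pose p2 := #|{: 'I_m * 'I_N}|.
pose u (l : 'I_(p1 + p2)) := match fintype.split l with inl i=> @fam _ der N d b i | inr i=> @fam _ der N m c i end.
pose sg (l : 'I_#|{: 'I_(d + m) * 'I_N}|) : 'I_(p1 + p2) := match fintype.split (enum_val l).1 with
 | inl i=> lshift p2 (enum_rank (i, (enum_val l).2)) | inr i=> rshift p1 (enum_rank (i, (enum_val l).2)) end.
have ul i : u (lshift p2 i) = @fam _ der N d b i by rewrite /u -[lshift p2 i]/(unsplit (inl i)) unsplitK.
have ur i : u (rshift p1 i) = @fam _ der N m c i by rewrite /u -[rshift p1 i]/(unsplit (inr i)) unsplitK.
have hu : mdep F u.
 apply: (mdep_ren (sg := sg) hF _ _ hm).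
 move=> l l';rewrite /sg;case E : (fintype.split _)=> [i|i];case E' : (fintype.split _)=> [i'|i'] e.
 - have /lshift_inj/enum_rank_inj[e1 e2] := e;apply: enum_val_inj.
 by rewrite [LHS]surjective_pairing [RHS]surjective_pairing -[(enum_val l).1]splitK -[(enum_val l').1]splitK E E' e1 e2.
 - by have /eqP := e;rewrite eq_lrshift.
 - by have /eqP := e;rewrite eq_rlshift.
 - have /rshift_inj/enum_rank_inj[e1 e2] := e;apply: enum_val_inj.
 by rewrite [LHS]surjective_pairing [RHS]surjective_pairing -[(enum_val l).1]splitK -[(enum_val l').1]splitK E E' e1 e2.
 move=> l;rewrite /sg /fam;case E : (fintype.split _)=> [i|i].
 by rewrite ul /fam enum_rankK.
 by rewrite ur /fam enum_rankK.
case: (mdep_split hF hu)=> [h1|h1].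
 by apply: (ib N);move: h1;under eq_fun do rewrite ul.
apply: (ic N);move: h1;under [in X in mdep _ X]eq_fun do rewrite ur;apply: mdep_mono.
apply: fg_min;first exact: hF1.1.
move=> x [/sF//|[i _ <-]];rewrite ul /fam;elim: (nat_of_ord _)=> [|n IH] /=;first exact: bF.
exact: hF1.2.
Qed.
Lemma d_alg_mono (K : RF) (der : K -> K) (F F' : set K) x : subfield F -> subfield F' -> F `<=` F' ->
 d_algebraic der F x -> d_algebraic der F' x.
move=> hF hF' s /(d_alg_jets _ _ hF)[N h];apply/(d_alg_jets _ _ hF');exists N;exact: mdep_mono h.
Qed.
Lemma d_alg_shift (K : RF) (der : K -> K) (hd : derivation der) (F : set K) x c : diff_subfield der F -> F c ->
 d_algebraic der F (x + c) -> d_algebraic der F x.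
move=> hF Fc h;apply: (d_alg_gen hd (s := fun _ : 'I_1=> x + c) hF)=> //.
suff: diff_field_gen der (F `|` range (fun _ : 'I_1=> x + c)) ((x + c) - c) by rewrite addrK.
have dF := (dg_diff der (F `|` range (fun _ : 'I_1=> x + c))).1.
by apply: (FB dF);apply: dg_sub;[right;exists ord0|left].
Qed.
Lemma tiny_exists (L : RF) (der : L -> L) (O k : set L) (T : tame der O k) :
 exists (K : RF) (derK : K -> K) (OK kK : set K) (i : L -> K) (t : K),
 [/\ elem der O k derK OK kK i, 0 < t & forall a, 0 < a -> t < i a].
have [K [dK [OK [kK [i [hi hs]]]]]] := @pair_saturated_extension L der O k L.
exists K, dK, OK, kK, i.
pose C a : K -> Prop := fun x=> 0 < x /\ x < i a.
pose Cs := [set D | exists2 a, 0 < a & D = C a].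
have cA : (range i #<= [set: L])%card by apply: card_le_image;exact: card_lexx.
have [D [a a0 ->]|l hl|t ht] := @realize _ dK OK kK L (range i) hs cA Cs.
- exists (fun K d O k v=> 0 < v 0%N /\ v 0%N < v 1%N), (fun=> i a);split=> //;first by ex.
- suff [c c0 hcc] : exists2 c, 0 < c & forall D, List.In D l -> exists2 a, c < a & D = C a.
 exists (i c)=> D /hcc[a ca ->];split;first by rewrite -(i0 hi) -(i_lt hi).
 by rewrite -(i_lt hi).
 elim: l hl=> [|D l IH] hl;first by exists 1.
 have [|c c0 hcc] := IH;first by move=> D' h;apply: hl;right.
 have [a a0 eD] := hl D (or_introl erefl).
 have hm : 0 < Num.min c a by rewrite lt_min c0 a0.
 exists (Num.min c a / 2);first by rewrite divr_gt0.
 have h2 : Num.min c a / 2 < Num.min c a by rewrite ltr_pdivrMr // mulr_natr mulr2n ltrDl.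
 move=> D' [<-|/hcc[a' h ->]].
 by exists a=> //;apply: (lt_le_trans h2);rewrite ge_min lexx orbT.
 by exists a'=> //;apply: lt_trans h;apply: (lt_le_trans h2);rewrite ge_min lexx.
have [t0 _] := ht (C 1) (ex_intro2 _ _ 1 ltr01 erefl).
exists t;split=> // a a0;have [] := ht (C a) (ex_intro2 _ _ a a0 erefl);by [].
Qed.
Lemma indep0 (K : RF) (der : K -> K) (F : set K) (b : 'I_0 -> K) : indep der F b.
by move=> N;apply: mdep0;rewrite card_prod card_ord mul0n. Qed.
(** The generic box: [w 0] is infinitesimal over [L], and each center is [c l] plus an element
    infinitesimal over the preceding field. The shift does not destroy differential transcendence,
    so the family stays independent. *)
Lemma chain m (L : RF) (der : L -> L) (O k : set L) (T : tame der O k) (c : nat -> L) :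
 exists (K : RF) (derK : K -> K) (OK kK : set K) (i : L -> K) (w : nat -> K),
 [/\ elem der O k derK OK kK i, 0 < w 0%N, forall a, 0 < a -> w 0%N < i a,
 forall l, (l < m)%N -> `|w l.+1 - i (c l)| < w 0%N
 & indep derK (field_gen (range i `|` kK)) (fun l : 'I_m.+1=> w l)].
elim: m=> [|m [K1 [d1 [O1 [k1 [i1 [w [hi w0 wt wc iw]]]]]]]].
 have [K [dK [OK [kK [i [t [hi t0 tt]]]]]]] := tiny_exists T.
 exists K, dK, OK, kK, i, (fun=> t);split=> //.
 have TK := tame_elem hi T.
 refine (@indep_last _ dK _ 0 (fun=> t) _ _ _);[exact: fg_subfield|exact: indep0|].
 apply: contra_not (tiny_not_alg T TK hi (y := t) _ _).
 - apply: d_alg_mono;[exact: (dg_diff _ _).1|exact: fg_subfield|].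
 by apply: dg_min;[exact: (fgk_diff TK hi)|move=> x [//|[[]]]].
 - by rewrite gt_eqF.
 - move=> a a0;rewrite gtr0_norm //;exact: tt.
have T1 := tame_elem hi T.
have [K [dK [OK [kK [i2 [t [hi2 t0 tt]]]]]]] := tiny_exists T1.
have TK := tame_elem hi2 T1;have hic := elem_comp hi hi2.
pose w' l := if l == m.+1 then i2 (i1 (c m)) + t else i2 (w l).
exists K, dK, OK, kK, (i2 \o i1), w';split=> //.
- by rewrite /w' /= -(i0 hi2) -(i_lt hi2).
- move=> a a0;rewrite /w' /= -(i_lt hi2);exact: wt.
- move=> l;rewrite ltnS leq_eqVlt=> /orP[/eqP ->|lt];rewrite /w' /=.
 rewrite eqxx addrAC subrr add0r gtr0_norm //;exact: tt.
 rewrite eqSS (ltn_eqF lt) -(iB hi2);have := wc l lt.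
 by rewrite !ltr_norml=> /andP[h1 h2];rewrite -(iN hi2) -!(i_lt hi2) h1 h2.
have e1 : (fun l : 'I_m.+1=> (fun l : 'I_m.+2=> w' l) (lift ord_max l)) = i2 \o (fun l : 'I_m.+1=> w l).
 by apply: funext=> l;rewrite /w' /= /bump leqNgt ltn_ord add0n ltn_eqF.
have er : range (i2 \o i1) = i2 @` range i1.
 by apply/seteqP;split=> [x [a _ <-]|x [_ [a _ <-] <-]];[exists (i1 a)=> //;exists a|exists a].
refine (@indep_last _ dK _ m.+1 (fun l : 'I_m.+2=> w' l) _ _ _);first exact: fg_subfield.
 rewrite e1 er;apply: (indep_elem hi2 TK)=> //;exact: (subfield_range hi).
rewrite e1 /w' eqxx=> alg.
have dE := fgk_diff TK hi2;have fE : subfield (field_gen (range i2 `|` kK)) := fg_subfield _.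
apply: (tiny_not_alg T1 TK hi2 (y := t));first by rewrite gt_eqF.
 move=> a a0;rewrite gtr0_norm //;exact: tt.
apply: (d_alg_shift (t_der TK) dE (c := i2 (i1 (c m))));first by apply: fg_sub;left;exists (i1 (c m)).
rewrite addrC;apply: d_alg_mono alg;[exact: (dg_diff _ _).1|exact: fE|].
apply: dg_min=> // x [|[l _ <-]];last by apply: fg_sub;left;exists (w l).
by apply: fg_mono=> y [[a _ <-]|ky];[left;exists (i1 a)|right].
Qed.

(** * Replacing an independent tuple by an infinitely close one *)

Section NearGraph.
Variables (L : RF) (derL : L -> L) (OL kL : set L) (K : RF) (der : K -> K) (O k : set K).
Variable i : L -> K.
Hypothesis TL : tame derL OL kL.
Hypothesis T : tame der O k.
Hypothesis hi : elem derL OL kL der O k i.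
Let hO := t_val T.
Let hd := t_der T.
Let hc := t_conv T.
Local Hint Resolve hO hd hc : core.
Notation KK := (K * K)%type.
Notation dd := (dd der der).
Let E := field_gen (range i `|` k).
Let fE : subfield E := fg_subfield _.
Definition negligible (t : K) := forall a, a != 0 -> ~ dominated O (i a) t.
Lemma negligible_abs t : (forall a, 0 < a -> `|t| < i a) -> negligible t.
move=> h a a0;have [e e0 e1] := t_ne TL.
have ia0 : i a != 0 by rewrite -(i0 hi) (inj_eq (i_inj hi)).
have ie1 : ~ dominated O 1 (i e) by rewrite -(i1 hi) -(idom hi).
apply: (dle_lt_trans hO (y := i (e * a))).
 have := h `|e * a|;rewrite normr_gt0 mulf_neq0 // => /(_ isT) lt.
 apply: dle_abs=> //;apply: (le_trans (ltW lt));case: (lerP 0 (e * a))=> s.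
 by rewrite ger0_norm // ler_norm.
 by rewrite ltr0_norm // (iN hi) -normrN ler_norm.
rewrite (iM hi) -[X in ~ dominated _ X _]mul1r;exact: dltMr.
Qed.
Lemma negligible_sub t t' : negligible t -> negligible t' -> negligible (t - t').
by move=> h h' a a0;apply: dltB=> //;[exact: h|exact: h']. Qed.
Lemma negligible0 : negligible 0.
by move=> a a0;apply: dlt0x=> //;rewrite -(i0 hi) (inj_eq (i_inj hi)). Qed.
Lemma negligible_mul t e : negligible t -> E e -> negligible (t * e).
move=> ht Ee;have [->|e0] := eqVneq e 0;first by rewrite mulr0;exact: negligible0.
move=> a a0;have [b b0 [eb _]] := fgk_asymp TL T hi Ee e0.
have ib0 : i b != 0 by rewrite -(i0 hi) (inj_eq (i_inj hi)).
have -> : i a = i (a / b) * i b by rewrite -(iM hi) divfK.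
by apply: dltM=> //;apply: (ht);rewrite mulf_neq0 ?invr_eq0.
Qed.
Lemma negligible_mul2 t t' : negligible t -> negligible t' -> negligible (t * t').
move=> ht ht' a a0;rewrite -[i a]mulr1;apply: dltM;[by []|exact: oner_neq0|exact: ht|].
apply: dltW=> //;rewrite -(i1 hi);apply: (ht');exact: oner_neq0.
Qed.
(** If [i a] is not infinitesimal, the derivation being small is enough. Otherwise [t] is below the
    square of [i a], and the derivative of that square is below [i a]. *)
Lemma negligible_der t : negligible t -> negligible (der t).
move=> ht a a0;have ia0 : i a != 0 by rewrite -(i0 hi) (inj_eq (i_inj hi)).
have t1 : ~ dominated O 1 t by rewrite -(i1 hi);apply: (ht);exact: oner_neq0.
case: (pselect (dominated O 1 (i a)))=> [ge|lt].
 apply: (dlt_le_trans hO _ ge);exact: (t_small T).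
have lt2 : ~ dominated O 1 (i a ^+ 2) by rewrite -(expr1n _ 2)=> /(dleX_inv hO).
have h : ~ dominated O (der (i a ^+ 2)) (der t).
 apply: (der_dlt T);[by rewrite expf_neq0|by case|].
 by rewrite expr2 -(iM hi);apply: (ht);rewrite mulf_neq0.
apply: (dlt_trans hO h);rewrite derX // expr1.
have h1 : ~ dominated O (i a) (i a * der (i a)).
 rewrite -[X in ~ dominated _ X _]mulr1;apply: dltMl=> //;exact: (t_small T).
rewrite mulr2n;exact: dltD.
Qed.

Variables (E0 : set K) (q : nat) (u u' : 'I_q -> K).
Hypothesis dE0 : diff_subfield der E0.
Hypothesis kE0 : k `<=` E0.
Hypothesis E0E : E0 `<=` E.
Hypothesis uE : forall l, E (u l).
Hypothesis iu : indep der E0 u.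
Hypothesis uu' : forall l, negligible (u' l - u l).
Let zz l : KK := (u' l, u l).
Let jz N (l : 'I_#|{: 'I_q * 'I_N}|) : KK := iter (enum_val l).2 dd (zz (enum_val l).1).
Let EvF N : set KK := [set x | exists2 Q : {mpoly KK[#|{: 'I_q * 'I_N}|]},
 forall m, exists2 e, E0 e & Q@_m = (e, e) & x = Q.@[@jz N]].
Let R : set KK := [set x | exists N, EvF N x].
Let D : set KK := [set x | exists2 e, E0 e & x = (e, e)].
Let fE0 := dE0.1.
Let D1 : D 1. by exists 1;[exact: (F1 fE0)|]. Qed.
Let DB a b : D a -> D b -> D (a - b).
by move=> [e h ->] [e' h' ->];exists (e - e');[exact: (FB fE0)|]. Qed.
Let DM a b : D a -> D b -> D (a * b).
by move=> [e h ->] [e' h' ->];exists (e * e');[exact: (FM fE0)|]. Qed.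
Let D0 : D 0. by rewrite -(subrr 1);exact: DB. Qed.
Let EvD N x : D x -> EvF N x.
move=> Dx;exists x%:MP;last by rewrite mevalC.
by move=> m;rewrite mcoeffC;case: eqP=> _;rewrite ?mulr1 ?mulr0.
Qed.
Let EvB N x y : EvF N x -> EvF N y -> EvF N (x - y).
move=> [Q hQ ->] [Q' hQ' ->];exists (Q - Q');last by rewrite mevalB.
move=> m;rewrite mcoeffB;exact: DB.
Qed.
Let EvM N x y : EvF N x -> EvF N y -> EvF N (x * y).
move=> [Q hQ ->] [Q' hQ' ->];exists (Q * Q');last by rewrite mevalM.
exact: (A_mpolyM D1 DB DM).
Qed.
Let Ev_jet N l j : (j < N)%N -> EvF N (iter j dd (zz l)).
move=> lt;exists 'X_(enum_rank (l, Ordinal lt));last by rewrite mevalXU /jz enum_rankK.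
by move=> m;rewrite mcoeffX;case: eqP.
Qed.
Let Ev_le N M : (N <= M)%N -> EvF N `<=` EvF M.
move=> le x [Q hQ ->];apply: A_meval;[exact: EvD D1|exact: EvB|exact: EvM|by move=> m;exact: EvD|].
by move=> l;apply: Ev_jet;apply: leq_trans le.
Qed.
Let Ev_d N x : EvF N x -> EvF N.+1 (dd x).
move=> [Q hQ ->];pose A := [set x | EvF N.+1 x /\ EvF N.+1 (dd x)].
have Dd x0 : D x0 -> D (dd x0) by move=> [e Ee ->];exists (der e)=> //;exact: dE0.2.
suff [] : A Q.@[@jz N] by [].
apply: A_meval.
- split;apply: EvD=> //;exact: Dd.
- move=> a b [a1 a2] [b1 b2];split;rewrite ?(ddB T T);exact: EvB.
- move=> a b [a1 a2] [b1 b2];split;first exact: EvM.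
 rewrite (ddM T T) -(opprK (a * dd b));apply: EvB;first exact: EvM.
 rewrite -mulNr;apply: EvM=> //;rewrite -sub0r;apply: EvB=> //;exact: EvD.
- by move=> m;split;apply: EvD;[exact: hQ|apply: Dd;exact: hQ].
- move=> l;split;first by apply: Ev_jet;exact: ltnW (ltn_ord _).
 by rewrite /jz -iterS;apply: Ev_jet;rewrite ltnS.
Qed.
Let R_near x : R x -> E x.2 /\ negligible (x.1 - x.2).
move=> [N [Q hQ ->]];pose I := [set x : KK | E x.2 /\ negligible (x.1 - x.2)].
suff : I Q.@[@jz N] by [].
apply: A_meval.
- by split;[exact: (F1 fE)|rewrite subrr;exact: negligible0].
- move=> a b [a1 a2] [b1 b2];split;first exact: (FB fE).
 rewrite /= (_ : a.1 - b.1 - (a.2 - b.2) = (a.1 - a.2) - (b.1 - b.2));last by ring.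
 exact: negligible_sub.
- move=> a b [a1 a2] [b1 b2];split;first exact: (FM fE).
 rewrite /= (_ : a.1 * b.1 - a.2 * b.2 =
 ((a.1 - a.2) * (b.1 - b.2) - (0 - (a.1 - a.2) * b.2)) - (0 - (b.1 - b.2) * a.2));last by ring.
 have n0 := negligible0.
 by do ![apply: negligible_sub=> //];[exact: negligible_mul2|exact: negligible_mul|exact: negligible_mul].
- by move=> m;have [e Ee ->] := hQ m;split;[exact: E0E|rewrite subrr;exact: negligible0].
- move=> l;rewrite /jz;elim: (nat_of_ord _)=> [|n [IH1 IH2]] /=;first by split;[exact: uE|exact: uu'].
 split;first exact: (fgk_diff T hi).2.
 rewrite /= -derB //;exact: negligible_der.
Qed.
(** Independence of [u] makes the map well defined: a polynomial vanishing at the jets of [u] is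
    zero, hence vanishes at those of [u']. *)
Let R_0 x : R x -> x.2 = 0 -> x = 0.
move=> [N [Q hQ ->]] e.
suff -> : Q = 0 by rewrite meval0.
have q0 : map_mpoly (@snd K K : {rmorphism KK -> K}) Q = 0.
 apply: contrapT=> /eqP q0;apply: (iu (N := N));exists (map_mpoly (@snd K K : {rmorphism KK -> K}) Q);split=> //.
 by move=> m;rewrite mcoeff_map_mpoly;have [e' Ee ->] := hQ m.
 have -> : @fam _ der N q u = (@snd K K : {rmorphism KK -> K}) \o @jz N.
 by apply: funext=> l;rewrite /fam /jz /=;elim: (nat_of_ord _)=> //= n ->.
 by rewrite -map_mpoly_eval.
apply/mpolyP=> m;rewrite mcoeff0;have [c Ec eq] := hQ m.
have : (map_mpoly (@snd K K : {rmorphism KK -> K}) Q)@_m = 0 by rewrite q0 mcoeff0.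
by rewrite mcoeff_map_mpoly eq /= => ->.
Qed.
(** Corresponding elements differ negligibly, while a nonzero element of [E] has the size of one of
    [L]. The two are therefore equivalent, and pairs with equal coordinates serve as monomials. *)
Lemma near_graph : exists G, [/\ good0 der O k der O k G, forall e, E0 e -> G (e, e) & forall l, G (u' l, u l)].
have R1 : R 1 by exists 0%N;exact: EvD.
have RDs : D `<=` R by move=> x Dx;exists 0%N;exact: EvD.
have sF := sub_Fr R1.
exists (Fr R);split;first last.
- move=> l;apply: sF;exists 1%N;exact: (@Ev_jet 1 l 0).
- by move=> e Ee;apply: sF;apply: RDs;exists e.
suff [] : goodk der O k der O k (Fr R) by [].
apply: (goodk_Fr T T (H := [set x | exists2 c, k c & x = (c, c)]) (Mon := [set x | x.1 != 0 /\ x.2 = x.1]))=> //.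
- move=> a b [n ha] [m hb];exists (maxn n m);apply: EvB;[by apply: Ev_le ha;exact: leq_maxl|idtac].
 apply: Ev_le hb;exact: leq_maxr.
- move=> a b [n ha] [m hb];exists (maxn n m);apply: EvM;[by apply: Ev_le ha;exact: leq_maxl|idtac].
 apply: Ev_le hb;exact: leq_maxr.
- by move=> x [n /Ev_d h];apply: sF;exists n.+1.
- move=> x [c kc ->];apply: RDs;exists c=> //;exact: kE0.
- by move=> c kc;exists (c, c)=> //;exists c.
- by move=> x [c kc ->].
- move=> phi v hv;suff -> : fst \o v = snd \o v by [].
 by apply: funext=> l /=;have [c _ ->] := hv l.
- by move=> a b [_ ea] [_ eb];rewrite ea eb.
- by move=> a [_ ->].
- move=> x Rx;have [Ex nx] := R_near Rx;have [x20|x20] := eqVneq x.2 0;[left;exact: R_0|right].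
 exists (x.2, x.2)=> //=;split;last exact: sim_refl.
 have [a a0 [_ ax]] := fgk_asymp TL T hi Ex x20.
 exact: (dlt_le_trans hO (nx a a0) ax).
Qed.
End NearGraph.

(** * The frontier of a definable set *)

Lemma e_sat_split phi n m : (n <= m)%N ->
 expr (fun K d O k u=> @sat _ (pst d O k) (vcat (fun l : 'I_n=> u l) (fun t=> u (m + t)%N)) phi).
move=> le;pose r j := if (j < n)%N then j else (m + (j - n))%N.
have ri : injective r.
 move=> a b;rewrite /r;case: (ltnP a n)=> ha;case: (ltnP b n)=> hb //.
 - by move=> e;move: ha;rewrite e ltnNge (leq_trans le) // leq_addr.
 - by move=> e;move: hb;rewrite -e ltnNge (leq_trans le) // leq_addr.
 - by move=> /addnI e;rewrite -(subnK ha) e subnK.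
apply: e_ext (e_ren ri (e_sat phi))=> K d O k u;suff -> : (fun j=> u (r j)) = vcat (fun l : 'I_n=> u l) (fun t=> u (m + t)%N) by [].
apply: funext=> j;rewrite /vcat /r;case: insubP=> [l _ <-|/negPf ->] //.
by rewrite ltn_ord.
Qed.
Definition adherent phi n (K : RF) (d : K -> K) (O k : set K) (v : nat -> K) :=
 forall e, 0 < e -> exists s : 'I_n -> K, @sat _ (pst d O k) (vcat s (fun t=> v (n + t)%N)) phi /\
 forall l : 'I_n, s l - v l < e /\ v l - s l < e.
Lemma e_adherent phi n : expr (adherent phi n).
apply: (@e_all (fun K d O k e v=> 0 < e -> exists s : 'I_n -> K, @sat _ (pst d O k) (vcat s (fun t=> v (n + t)%N)) phi /\
 forall l : 'I_n, s l - v l < e /\ v l - s l < e)).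
apply: e_imp;first by ex.
have h : expr (fun K d O k u=> @sat _ (pst d O k) (vcat (fun l : 'I_n=> u l) (fun t=> u (n + n.+1 + t)%N)) phi /\
 forall l : 'I_n, u l - u (n + l.+1)%N < u (n + 0)%N /\ u (n + l.+1)%N - u l < u (n + 0)%N).
 apply: e_and;last by ex.
 apply: e_sat_split;exact: leq_addr.
apply: e_ext (e_exn n h)=> K d O k v.
suff e (s : 'I_n -> K) : vcat (fun l : 'I_n=> vcat s v l) (fun t=> vcat s v (n + n.+1 + t)%N) = vcat s (fun t=> v (n + t).+1).
 by split=> -[s [hs1 hs2]];exists s;split;move: hs1;rewrite ?e // => _ l;have := hs2 l;rewrite vcat_lt !vcat_ge.
apply: funext=> j;rewrite /vcat;case: insubP=> [l _ _|_];first by rewrite valK.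
by rewrite insubN -?leqNgt -?addnA ?leq_addr // addKn addSn.
Qed.
Lemma fg_range_comp (A B C : Type) (f : A -> B) (g : B -> C) : range (g \o f) = g @` range f.
by apply/seteqP;split=> [x [a _ <-]|x [_ [a _ <-] <-]];[exists (f a)=> //;exists a|exists a]. Qed.

Section FrontierStep.
Variables (phi : formula PS) (n d : nat) (j : 'I_d -> 'I_n).
Let q := (d + n.+1)%N.
(** Layout of the environment: d prescribed coordinates, then the radius of the box at index d, the
    n centers after it, and from index [q] on the parameters of [phi]. *)
Definition refit (K : RF) (dr : K -> K) (O k : set K) (v : nat -> K) :=
 exists y : 'I_n -> K, @sat _ (pst dr O k) (vcat y (fun t=> v (q + t)%N)) phi /\
 ((forall l : 'I_d, y (j l) = v l) /\
 forall l : 'I_n, l \notin codom j -> y l - v (d + l.+1)%N < v (d + 0)%N /\ v (d + l.+1)%N - y l < v (d + 0)%N).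
Lemma e_refit : expr refit.
have h : expr (fun K dr O k u=> @sat _ (pst dr O k) (vcat (fun l : 'I_n=> u l) (fun t=> u (n + q + t)%N)) phi /\
 ((forall l : 'I_d, u (j l) = u (n + l)%N) /\
 forall l : 'I_n, l \notin codom j -> u l - u (n + (d + l.+1))%N < u (n + (d + 0))%N /\
 u (n + (d + l.+1))%N - u l < u (n + (d + 0))%N)).
 apply: e_and;first by apply: e_sat_split;exact: leq_addr.
 apply: e_and;first by ex.
 by apply: e_all_fin=> l;apply: e_imp;[exact: e_prop|ex].
apply: e_ext (e_exn n h)=> K dr O k v.
suff e (s : 'I_n -> K) : vcat (fun l : 'I_n=> vcat s v l) (fun t=> vcat s v (n + q + t)%N) = vcat s (fun t=> v (q + t)%N).
 split=> -[s [hs1 [hs2 hs3]]];exists s;(split;first by move: hs1;rewrite e);split=> l.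
 - by have := hs2 l;rewrite vcat_lt vcat_ge.
 - by move=> /hs3;rewrite vcat_lt !vcat_ge.
 - by rewrite vcat_lt vcat_ge.
 - by move=> /hs3;rewrite vcat_lt !vcat_ge.
apply: funext=> i;rewrite /vcat;case: insubP=> [l _ _|_];first by rewrite valK.
by rewrite insubN -?leqNgt -?addnA ?leq_addr // addKn.
Qed.

Variables (K : RF) (der : K -> K) (O k : set K) (T : tame der O k) (par : nat -> K).
Variables (L : RF) (derL : L -> L) (OL kL : set L) (i : K -> L) (b : 'I_n -> L).
Hypothesis hi : elem der O k derL OL kL i.
Hypothesis ji : injective j.
Hypothesis ad : adherent phi n derL OL kL (vcat b (i \o par)).
Hypothesis nS : ~ @sat _ (pst derL OL kL) (vcat b (i \o par)) phi.
Hypothesis ib : indep derL (field_gen (range i `|` kL)) (b \o j).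
(** The pair (s on [j], box) maps to (b on [j], box) by [near_graph], and [s] witnesses [refit] on
    the first side. Relative elimination gives a witness [y] on the other side, agreeing with [b] on
    [j] and infinitely close to it over [L] elsewhere. *)
Lemma frontier_step : exists (K2 : RF) (der2 : K2 -> K2) (O2 k2 : set K2) (i2 : K -> K2) (s : 'I_n -> K2)
 (j' : 'I_d.+1 -> 'I_n),
 [/\ elem der O k der2 O2 k2 i2, @sat _ (pst der2 O2 k2) (vcat s (i2 \o par)) phi, injective j' &
 indep der2 (field_gen (range i2 `|` k2)) (s \o j')].
have TL := tame_elem hi T.
have [L1 [d1 [O1 [k1 [i1 [w [hi1 w0 wt wc iw]]]]]]] := chain n TL (vcat b (fun=> 0)).
have T1 := tame_elem hi1 TL.
have [L2 [d2 [O2 [k2 [i2 [eta [hi2 eta0 etat]]]]]]] := tiny_exists T1.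
have T2 := tame_elem hi2 T1.
have h12 := elem_comp hi1 hi2;have h02 := elem_comp hi h12.
pose b2 l := i2 (i1 (b l));pose par2 := (i2 \o i1) \o (i \o par).
have eb2 : (i2 \o i1) \o vcat b (i \o par) = vcat b2 par2 by rewrite vcat_comp.
have ad2 : adherent phi n d2 O2 k2 (vcat b2 par2) by rewrite -eb2;apply/(elem_expr h12 _ (e_adherent phi n)).
have nS2 : ~ @sat _ (pst d2 O2 k2) (vcat b2 par2) phi by rewrite -eb2 -(h12 phi (vcat b (i \o par))).
have [s [Ss sb]] := ad2 eta eta0.
have {}Ss : @sat _ (pst d2 O2 k2) (vcat s par2) phi.
 by rewrite (_ : par2 = fun t=> vcat b2 par2 (n + t)%N) //;apply: funext=> t;rewrite vcat_ge.
have {}sb l : s l - b2 l < eta /\ b2 l - s l < eta by have := sb l;rewrite vcat_lt.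
have {}wc (l : 'I_n) : i1 (b l) - w l.+1 < w 0%N /\ w l.+1 - i1 (b l) < w 0%N.
 by have := wc l (ltn_ord l);rewrite vcat_lt ltr_norml=> /andP[h1 h2];split=> //;rewrite -opprB ltrNl.
pose E0 := field_gen (range ((i2 \o i1) \o i) `|` k2);pose E1 := field_gen (range (i2 \o i1) `|` k2).
pose E := field_gen (range i2 `|` k2).
have dE0 : diff_subfield d2 E0 := fgk_diff T2 h02.
have dE1 : diff_subfield d2 E1 := fgk_diff T2 h12.
have E01 : E0 `<=` E1 by apply: fg_mono=> y [[a _ <-]|ky];[left;exists (i a)|right].
have E1E : E1 `<=` E by apply: fg_mono=> y [[a _ <-]|ky];[left;exists (i1 a)|right].
pose u (l : 'I_q) := match fintype.split l with inl a=> b2 (j a) | inr a=> i2 (w a) end.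
pose u' (l : 'I_q) := match fintype.split l with inl a=> s (j a) | inr a=> i2 (w a) end.
have ibj : indep d2 E0 (fun a=> b2 (j a)).
 rewrite /E0 fg_range_comp;apply: (indep_elem h12 T2 _ ib);exact: (subfield_range hi).
have iu : indep d2 E0 u.
 apply: (indep_cat (t_der T2) (F1 := E1) dE0.1 dE1 E01 (c := fun a : 'I_n.+1=> i2 (w a)))=> //.
 by move=> a;apply: fg_sub;left;exists (b (j a)).
 rewrite /E1 fg_range_comp;apply: (indep_elem hi2 T2 _ iw);exact: (subfield_range hi1).
have [||||G [hG GE Gu]] := near_graph T1 T2 hi2 (u' := u') dE0 _ _ _ iu _.
- by move=> c kc;apply: fg_sub;right.
- by move=> x /E01/E1E.
- move=> l;rewrite /u;case: fintype.split=> a;apply: fg_sub;left;first by exists (i1 (b (j a))).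
 by exists (w a).
- move=> l c1 c10;apply: (negligible_abs T1 T2 hi2 _ c10)=> c c0.
 rewrite /u /u';case: fintype.split=> a;last by rewrite subrr normr0 -(i0 hi2) -(i_lt hi2).
 have [h1 h2] := sb (j a);apply: lt_trans (etat c c0);by rewrite ltr_norml h1 andbT ltrNl opprB.
pose v := vcat (fun l=> (u' l, u l)) (fun t=> (par2 t, par2 t)).
have Gv t : G (v t).
 rewrite /v /vcat;case: insubP=> [l _ _|_];first exact: Gu.
 by apply: GE;apply: fg_sub;left;exists (par (t - q)%N).
have [psi hpsi] := e_refit.
have [y [Sy [yj yb]]] : refit d2 O2 k2 (vcat u par2).
 have e2 : vcat u par2 = snd \o v by rewrite vcat_comp.
 have e1 : vcat u' par2 = fst \o v by rewrite vcat_comp.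
 rewrite e2 -hpsi -(relative_QE psi T2 T2 hG Gv) hpsi -e1.
 exists s;split;first by rewrite (_ : (fun t=> _) = par2) //;apply: funext=> t;rewrite vcat_ge.
 split=> [l|l _].
 by rewrite -[l : nat]/(lshift n.+1 l : nat) vcat_lt /u' -[lshift _ l]/(unsplit (inl l)) unsplitK.
 have er (a : 'I_n.+1) : vcat u' par2 (d + a)%N = i2 (w a).
 by rewrite -[(d + a)%N]/(rshift d a : nat) vcat_lt /u' -[rshift _ a]/(unsplit (inr a)) unsplitK.
 rewrite (er ord0) (er (lift ord0 l)) /=.
 have [h1 h2] := sb l;have [h3 h4] := wc l;rewrite -[bump 0 l]/(l.+1).
 have g1 := etat (w 0%N - (i1 (b l) - w l.+1));have g2 := etat (w 0%N - (w l.+1 - i1 (b l))).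
 rewrite !subr_gt0 in g1 g2;move: (g1 h3) (g2 h4);rewrite !(iB hi2) -/(b2 l)=> g3 g4.
 by split;lra.
have el (l : 'I_d) : vcat u par2 l = b2 (j l).
 by rewrite -[l : nat]/(lshift n.+1 l : nat) vcat_lt /u -[lshift _ l]/(unsplit (inl l)) unsplitK.
have er (a : 'I_n.+1) : vcat u par2 (d + a)%N = i2 (w a).
 by rewrite -[(d + a)%N]/(rshift d a : nat) vcat_lt /u -[rshift _ a]/(unsplit (inr a)) unsplitK.
have {}Sy : @sat _ (pst d2 O2 k2) (vcat y par2) phi.
 by rewrite (_ : par2 = fun t=> vcat u par2 (q + t)%N) //;apply: funext=> t;rewrite vcat_ge.
have {}yj l : y (j l) = b2 (j l) by rewrite yj el.
have [l0 yl0] : exists l, y l != b2 l.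
 apply: contrapT=> h;apply: nS2;suff <- : y = b2 by [].
 by apply: funext=> l;apply: contrapT=> /eqP hl;apply: h;exists l.
have l0j : l0 \notin codom j by apply: contraNN yl0=> /codomP[a ->];rewrite yj.
(* The distance is at most twice the radius, once from the box and once from the position of its
   center; this is why the radius is compared with [a / 2]. *)
have tiny a : 0 < a -> `|y l0 - b2 l0| < i2 (i1 a).
 move=> a0;have := wt (a / 2);rewrite divr_gt0 // => /(_ isT);rewrite (i_lt hi2)=> g.
 have [h1 h2] := yb l0 l0j;move: h1 h2;rewrite (er ord0) (er (lift ord0 l0)) /= -[bump 0 l0]/(l0.+1)=> h1 h2.
 have [] := wc l0;rewrite !(i_lt hi2) !(iB hi2) -/(b2 l0)=> h3 h4.
 have e : i2 (i1 a) = i2 (i1 (a / 2)) + i2 (i1 (a / 2)).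
 rewrite -(iD hi2) -(iD hi1);congr (i2 (i1 _));exact: splitr.
 by rewrite e ltr_norml;apply/andP;split;lra.
have nalg : ~ d_algebraic d2 E1 (y l0).
 move=> alg;apply: (tiny_not_alg TL T2 h12 (y := y l0 - b2 l0))=> //;first by rewrite subr_eq0.
 apply: (d_alg_shift (t_der T2) dE1 (c := b2 l0));last by rewrite subrK.
 by apply: fg_sub;left;exists (b l0).
pose j' (a : 'I_d.+1) := if unlift ord_max a is Some a' then j a' else l0.
have j'l a : j' (lift ord_max a) = j a by rewrite /j' liftK.
have j'm : j' ord_max = l0 by rewrite /j' unlift_none.
exists L2, d2, O2, k2, ((i2 \o i1) \o i), y, j';split=> //.
 move=> a a';rewrite /j';case: (unliftP ord_max a)=> [c ->|->];case: (unliftP ord_max a')=> [c' ->|->] //.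
 - by move/ji ->.
 - by move=> e;case/negP: l0j;rewrite -e codom_f.
 - by move=> e;case/negP: l0j;rewrite e codom_f.
have eyj : (fun a=> (y \o j') (lift ord_max a)) = (fun a=> b2 (j a)).
 by apply: funext=> a;rewrite /= j'l yj.
refine (@indep_last _ d2 _ d (y \o j') dE0.1 _ _);rewrite eyj //= j'm.
apply: contra_not nalg;apply: d_alg_mono;[exact: (dg_diff _ _).1|exact: dE1.1|].
by apply: dg_min=> // x [/E01//|[a _ <-]];apply: fg_sub;left;exists (b (j a)).
Qed.
End FrontierStep.

Section Realization.
Variables (K : RF) (der : K -> K) (O k : set K).
Variables (L : RF) (derL : L -> L) (OL kL : set L) (i : K -> L).
Variables (K' : RF) (der' : K' -> K') (O' k' : set K') (i' : K -> K').
Hypothesis hi : elem der O k derL OL kL i.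
Hypothesis hi' : elem der O k der' O' k' i'.
Hypothesis hs : @succ_card_saturated _ (pst der' O' k') K.
Lemma realize_fin m (s : nat -> L) : exists (s' : nat -> K') (H : set (L * K')),
 [/\ pmap derL OL kL der' O' k' false H, (snd @` H #<= [set: K])%card, forall a, H (i a, i' a)
 & forall l, (l < m)%N -> H (s l, s' l)].
elim: m=> [|m [s' [H [pH cH Hi Hs]]]].
 pose H := [set x : L * K' | exists a, x = (i a, i' a)].
 exists (fun=> 0), H;split=> //;last by move=> a;exists a.
 move=> phi v hv;have [a ha] := choice hv.
 have -> : fst \o v = i \o a by apply: funext=> l;rewrite /= ha.
 have -> : snd \o v = i' \o a by apply: funext=> l;rewrite /= ha.
 by rewrite -(hi (relf false phi) a) -(hi' (relf false phi) a).
 have -> : snd @` H = range i' by apply/seteqP;split=> [x [_ [a ->] <-]|x [a _ <-]];[exists a|exists (i a, i' a)=> //;exists a].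
 apply: card_le_image;exact: card_lexx.
have gi : injective (fun l : nat=> l%:R : K) by move=> x y /eqP;rewrite eqr_nat=> /eqP.
have [//|c' _ pH'] := @pmap_ext _ _ _ _ _ _ _ _ _ K H (i 0, i' 0) (s m) hs cH (Hi 0) pH.
exists (fun l=> if l == m then c' else s' l), (H `|` [set (s m, c')]);split=> //.
- rewrite image_setU image_set1;exact: card_le_add gi cH.
- by move=> a;left.
- move=> l;rewrite ltnS leq_eqVlt=> /orP[/eqP ->|lt];first by rewrite eqxx;right.
 rewrite (ltn_eqF lt);left;exact: Hs.
Qed.
(** The new point lives in some extension, while the dimension is measured in a given saturated one.
    Its finitely many coordinates are realized there over [K], and [dep_transfer] preserves
    independence over the larger [k']. *)
Lemma realize_point (T' : tame der' O' k') phi n e (par : nat -> K) (s : 'I_n -> L) (j : 'I_e -> 'I_n) :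
 @sat _ (pst derL OL kL) (vcat s (i \o par)) phi -> indep derL (field_gen (range i `|` kL)) (s \o j) ->
 exists2 s' : 'I_n -> K', @sat _ (pst der' O' k') (vcat s' (i' \o par)) phi &
 indep der' (field_gen (range i' `|` k')) (s' \o j).
move=> Ss is_;have [s' [H [pH _ Hi Hs]]] := realize_fin n (vcat s (fun=> 0)).
have {}Hs (l : 'I_n) : H (s l, s' l) by have := Hs l (ltn_ord l);rewrite vcat_lt.
exists (fun l=> s' l).
 pose v := vcat (fun l : 'I_n=> (s l, s' l)) (fun t=> (i (par t), i' (par t))).
 have hv t : H (v t) by rewrite /v /vcat;case: insubP=> [l _ _|_].
 have := pmap_expr pH (e_sat phi) hv;rewrite /v !vcat_comp=> <-;exact: Ss.
move=> N hm;apply: (is_ N).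
apply: (dep_transfer T' pH (subfield_range hi') (A := range i) _ (b' := (fun l=> s' l) \o j))=> //.
 by move=> _ [a _ <-];exists (i a).
move=> l;exact: Hs.
Qed.
End Realization.

(** * The set named by the predicate in an elementary extension *)

Section Expansion.
Variables (K : RF) (der : K -> K) (O k : set K) (n : nat) (S : set ('I_n -> K)).
Variables (K' : RF) (der' : K' -> K') (O' k' : set K') (S' : set ('I_n -> K')) (i : K -> K').
Notation M := (@expand _ (pst der O k) n S).
Notation M' := (@expand _ (pst der' O' k') n S').
Hypothesis he : @elementary_embedding _ M M' i.
Let L' := expand_signature PS n.
Let FS : formula L' := @FRel L' None (fun l=> @Var L' (l : 'I_n)).
Lemma assign_vcat (A : structure PS) (x : 'I_n -> A) v : assign x v = vcat x (fun t=> v (n + t)%N).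
by apply: funext=> t;rewrite /assign /vcat;case: insubP=> [l _ _|] //;rewrite -leqNgt=> /subnKC ->. Qed.
Let valid chi (v0 : nat -> K) (g : formula L' -> formula L' -> formula L') :
 (forall x, @sat _ M (@assign _ M n x v0) (g FS (flft n chi))) ->
 forall x', @sat _ M' (@assign _ M' n x' (i \o v0)) (g FS (flft n chi)).
move=> h x';have : @sat _ M v0 (clos n (g FS (flft n chi))).
 apply/sat_clos=> w hw;have -> : w = @assign _ M n (fun l=> w l) v0;last exact: h.
 by apply: funext=> t;rewrite /assign;case: insubP=> [l _ <-|] //;rewrite -leqNgt=> /hw.
rewrite (he _ v0) sat_clos;apply=> t ht.
by rewrite /assign;case: insubP=> [l lt _|//];move: lt;rewrite ltnNge ht.
Qed.
Let satFS (N : structure L') x v : @sat _ N (@assign _ N n x v) FS <-> @rinterp _ N None x.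
rewrite /FS /=;suff -> : (fun l : 'I_n=> @assign _ N n x v l) = x by [].
by apply: funext=> l;rewrite /assign valK.
Qed.
(** The inclusion is a sentence of the expanded language with parameters from [K], so it passes to
    the extension. This allows a predicate to be handled through its defining formula. *)
Lemma expansion_sub chi v0 : (forall x, S x -> @sat _ (pst der O k) (@assign _ (pst der O k) n x v0) chi) ->
 forall x', S' x' -> @sat _ (pst der' O' k') (@assign _ (pst der' O' k') n x' (i \o v0)) chi.
move=> h x' Sx;have := @valid chi v0 (fun a b=> FImp a b).
move=> /(_ _ x')/= h';apply/(@sat_flft _ n M');apply: h';last by apply/(satFS (N := M')).
move=> x /(satFS (N := M)) Sx1;apply/(@sat_flft _ n M);exact: h.
Qed.
Lemma expansion_sup chi v0 : (forall x, @sat _ (pst der O k) (@assign _ (pst der O k) n x v0) chi -> S x) ->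
 forall x', @sat _ (pst der' O' k') (@assign _ (pst der' O' k') n x' (i \o v0)) chi -> S' x'.
move=> h x' Sx;have := @valid chi v0 (fun a b=> FImp b a).
move=> /(_ _ x')/= h';apply/(satFS (N := M'));apply: h';last by apply/(@sat_flft _ n M').
move=> x /(@sat_flft _ n M) Sx1;apply/(satFS (N := M));exact: h.
Qed.
Lemma expansion_nonempty : S !=set0 -> S' !=set0.
move=> [x Sx];exists (i \o x).
have /(satFS (N := M)) : @rinterp _ M None x by [];move=> /(_ (fun=> 0)).
rewrite (he _ _)=> h;have /(satFS (N := M')) : @sat _ M' (@assign _ M' n (i \o x) (i \o fun=> 0)) FS;last by [].
move: h;congr (@sat _ M' _ FS);apply: funext=> t;rewrite /= /assign;by case: insubP.
Qed.
End Expansion.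
Lemma closure_box (K : RF) n (S : set ('I_n -> K)) b : closure_ord S b ->
 forall e, 0 < e -> exists2 s, S s & forall l, s l - b l < e /\ b l - s l < e.
move=> h e e0.
have [|s [Ss hs]] := h [set s : 'I_n -> K | forall l, s l - b l < e /\ b l - s l < e];last by exists s.
pose Kn : topologicalType := {ptws 'I_n -> order_topology K}.
apply: (@filter_forall _ _ (fun l s=> s l - b l < e /\ b l - s l < e) (nbhs (b : Kn)) (nbhs_filter (b : Kn)))=> l.
have := @proj_continuous 'I_n (fun=> order_topology K) l (b : {ptws 'I_n -> order_topology K}).
move=> /(_ [set x : K | x - b l < e /\ b l - x < e]);apply.
have ho := @itv_open _ (order_topology K) (b l - e) (b l + e).
have hb : `](b l - e : order_topology K), (b l + e)[%classic (b l).
 by rewrite /= in_itv /= ltrBlDr ltrDl e0.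
apply: (filterS _ (open_nbhs_nbhs (conj ho hb)))=> x /=;rewrite in_itv /= => /andP[h1 h2].
split;first by rewrite ltrBlDr [X in _ < X]addrC;exact: h2.
rewrite ltrBlDr [X in _ < X]addrC -ltrBlDr;exact: h1.
Qed.
(** By [dtrdeg_indep] the transcendence degrees are bounded by n, and [trans_basis] shows that one
    occurs. *)
Lemma dim2_exists (K : RF) (der : K -> K) (O k : set K) n (S : set ('I_n -> K)) :
 tame der O k -> S !=set0 -> exists d, is_dim2 der O k S d.
move=> T S0;have [K' [der' [O' [k' [S' [i [he hs]]]]]]] := @expand_saturated_extension K der O k n S K.
have hi := expand_elem he;have T' := tame_elem hi T;have dF := fgk_diff T' hi.
pose F := field_gen (range i `|` k').
pose P e := `[< exists2 s, S' s & is_dtrdeg der' F (diff_field_gen der' (F `|` range s)) e >].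
have exP : exists e, P e.
 have [s Ss] := expansion_nonempty he S0.
 pose j0 (a : 'I_0) : 'I_n := let: Ordinal m h := a in False_rect _ (notF h).
 have [||e [j [_ _ _ hj]]] := @trans_basis K' der' (t_der T') F n s 0 j0 dF;[by case|exact: indep0|].
 by exists e;apply/asboolP;exists s=> //;exists (s \o j).
have bP e : P e -> (e <= n)%N.
 move=> /asboolP[s _ he'];have [j [ji _]] := dtrdeg_indep (t_der T') dF he'.
 by have := leq_card j ji;rewrite !card_ord.
have [d /asboolP hd hm] := ex_maxnP exP bP.
exists d, K', der', O', k', S', i;split=> //.
by move=> s e Ss he';apply: hm;apply/asboolP;exists s.
Qed.
(** If d were at most e, d of the e independent coordinates of a frontier point would feed
    [frontier_step], and the resulting point of S* would have degree at least d+1. The two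
    dimensions may come from different saturated extensions, which [realize_point] bridges. *)
Lemma dim2_frontier (K : RF) (der : K -> K) (O k : set K) n (S : set ('I_n -> K)) d e :
 tame der O k -> @definable _ (pst der O k) n S ->
 is_dim2 der O k (closure_ord S `\` S) e -> is_dim2 der O k S d -> (e < d)%N.
move=> T [phi [v0 hS]].
move=> [K1 [der1 [O1 [k1 [B1 [i1 [[he1 _] [b Bb hb] _]]]]]]].
move=> [K2 [der2 [O2 [k2 [S2 [i2 [[he2 hs2] _ hmax]]]]]]].
rewrite ltnNge;apply/negP=> le.
pose par t := v0 (n + t)%N.
have hi1 := expand_elem he1;have T1 := tame_elem hi1 T.
have hi2 := expand_elem he2;have T2 := tame_elem hi2 T.
have [chi hchi] := e_and (e_adherent phi n) (e_not (e_sat phi)).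
have Bchi x : (closure_ord S `\` S) x -> @sat _ (pst der O k) (@assign _ (pst der O k) n x v0) chi.
 move=> [cx nx];apply/hchi;split;last by move/hS.
 move=> c /(closure_box cx)[s Ss sx];exists s;split.
 have -> : (fun t=> @assign _ (pst der O k) n x v0 (n + t)%N) = (fun t=> v0 (n + t)%N).
 by apply: funext=> t;rewrite assign_vcat vcat_ge.
 by rewrite -(@assign_vcat n (pst der O k));apply/hS.
 move=> l;rewrite assign_vcat vcat_lt;exact: sx.
have /hchi[ad nS] := expansion_sub he1 Bchi Bb.
rewrite (@assign_vcat n (pst der1 O1 k1)) in ad nS.
have [j [ji ij]] := dtrdeg_indep (t_der T1) (fgk_diff T1 hi1) hb.
have wi : injective (widen_ord le) by move=> x y /(congr1 val)/= h;apply: val_inj.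
have ij' := indep_sub (fg_subfield _) wi ij.
have [K3 [der3 [O3 [k3 [i3 [s [j' [hi3 Ss j'i is_]]]]]]]] :=
 frontier_step T hi1 (par := par) (inj_comp ji wi) ad nS ij'.
have [s' Ss' is'] := realize_point hi3 hi2 (expand_sat hs2) T2 Ss is_.
have S2s : S2 s'.
 apply: (expansion_sup he2 (chi := phi) (v0 := v0));first by move=> x /hS.
 by rewrite (@assign_vcat n (pst der2 O2 k2)).
have [d' [j2 [led _ _ hj2]]] := trans_basis (t_der T2) (fgk_diff T2 hi2) j'i is'.
have := hmax s' d' S2s (ex_intro _ _ hj2).
by rewrite leqNgt led.
Qed.

Theorem theorem5p21 (K : realFieldType) (der : K -> K) (O k : set K)
    (hpreH : pre_H_field der O)
    (hdhens : d_henselian der O)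
    (hLiouville : liouville_closed der)
    (hproper : O <> [set: K])
    (hlift : residue_lift der O k)
    (n : nat) (S : set ('I_n -> K))
    (hdef : @definable _ (pair_structure der O k) n S)
    (hS : S !=set0) :
  (dim2 der O k (closure_ord S `\` S) < dim2 der O k S)%E.
Proof.
have T : tame der O k by exact: tame_of_hypotheses.
have S0 : S <> set0 by apply/eqP/set0P.
rewrite /dim2 (asboolF S0).
case: asboolP => [_|/eqP/set0P B0]; first by rewrite ltNyr.
rewrite lte_fin ltz_nat.
(* [xget] falls back on 0 only when no dimension exists, so existence is supplied for both sets. *)
apply: (dim2_frontier T hdef); [exact: xgetPex (dim2_exists T B0)|exact: xgetPex (dim2_exists T hS)].
Qed.
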